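(* Let $\theta_0\in L^2(0,1)$ (complex-valued) and $T>0$ be given. Pick any $\tau\in(0,T)$ and any $s\in(1,2)$. Let $\phi_s$ be a Gevrey step function of order $s$, let $\theta^-$ be the function built from $\theta_0$ as described in the context, and define, for $t\in(0,T]$, $$Y(t):=\phi_s\Bigl(\frac{t-\tau}{T-\tau}\Bigr)\,\partial_x\theta^-(t,0).$$ Then the control $$u(t):=\begin{cases}\theta^-(t,1) & \text{if } 0\le t\le\tau,\\[2pt] \displaystyle\sum_{j\ge0}\frac{(-i)^j}{(2j+1)!}Y^{(j)}(t) & \text{if }\tau<t\le T\end{cases}$$ steers the system $$\begin{aligned} i\theta_t+\theta_{xx}&=0, &&(t,x)\in(0,T)\times(0,1),\\ \theta(t,0)&=0, && t\in(0,T),\\ \theta(t,1)&=u(t), && t\in(0,T),\\ \theta(0,x)&=\theta_0(x), && x\in(0,1),\end{aligned}$$ from $\theta_0$ to $\theta(T,\cdot)=0$. Moreover, $u$ belongs to $L^4(0,T)$, and $u$ is Gevrey of order $s$ on $[\varepsilon,T]$ for all $\varepsilon\in(0,T)$. The corresponding solution of the system is given by $$\theta(t,x):=\begin{cases}\theta^-(t,x) & \text{if } 0\le t\le\tau,\\[2pt] \displaystyle\sum_{j\ge0}\frac{(-i)^jx^{2j+1}}{(2j+1)!}Y^{(j)}(t) & \text{if }\tau<t\le T;\end{cases}$$ the map $t\mapsto\theta(t,\cdot)$ belongs to $C([0,T],L^2(0,1))$, and $\theta$ is Gevrey of order $(s,\frac{s}{2})$ on $[\varepsilon,T]\times[0,1]$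 for all $\varepsilon\in(0,T)$.
   Context: All functions ($\theta_0,\theta,u,Y$) are complex-valued, except the step function $\phi_s$, which is real-valued. Gevrey functions of one variable: a function $y\in C^\infty$ on an interval $I$ (here a compact interval, or $\mathbb{R}$) is Gevrey of order $s\ge0$ on $I$ if there exist constants $M,R>0$ such that $|y^{(p)}(t)|\le M\frac{(p!)^s}{R^p}$ for all $t\in I$ and all integers $p\ge0$. Gevrey functions of two variables: let $K\subset\mathbb{R}^2$ be compact and let $y(t,x)$ be of class $C^\infty$ on $K$ (i.e. the restriction to $K$ of a $C^\infty$ function on some open neighborhood of $K$). Then $y$ is Gevrey of order $(s_1,s_2)$ on $K$ if there exist constants $M,R_1,R_2>0$ such that $|\partial_t^{p_1}\partial_x^{p_2}y(t,x)|\le M\frac{(p_1!)^{s_1}(p_2!)^{s_2}}{R_1^{p_1}R_2^{p_2}}$ for all $(t,x)\in K$ and all integers $p_1,p_2\ge0$. Gevrey step function of order $s>1$: a function $\phi_s:\mathbb{R}\to\mathbb{R}$ that is Gevrey of order $s$ on $\mathbb{R}$, with $\phi_s(\rho)=1$ for $\rho\le0$ and $\phi_s(\rho)=0$ for $\rho\ge1$. An example, with $M>0$ and $\sigma:=(s-1)^{-1}$, is given by $\phi_s(\rho)=\dfrac{e^{-M/(1-\rho)^\sigma}}{e^{-M/\rho^\sigma}+e^{-M/(1-\rho)^\sigma}}$ for $\rho\in(0,1)$. Function $\theta^-$: let $\theta_0^{odd}$ be the odd extension of $\theta_0$ by zero, i.e. $\theta_0^{odd}(x)=\theta_0(x)$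 for $x\in(0,1)$, $\theta_0^{odd}(x)=-\theta_0(-x)$ for $x\in(-1,0)$, and $\theta_0^{odd}(x)=0$ for $|x|\ge1$ (the value at $x=0$ is irrelevant). Let $E(t,x):=\dfrac{e^{i\frac{x^2}{4t}}}{\sqrt{4\pi it}}$ for $t\ne0$ (principal branch of the square root). Define $\theta^-(0,\cdot):=\theta_0^{odd}$ and $\theta^-(t,x):=\int_{-1}^1E(t,x-y)\,\theta_0^{odd}(y)\,dy$ for $t\neq0$, $x\in\mathbb{R}$. Notion of solution: for $u\in L^1(0,T)$ and $\theta_0\in L^2(0,1)$, the solution of the system is the (unique) $\theta\in C([0,T],L^2(0,1))$, if it exists, such that for every $\psi\in H^2(0,1)\cap H^1_0(0,1)$ and every $t\in[0,T]$, $$\int_0^1\theta(t,x)\psi(x)\,dx=\int_0^1\theta_0(x)\psi(x)\,dx+i\int_0^t\Bigl(\int_0^1\theta(r,x)\psi''(x)\,dx-u(r)\psi'(1)\Bigr)dr.$$ *)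

(* Defs.v *)
From mathcomp Require Import all_boot all_order all_algebra.
From mathcomp Require Import all_classical all_reals all_analysis.
From mathcomp Require Import complex.

Set Implicit Arguments.
Unset Strict Implicit.
Unset Printing Implicit Defensive.

Import Order.TTheory GRing.Theory Num.Theory.
Import numFieldNormedType.Exports.
Import ComplexField.

Local Open Scope classical_set_scope.
Local Open Scope ring_scope.
Local Open Scope complex_scope.

Section Defs.
Context {R : realType}.
Local Notation C := R[i].
Local Notation mu := (@lebesgue_measure R).
Local Notation normc := (@Normc.normc R).
Local Notation Re := (@complex.Re R).
Local Notation Im := (@complex.Im R).
Implicit Types (f g y : R -> C) (I U : set R).

(** Calculus of complex-valued functions of real variables. MathComp-Analysis
    has no R-normed-module structure on [R[i]], so derivatives, integrals and
    sums are taken on the real and imaginary parts. *)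

Definition expi (a : R) : C := cos a +i* sin a.

Definition cderivable f (x : R) : Prop :=
  derivable (fun z => Re (f z)) x 1 /\ derivable (fun z => Im (f z)) x 1.

Definition cderive (n : nat) f (x : R) : C :=
  derive1n n (fun z => Re (f z)) x +i* derive1n n (fun z => Im (f z)) x.

Definition cint (D : set R) f : C :=
  Rintegral mu D (fun x => Re (f x)) +i* Rintegral mu D (fun x => Im (f x)).

Definition csummable (a : nat -> C) : Prop :=
  cvgn (series (fun j => Re (a j))) /\ cvgn (series (fun j => Im (a j))).

Definition csum (a : nat -> C) : C :=
  limn (series (fun j => Re (a j))) +i* limn (series (fun j => Im (a j))).

Definition csmooth U f : Prop :=
  forall n x, U x -> cderivable (cderive n f) x.

(** The variables of a function on [R * R] are [(t, x)]. *)
Definition dt (h : R * R -> R) : R * R -> R := 'D_(1, 0) h.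
Definition dx (h : R * R -> R) : R * R -> R := 'D_(0, 1) h.

(** C^oo on an open set: all iterated partial derivatives, in any order of
    differentiation (encoded by the word [w]), exist and are continuous. *)
Definition smooth2 (U : set (R * R)) (h : R * R -> R) : Prop :=
  forall (w : seq bool) (z : R * R), U z ->
    let k := foldr (fun b : bool => if b then dt else dx) h w in
    [/\ {for z, continuous k}, derivable k z (1, 0) & derivable k z (0, 1)].

Definition cpartial (p1 p2 : nat) (h : R * R -> C) (z : R * R) : C :=
  iter p1 dt (iter p2 dx (fun w => Re (h w))) z
  +i* iter p1 dt (iter p2 dx (fun w => Im (h w))) z.

(** "C^oo on I" means: restriction to I of a function [g] that
    is C^oo on an open neighbourhood of I. On a set which is the closure of its
    interior the derivatives of [g] on I depend only on [y]. *)
Definition gevrey (s : R) I y : Prop :=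
  exists (U : set R) (g : R -> C),
    [/\ open U, I `<=` U, csmooth U g, (forall t, I t -> g t = y t) &
     exists M r : R, [/\ 0 < M, 0 < r &
       forall (p : nat) (t : R), I t ->
         normc (cderive p g t) <= M * (p`!%:R `^ s) / r ^+ p]].

Definition gevrey2 (s1 s2 : R) (K : set (R * R)) (y : R * R -> C) : Prop :=
  exists (U : set (R * R)) (g : R * R -> C),
    [/\ open U, K `<=` U,
        (smooth2 U (fun z => Re (g z)) /\ smooth2 U (fun z => Im (g z))),
        (forall z, K z -> g z = y z) &
     exists M r1 r2 : R, [/\ 0 < M, 0 < r1, 0 < r2 &
       forall (p1 p2 : nat) (z : R * R), K z ->
         normc (cpartial p1 p2 g z) <=
           M * (p1`!%:R `^ s1) * (p2`!%:R `^ s2) / (r1 ^+ p1 * r2 ^+ p2)]].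

Definition gevrey_step (s : R) (phi : R -> R) : Prop :=
  [/\ gevrey s setT (fun rho => (phi rho)%:C),
      forall rho, rho <= 0 -> phi rho = 1 &
      forall rho, 1 <= rho -> phi rho = 0].

(** Elements of L^p(D) are represented by functions on the whole line, of which
    only the values on [D] matter. *)
Definition memL (p : nat) (D : set R) f : Prop :=
  [/\ measurable_fun D (fun x => Re (f x)),
      measurable_fun D (fun x => Im (f x)) &
      (\int[mu]_(x in D) (normc (f x) ^+ p)%:E < +oo)%E].

Definition J01 : set R := `]0, 1[.

Definition L2norm f : R :=
  Num.sqrt (Rintegral mu J01 (fun x => normc (f x) ^+ 2)).

Definition eqL2 f g : Prop := {ae mu, forall x, J01 x -> f x = g x}.

Definition continuousL2 (T : R) (theta : R -> R -> C) : Prop :=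
  (forall t, 0 <= t <= T -> memL 2 J01 (theta t)) /\
  (forall t0, 0 <= t0 <= T ->
     (fun t => L2norm (fun x => theta t x - theta t0 x))
       @ within `[0, T] (nbhs t0) --> (0 : R)).

Definition test_function f : Prop :=
  csmooth setT f /\
  exists K : set R, [/\ compact K, K `<=` J01 & forall x, ~ K x -> f x = 0].

Definition weak_derivative f g : Prop :=
  forall eta, test_function eta ->
    cint J01 (fun x => f x * cderive 1 eta x) =
    - cint J01 (fun x => g x * eta x).

(** [psi] is in H^2(0,1) and in H^1_0(0,1), the H^1-closure of the test
    functions, with first and second weak derivatives [psi1] and [psi2]; [psi1]
    is the representative that is continuous on [0,1], so that [psi1 1] is the
    trace psi'(1). *)
Definition H2_H10 (psi psi1 psi2 : R -> C) : Prop :=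
  [/\ [/\ memL 2 J01 psi, memL 2 J01 psi1 & memL 2 J01 psi2],
      weak_derivative psi psi1 /\ weak_derivative psi1 psi2,
      {within `[0, 1], continuous (fun x => Re (psi1 x))} /\
      {within `[0, 1], continuous (fun x => Im (psi1 x))} &
      forall e : R, 0 < e -> exists2 eta, test_function eta &
        L2norm (fun x => psi x - eta x) < e /\
        L2norm (fun x => psi1 x - cderive 1 eta x) < e].

(** The weak (transposition) formulation of
    [i theta_t + theta_xx = 0], [theta(t,0) = 0], [theta(t,1) = u(t)],
    [theta(0,.) = theta0]. *)
Definition satisfies_system (T : R) (theta0 u : R -> C) (theta : R -> R -> C)
    : Prop :=
  [/\ memL 1 `]0, T[ u, continuousL2 T theta &
      forall psi psi1 psi2, H2_H10 psi psi1 psi2 ->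
      forall t, 0 <= t <= T ->
        cint J01 (fun x => theta t x * psi x) =
        cint J01 (fun x => theta0 x * psi x) +
        'i%C * cint `[0, t] (fun r =>
          cint J01 (fun x => theta r x * psi2 x) - u r * psi1 1)].

(** [theta] is the solution, unique as an element of C([0,T], L^2(0,1)). *)
Definition is_solution (T : R) (theta0 u : R -> C) (theta : R -> R -> C)
    : Prop :=
  satisfies_system T theta0 u theta /\
  forall theta', satisfies_system T theta0 u theta' ->
    forall t, 0 <= t <= T -> eqL2 (theta' t) (theta t).

Definition steers (T : R) (theta0 u thetaT : R -> C) : Prop :=
  exists2 theta, is_solution T theta0 u theta & eqL2 (theta T) thetaT.

Definition odd_ext (theta0 : R -> C) (x : R) : C :=
  if 0 < x < 1 then theta0 x
  else if -1 < x < 0 then - theta0 (- x) else 0.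

(** [sqrtc] from [mathcomp.real_closed] is the principal branch (nonnegative real part). *)
Definition Ekernel (t x : R) : C :=
  expi (x ^+ 2 / (4 * t)) / sqrtc (0 +i* (4 * pi * t)).

Definition theta_minus (theta0 : R -> C) (t x : R) : C :=
  if t == 0 then odd_ext theta0 x
  else cint `[-1, 1] (fun z => Ekernel t (x - z) * odd_ext theta0 z).

(** Defined by the same formula for every real t, so that the two-sided
    derivatives at t = T make sense; they equal the left ones, where Y is C^oo
    up to T. *)
Definition Yflat (T tau : R) (phi : R -> R) (theta0 : R -> C) (t : R) : C :=
  (phi ((t - tau) / (T - tau)))%:C * cderive 1 (theta_minus theta0 t) 0.

Definition theta_term (Y : R -> C) (t x : R) (j : nat) : C :=
  (- 'i%C) ^+ j * (x ^+ (2 * j + 1))%:C / ((2 * j + 1)`!)%:R * cderive j Y t.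

Definition u_term (Y : R -> C) (t : R) (j : nat) : C :=
  (- 'i%C) ^+ j / ((2 * j + 1)`!)%:R * cderive j Y t.

Definition control (tau : R) (theta0 Y : R -> C) (t : R) : C :=
  if t <= tau then theta_minus theta0 t 1 else csum (u_term Y t).

Definition trajectory (tau : R) (theta0 Y : R -> C) (t x : R) : C :=
  if t <= tau then theta_minus theta0 t x else csum (theta_term Y t x).

End Defs.

(* Main.v *)
From HB Require Import structures.
Require Import Defs.
From mathcomp Require Import all_boot all_order all_algebra.
From mathcomp Require Import all_classical all_reals all_analysis.
From mathcomp Require Import complex.
From mathcomp Require Import ring lra zify.
From mathcomp Require Import measurable_realfun.

(** The trajectory is one and the same series at all positive times. The free
    evolution of the odd datum is smooth in x for t > 0 and vanishes at x = 0; by the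
    equation, its odd derivatives in x at 0 are time derivatives of the flux
    [flat 0 t], so that its Taylor expansion reads

      [\sum_j (-i)^j x^(2j+1) / (2j+1)! * y^(j)(t)]   with [y] the flux

    ([evol_series]). After [tau] the flux is multiplied by the Gevrey step and the
    series is kept ([trajectoryE]). It solves the Schroedinger equation term by
    term ([ser_pde]), it vanishes at x = 0, its value at x = 1 is the control, and at
    time T it is zero since the step is flat there ([output_end]). Convergence and
    Gevrey regularity rest on one estimate, [gevrey_term_bound]: the flux is analytic
    for t > 0 ([flat_bound]), so the output is Gevrey of order s, and s < 2 makes
    [j!^s] negligible before [(2j+1)!].

    The series says nothing about the limit t -> 0. There the explicit kernel is
    used: sampled on a suitable grid, the free evolution gives Fourier
    coefficients, and Bessel's inequality bounds it in L^2 uniformly in time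
    ([evol_L2_bound]). Continuity at time 0 need then be checked on step functions
    only, whose evolution is expressed with Fresnel's integral
    ([initial_cvg_heaviside], [fresnel_cvg]). The L^4 bound on the trace at x = 1 is
    the same sampling argument applied to its square, which oscillates with the
    phase [(1-y)^2 + (1-z)^2]; what is needed is that a sum of two squares has bounded
    density ([trace_L4_bound], [bessel4], [square_estimate]).

    The weak formulation is obtained by integrating in time on [[a, t]] and letting
    a tend to 0 ([weak_identity]). As the test functions are known through weak
    derivatives only, Green's formula is proved by density and cut-offs, for which
    the Gevrey step serves again ([weak_green], [smooth_H2_H10]). Uniqueness is read
    on the sine coefficients, each of which solves a scalar linear equation
    ([imaginary_volterra]); completeness of the sines follows by approximating
    indicators of intervals by polynomials in [cos (pi x)] ([sine_complete]). *)

Set Implicit Arguments.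
Unset Strict Implicit.
Unset Printing Implicit Defensive.
Import Order.TTheory GRing.Theory Num.Theory.
Import numFieldNormedType.Exports.
Local Open Scope classical_set_scope.
Local Open Scope ring_scope.


(** * Taylor estimates for real functions *)
Section RealCalculus.
Context {R : realType}.
Implicit Types (f g : R -> R) (x y h d K e c : R).

(** Derivatives of series and integrals are obtained below through a quadratic
    bound on the Taylor remainder: such a bound can be summed and integrated,
    which a statement about limits of difference quotients cannot. *)
Lemma is_derive_quad f x d K e : 0 < e ->
  (forall h, `|h| < e -> `|f (x + h) - f x - h * d| <= K * h ^+ 2) ->
  is_derive x 1 f d.
Proof.
move=> e0 H.
have cv : h^-1 *: ((f \o shift x) (h *: 1) - f x) @[h --> 0^'] --> d.
  apply/cvgrPdist_le => /= eps eps0; near=> h.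
  have h0 : h != 0 by near: h; exact: nbhs_dnbhs_neq.
  have hn : 0 < `|h| by rewrite normr_gt0.
  have he : `|h| < e.
    by near: h; apply: dnbhs0_lt.
  have hK : `|h| < eps / (`|K| + 1).
    by near: h; apply: dnbhs0_lt; rewrite divr_gt0// ltr_wpDl.
  have -> : d - h^-1 *: ((f \o shift x) (h *: 1) - f x) =
            - (h^-1 * (f (x + h) - f x - h * d)).
    by rewrite /= -[h *: 1]/(h * 1) mulr1 addrC [in LHS]addrC -[_ *: _]/(_ * _) [h + x]addrC; field.
  rewrite normrN normrM normfV -(ler_pM2l hn) mulrA mulfV ?gt_eqF// mul1r.
  apply: (le_trans (H _ he)); rewrite -[h ^+ 2]real_normK ?num_real// expr2 mulrCA ler_wpM2l//.
  rewrite ltr_pdivlMr ?ltr_wpDl// in hK.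
  apply: (le_trans _ (ltW hK)); rewrite mulrC ler_wpM2l//.
  by rewrite (le_trans (ler_norm K))// lerDl.
by apply: DeriveDef; [apply/cvg_ex; exists d|exact/cvg_lim].
Unshelve. all: by end_near. Qed.

Lemma mean_value_le f (df : R -> R) x y : x <= y ->
  (forall z, x <= z <= y -> is_derive z 1 f (df z)) ->
  exists2 z, x <= z <= y & f y - f x = df z * (y - x).
Proof.
move=> xy D; have [||z Hz Ez] := @MVT_segment R f df x y xy.
- by move=> z /[!in_itv]/= /andP[a b]; apply: D; rewrite !ltW.
- apply: derivable_within_continuous => z /[!in_itv]/= Hz.
  by case: (D _ Hz).
by exists z => //; move: Hz; rewrite in_itv.
Qed.

Lemma mean_value f (df : R -> R) x y :
  (forall z, Num.min x y <= z <= Num.max x y -> is_derive z 1 f (df z)) ->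
  exists2 z, Num.min x y <= z <= Num.max x y & f y - f x = df z * (y - x).
Proof.
case: (leP x y) => [xy|/ltW xy] D; first exact: mean_value_le.
have [z Hz Ez] := mean_value_le xy D; exists z => //.
by rewrite -[LHS]opprB Ez -mulrN opprB.
Qed.

Lemma lipschitz_of_derive f (df : R -> R) C x y :
  (forall z, Num.min x y <= z <= Num.max x y -> is_derive z 1 f (df z)) ->
  (forall z, Num.min x y <= z <= Num.max x y -> `|df z| <= C) ->
  `|f y - f x| <= C * `|y - x|.
Proof.
move=> D B; have [z /B Hz ->] := mean_value D.
by rewrite normrM ler_wpM2r.
Qed.

Lemma between_ball x h e z : `|h| < e ->
  Num.min x (x + h) <= z <= Num.max x (x + h) -> `|z - x| <= `|h|.
Proof.
move=> he; have [h0|h0] := leP 0 h.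
  rewrite min_l ?lerDl// max_r ?lerDl// => /andP[a b].
  by rewrite ger0_norm ?subr_ge0// lerBlDl (le_trans b)// lerD2l ler_norm.
have xh : x + h <= x by rewrite gerDl ltW.
rewrite (min_idPr xh) (max_idPl xh) => /andP[a b].
by rewrite ler0_norm ?subr_le0// opprB ltr0_norm// lerBlDl; lra.
Qed.

Lemma taylor2 f (f1 f2 : R -> R) x e c :
  (forall y, `|y - x| < e -> is_derive y 1 f (f1 y)) ->
  (forall y, `|y - x| < e -> is_derive y 1 f1 (f2 y)) ->
  (forall y, `|y - x| < e -> `|f2 y| <= c) ->
  forall h, `|h| < e -> `|f (x + h) - f x - h * f1 x| <= c * h ^+ 2.
Proof.
move=> D1 D2 B h he.
have bb z := @between_ball x h e z he.
have [z /bb Hz ->] := @mean_value f f1 x (x + h)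
   (fun z Hz => D1 z (le_lt_trans (bb z Hz) he)).
have zx : Num.min x (x + (z - x)) <= x <= Num.max x (x + (z - x)).
  by rewrite ge_min le_max lexx.
rewrite (addrC x h) addrK mulrC -mulrBr normrM.
have b' w : Num.min x z <= w <= Num.max x z -> `|w - x| < e.
  have -> : z = x + (z - x) by rewrite addrC subrK.
  move=> /(@between_ball x (z - x) e w (le_lt_trans Hz he)) H.
  by rewrite (le_lt_trans H)// (le_lt_trans Hz).
have L : `|f1 z - f1 x| <= c * `|z - x|.
  by apply: (@lipschitz_of_derive f1 f2) => w /b' Hw; [exact: D2|exact: B].
have c0 : 0 <= c.
  by rewrite (le_trans _ (B x _))// subrr normr0 (le_lt_trans _ he).
apply: (le_trans (ler_wpM2l (normr_ge0 h) L)).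
rewrite -[h ^+ 2]real_normK ?num_real// expr2 mulrCA ler_wpM2l// ler_wpM2l//.
Qed.

End RealCalculus.

(** * Complex-valued functions of a real variable *)
Section ComplexTools.
Context {R : realType}.
Local Notation C := R[i].
Local Notation Re := (@complex.Re R).
Local Notation Im := (@complex.Im R).
Local Notation normc := (@Normc.normc R).
Local Notation ii := (Complex 0 1 : R[i]).
Local Notation rc := (real_complex R).
Implicit Types (z w : C) (x t : R).

Lemma cext z w : Re z = Re w -> Im z = Im w -> z = w.
Proof. by case: z w => [a b] [c d] /= -> ->. Qed.
Lemma ReD z w : Re (z + w) = Re z + Re w. Proof. by case: z w => [a b] []. Qed.
Lemma ImD z w : Im (z + w) = Im z + Im w. Proof. by case: z w => [a b] []. Qed.
Lemma ReN z : Re (- z) = - Re z. Proof. by case: z. Qed.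
Lemma ImN z : Im (- z) = - Im z. Proof. by case: z. Qed.
Lemma ReB z w : Re (z - w) = Re z - Re w. Proof. by case: z w => [a b] []. Qed.
Lemma ImB z w : Im (z - w) = Im z - Im w. Proof. by case: z w => [a b] []. Qed.
Lemma ReM z w : Re (z * w) = Re z * Re w - Im z * Im w.
Proof. by case: z w => [a b] []. Qed.
Lemma ImM z w : Im (z * w) = Re z * Im w + Im z * Re w.
Proof. by case: z w => [a b] []. Qed.
Lemma Re_rcM x z : Re (rc x * z) = x * Re z.
Proof. by rewrite ReM /= mul0r subr0. Qed.
Lemma Im_rcM x z : Im (rc x * z) = x * Im z.
Proof. by rewrite ImM /= mul0r addr0. Qed.
Lemma rcE (z : C) : z = rc (Re z) + ii * rc (Im z).
Proof. by apply: cext; rewrite ?ReD ?ImD ?ReM ?ImM/=; ring. Qed.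
Lemma natcE n : n%:R = rc n%:R :> C.
Proof. by rewrite raddfMn. Qed.
Lemma iiM : ii * ii = -1.
Proof. by apply: cext; rewrite ?ReM ?ImM /=; ring. Qed.

Lemma normc2E z : normc z ^+ 2 = Re z ^+ 2 + Im z ^+ 2.
Proof. by case: z => a b /=; rewrite sqr_sqrtr// addr_ge0 ?sqr_ge0. Qed.
Lemma normc_ge0 z : 0 <= normc z.
Proof. by case: z => a b; rewrite sqrtr_ge0. Qed.
Lemma normcM z w : normc (z * w) = normc z * normc w.
Proof. exact: Normc.normcM. Qed.
Lemma normcN z : normc (- z) = normc z.
Proof. by case: z => a b /=; rewrite !sqrrN. Qed.
Lemma normcB z w : normc (z - w) = normc (w - z).
Proof. by rewrite -normcN opprB. Qed.
Lemma normcV z : normc z^-1 = (normc z)^-1.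
Proof. exact: Normc.normcV. Qed.
Lemma normc_rc x : normc (rc x) = `|x|.
Proof. by rewrite /= expr0n addr0 sqrtr_sqr. Qed.
Lemma normc_nat n : normc n%:R = n%:R.
Proof. by rewrite natcE normc_rc normr_nat. Qed.
Lemma normcD z w : normc (z + w) <= normc z + normc w.
Proof. exact: le_normcD. Qed.
Lemma normcDB z w : normc (z - w) <= normc z + normc w.
Proof. by rewrite -(normcN w); exact: normcD. Qed.
Lemma normc_Re z : `|Re z| <= normc z.
Proof.
by rewrite -ler_sqr ?nnegrE ?normc_ge0// normc2E real_normK ?num_real// lerDl sqr_ge0.
Qed.
Lemma normc_Im z : `|Im z| <= normc z.
Proof.
by rewrite -ler_sqr ?nnegrE ?normc_ge0// normc2E real_normK ?num_real// lerDr sqr_ge0.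
Qed.
Lemma normc_le z : normc z <= `|Re z| + `|Im z|.
Proof.
rewrite -ler_sqr ?nnegrE ?normc_ge0 ?addr_ge0// normc2E sqrrD.
by rewrite !real_normK ?num_real// lerD2r lerDl mulrn_wge0// mulr_ge0.
Qed.
Lemma normc_i : normc ii = 1.
Proof. by rewrite /= expr0n add0r expr1n sqrtr1. Qed.
Lemma normcX z n : normc (z ^+ n) = normc z ^+ n.
Proof.
elim: n => [|n IH]; first by rewrite !expr0 -[1]/(rc 1) normc_rc normr1.
by rewrite !exprS normcM IH.
Qed.
Lemma normc_expi x : normc (expi x) = 1.
Proof. by rewrite /= cos2Dsin2 sqrtr1. Qed.
Lemma normc0 : normc 0 = 0. Proof. exact: Normc.normc0. Qed.
Lemma normc1 : normc 1 = 1. Proof. exact: Normc.normc1. Qed.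
Lemma normc_eq0 z : (normc z == 0) = (z == 0).
Proof. by apply/eqP/eqP => [/Normc.eq0_normc//|->]; exact: normc0. Qed.
Lemma normc_sum I (r : seq I) (F : I -> C) :
  normc (\sum_(i <- r) F i) <= \sum_(i <- r) normc (F i).
Proof.
elim: r => [|i r IH]; first by rewrite !big_nil normc0.
by rewrite !big_cons (le_trans (normcD _ _))// lerD2l.
Qed.

Lemma expiD x t : expi (x + t) = expi x * expi t.
Proof. by rewrite /expi cosD sinD; apply: cext => /=; ring. Qed.
Lemma expi0 : expi (0 : R) = 1.
Proof. by rewrite /expi cos0 sin0. Qed.

(** Differentiability together with the value of the derivative, so that the
    rules of calculus compose without ever evaluating an iterated [derive1n]. *)
Definition cdiff (f : R -> C) (d : C) (x : R) : Prop :=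
  is_derive x 1 (fun y => Re (f y)) (Re d) /\ is_derive x 1 (fun y => Im (f y)) (Im d).

Lemma is_derive_ext (f g : R -> R) x d :
  f =1 g -> is_derive x 1 f d -> is_derive x 1 g d.
Proof. by move=> /funext ->. Qed.

Lemma cdiff_ext f g d x : f =1 g -> cdiff f d x -> cdiff g d x.
Proof. by move=> /funext ->. Qed.

Lemma cdiff_near f g d x : (\near x, f x = g x) -> cdiff f d x -> cdiff g d x.
Proof.
by move=> H [a b]; split;
  [apply: near_eq_is_derive a|apply: near_eq_is_derive b];
  near do rewrite (near H _)//.
Unshelve. all: by end_near. Qed.

Lemma cdiff_cst c x : cdiff (fun=> c) 0 x.
Proof. by split; exact: is_derive_cst. Qed.

Lemma cdiffD f g df dg x : cdiff f df x -> cdiff g dg x ->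
  cdiff (fun y => f y + g y) (df + dg) x.
Proof.
move=> [a b] [c d]; split; rewrite ?ReD ?ImD.
  by apply: is_derive_ext (is_deriveD a c) => y; rewrite /= ReD.
by apply: is_derive_ext (is_deriveD b d) => y; rewrite /= ImD.
Qed.

Lemma cdiffM f g df dg x : cdiff f df x -> cdiff g dg x ->
  cdiff (fun y => f y * g y) (df * g x + f x * dg) x.
Proof.
move=> [a b] [c d]; split.
  apply: is_derive_eq.
    apply: is_derive_ext (is_deriveB (is_deriveM a c) (is_deriveM b d)) => y.
    by rewrite /= ReM.
  by rewrite ReD !ReM -![_ *: _]/(_ * _); ring.
apply: is_derive_eq.
  apply: is_derive_ext (is_deriveD (is_deriveM a d) (is_deriveM b c)) => y.
  by rewrite /= ImM.
by rewrite ImD !ImM -![_ *: _]/(_ * _); ring.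
Qed.

Lemma cdiffZ c f df x : cdiff f df x -> cdiff (fun y => c * f y) (c * df) x.
Proof.
by move=> H; have := cdiffM (cdiff_cst c x) H; rewrite mul0r add0r.
Qed.

Lemma cdiffN f df x : cdiff f df x -> cdiff (fun y => - f y) (- df) x.
Proof.
move=> H; rewrite -mulN1r; apply: cdiff_ext (cdiffZ (-1) H) => y.
by rewrite mulN1r.
Qed.

Lemma cdiffB f g df dg x : cdiff f df x -> cdiff g dg x ->
  cdiff (fun y => f y - g y) (df - dg) x.
Proof. by move=> F G; apply: cdiffD F (cdiffN G). Qed.

Lemma cdiff_rc (f : R -> R) d x : is_derive x 1 f d ->
  cdiff (fun y => rc (f y)) (rc d) x.
Proof. by move=> H; split => //=; exact: is_derive_cst. Qed.

Lemma cdiff_expi (f : R -> R) d x : is_derive x 1 f d ->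
  cdiff (fun y => expi (f y)) (ii * rc d * expi (f x)) x.
Proof.
move=> H; split => /=.
  have D := is_derive1_comp (is_derive_cos (f x)) H.
  by apply: is_derive_eq D _ => /=; ring.
have D := is_derive1_comp (is_derive_sin (f x)) H.
by apply: is_derive_eq D _ => /=; ring.
Qed.

Lemma cdiff_comp (f : R -> C) (g : R -> R) d dg x : cdiff f d (g x) ->
  is_derive x 1 g dg -> cdiff (fun y => f (g y)) (rc dg * d) x.
Proof.
move=> [a b] H; split; rewrite ?Re_rcM ?Im_rcM mulrC.
  exact: (is_derive1_comp a H).
exact: (is_derive1_comp b H).
Qed.

Lemma is_derive_unique (f : R -> R) x d d' :
  is_derive x 1 f d -> is_derive x 1 f d' -> d = d'.
Proof. by move=> [_ <-] [_ <-]. Qed.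

Lemma cdiff_unique f x d d' : cdiff f d x -> cdiff f d' x -> d = d'.
Proof.
by move=> [a b] [c e]; apply: cext; [exact: is_derive_unique a c|exact: is_derive_unique b e].
Qed.

Lemma cdiff_cderivable f x d : cdiff f d x -> cderivable f x.
Proof. move=> [[a _] [b _]]; exact: conj a b. Qed.

Lemma cderivable_cdiff f x : cderivable f x -> cdiff f (cderive 1 f x) x.
Proof.
by move=> [a b]; split; rewrite /= /derive1n /= derive1E; exact: derivableP.
Qed.

Lemma is_derive_continuous (f : R -> R) x d :
  is_derive x 1 f d -> {for x, continuous f}.
Proof.
by move=> [D _]; apply: differentiable_continuous; apply/derivable1_diffP.
Qed.

Lemma cdiff_quad f d x K e : 0 < e ->
  (forall h, `|h| < e -> normc (f (x + h) - f x - rc h * d) <= K * h ^+ 2) ->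
  cdiff f d x.
Proof.
move=> e0 H; split; apply: (@is_derive_quad _ _ _ _ K e e0) => h /H Hh.
  by rewrite -Re_rcM -!ReB (le_trans (normc_Re _)).
by rewrite -Im_rcM -!ImB (le_trans (normc_Im _)).
Qed.

Lemma ctaylor2 f (f1 f2 : R -> C) x e c :
  (forall y, `|y - x| < e -> cdiff f (f1 y) y) ->
  (forall y, `|y - x| < e -> cdiff f1 (f2 y) y) ->
  (forall y, `|y - x| < e -> normc (f2 y) <= c) ->
  forall h, `|h| < e -> normc (f (x + h) - f x - rc h * f1 x) <= 2 * c * h ^+ 2.
Proof.
move=> D1 D2 B h he; apply: (le_trans (normc_le _)).
rewrite -mulrA mulr_natl mulr2n; apply: lerD.
  rewrite !ReB Re_rcM.
  apply: (@taylor2 _ (fun y => Re (f y)) (fun y => Re (f1 y)) (fun y => Re (f2 y)) x e) => //.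
  - by move=> y /D1[].
  - by move=> y /D2[].
  - by move=> y /B; apply: le_trans; exact: normc_Re.
rewrite !ImB Im_rcM.
apply: (@taylor2 _ (fun y => Im (f y)) (fun y => Im (f1 y)) (fun y => Im (f2 y)) x e) => //.
- by move=> y /D1[].
- by move=> y /D2[].
- by move=> y /B; apply: le_trans; exact: normc_Im.
Qed.

(** The factor 2, here and in [ctaylor2] and [normc_cint_le], is the price of
    bounding the real and imaginary parts separately. *)
Lemma clipschitz (f df : R -> C) (K x y : R) :
  (forall z : R, Num.min x y <= z <= Num.max x y -> cdiff f (df z) z) ->
  (forall z : R, Num.min x y <= z <= Num.max x y -> normc (df z) <= K) ->
  normc (f y - f x) <= 2 * K * `|y - x|.
Proof.
move=> D B; apply: (le_trans (normc_le _)); rewrite ReB ImB -mulrA mulr_natl mulr2n.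
apply: lerD.
  apply: (@lipschitz_of_derive _ (fun y => Re (f y)) (fun y => Re (df y))).
  - by move=> z /D[].
  - by move=> z /B; apply: le_trans; exact: normc_Re.
apply: (@lipschitz_of_derive _ (fun y => Im (f y)) (fun y => Im (df y))).
- by move=> z /D[].
- by move=> z /B; apply: le_trans; exact: normc_Im.
Qed.

(** All the derivatives of [F 0], given in closed form. Smoothness and the value
    of every iterated derivative then follow from one differentiation step; see
    [ladder_cderive] and [ladder_csmooth]. *)
Definition ladder (U : set R) (F : nat -> R -> C) : Prop :=
  forall n x, U x -> cdiff (F n) (F n.+1 x) x.

Lemma ladder_cderive U F g : open U -> ladder U F ->
  (forall x, U x -> g x = F 0 x) ->
  forall n x, U x -> cderive n g x = F n x.
Proof.
move=> oU L E; elim=> [|n IH] x Ux; first by rewrite /cderive /= -E//; case: (g x).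
have N : \near x, F n x = cderive n g x.
  by near=> y; rewrite IH//; near: y; exact: open_nbhs_nbhs.
have [a b] := cdiff_near N (L n x Ux).
apply: cext; rewrite /= derive1E.
  exact: (@derive_val _ _ _ _ _ _ _ a).
exact: (@derive_val _ _ _ _ _ _ _ b).
Unshelve. all: by end_near. Qed.

Lemma ladder_csmooth U F g : open U -> ladder U F ->
  (forall x, U x -> g x = F 0 x) -> csmooth U g.
Proof.
move=> oU L E n x Ux; apply: (@cdiff_cderivable _ _ (F n.+1 x)).
apply: cdiff_near (L n x Ux); near=> y.
by rewrite (ladder_cderive oU L E)//; near: y; exact: open_nbhs_nbhs.
Unshelve. all: by end_near. Qed.

Lemma csmooth_ladder U f : csmooth U f -> ladder U (fun n => cderive n f).
Proof.
move=> S n x Ux; have [a b] := S n x Ux.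
by split; rewrite /cderive /= derive1E; exact: derivableP.
Qed.

Local Notation half := (2^-1 : R).

Lemma half_lt1 : `|half| < 1.
Proof. by rewrite gtr0_norm ?invr_gt0// invf_lt1 ?ltr1n. Qed.

Lemma series_dom (a : nat -> R) K : (forall j, `|a j| <= K * half ^+ j) ->
  cvgn (series a) /\ `|limn (series a)| <= K * 2.
Proof.
move=> H; have cg := is_cvg_geometric_series (a := K) half_lt1.
have cn : cvgn [normed series a].
  exact: series_le_cvg (fun n => normr_ge0 _) (fun n => le_trans (normr_ge0 _) (H n)) H cg.
split; first exact: normed_cvg.
apply: (le_trans (lim_series_norm cn)).
have -> : K * 2 = limn (series (geometric K half)).
  rewrite (cvg_lim _ (cvg_geometric_series (a := K) half_lt1))//.
  by rewrite (_ : 1 - half = half) ?invrK//; lra.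
exact: lim_series_le.
Qed.

(** The ratio 1/2 is fixed once for all: the estimates on the terms leave room to
    absorb any other geometric factor in the constant. *)
Definition geodom (a : nat -> C) (K : R) := forall j, normc (a j) <= K * half ^+ j.

Lemma geodom_summable a K : geodom a K -> csummable a.
Proof.
move=> H; split.
  by apply: (proj1 (@series_dom _ K _)) => j; rewrite (le_trans (normc_Re _)).
by apply: (proj1 (@series_dom _ K _)) => j; rewrite (le_trans (normc_Im _)).
Qed.

Lemma geodom_csum_le a K : geodom a K -> normc (csum a) <= 4 * K.
Proof.
move=> H; apply: (le_trans (normc_le _)); rewrite /csum /=.
have A : `|limn (series (fun j => Re (a j)))| <= K * 2.
  by apply: (proj2 (@series_dom _ K _)) => j; rewrite (le_trans (normc_Re _)).
have B : `|limn (series (fun j => Im (a j)))| <= K * 2.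
  by apply: (proj2 (@series_dom _ K _)) => j; rewrite (le_trans (normc_Im _)).
by apply: (le_trans (lerD A B)); lra.
Qed.

Lemma csumB (a b : nat -> C) : csummable a -> csummable b ->
  csum (fun j => a j - b j) = csum a - csum b.
Proof.
move=> [ra ia] [rb ib]; rewrite /csum; apply: cext; rewrite /= -lim_seriesB//;
  congr (limn (series _)); apply/funext => j; by rewrite ?ReB ?ImB.
Qed.

Lemma eq_csum (a b : nat -> C) : a =1 b -> csum a = csum b.
Proof. by move=> /funext ->. Qed.

Lemma csum0 : csum (fun=> 0 : C) = 0.
Proof.
by apply: cext => /=; apply/cvg_lim => //; rewrite (_ : series _ = fun=> 0); try exact: cvg_cst;
  apply/funext => n; rewrite /series /= big1.
Qed.

Lemma csumZ c (a : nat -> C) : csummable a ->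
  csum (fun j => c * a j) = c * csum a.
Proof.
move=> [ra ia]; have Z (k : R) (f : nat -> R) : cvgn (series f) ->
    cvgn (series (fun j => k * f j)) /\ limn (series (fun j => k * f j)) = k * limn (series f).
  by move=> cf; split; [exact: (is_cvg_seriesZ (k := k) cf)|exact: (lim_seriesZ k cf)].
rewrite /csum; apply: cext; rewrite /= ?ReM ?ImM /=.
  rewrite -(proj2 (Z (Re c) _ ra)) -(proj2 (Z (Im c) _ ia)) -lim_seriesB.
  - by congr (limn (series _)); apply/funext => j; rewrite ReM.
  - exact: (proj1 (Z _ _ ra)).
  - exact: (proj1 (Z _ _ ia)).
rewrite -(proj2 (Z (Re c) _ ia)) -(proj2 (Z (Im c) _ ra)) -lim_seriesD.
- by congr (limn (series _)); apply/funext => j; rewrite ImM.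
- exact: (proj1 (Z _ _ ia)).
- exact: (proj1 (Z _ _ ra)).
Qed.

Lemma geodomB a b K L : geodom a K -> geodom b L -> geodom (fun j => a j - b j) (K + L).
Proof.
by move=> A B j; apply: (le_trans (normcDB _ _)); rewrite mulrDl lerD.
Qed.

Lemma geodomZ c a K : geodom a K -> geodom (fun j => c * a j) (normc c * K).
Proof. by move=> A j; rewrite normcM -mulrA ler_wpM2l// normc_ge0. Qed.

(** Termwise differentiation: the quadratic Taylor remainders of the terms are
    dominated by the same geometric series as the second derivatives. *)
Lemma cdiff_csum (a b c : nat -> R -> C) x (e K : R) : 0 < e ->
  (forall j y, `|y - x| < e -> cdiff (a j) (b j y) y) ->
  (forall j y, `|y - x| < e -> cdiff (b j) (c j y) y) ->
  (forall y, `|y - x| < e -> geodom (a^~ y) K) ->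
  (forall y, `|y - x| < e -> geodom (b^~ y) K) ->
  (forall y, `|y - x| < e -> geodom (c^~ y) K) ->
  cdiff (fun y => csum (a^~ y)) (csum (b^~ x)) x.
Proof.
move=> e0 Da Db Ga Gb Gc; apply: (@cdiff_quad _ _ _ (4 * (2 * K)) e e0) => h he.
have xx : `|x - x| < e by rewrite subrr normr0.
have xh : `|x + h - x| < e by rewrite addrC addKr.
rewrite -csumZ; last exact: geodom_summable (Gb _ xx).
rewrite -csumB; [|exact: geodom_summable (Ga _ xh)|exact: geodom_summable (Ga _ xx)].
rewrite -csumB; first last.
- exact: geodom_summable (geodomZ _ (Gb _ xx)).
- exact: geodom_summable (geodomB (Ga _ xh) (Ga _ xx)).
rewrite -mulrA; apply: geodom_csum_le => j.
have -> : 2 * K * h ^+ 2 * half ^+ j = 2 * (K * half ^+ j) * h ^+ 2 by ring.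
apply: (@ctaylor2 (a j) (b j) (c j) x e) => // y ye; [exact: Da|exact: Db|exact: Gc].
Qed.

End ComplexTools.

(** * Complex-valued integrals *)
Section Integrals.
Context {R : realType}.
Local Notation C := R[i].
Local Notation Re := (@complex.Re R).
Local Notation Im := (@complex.Im R).
Local Notation normc := (@Normc.normc R).
Local Notation rc := (real_complex R).
Local Notation mu := (@lebesgue_measure R).
Implicit Types (D : set R) (f g : R -> C) (u v : R -> R) (z w : C).

Definition rint D u := mu.-integrable D (EFin \o u).
Definition cmeas D f := measurable_fun D (fun x => Re (f x)) /\
  measurable_fun D (fun x => Im (f x)).
Definition cintegrable D f := rint D (fun x => Re (f x)) /\ rint D (fun x => Im (f x)).

Lemma rint_meas D u : rint D u -> measurable_fun D u.
Proof. by move=> /measurable_int/measurable_EFinP. Qed.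

Lemma rint_dom D u v : measurable D -> measurable_fun D u ->
  (forall x, D x -> `|u x| <= v x) -> rint D v -> rint D u.
Proof.
move=> mD mu' uv iv; apply: le_integrable iv => //; first exact/measurable_EFinP.
by move=> x Dx /=; rewrite lee_fin (le_trans (uv x Dx))// ler_norm.
Qed.

Lemma rintD D u v : measurable D -> rint D u -> rint D v -> rint D (fun x => u x + v x).
Proof. by move=> mD iu iv; have := integrableD (mu := mu) mD iu iv; apply: eq_integrable. Qed.

Lemma rintB D u v : measurable D -> rint D u -> rint D v -> rint D (fun x => u x - v x).
Proof. by move=> mD iu iv; have := integrableB (mu := mu) mD iu iv; apply: eq_integrable. Qed.

Lemma rintZ D k u : measurable D -> rint D u -> rint D (fun x => k * u x).
Proof. by move=> mD iu; have := integrableZl (mu := mu) mD k iu; apply: eq_integrable. Qed.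

Lemma rint_norm D u : rint D u -> rint D (fun x => `|u x|).
Proof. exact: integrable_norm. Qed.

Lemma rintS D E u : measurable D -> measurable E -> E `<=` D -> rint D u -> rint E u.
Proof. by move=> mD mE ED; exact: integrableS. Qed.

Lemma rint_cst (a b : R) k : rint `[a, b] (fun=> k).
Proof.
apply: (@measurable_bounded_integrable _ _ _ _ (fun=> k)) => //.
- by rewrite /= lebesgue_measure_itv/=; case: ifP => // _; rewrite -EFinB ltry.
- exact: bounded_cst.
Qed.

Lemma cmeasD D f g : cmeas D f -> cmeas D g -> cmeas D (fun x => f x + g x).
Proof.
move=> [a b] [c d]; split.
  by under eq_fun do rewrite ReD; exact: measurable_funD.
by under eq_fun do rewrite ImD; exact: measurable_funD.
Qed.

Lemma cmeasN D f : cmeas D f -> cmeas D (fun x => - f x).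
Proof.
move=> [a b]; split.
  by under eq_fun do rewrite ReN; exact: measurable_funN.
by under eq_fun do rewrite ImN; exact: measurable_funN.
Qed.

Lemma cmeasB D f g : cmeas D f -> cmeas D g -> cmeas D (fun x => f x - g x).
Proof. by move=> a b; apply: cmeasD => //; exact: cmeasN. Qed.

Lemma cmeasM D f g : cmeas D f -> cmeas D g -> cmeas D (fun x => f x * g x).
Proof.
move=> [a b] [c d]; split.
  by under eq_fun do rewrite ReM; apply: measurable_funB; exact: measurable_funM.
by under eq_fun do rewrite ImM; apply: measurable_funD; exact: measurable_funM.
Qed.

Lemma cmeas_cst D z : cmeas D (fun=> z).
Proof. by split; exact: measurable_cst. Qed.

Lemma cmeas_rc D u : measurable_fun D u -> cmeas D (fun x => rc (u x)).
Proof. by move=> m; split => //=; exact: measurable_cst. Qed.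

Lemma cmeasS D E f : measurable D -> E `<=` D -> cmeas D f -> cmeas E f.
Proof. by move=> mD ED [a b]; split; [exact: measurable_funS a|exact: measurable_funS b]. Qed.

Lemma measurable_normc2 D f : cmeas D f -> measurable_fun D (fun x => normc (f x) ^+ 2).
Proof.
move=> [a b]; under eq_fun do rewrite normc2E.
by apply: measurable_funD; exact: measurable_funX.
Qed.

Lemma normcE z : normc z = Num.sqrt (normc z ^+ 2).
Proof. by rewrite sqrtr_sqr ger0_norm// normc_ge0. Qed.

Lemma measurable_normc D f : cmeas D f -> measurable_fun D (fun x => normc (f x)).
Proof.
move=> m; under eq_fun do rewrite normcE.
have ms : measurable_fun [set: R] (@Num.sqrt R).
  by apply: continuous_measurable_fun; exact: sqrt_continuous.
exact: (measurableT_comp ms (measurable_normc2 m)).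
Qed.

Lemma cint_meas D f : cintegrable D f -> cmeas D f.
Proof. by move=> [/rint_meas a /rint_meas b]. Qed.

Lemma cintegrable_dom D f u : measurable D -> cmeas D f ->
  (forall x, D x -> normc (f x) <= u x) -> rint D u -> cintegrable D f.
Proof.
move=> mD [a b] fu iu; split; apply: rint_dom iu => // x Dx.
  exact: le_trans (normc_Re _) (fu x Dx).
exact: le_trans (normc_Im _) (fu x Dx).
Qed.

Lemma cintegrable_normc D f : measurable D -> cintegrable D f ->
  rint D (fun x => normc (f x)).
Proof.
move=> mD H; have [a b] := H.
apply: (@rint_dom _ _ (fun x => `|Re (f x)| + `|Im (f x)|)) => //.
- exact: measurable_normc (cint_meas H).
- by move=> x _; rewrite ger0_norm ?normc_ge0 ?normc_le.
- by apply: rintD => //; exact: rint_norm.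
Qed.

Lemma normc_cint_le D f u : measurable D -> cmeas D f ->
  (forall x, D x -> normc (f x) <= u x) -> rint D u ->
  normc (cint D f) <= 2 * \int[mu]_(x in D) u x.
Proof.
move=> mD mf fu iu; have [a b] := cintegrable_dom mD mf fu iu.
apply: (le_trans (normc_le _)); rewrite /cint /= mulr_natl mulr2n.
apply: lerD; apply: (le_trans (le_normr_Rintegral _ _)) => //;
  apply: le_Rintegral => //; try exact: rint_norm.
  by move=> x Dx; exact: le_trans (normc_Re _) (fu x Dx).
by move=> x Dx; exact: le_trans (normc_Im _) (fu x Dx).
Qed.

Lemma eq_cint D f g : (forall x, D x -> f x = g x) -> cint D f = cint D g.
Proof.
by move=> E; rewrite /cint; congr Complex; apply: eq_Rintegral => x /set_mem Dx; rewrite E.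
Qed.

Lemma cintegrableD D f g : measurable D -> cintegrable D f -> cintegrable D g ->
  cintegrable D (fun x => f x + g x).
Proof.
move=> mD [a b] [c d]; split.
  by under eq_fun do rewrite ReD; exact: rintD.
by under eq_fun do rewrite ImD; exact: rintD.
Qed.

Lemma cintegrableZ D z f : measurable D -> cintegrable D f ->
  cintegrable D (fun x => z * f x).
Proof.
move=> mD [a b]; split.
  by under eq_fun do rewrite ReM; apply: rintB => //; exact: rintZ.
by under eq_fun do rewrite ImM; apply: rintD => //; exact: rintZ.
Qed.

Lemma cintegrableN D f : measurable D -> cintegrable D f ->
  cintegrable D (fun x => - f x).
Proof.
by move=> mD H; under eq_fun do rewrite -mulN1r; exact: cintegrableZ.
Qed.

Lemma cintegrableB D f g : measurable D -> cintegrable D f -> cintegrable D g ->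
  cintegrable D (fun x => f x - g x).
Proof. by move=> mD F G; apply: cintegrableD => //; exact: cintegrableN. Qed.

Lemma cintD D f g : measurable D -> cintegrable D f -> cintegrable D g ->
  cint D (fun x => f x + g x) = cint D f + cint D g.
Proof.
move=> mD [a b] [c d]; apply: cext; rewrite ?ReD ?ImD /= -RintegralD//;
  by apply: eq_Rintegral => x _; rewrite ?ReD ?ImD.
Qed.

Lemma cintZ D z f : measurable D -> cintegrable D f ->
  cint D (fun x => z * f x) = z * cint D f.
Proof.
move=> mD [a b]; apply: cext; rewrite ?ReM ?ImM /= -!RintegralZl// -?RintegralB -?RintegralD//;
  do ?[exact: rintZ]; by apply: eq_Rintegral => x _; rewrite ?ReM ?ImM.
Qed.

Lemma cintN D f : measurable D -> cintegrable D f ->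
  cint D (fun x => - f x) = - cint D f.
Proof.
by move=> mD H; under eq_fun do rewrite -mulN1r; rewrite cintZ// mulN1r.
Qed.

Lemma cintB D f g : measurable D -> cintegrable D f -> cintegrable D g ->
  cint D (fun x => f x - g x) = cint D f - cint D g.
Proof.
move=> mD F G; rewrite cintD//; last exact: cintegrableN.
by rewrite cintN.
Qed.

Lemma cint0 D : cint D (fun=> 0 : C) = 0.
Proof.
by rewrite /cint/= /Rintegral integral0.
Qed.

Lemma cintegrable0 D : cintegrable D (fun=> 0 : C).
Proof. by split; exact: integrable0. Qed.

Lemma cintegrable_sum I (r : seq I) D (F : I -> R -> C) : measurable D ->
  (forall i, cintegrable D (F i)) ->
  cintegrable D (fun x => \sum_(i <- r) F i x).
Proof.
move=> mD H; elim: r => [|i r IH].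
  by under eq_fun do rewrite big_nil; exact: cintegrable0.
by under eq_fun do rewrite big_cons; exact: cintegrableD.
Qed.

Lemma cint_sum I (r : seq I) D (F : I -> R -> C) : measurable D ->
  (forall i, cintegrable D (F i)) ->
  cint D (fun x => \sum_(i <- r) F i x) = \sum_(i <- r) cint D (F i).
Proof.
move=> mD H; elim: r => [|i r IH].
  by rewrite big_nil -[RHS](cint0 D); apply: eq_cint => x _; rewrite big_nil.
rewrite big_cons -IH -cintD//; last exact: cintegrable_sum.
by apply: eq_cint => x _; rewrite big_cons.
Qed.

Lemma cintegrable_bounded D f g K : measurable D -> cmeas D f -> cintegrable D g ->
  (forall x, D x -> normc (f x) <= K) -> cintegrable D (fun x => f x * g x).
Proof.
move=> mD mf ig B; apply: (@cintegrable_dom _ _ (fun x => K * normc (g x))) => //.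
- exact: cmeasM mf (cint_meas ig).
- by move=> x Dx; rewrite normcM ler_wpM2r ?normc_ge0 ?B.
- by apply: rintZ => //; exact: cintegrable_normc.
Qed.

(** A bounded second derivative makes the Taylor remainder of the kernel
    quadratic uniformly in [s]; it remains so after integration against [g]. *)
Lemma cdiff_cint D (a b c : R -> R -> C) g x (e K : R) : 0 < e -> measurable D ->
  cintegrable D g ->
  (forall y, `|y - x| < e -> cmeas D (a y)) ->
  (forall y, `|y - x| < e -> cmeas D (b y)) ->
  (forall s y, D s -> `|y - x| < e -> cdiff (a ^~ s) (b y s) y) ->
  (forall s y, D s -> `|y - x| < e -> cdiff (b ^~ s) (c y s) y) ->
  (forall s y, D s -> `|y - x| < e -> normc (a y s) <= K) ->
  (forall s y, D s -> `|y - x| < e -> normc (b y s) <= K) ->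
  (forall s y, D s -> `|y - x| < e -> normc (c y s) <= K) ->
  cdiff (fun y => cint D (fun s => a y s * g s)) (cint D (fun s => b x s * g s)) x.
Proof.
move=> e0 mD ig ma mb Da Db Ba Bb Bc.
pose G := \int[mu]_(s in D) normc (g s).
apply: (@cdiff_quad _ _ _ _ (2 * (2 * K * G)) e e0) => h he.
have xx : `|x - x| < e by rewrite subrr normr0.
have xh : `|x + h - x| < e by rewrite addrC addKr.
have ia y : `|y - x| < e -> cintegrable D (fun s => a y s * g s).
  by move=> ye; apply: (@cintegrable_bounded _ _ _ K) => // [|s Ds]; [exact: ma|exact: Ba].
have ib : cintegrable D (fun s => b x s * g s).
  by apply: (@cintegrable_bounded _ _ _ K) => // [|s Ds]; [exact: mb|exact: Bb].
rewrite -cintZ// -(cintB mD (ia _ xh) (ia _ xx)).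
rewrite -(cintB mD (cintegrableB mD (ia _ xh) (ia _ xx)) (cintegrableZ _ mD ib)).
have ing := cintegrable_normc mD ig.
have -> : 2 * (2 * K * G) * h ^+ 2 = 2 * \int[mu]_(s in D) (2 * K * h ^+ 2 * normc (g s)).
  by rewrite RintegralZl// -/G; ring.
apply: normc_cint_le => //.
- apply: (cint_meas (cintegrableB mD (cintegrableB mD (ia _ xh) (ia _ xx)) (cintegrableZ _ mD ib))).
- move=> s Ds; have -> : a (x + h) s * g s - a x s * g s - rc h * (b x s * g s) =
     (a (x + h) s - a x s - rc h * b x s) * g s by ring.
  rewrite normcM ler_wpM2r ?normc_ge0//.
  apply: (@ctaylor2 _ (a ^~ s) (b ^~ s) (c ^~ s) x e) => // y ye; [exact: Da|exact: Db|exact: Bc].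
- exact: rintZ.
Qed.

End Integrals.

(** * Factorials and the terms of the flat series *)
Section GevreyEstimates.
Context {R : realType}.
Local Notation Re := (@complex.Re R).
Local Notation Im := (@complex.Im R).
Local Notation normc := (@Normc.normc R).
Implicit Types (x t s : R).

Lemma fact_neq0 n : n`!%:R != 0 :> R.
Proof. by rewrite pnatr_eq0 -lt0n fact_gt0. Qed.
Lemma factR_gt0 n : 0 < n`!%:R :> R.
Proof. by rewrite ltr0n fact_gt0. Qed.

Lemma pow_fact_le_exp x n : 0 <= x -> x ^+ n / n`!%:R <= expR x.
Proof.
move=> x0; have cv := is_cvg_series_exp_coeff x.
have nd : nondecreasing_seq (series (exp_coeff x)).
  apply/nondecreasing_seqP => k; rewrite /series /= big_nat_recr//= lerDl.
  by rewrite divr_ge0 ?exprn_ge0.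
apply: (@le_trans _ _ (limn (series (exp_coeff x)))); last by [].
apply: le_trans (nondecreasing_cvgn_le nd cv n.+1).
rewrite /series /= big_nat_recr//= lerDr.
by apply: sumr_ge0 => k _; rewrite divr_ge0 ?exprn_ge0.
Qed.

(** This is where [s < 2] enters: the gain [(2j+1)!] over [j!^s] leaves a positive
    power of a factorial, which absorbs every geometric factor. *)
Lemma pow_le_fact_pow (B d : R) : 0 <= B -> 0 < d ->
  exists2 K : R, 0 < K & forall m, B ^+ m <= K * m`!%:R `^ d.
Proof.
move=> B0 d0; pose b := B `^ d^-1; exists (expR b `^ d); first exact/powR_gt0/expR_gt0.
move=> m; have b0 : 0 <= b by exact: powR_ge0.
have -> : B ^+ m = (b ^+ m) `^ d.
  rewrite -[b ^+ m]powR_mulrn// /b -!powRrM (_ : d^-1 * _ = m%:R) ?powR_mulrn//.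
  by field; rewrite gt_eqF.
rewrite -powRM ?expR_ge0//; apply: ge0_ler_powR; rewrite ?nnegrE ?(ltW d0)//.
- by rewrite exprn_ge0.
- by rewrite -ler_pdivrMr ?factR_gt0// pow_fact_le_exp.
Qed.

Lemma bin_le_exp n k : ('C(n, k) <= 2 ^ n)%N.
Proof.
elim: n k => [|n IH] [|k] //; first by rewrite bin0 expn_gt0.
by rewrite binS expnS mul2n -addnn leq_add.
Qed.

Lemma fact_addn_le n k : ((n + k)`! <= 2 ^ (n + k) * (n`! * k`!))%N.
Proof.
have := @bin_fact (n + k) k (leq_addl _ _).
rewrite addnK => <-; rewrite leq_mul ?bin_le_exp//.
by rewrite mulnC.
Qed.

Lemma fact_sqr_le j : (j`! * j`! <= (2 * j + 1)`!)%N.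
Proof.
have := @bin_fact (j + j) j (leq_addl _ _).
rewrite addnK => E; apply: (@leq_trans (j + j)`!).
  by rewrite -E leq_pmull// bin_gt0 leq_addl.
by apply: leq_fact; rewrite mul2n -addnn leq_addr.
Qed.

Lemma powR_fact_add n k s : 1 <= s <= 2 ->
  (n + k)`!%:R `^ s <= 4 ^+ (n + k) * (n`!%:R `^ s * k`!%:R `^ s) :> R.
Proof.
move=> /andP[s1 s2]; have s0 : 0 <= s by exact: le_trans s1.
apply: (@le_trans _ _ ((2 ^ (n + k) * (n`! * k`!))%:R `^ s)).
  by apply: ge0_ler_powR; rewrite ?nnegrE// ler_nat fact_addn_le.
rewrite !natrM !powRM// ler_wpM2r ?mulr_ge0 ?powR_ge0//.
apply: (@le_trans _ _ ((2 ^ (n + k))%:R `^ 2)).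
  by apply: ler_powR => //; rewrite ler1n expn_gt0.
by rewrite powR_mulrn// natrX -exprM mulnC exprM -natrX.
Qed.

Lemma powR_fact_half q m j s : 1 <= s <= 2 -> (q + m = 2 * j + 1)%N ->
  j`!%:R `^ s <= 2 ^+ (q + m) * (q`!%:R `^ (s / 2) * m`!%:R `^ (s / 2)) :> R.
Proof.
move=> /andP[s1 s2] E; have s0 : 0 <= s / 2 by lra.
have -> : j`!%:R `^ s = (j`! * j`!)%:R `^ (s / 2) :> R.
  rewrite natrM powRM// -powRD; last by rewrite fact_neq0 implybT.
  by congr (_ `^ _); field.
apply: (@le_trans _ _ ((2 ^ (q + m) * (q`! * m`!))%:R `^ (s / 2))).
  apply: ge0_ler_powR; rewrite ?nnegrE// ler_nat.
  by apply: (leq_trans (fact_sqr_le j)); rewrite -E fact_addn_le.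
rewrite !natrM !powRM// ler_wpM2r ?mulr_ge0 ?powR_ge0//.
have h : 1 <= (2 ^ (q + m))%:R :> R by rewrite ler1n expn_gt0.
apply: (@le_trans _ _ ((2 ^ (q + m))%:R `^ 1)); first by apply: ler_powR => //; lra.
by rewrite powRr1// natrX.
Qed.

Definition mon (k : nat) x : R := x ^+ k / k`!%:R.
(** The [q]-th derivative of [x^(2j+1) / (2j+1)!]. *)
Definition dmon (j q : nat) x : R := if (q <= 2 * j + 1)%N then mon (2 * j + 1 - q) x else 0.

Lemma is_derive_pow k x : is_derive x 1 (fun y => y ^+ k.+1) (k.+1%:R * x ^+ k).
Proof.
apply: DeriveDef; first exact: exprn_derivable.
by rewrite exp_derive /= -[(_ *: _)%:A]/((_ * _) * 1) mulr1.
Qed.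

Lemma is_derive_mon k x : is_derive x 1 (mon k.+1) (mon k x).
Proof.
rewrite /mon; have := is_deriveM (is_derive_pow k x) (is_derive_cst (k.+1`!%:R^-1 : R) x 1).
move=> H; apply: is_derive_eq H _.
rewrite scaler0 add0r -![_ *: _]/(_ * _) /= factS natrM invfM.
by field; rewrite fact_neq0 nat1r pnatr_eq0.
Qed.

Lemma is_derive_dmon j q x : is_derive x 1 (dmon j q) (dmon j q.+1 x).
Proof.
rewrite /dmon; case: (ltnP q (2 * j + 1)) => [H|H].
  rewrite (ltnW H); have -> : (2 * j + 1 - q = (2 * j + 1 - q.+1).+1)%N by rewrite subnSK.
  exact: is_derive_mon.
case: leqP => H2; last exact: is_derive_cst.
have -> : (2 * j + 1 - q = 0)%N by apply/eqP; rewrite subn_eq0.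
apply: is_derive_ext (is_derive_cst (1 : R) x 1) => y.
by rewrite /mon expr0 fact0 divr1.
Qed.

(** The key estimate of the flat parametrisation. With [m = 2j+1-q], one has
    [(j+p)!^s <= 4^(j+p) j!^s p!^s], and [j!^2 <= (2j+1)! <= 2^(2j+1) q! m!] turns
    [j!^s] into [q!^(s/2) m!^(s/2)]. The denominator [m!] of the monomial then leaves
    [m!^(s/2-1)], which beats all the geometric factors and a further [2^j]. *)
Lemma gevrey_term_bound s (rho X : R) : 1 < s < 2 -> 0 < rho -> 0 <= X ->
  exists K r1 r2 : R, [/\ 0 < K, 0 < r1, 0 < r2 &
   forall (p q j : nat) x, `|x| <= X ->
    `|dmon j q x| * ((j + p)`!%:R `^ s / rho ^+ (j + p)) <=
    K * p`!%:R `^ s * q`!%:R `^ (s / 2) / (r1 ^+ p * r2 ^+ q) * (2^-1) ^+ j].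
Proof.
move=> s12 rho0 X0; have s12' : 1 <= s <= 2 by lra.
pose k := 1 + 8 / rho.
have k1 : 1 <= k by rewrite lerDl divr_ge0// ltW.
have k0 : 0 < k by exact: lt_le_trans k1.
have [||K K0 HK] := @pow_le_fact_pow (2 * X * k) (1 - s / 2).
- by rewrite !mulr_ge0// ltW.
- by lra.
exists K, (rho / 4), ((2 * k)^-1); split=> //; rewrite ?divr_gt0 ?invr_gt0 ?mulr_gt0//.
move=> p q j x xX; rewrite /dmon; case: ifPn => H; last first.
  by rewrite normr0 mul0r !mulr_ge0 ?invr_ge0 ?mulr_ge0 ?exprn_ge0 ?powR_ge0 ?divr_ge0 ?invr_ge0 ?mulr_ge0 ?(ltW k0) ?(ltW K0) ?(ltW rho0).
set m := (2 * j + 1 - q)%N.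
have E : (q + m = 2 * j + 1)%N by rewrite subnKC.
have Pp : 0 <= p`!%:R `^ s :> R by exact: powR_ge0.
have Pq : 0 <= q`!%:R `^ (s / 2) :> R by exact: powR_ge0.
have rj n : 0 < rho ^+ n by rewrite exprn_gt0.
have B1 : (j + p)`!%:R `^ s <= 4 ^+ (j + p) *
   ((2 ^+ (q + m) * (q`!%:R `^ (s / 2) * m`!%:R `^ (s / 2))) * p`!%:R `^ s) :> R.
  apply: (le_trans (powR_fact_add _ _ s12')).
  by rewrite ler_wpM2l ?exprn_ge0// ler_wpM2r// powR_fact_half.
have B2 : `|mon m x| <= X ^+ m / m`!%:R.
  rewrite /mon normrM normrX (ger0_norm (x := _^-1)) ?invr_ge0//.
  by rewrite ler_wpM2r ?invr_ge0// lerXn2r ?nnegrE.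
have mf : m`!%:R = m`!%:R `^ (1 - s / 2) * m`!%:R `^ (s / 2) :> R.
  rewrite -powRD; last by rewrite fact_neq0 implybT.
  by rewrite subrK powRr1.
set F := m`!%:R `^ (s / 2) in B1 mf; set G := m`!%:R `^ (1 - s / 2) in mf.
have F0 : 0 < F by rewrite powR_gt0// factR_gt0.
have G0 : 0 < G by rewrite powR_gt0// factR_gt0.
apply: (le_trans (ler_pM _ _ B2 (ler_wpM2r _ B1))) => //.
- by rewrite mulr_ge0 ?powR_ge0// invr_ge0 ltW.
- by rewrite invr_ge0 ltW.
have -> : X ^+ m / m`!%:R *
   (4 ^+ (j + p) * (2 ^+ (q + m) * (q`!%:R `^ (s / 2) * F) * p`!%:R `^ s) / rho ^+ (j + p)) =
   (p`!%:R `^ s * q`!%:R `^ (s / 2) * (4 / rho) ^+ p * 2 ^+ q) *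
   ((4 / rho) ^+ j * ((2 * X) ^+ m / G)).
  rewrite mf !exprMn !exprVn (exprD 2) (exprD 4) (exprD rho); field.
  by rewrite !gt_eqF.
have -> : K * p`!%:R `^ s * q`!%:R `^ (s / 2) / ((rho / 4) ^+ p * (2 * k)^-1 ^+ q) *
   2^-1 ^+ j = (p`!%:R `^ s * q`!%:R `^ (s / 2) * (4 / rho) ^+ p * 2 ^+ q) *
   (K * k ^+ q * 2^-1 ^+ j).
  rewrite !exprMn !exprVn !exprMn; field.
  by rewrite !expf_neq0 ?gt_eqF.
rewrite ler_wpM2l//.
  by rewrite !mulr_ge0 ?exprn_ge0 ?divr_ge0// ltW.
(* [j <= 2j+1 = q+m]: the powers of [8 / rho] are charged to [q] and [m] *)
have kj : (8 / rho) ^+ j <= k ^+ (q + m).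
  apply: (@le_trans _ _ (k ^+ j)).
    by rewrite lerXn2r ?nnegrE ?(ltW k0) ?divr_ge0 ?(ltW rho0)// lerDr.
  by rewrite ler_weXn2l// E; apply: leq_trans (leq_addr 1 _); rewrite leq_pmull.
have -> : (4 / rho) ^+ j = (8 / rho) ^+ j * 2^-1 ^+ j.
  by rewrite -exprMn; congr (_ ^+ _); field; rewrite gt_eqF.
rewrite [leLHS]mulrAC ler_wpM2r ?exprn_ge0//.
apply: (le_trans (ler_wpM2r _ kj)); first by rewrite divr_ge0 ?exprn_ge0 ?mulr_ge0// ltW.
rewrite exprD -mulrA mulrCA [leRHS]mulrC mulrA (mulrC (k ^+ q)) -mulrA mulrCA [leLHS]mulrC -mulrA.
rewrite mulrA ler_wpM2r ?exprn_ge0 ?(ltW k0)//.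
by rewrite mulrA -exprMn ler_pdivrMr// (mulrC k) HK.
Qed.

End GevreyEstimates.

(** * The flat series and its derivatives *)
Section GevreySeries.
Context {R : realType}.
Local Notation C := R[i].
Local Notation Re := (@complex.Re R).
Local Notation Im := (@complex.Im R).
Local Notation normc := (@Normc.normc R).
Local Notation ii := (Complex 0 1 : R[i]).
Local Notation rc := (real_complex R).
Implicit Types (x t : R).
Variables (s e M rho : R) (Y : nat -> R -> C).
Hypotheses (s12 : 1 < s < 2) (rho0 : 0 < rho) (M0 : 0 < M).
Hypothesis DY : ladder [set t | e < t] Y.
Hypothesis BY : forall n t, e < t -> normc (Y n t) <= M * (n`!%:R `^ s / rho ^+ n).

(** The derivatives of order [p] in t and [q] in x of the flat series are series
    of the same form, so that they can be treated as one family. *)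
Definition sterm (p q : nat) t x (j : nat) : C :=
  (- ii) ^+ j * rc (dmon j q x) * Y (j + p) t.
Definition ser p q t x : C := csum (sterm p q t x).

Lemma geodom_le (a : nat -> C) (K L : R) : geodom a K -> K <= L -> geodom a L.
Proof. by move=> H KL j; apply: (le_trans (H j)); rewrite ler_wpM2r// exprn_ge0. Qed.

Lemma sterm_bound (X : R) : 0 <= X -> exists K r1 r2 : R, [/\ 0 < K, 0 < r1, 0 < r2 &
  forall (p q : nat) t x, e < t -> `|x| <= X ->
    geodom (sterm p q t x) (K * p`!%:R `^ s * q`!%:R `^ (s / 2) / (r1 ^+ p * r2 ^+ q))].
Proof.
move=> X0; have [K [r1 [r2 [K0 r10 r20 H]]]] := gevrey_term_bound s12 rho0 X0.
exists (M * K), r1, r2; split => //; first exact: mulr_gt0.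
move=> p q t x te xX j; rewrite /sterm !normcM normcX normcN normc_i expr1n mul1r normc_rc.
apply: (le_trans (ler_wpM2l _ (BY _ te))) => //.
rewrite mulrCA -!mulrA ler_wpM2l ?(ltW M0)// !mulrA.
by have := H p q j x xX; rewrite !mulrA.
Qed.

(** A single constant for all orders up to [p + 2] and [q + 2], as required by
    the second-order Taylor argument in [cdiff_csum]. *)
Lemma sterm_bound_pq (X : R) (p q : nat) : 0 <= X ->
  exists2 K : R, 0 <= K & forall p' q' t x, (p' <= p + 2)%N -> (q' <= q + 2)%N ->
    e < t -> `|x| <= X -> geodom (sterm p' q' t x) K.
Proof.
move=> X0; have [K [r1 [r2 [K0 r10 r20 H]]]] := sterm_bound X0.
pose b i j := K * i`!%:R `^ s * j`!%:R `^ (s / 2) / (r1 ^+ i * r2 ^+ j).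
have b0 i j : 0 <= b i j.
  by rewrite divr_ge0 ?mulr_ge0 ?powR_ge0 ?exprn_ge0 ?(ltW K0) ?(ltW r10) ?(ltW r20).
exists (\sum_(i < p.+3) \sum_(j < q.+3) b i j).
  by apply: sumr_ge0 => i _; apply: sumr_ge0.
move=> p' q' t x; rewrite !addn2 => pp qq te xX.
apply: geodom_le (H p' q' t x te xX) _.
rewrite -ltnS in pp; rewrite -ltnS in qq.
rewrite (bigD1 (Ordinal pp))//= (bigD1 (Ordinal qq))//= -addrA lerDl.
by apply: addr_ge0; [apply: sumr_ge0|apply: sumr_ge0 => i _; apply: sumr_ge0].
Qed.

Lemma ser_summable p q t x : e < t -> csummable (sterm p q t x).
Proof.
move=> te; have [K _ H] := @sterm_bound_pq `|x| p q (normr_ge0 x).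
by apply: geodom_summable (H _ _ _ _ _ _ te _); rewrite ?leq_addr.
Qed.

Lemma sterm_dt p q t x j : e < t -> cdiff (fun y => sterm p q y x j) (sterm p.+1 q t x j) t.
Proof. by move=> te; apply: cdiffZ; rewrite addnS; exact: DY. Qed.

Lemma sterm_dx p q t x j : cdiff (fun y => sterm p q t y j) (sterm p q.+1 t x j) x.
Proof.
have := cdiffZ ((- ii) ^+ j * Y (j + p) t) (cdiff_rc (is_derive_dmon j q x)).
rewrite /sterm mulrAC; apply: cdiff_ext => y; exact: mulrAC.
Qed.

Lemma ser_dt p q t x : e < t -> cdiff (fun y => ser p q y x) (ser p.+1 q t x) t.
Proof.
move=> te; have [K K0 H] := @sterm_bound_pq `|x| p q (normr_ge0 x).
have b y : `|y - t| < t - e -> e < y by rewrite ltr_distlC => /andP[]; lra.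
apply: (@cdiff_csum _ (fun j y => sterm p q y x j) (fun j y => sterm p.+1 q y x j)
  (fun j y => sterm p.+2 q y x j) t (t - e) K).
- by rewrite subr_gt0.
- by move=> j y /b ye; exact: sterm_dt.
- by move=> j y /b ye; exact: sterm_dt.
- by move=> y /b ye; apply: H; rewrite ?addn2 ?leq_addr// ltnW.
- by move=> y /b ye; apply: H; rewrite ?addn2// ltnW.
- by move=> y /b ye; apply: H; rewrite ?addn2// ltnW.
Qed.

Lemma ser_dx p q t x : e < t -> cdiff (ser p q t) (ser p q.+1 t x) x.
Proof.
move=> te; have [|K K0 H] := @sterm_bound_pq (`|x| + 1) p q; first by rewrite addr_ge0.
have b y : `|y - x| < 1 -> `|y| <= `|x| + 1.
  by move=> yx; have := ler_normD (y - x) x; rewrite subrK; lra.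
apply: (@cdiff_csum _ (fun j y => sterm p q t y j) (fun j y => sterm p q.+1 t y j)
  (fun j y => sterm p q.+2 t y j) x 1 K) => //.
- by move=> j y _; exact: sterm_dx.
- by move=> j y _; exact: sterm_dx.
- by move=> y /b ye; apply: H; rewrite ?addn2 ?leq_addr// ltnW.
- by move=> y /b ye; apply: H; rewrite ?addn2// ltnW.
- by move=> y /b ye; apply: H; rewrite ?addn2// ltnW.
Qed.

Lemma ser_bound (X : R) : 0 <= X -> exists K r1 r2 : R, [/\ 0 < K, 0 < r1, 0 < r2 &
  forall (p q : nat) t x, e < t -> `|x| <= X ->
    normc (ser p q t x) <= K * p`!%:R `^ s * q`!%:R `^ (s / 2) / (r1 ^+ p * r2 ^+ q)].
Proof.
move=> /sterm_bound[K [r1 [r2 [K0 r10 r20 H]]]].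
exists (4 * K), r1, r2; split => //; first exact: mulr_gt0.
by move=> p q t x te xX; have := geodom_csum_le (H p q t x te xX); rewrite !mulrA.
Qed.

Lemma ser_lipschitz (X : R) p q : 0 <= X -> exists2 K : R, 0 <= K &
  forall t t' x x', e < t -> e < t' -> `|x| <= X -> `|x'| <= X ->
  normc (ser p q t' x' - ser p q t x) <= K * (`|t' - t| + `|x' - x|).
Proof.
move=> X0; have [K K0 H] := sterm_bound_pq p q X0.
have B p' q' t x : (p' <= p + 2)%N -> (q' <= q + 2)%N -> e < t -> `|x| <= X ->
    normc (ser p' q' t x) <= 4 * K.
  by move=> *; apply: geodom_csum_le; exact: H.
exists (2 * (4 * K)); first by rewrite !mulr_ge0.
move=> t t' x x' te te' xX xX'.
have -> : ser p q t' x' - ser p q t x =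
  (ser p q t' x' - ser p q t x') + (ser p q t x' - ser p q t x) by rewrite addrA subrK.
apply: (le_trans (normcD _ _)); rewrite mulrDr lerD//.
  apply: (@clipschitz _ (fun y => ser p q y x') (fun y => ser p.+1 q y x')).
    move=> z /andP[z1 _]; apply: ser_dt; apply: lt_le_trans z1; by rewrite lt_min te.
  move=> z /andP[z1 _]; apply: B => //; [by rewrite addn2|exact: leq_addr|].
  by apply: lt_le_trans z1; rewrite lt_min te.
apply: (@clipschitz _ (ser p q t) (ser p q.+1 t)) => z /andP[z1 z2]; first exact: ser_dx.
apply: B => //; [exact: leq_addr|by rewrite addn2|]; move: xX xX'; rewrite !ler_norml => /andP[a b] /andP[c d].
by rewrite (le_trans _ z1) ?le_min ?a// (le_trans z2)// ge_max b.
Qed.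

Lemma csum_shift (a : nat -> C) : csummable (fun j => a j.+1) -> a 0%N = 0 ->
  csum a = csum (fun j => a j.+1).
Proof.
move=> [cr ci] a0.
have sh (u : nat -> R) : cvgn (series (fun j => u j.+1)) -> u 0%N = 0 ->
    limn (series u) = limn (series (fun j => u j.+1)).
  move=> cu u0; apply/cvg_lim => //; rewrite -cvg_shiftS /=.
  rewrite (_ : (fun n => series u n.+1) = series (fun j => u j.+1)); first exact: cu.
  by apply/funext => n; rewrite /series /= big_nat_recl// u0 add0r.
by rewrite /csum (sh (fun j => Re (a j)) cr) ?a0// (sh (fun j => Im (a j)) ci) ?a0.
Qed.

(** Two derivatives in x shift the index [j] by one, which costs [- i] and one
    derivative in t: the series solves the Schroedinger equation. *)
Lemma ser_pde p q t x : e < t -> ser p q.+2 t x = - ii * ser p.+1 q t x.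
Proof.
move=> te; have E j : sterm p q.+2 t x j.+1 = - ii * sterm p.+1 q t x j.
  rewrite /sterm exprS -!mulrA addSnnS; do 3 congr (_ * _).
  rewrite /dmon; have -> : (q.+2 <= 2 * j.+1 + 1)%N = (q <= 2 * j + 1)%N.
    by rewrite mulnS -addnA !addSn !ltnS add0n.
  by have -> : (2 * j.+1 + 1 - q.+2 = 2 * j + 1 - q)%N by rewrite mulnS.
rewrite -csumZ; last exact: ser_summable.
rewrite /ser csum_shift; first by apply: eq_csum => j; exact: E.
  have -> : (fun j => sterm p q.+2 t x j.+1) = (fun j => - ii * sterm p.+1 q t x j).
    by apply/funext => j; exact: E.
  have [K _ H] := @sterm_bound_pq `|x| p.+1 q (normr_ge0 x).
  by apply: geodom_summable (geodomZ _ (H _ _ _ _ _ _ te _)); rewrite ?leq_addr.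
by rewrite /sterm /dmon /= mulr0 mul0r.
Qed.

Lemma ser_x0 p t : ser p 0 t 0 = 0.
Proof.
rewrite /ser (_ : sterm p 0 t 0 = fun=> 0); first exact: csum0.
by apply/funext => j; rewrite /sterm /dmon /= subn0 /mon addn1 expr0n/= mul0r mulr0 mul0r.
Qed.

End GevreySeries.

(** * Smooth functions of two variables *)
Section TwoVariables.
Context {R : realType}.
Local Notation Re := (@complex.Re R).
Local Notation Im := (@complex.Im R).
Local Notation normc := (@Normc.normc R).

Lemma is_derive_fst (G : R * R -> R) (z : R * R) (d : R) :
  is_derive z.1 1 (fun t => G (t, z.2)) d -> is_derive z (1, 0) G d.
Proof.
case: z => t x /= [D E].
have EQ : (fun h : R => h^-1 *: ((G \o shift (t, x)) (h *: (1, 0)) - G (t, x))) =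
          (fun h : R => h^-1 *: (((fun t => G (t, x)) \o shift t) (h *: 1) - G (t, x))).
  apply/funext => h /=; congr (_ *: (G _ - _)).
  by congr pair => /=; rewrite scaler0 add0r.
by apply: DeriveDef; rewrite /derivable /derive EQ.
Qed.

Lemma is_derive_snd (G : R * R -> R) (z : R * R) (d : R) :
  is_derive z.2 1 (fun x => G (z.1, x)) d -> is_derive z (0, 1) G d.
Proof.
case: z => t x /= [D E].
have EQ : (fun h : R => h^-1 *: ((G \o shift (t, x)) (h *: (0, 1)) - G (t, x))) =
          (fun h : R => h^-1 *: (((fun x => G (t, x)) \o shift x) (h *: 1) - G (t, x))).
  apply/funext => h /=; congr (_ *: (G _ - _)).
  by congr pair => /=; rewrite scaler0 add0r.
by apply: DeriveDef; rewrite /derivable /derive EQ.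
Qed.

(** A word of derivatives in any order only counts how often each letter occurs
    when the partial derivatives shift the indices of a doubly indexed family. *)
Lemma smooth2_family (U : set (R * R)) (F : nat -> nat -> R * R -> R) (h : R * R -> R) :
  open U ->
  (forall p q z, U z -> is_derive z (1, 0) (F p q) (F p.+1 q z)) ->
  (forall p q z, U z -> is_derive z (0, 1) (F p q) (F p q.+1 z)) ->
  (forall p q z, U z -> {for z, continuous (F p q)}) ->
  (forall z, U z -> h z = F 0 0 z) ->
  smooth2 U h /\ forall p q z, U z -> iter p dt (iter q dx h) z = F p q z.
Proof.
move=> oU Dt Dx Cn E.
have nearU (k : R * R -> R) p q z : (forall z, U z -> k z = F p q z) -> U z ->
    \near z, F p q z = k z.
  by move=> H Uz; near=> w; rewrite H//; near: w; exact: open_nbhs_nbhs.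
have st k p q z : (forall z, U z -> k z = F p q z) -> U z -> dt k z = F p.+1 q z.
  by move=> H Uz; have [_ <-] := near_eq_is_derive (nearU _ _ _ _ H Uz) (Dt p q z Uz).
have sx k p q z : (forall z, U z -> k z = F p q z) -> U z -> dx k z = F p q.+1 z.
  by move=> H Uz; have [_ <-] := near_eq_is_derive (nearU _ _ _ _ H Uz) (Dx p q z Uz).
split.
  move=> w z Uz; cbv zeta.
  have [p [q H]] : exists p q, forall z, U z ->
      foldr (fun b : bool => if b then dt else dx) h w z = F p q z.
    elim: w => [|[] w [p [q IH]]] /=; first by exists 0%N, 0%N.
      by exists p.+1, q => y Uy; exact: st.
    by exists p, q.+1 => y Uy; exact: sx.
  have N := nearU _ _ _ _ H Uz.
  split.
  - have := Cn p q z Uz; rewrite /continuous_at /prop_for /= H// => C.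
    by apply: cvg_trans C; apply: near_eq_cvg.
  - exact: near_eq_derivable N (@ex_derive _ _ _ _ _ _ _ (Dt p q z Uz)).
  - exact: near_eq_derivable N (@ex_derive _ _ _ _ _ _ _ (Dx p q z Uz)).
have IX q z : U z -> iter q dx h z = F 0%N q z.
  by elim: q z => [|q IH] z Uz /=; [exact: E|exact: sx].
by move=> p q; elim: p => [|p IH] z Uz /=; [exact: IX|exact: st].
Unshelve. all: by end_near. Qed.

Lemma lipschitz2_continuous (G : R * R -> R) (z : R * R) (K : R) :
  (\forall w \near z, `|G w - G z| <= K * (`|w.1 - z.1| + `|w.2 - z.2|)) ->
  {for z, continuous G}.
Proof.
move=> H.
have c0 : (fun w : R * R => K * (`|w.1 - z.1| + `|w.2 - z.2|)) @ z --> (0 : R).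
  have -> : 0 = K * (`|z.1 - z.1| + `|z.2 - z.2|) by rewrite !subrr !normr0 addr0 mulr0.
  apply: cvgMr; apply: cvgD; apply: cvg_norm; apply: cvgB; try exact: cvg_cst.
    exact: cvg_fst.
  exact: cvg_snd.
apply/cvgrPdist_le => eps eps0; near=> w.
rewrite distrC; apply: (@le_trans _ _ (K * (`|w.1 - z.1| + `|w.2 - z.2|))).
  by near: w.
apply: (le_trans (ler_norm _)); near: w.
by move/cvgrPdist_le : c0 => /(_ _ eps0); apply: filterS => w; rewrite sub0r normrN.
Unshelve. all: by end_near. Qed.

End TwoVariables.

(** * Gevrey regularity of the flat series *)
Section GevreyConclusions.
Context {R : realType}.
Local Notation C := R[i].
Local Notation Re := (@complex.Re R).
Local Notation Im := (@complex.Im R).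
Local Notation normc := (@Normc.normc R).
Implicit Types (x t : R).

Lemma open_fst_gt (e : R) : open [set z : R * R | e < z.1].
Proof.
apply: (@open_comp _ _ fst [set t | e < t]); last exact: open_gt.
by move=> z _; exact: cvg_fst.
Qed.

Section Series.
Variables (s e M rho : R) (Y : nat -> R -> C).
Hypotheses (s12 : 1 < s < 2) (rho0 : 0 < rho) (M0 : 0 < M).
Hypothesis DY : ladder [set t | e < t] Y.
Hypothesis BY : forall n t, e < t -> normc (Y n t) <= M * (n`!%:R `^ s / rho ^+ n).

Lemma ser_continuous2 p q z : e < z.1 ->
  {for z, continuous (fun w : R * R => Re (ser Y p q w.1 w.2))} /\
  {for z, continuous (fun w : R * R => Im (ser Y p q w.1 w.2))}.
Proof.
move=> ez; have [|K K0 H] := ser_lipschitz s12 rho0 M0 DY BY (X := `|z.2| + 1) p q.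
  by rewrite addr_ge0.
have N : \forall w \near z,
    normc (ser Y p q w.1 w.2 - ser Y p q z.1 z.2) <= K * (`|w.1 - z.1| + `|w.2 - z.2|).
  near=> w; apply: H => //.
  - by near: w; apply: open_nbhs_nbhs; split; [exact: open_fst_gt|].
  - by rewrite lerDl.
  - have : `|w.2 - z.2| < 1.
      near: w; have /cvgrPdist_lt/(_ _ ltr01) : snd w @[w --> z] --> z.2 by exact: cvg_snd.
      by apply: filterS => w; rewrite distrC.
    by have := ler_normD (w.2 - z.2) z.2; rewrite subrK; lra.
split; apply: (@lipschitz2_continuous _ _ _ K); apply: filterS N => w; apply: le_trans.
  by rewrite -ReB normc_Re.
by rewrite -ImB normc_Im.
Unshelve. all: by end_near. Qed.

Lemma ser_gevrey2 (a b : R) (h : R * R -> C) : e < a ->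
  (forall t x, a <= t <= b -> 0 <= x <= 1 -> h (t, x) = ser Y 0 0 t x) ->
  gevrey2 s (s / 2) (`[a, b] `*` `[0, 1]) h.
Proof.
move=> ea E; exists [set z | e < z.1], (fun z => ser Y 0 0 z.1 z.2).
have oU := @open_fst_gt e.
have KU : `[a, b]%classic `*` `[0, 1]%classic `<=` [set z : R * R | e < z.1].
  by move=> [t x] [] /=; rewrite !in_itv/= => /andP[ta _] _; exact: lt_le_trans ta.
have [sr ir] := @smooth2_family _ _ (fun p q z => Re (ser Y p q z.1 z.2))
  (fun z => Re (ser Y 0 0 z.1 z.2)) oU
  (fun p q z ez => is_derive_fst (proj1 (ser_dt s12 rho0 M0 DY BY p q z.2 ez)))
  (fun p q z ez => is_derive_snd (proj1 (ser_dx s12 rho0 M0 BY p q z.2 ez)))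
  (fun p q z ez => proj1 (ser_continuous2 p q ez))
  (fun z _ => erefl).
have [si iim] := @smooth2_family _ _ (fun p q z => Im (ser Y p q z.1 z.2))
  (fun z => Im (ser Y 0 0 z.1 z.2)) oU
  (fun p q z ez => is_derive_fst (proj2 (ser_dt s12 rho0 M0 DY BY p q z.2 ez)))
  (fun p q z ez => is_derive_snd (proj2 (ser_dx s12 rho0 M0 BY p q z.2 ez)))
  (fun p q z ez => proj2 (ser_continuous2 p q ez))
  (fun z _ => erefl).
split; [exact: oU|exact: KU|by split| |].
  by move=> [t x] [] /=; rewrite !in_itv/= => ta x01; rewrite E.
have [K [r1 [r2 [K0 r10 r20 H]]]] := ser_bound s12 rho0 M0 BY ler01.
exists K, r1, r2; split=> // p1 p2 z Kz.
rewrite /cpartial ir ?iim; try exact: KU.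
have := H p1 p2 z.1 z.2 (KU _ Kz); case: (ser Y p1 p2 z.1 z.2) => u v /=; apply.
case: z Kz => t x [_] /=; rewrite in_itv/= => /andP[x0 x1].
by rewrite ger0_norm.
Qed.

Lemma ser_gevrey (a b : R) (u : R -> C) : e < a ->
  (forall t, a <= t <= b -> u t = ser Y 0 0 t 1) -> gevrey s `[a, b] u.
Proof.
move=> ea E; exists [set t | e < t], (fun t => ser Y 0 0 t 1).
have oU : open [set t : R | e < t] by exact: open_gt.
have L : ladder [set t | e < t] (fun p t => ser Y p 0 t 1).
  by move=> p t te; exact: (ser_dt s12 rho0 M0 DY BY p 0 1 te).
have KU : `[a, b]%classic `<=` [set t : R | e < t].
  by move=> t; rewrite /= in_itv/= => /andP[ta _]; exact: lt_le_trans ta.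
split => //.
- by apply: ladder_csmooth L _.
- by move=> t; rewrite /= in_itv/= => ta; rewrite E.
have [K [r1 [r2 [K0 r10 r20 H]]]] := ser_bound s12 rho0 M0 BY ler01.
exists K, r1; split=> // p t Kt; rewrite (ladder_cderive oU L)//; last exact: KU.
have := H p 0%N t 1 (KU _ Kt); rewrite fact0 powR1 !mulr1 normr1; exact.
Qed.

End Series.

(** The [n]-th derivative of [F i * G j]. Unfolding Leibniz' rule one derivative
    at a time avoids binomial coefficients. *)
Fixpoint prodD (F G : nat -> R -> C) (n i j : nat) (t : R) : C :=
  if n is n'.+1 then prodD F G n' i.+1 j t + prodD F G n' i j.+1 t
  else F i t * G j t.

Lemma ladder_prodD U F G i j : ladder U F -> ladder U G ->
  ladder U (fun n => prodD F G n i j).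
Proof.
move=> LF LG n; elim: n i j => [|n IH] i j t Ut /=.
  by apply: cdiffM; [exact: LF|exact: LG].
by apply: cdiffD; exact: IH.
Qed.

(** The [2^n] terms of the [n]-th derivative each satisfy the same bound, because
    [i! j! <= (i+j)!]; halving the radius pays for their number. *)
Lemma prodD_bound (U : set R) F G (s MF MG r : R) : 1 <= s -> 0 < r -> 0 <= MF -> 0 <= MG ->
  (forall n t, U t -> normc (F n t) <= MF * (n`!%:R `^ s / r ^+ n)) ->
  (forall n t, U t -> normc (G n t) <= MG * (n`!%:R `^ s / r ^+ n)) ->
  forall n t, U t -> normc (prodD F G n 0 0 t) <= (MF * MG) * (n`!%:R `^ s / (r / 2) ^+ n).
Proof.
move=> s1 r0 MF0 MG0 BF BG.
have s0 : 0 <= s by exact: le_trans s1.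
have H n i j t : U t -> normc (prodD F G n i j t) <=
    MF * MG * 2 ^+ n * ((i + j + n)`!%:R `^ s / r ^+ (i + j + n)).
  move=> Ut; elim: n i j => [|n IH] i j /=.
    rewrite normcM addn0 expr0 mulr1.
    apply: (le_trans (ler_pM (normc_ge0 _) (normc_ge0 _) (BF i t Ut) (BG j t Ut))).
    rewrite mulrACA ler_wpM2l ?mulr_ge0// mulrACA -invfM -exprD ler_wpM2r//.
      by rewrite invr_ge0 exprn_ge0// ltW.
    rewrite -powRM//; apply: ge0_ler_powR; rewrite ?nnegrE ?mulr_ge0//.
    rewrite -natrM ler_nat -(@bin_fact (i + j) i) ?leq_addr// addKn.
    by rewrite leq_pmull// bin_gt0 leq_addr.
  apply: (le_trans (normcD _ _)).
  have := lerD (IH i.+1 j) (IH i j.+1); rewrite addSn addnS addSn -addnS => /le_trans; apply.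
  by rewrite exprS le_eqVlt; apply/orP; left; apply/eqP; ring.
move=> n t Ut; apply: (le_trans (H n 0%N 0%N t Ut)); rewrite !add0n -mulrA.
rewrite ler_wpM2l ?mulr_ge0// expr_div_n invf_div mulrCA mulrA.
by rewrite (mulrC (n`!%:R `^ s)) mulrAC.
Qed.

End GevreyConclusions.

(** * The free Schroedinger kernel *)
Section Kernel.
Context {R : realType}.
Local Notation C := R[i].
Local Notation Re := (@complex.Re R).
Local Notation Im := (@complex.Im R).
Local Notation normc := (@Normc.normc R).
Local Notation ii := (Complex 0 1 : R[i]).
Local Notation rc := (real_complex R).
Implicit Types (x t z y : R).

Definition kconst : C := (rc (Num.sqrt (2 * pi)) * (1 + ii))^-1.

Lemma sqrt2pi_gt0 : 0 < Num.sqrt (2 * pi) :> R.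
Proof. by rewrite sqrtr_gt0 mulr_gt0// pi_gt0. Qed.

Lemma onei_neq0 : 1 + ii != 0.
Proof. by rewrite eq_complex /= addr0 oner_eq0. Qed.

Lemma rcM x y : rc (x * y) = rc x * rc y.
Proof. exact: rmorphM. Qed.
Lemma rcD x y : rc (x + y) = rc x + rc y.
Proof. exact: rmorphD. Qed.
Lemma rcN x : rc (- x) = - rc x.
Proof. exact: rmorphN. Qed.
Lemma rcV x : rc (x^-1) = (rc x)^-1.
Proof. exact: fmorphV. Qed.
Lemma rcX x n : rc (x ^+ n) = rc x ^+ n.
Proof. exact: rmorphXn. Qed.

(** [1 + i] has positive real part, so this is the principal square root. *)
Lemma sqrtc_imag (b : R) : 0 < b -> sqrtc (Complex 0 b) = rc (Num.sqrt (b / 2)) * (1 + ii).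
Proof.
move=> b0; rewrite /sqrtc gt_eqF// gtr0_sg// mul1r expr0n/= add0r addr0 subr0.
rewrite sqrtr_sqr gtr0_norm//; apply: cext; rewrite ?Re_rcM ?Im_rcM ?ReD ?ImD/=.
  by rewrite addr0 mulr1.
by rewrite add0r mulr1.
Qed.

Lemma EkernelE t z : 0 < t ->
  Ekernel t z = kconst * rc (Num.sqrt t)^-1 * expi (z ^+ 2 / (4 * t)).
Proof.
move=> t0; rewrite /Ekernel sqrtc_imag; last by rewrite !mulr_gt0// pi_gt0.
have -> : 4 * pi * t / 2 = 2 * pi * t by field.
rewrite sqrtrM; last by rewrite mulr_ge0// pi_ge0.
rewrite rcM mulrC; congr (_ * _); rewrite /kconst rcV -invfM; congr (_^-1).
by rewrite mulrAC.
Qed.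

Definition acoef t : C := ii * rc (2 * t)^-1.

Definition kern0 t z : C := kconst * rc (Num.sqrt t)^-1 * expi (z ^+ 2 / (4 * t)).

(** The [n]-th derivative in z of the kernel. The first one is [(i z / 2t) kern 0],
    and Leibniz' rule applied to this product gives the recursion of the Hermite
    functions. *)
Fixpoint kern (n : nat) t z {struct n} : C :=
  if n is m.+1 then acoef t * rc z * kern m t z + m%:R * acoef t * kern m.-1 t z
  else kern0 t z.

Lemma kernS n t z :
  kern n.+1 t z = acoef t * rc z * kern n t z + n%:R * acoef t * kern n.-1 t z.
Proof. by []. Qed.

Lemma is_derive_sqr z : is_derive z 1 (fun y => y ^+ 2) (2 * z).
Proof. by have := is_derive_pow 1 z; rewrite expr1. Qed.

Lemma is_derive_scale (f : R -> R) (d c z : R) : is_derive z 1 f d ->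
  is_derive z 1 (fun y => f y * c) (d * c).
Proof.
move=> H; apply: is_derive_eq (is_deriveM H (is_derive_cst c z 1)) _.
by rewrite -![_ *: _]/(_ * _) mulr0 add0r mulrC.
Qed.

Lemma is_derive_inv t : t != 0 -> is_derive t 1 (fun y => y^-1) (- (t ^- 2)).
Proof.
move=> t0; apply: is_derive_eq (@is_deriveV _ id t 1 1 t0 _) _.
by rewrite -[_ *: _]/(_ * _) mulr1.
Qed.

Lemma cdiff_kern_z n t z : 0 < t -> cdiff (kern n t) (kern n.+1 t z) z.
Proof.
move=> t0; have t1 : t != 0 by rewrite gt_eqF.
have Dz : cdiff rc 1 z by exact: (cdiff_rc (is_derive_id z 1)).
suff [] : cdiff (kern n t) (kern n.+1 t z) z /\ cdiff (kern n.+1 t) (kern n.+2 t z) z by [].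
elim: n => [|n [IH1 IH2]].
  have D0 : cdiff (kern 0 t) (kern 1 t z) z.
    have D := cdiffZ (kconst * rc (Num.sqrt t)^-1)
      (cdiff_expi (is_derive_scale (4 * t)^-1 (is_derive_sqr z))).
    suff -> : kern 1 t z = kconst * rc (Num.sqrt t)^-1 *
        (ii * rc (2 * z * (4 * t)^-1) * expi (z ^+ 2 / (4 * t))) by exact: D.
    rewrite /= /kern0 /acoef mul0r mul0r addr0.
    have -> : 2 * z * (4 * t)^-1 = (2 * t)^-1 * z by field.
    by rewrite rcM; ring.
  split; first exact: D0.
  have D := cdiffM (cdiffZ (acoef t) Dz) D0.
  have E : kern 1 t = fun y => acoef t * rc y * kern 0 t y.
    by apply/funext => y; rewrite kernS !mul0r addr0.
  rewrite {1}E (_ : kern 2 t z = acoef t * 1 * kern 0 t z + acoef t * rc z * kern 1 t z)//.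
  by rewrite kernS /= mulr1 addrC mul1r.
split; first exact: IH2.
have D := cdiffD (cdiffM (cdiffZ (acoef t) Dz) IH2) (cdiffZ (n.+1%:R * acoef t) IH1).
suff -> : kern n.+3 t z = acoef t * 1 * kern n.+1 t z + acoef t * rc z * kern n.+2 t z
  + n.+1%:R * acoef t * kern n.+1 t z by exact: D.
by rewrite [in LHS]kernS -[n.+2%:R]natr1 [n.+2.-1]/=; ring.
Qed.

Lemma cdiff_acoef t : 0 < t -> cdiff acoef (2 * ii * acoef t ^+ 2) t.
Proof.
move=> t0; have t1 : t != 0 by rewrite gt_eqF.
have D : is_derive t 1 (fun y => (2 * y)^-1) (- (t ^- 2) * 2^-1).
  apply: is_derive_ext (is_derive_scale 2^-1 (is_derive_inv t1)) => y.
  by rewrite invfM mulrC.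
have := cdiffZ ii (cdiff_rc D).
suff -> : 2 * ii * acoef t ^+ 2 = ii * rc (- t ^- 2 / 2) by [].
rewrite /acoef; have -> : 2 = rc 2 :> C by exact: natcE.
have -> : rc 2 * ii * (ii * rc (2 * t)^-1) ^+ 2 = (ii * ii) * (ii * (rc 2 * rc (2 * t)^-1 ^+ 2)) by ring.
rewrite iiM mulN1r -mulrN -rcX -rcM -rcN; congr (_ * rc _).
by field.
Qed.

Lemma cdiff_kern0_t t z : 0 < t -> cdiff (kern 0 ^~ z) (ii * kern 2 t z) t.
Proof.
move=> t0; have t1 : t != 0 by rewrite gt_eqF.
have s0 : 0 < Num.sqrt t by rewrite sqrtr_gt0.
have Ds : is_derive t 1 (fun y => (Num.sqrt y)^-1) (- (2 * t)^-1 * (Num.sqrt t)^-1).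
  have s1 : Num.sqrt t != 0 by rewrite gt_eqF.
  apply: is_derive_eq (@is_deriveV _ _ t _ 1 s1 (is_derive1_sqrt t0)) _.
  rewrite -[_ *: _]/(_ * _) sqr_sqrtr ?(ltW t0)//; field.
  by rewrite t1 s1.
have De : is_derive t 1 (fun y => z ^+ 2 / (4 * y)) (- (t ^- 2) * (z ^+ 2 / 4)).
  apply: is_derive_ext (is_derive_scale (z ^+ 2 / 4) (is_derive_inv t1)) => y.
  by rewrite invfM; ring.
have := cdiffM (cdiffZ kconst (cdiff_rc Ds)) (cdiff_expi De).
suff -> : ii * kern 2 t z = kconst * rc (- (2 * t)^-1 / Num.sqrt t) * expi (z ^+ 2 / (4 * t)) +
   kconst * rc (Num.sqrt t)^-1 * (ii * rc (- t ^- 2 * (z ^+ 2 / 4)) * expi (z ^+ 2 / (4 * t))) by [].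
rewrite /= /kern0 !mul0r addr0 mul1r.
set E := expi _; set S := rc (Num.sqrt t)^-1.
have -> : ii * (acoef t * rc z * (acoef t * rc z * (kconst * S * E)) + acoef t * (kconst * S * E)) =
  kconst * S * E * (ii * acoef t + ii * acoef t ^+ 2 * rc (z ^+ 2)) by rewrite rcX; ring.
have -> : ii * acoef t = rc (- (2 * t)^-1).
  by rewrite /acoef mulrA iiM mulN1r rcN.
have -> : acoef t ^+ 2 = - rc ((2 * t)^-1 ^+ 2).
  by rewrite /acoef exprMn -rcX expr2 iiM mulN1r.
rewrite (rcM (- (2 * t)^-1)) (_ : - t ^- 2 * (z ^+ 2 / 4) = - ((2 * t)^-1 ^+ 2 * z ^+ 2)); last by field.
by rewrite rcN !rcM -/S; ring.
Qed.

(** The kernel solves the Schroedinger equation: one derivative in t is [i] times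
    two derivatives in z. *)
Lemma cdiff_kern_t n t z : 0 < t -> cdiff (kern n ^~ z) (ii * kern n.+2 t z) t.
Proof.
move=> t0; have Da := cdiff_acoef t0.
suff [] : cdiff (kern n ^~ z) (ii * kern n.+2 t z) t /\
          cdiff (kern n.+1 ^~ z) (ii * kern n.+3 t z) t by [].
elim: n => [|n [IH1 IH2]].
  have D0 := @cdiff_kern0_t t z t0; split; first exact: D0.
  have D := cdiffM (cdiffZ (rc z) Da) D0.
  have E : kern 1 ^~ z = fun y => rc z * acoef y * kern 0 y z.
    by apply/funext => y; rewrite kernS !mul0r addr0 (mulrC (rc z)).
  rewrite {1}E.
  suff -> : ii * kern 3 t z = rc z * (2 * ii * acoef t ^+ 2) * kern 0 t z +
     rc z * acoef t * (ii * kern 2 t z) by exact: D.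
  by rewrite kernS (kernS 0) /= !mul0r addr0; ring.
split; first exact: IH2.
have D := cdiffD (cdiffM (cdiffZ (rc z) Da) IH2) (cdiffM (cdiffZ n.+1%:R Da) IH1).
have E : kern n.+2 ^~ z = fun y => rc z * acoef y * kern n.+1 y z + n.+1%:R * acoef y * kern n y z.
  by apply/funext => y; rewrite kernS (mulrC (rc z)).
rewrite {1}E.
suff -> : ii * kern n.+4 t z = rc z * (2 * ii * acoef t ^+ 2) * kern n.+1 t z
   + rc z * acoef t * (ii * kern n.+3 t z) +
  (n.+1%:R * (2 * ii * acoef t ^+ 2) * kern n t z + n.+1%:R * acoef t * (ii * kern n.+2 t z)).
  exact: D.
rewrite [in LHS]kernS -[n.+3%:R]natr1 -[n.+2%:R]natr1 [n.+3.-1]/=.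
by rewrite [in X in _ + X]kernS /=; ring.
Qed.

Lemma normc_kconst_gt0 : 0 < normc kconst.
Proof.
rewrite normcV invr_gt0 lt_def normc_ge0 andbT normc_eq0 mulf_neq0 ?onei_neq0//.
by rewrite -[0]/(rc 0) (inj_eq (@complexI _)) gt_eqF ?sqrt2pi_gt0.
Qed.

(** In the recursion the factor [n.+1] meets a derivative two orders lower, so
    that each step costs about [sqrt n]: the bound grows like the square root of
    [n!], and the Taylor series in z converges everywhere. *)
Lemma kern_bound (e Z : R) : 0 < e -> 0 <= Z ->
  exists B K : R, [/\ 0 < B, 1 <= K & forall n t z, e < t -> `|z| <= Z ->
    normc (kern n t z) <= B * K ^+ n * Num.sqrt n`!%:R].
Proof.
move=> e0 Z0; pose al := (2 * e)^-1; have al0 : 0 < al by rewrite invr_gt0 mulr_gt0.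
pose B := normc kconst * (Num.sqrt e)^-1; pose K := 1 + al * (Z + 1).
have se : 0 < Num.sqrt e by rewrite sqrtr_gt0.
have B0 : 0 < B by rewrite mulr_gt0 ?normc_kconst_gt0// invr_gt0.
have K1 : 1 <= K by rewrite lerDl mulr_ge0// ?addr_ge0// ltW.
have K0 : 0 < K by exact: lt_le_trans K1.
exists B, K; split => // n t z et zZ.
have t0 : 0 < t by exact: lt_trans et.
have acE : normc (acoef t) <= al.
  rewrite /acoef normcM normc_i mul1r normc_rc gtr0_norm ?invr_gt0 ?mulr_gt0//.
  by rewrite lef_pV2 ?posrE ?mulr_gt0// ler_pM2l// ltW.
have k0E : normc (kern 0 t z) <= B.
  rewrite [kern 0 t z]/(kern0 t z) /kern0 !normcM normc_expi mulr1 normc_rc ler_wpM2l ?normc_ge0//.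
  rewrite gtr0_norm ?invr_gt0 ?sqrtr_gt0// lef_pV2 ?posrE ?sqrtr_gt0//.
  by rewrite ler_wsqrtr// ltW.
suff [] : normc (kern n t z) <= B * K ^+ n * Num.sqrt n`!%:R /\
   normc (kern n.+1 t z) <= B * K ^+ n.+1 * Num.sqrt n.+1`!%:R by [].
elim: n => [|n [IH1 IH2]].
  rewrite expr0 expr1 fact0 !sqrtr1 !mulr1; split => //.
  rewrite kernS !mul0r addr0 2!normcM (normc_rc z) [in leRHS]mulrC.
  apply: ler_pM => //; rewrite ?mulr_ge0 ?normc_ge0//.
  apply: (le_trans (ler_pM (normc_ge0 _) (normr_ge0 _) acE zZ)).
  by rewrite /K mulrDr mulr1; lra.
split => //; rewrite kernS; apply: (le_trans (normcD _ _)).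
rewrite (normcM (_ * _)) (normcM (acoef t)) (normc_rc z) [n.+1.-1]/=.
rewrite (normcM (_ * _)) (normcM _ (acoef t)) normc_nat.
set f := Num.sqrt n`!%:R in IH1; set g := Num.sqrt n.+1`!%:R in IH2 *.
pose h : R := Num.sqrt n.+2%:R.
have f0 : 0 < f by rewrite sqrtr_gt0 factR_gt0.
have g0 : 0 < g by rewrite sqrtr_gt0 factR_gt0.
have h1 : 1 <= h by rewrite -[1]sqrtr1 ler_wsqrtr// ler1n.
have -> : Num.sqrt n.+2`!%:R = h * g by rewrite -sqrtrM// -natrM -factS.
have ng : n.+1%:R * f <= h * g.
  have -> : g = Num.sqrt n.+1%:R * f by rewrite -sqrtrM// -natrM -factS.
  rewrite mulrA ler_wpM2r ?(ltW f0)// -[leLHS]sqr_sqrtr// expr2 ler_wpM2r ?sqrtr_ge0//.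
  by rewrite ler_wsqrtr// ler_nat.
have BK m : 0 <= B * K ^+ m.
  by apply: mulr_ge0; [exact: ltW|rewrite exprn_ge0// ltW].
have P1 : normc (acoef t) * `|z| * normc (kern n.+1 t z) <= (al * Z) * (B * K ^+ n.+1 * (h * g)).
  apply: ler_pM; rewrite ?mulr_ge0 ?normc_ge0//; first exact: ler_pM (normc_ge0 _) _ acE zZ.
  apply: (le_trans IH2); rewrite (ler_wpM2l (BK _))//.
  by rewrite ler_peMl// ltW.
have P2 : n.+1%:R * normc (acoef t) * normc (kern n t z) <= al * (B * K ^+ n * (h * g)).
  rewrite (mulrC n.+1%:R) -[leLHS]mulrA; apply: ler_pM; rewrite ?mulr_ge0 ?normc_ge0//.
  apply: (@le_trans _ _ (n.+1%:R * (B * K ^+ n * f))); first by rewrite ler_wpM2l.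
  by rewrite mulrCA (ler_wpM2l (BK _)).
apply: (le_trans (lerD P1 P2)); rewrite !exprS.
have -> : al * Z * (B * (K * K ^+ n) * (h * g)) + al * (B * K ^+ n * (h * g)) =
  (B * K ^+ n * (h * g)) * (al * Z * K + al) by ring.
have -> : B * (K * (K * K ^+ n)) * (h * g) = (B * K ^+ n * (h * g)) * (K * K) by ring.
apply: ler_wpM2l; first by apply: (mulr_ge0 (BK _)); rewrite mulr_ge0 ?(ltW g0)// (le_trans _ h1).
apply: (@le_trans _ _ (al * (Z + 1) * K)); last by rewrite ler_wpM2r ?(ltW K0)// lerDr.
have -> : al * (Z + 1) * K = al * Z * K + al * K by ring.
by rewrite lerD2l ler_peMr// ltW.
Qed.

End Kernel.

(** * The free evolution of an odd datum *)
Section FreeEvolution.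
Context {R : realType}.
Local Notation C := R[i].
Local Notation Re := (@complex.Re R).
Local Notation Im := (@complex.Im R).
Local Notation normc := (@Normc.normc R).
Local Notation ii := (Complex 0 1 : R[i]).
Local Notation rc := (real_complex R).
Local Notation mu := (@lebesgue_measure R).
Implicit Types (x t z y : R).

Lemma cmeas_cdiff (D : set R) (f d : R -> C) : measurable D ->
  (forall x, cdiff f (d x) x) -> cmeas D f.
Proof.
move=> mD H; split; apply: (@measurable_funS _ _ _ _ setT) => //;
  apply: continuous_measurable_fun => x; have [a b] := H x.
  exact: is_derive_continuous a.
exact: is_derive_continuous b.
Qed.

Lemma cmeas_kern (D : set R) n t x : measurable D -> 0 < t ->
  cmeas D (fun y => kern n t (x - y)).
Proof.
move=> mD t0; apply: (@cmeas_cdiff _ _ (fun y => rc (-1) * kern n.+1 t (x - y))) => // y.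
apply: (@cdiff_comp _ (kern n t) (fun y => x - y)); first exact: cdiff_kern_z.
by apply: is_derive_eq (is_deriveB (is_derive_cst x y 1) (is_derive_id y 1)) _; rewrite sub0r.
Qed.

Variable f : R -> C.
Local Notation D := (`[-1, 1]%classic : set R).
Hypothesis intf : cintegrable D f.

(** For [n = 0] this is the solution on the line with datum [f] on [[-1, 1]] and
    zero elsewhere; in general, its [n]-th derivative in x. *)
Definition evol n t x : C := cint D (fun y => kern n t (x - y) * f y).

Let mD : measurable D. Proof. exact: measurable_itv. Qed.

Lemma D_dist x y (X : R) : D y -> `|x| <= X -> `|x - y| <= X + 1.
Proof.
rewrite /= in_itv/= => /andP[a b] xX; apply: (le_trans (ler_normB _ _)).
by rewrite lerD// ler_norml a.
Qed.

Lemma cintegrable_evol n t x : 0 < t -> cintegrable D (fun y => kern n t (x - y) * f y).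
Proof.
move=> t0; have [||B [K [B0 K1 H]]] := @kern_bound R (t / 2) (`|x| + 1).
- by rewrite divr_gt0.
- by rewrite addr_ge0.
apply: (@cintegrable_bounded _ _ _ _ (B * K ^+ n * Num.sqrt n`!%:R)) => //.
  exact: cmeas_kern.
by move=> y Dy; apply: H; [lra|exact: D_dist].
Qed.

Lemma evol_bound (e X : R) : 0 < e -> 0 <= X ->
  exists B K : R, [/\ 0 < B, 1 <= K & forall n t x, e < t -> `|x| <= X ->
    normc (evol n t x) <= B * K ^+ n * Num.sqrt n`!%:R].
Proof.
move=> e0 X0; have [|B [K [B0 K1 H]]] := @kern_bound R e (X + 1) e0; first by rewrite addr_ge0.
pose G := \int[mu]_(y in D) normc (f y).
have G0 : 0 <= G by apply: Rintegral_ge0 => y _; exact: normc_ge0.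
exists (2 * B * (G + 1)), K; split => //; first by rewrite !mulr_gt0// ltr_wpDl.
move=> n t x et xX; set k := Num.sqrt _.
have t0 : 0 < t by exact: lt_trans et.
have k0 : 0 <= k by exact: sqrtr_ge0.
have ing := cintegrable_normc mD intf.
apply: (@le_trans _ _ (2 * \int[mu]_(y in D) (B * K ^+ n * k * normc (f y)))).
  apply: normc_cint_le => //.
  - exact: cint_meas (cintegrable_evol n x t0).
  - by move=> y Dy; rewrite normcM ler_wpM2r ?normc_ge0// H// D_dist.
  - exact: rintZ.
have Kn : 0 <= B * K ^+ n * k.
  by rewrite !mulr_ge0 ?exprn_ge0 ?(ltW B0)// (le_trans ler01).
rewrite RintegralZl// -/G.
have -> : 2 * B * (G + 1) * K ^+ n * k = 2 * (B * K ^+ n * k * (G + 1)) by ring.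
by rewrite ler_wpM2l// ler_wpM2l// lerDl.
Qed.

Lemma cdiff_evol_t n t x : 0 < t -> cdiff (fun s => evol n s x) (ii * evol n.+2 t x) t.
Proof.
move=> t0; have e0 : 0 < t / 2 by rewrite divr_gt0.
have [|B [K [B0 K1 H]]] := @kern_bound R (t / 2) (`|x| + 1) e0; first by rewrite addr_ge0.
pose b m := B * K ^+ m * Num.sqrt m`!%:R.
have b0 m : 0 <= b m.
  by rewrite !mulr_ge0 ?exprn_ge0 ?sqrtr_ge0 ?(ltW B0)// (le_trans ler01).
have near s : `|s - t| < t / 2 -> t / 2 < s by rewrite ltr_distlC => /andP[]; lra.
have nk m y s : D y -> `|s - t| < t / 2 -> normc (kern m s (x - y)) <= b m.
  by move=> Dy st; apply: H; [exact: near|exact: D_dist].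
have near0 s : `|s - t| < t / 2 -> 0 < s by move/near; lra.
rewrite /evol -cintZ//; last exact: cintegrable_evol.
under [X in cdiff _ X _]eq_cint => y _ do rewrite mulrA.
apply: (@cdiff_cint _ D (fun s y => kern n s (x - y)) (fun s y => ii * kern n.+2 s (x - y))
  (fun s y => ii * (ii * kern n.+4 s (x - y))) f t (t / 2) (b n + b n.+2 + b n.+4)) => //.
- by move=> s st; apply: cmeas_kern => //; exact: near0.
- move=> s st; apply: cmeasM; first exact: cmeas_cst.
  by apply: cmeas_kern => //; exact: near0.
- by move=> y s _ st; apply: cdiff_kern_t; exact: near0.
- by move=> y s _ st; apply: cdiffZ; apply: cdiff_kern_t; exact: near0.
- by move=> y s Dy st; apply: (le_trans (nk _ _ _ Dy st)); rewrite -addrA lerDl addr_ge0.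
- move=> y s Dy st; rewrite normcM normc_i mul1r; apply: (le_trans (nk _ _ _ Dy st)).
  by rewrite (addrC (b n)) -addrA lerDl addr_ge0.
- move=> y s Dy st; rewrite !normcM normc_i !mul1r; apply: (le_trans (nk _ _ _ Dy st)).
  by rewrite lerDr addr_ge0.
Qed.

Lemma cdiff_evol_x n t x : 0 < t -> cdiff (evol n t) (evol n.+1 t x) x.
Proof.
move=> t0; have e0 : 0 < t / 2 by rewrite divr_gt0.
have [|B [K [B0 K1 H]]] := @kern_bound R (t / 2) (`|x| + 1 + 1) e0; first by rewrite !addr_ge0.
pose b m := B * K ^+ m * Num.sqrt m`!%:R.
have b0 m : 0 <= b m.
  by rewrite !mulr_ge0 ?exprn_ge0 ?sqrtr_ge0 ?(ltW B0)// (le_trans ler01).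
have nk m y s : D y -> `|s - x| < 1 -> normc (kern m t (s - y)) <= b m.
  move=> Dy sx; apply: H; [lra|apply: D_dist => //].
  by have := ler_normD (s - x) x; rewrite subrK; lra.
have dk m y s : cdiff (fun s => kern m t (s - y)) (kern m.+1 t (s - y)) s.
  rewrite -[X in cdiff _ X _]mul1r.
  apply: (@cdiff_comp _ (kern m t) (fun s => s - y)); first exact: cdiff_kern_z.
  by apply: is_derive_eq (is_deriveB (is_derive_id s 1) (is_derive_cst y s 1)) _; rewrite subr0.
apply: (@cdiff_cint _ D (fun s y => kern n t (s - y)) (fun s y => kern n.+1 t (s - y))
  (fun s y => kern n.+2 t (s - y)) f x 1 (b n + b n.+1 + b n.+2)) => //.
- by move=> s _; exact: cmeas_kern.
- by move=> s _; exact: cmeas_kern.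
- by move=> y s Dy st; apply: (le_trans (nk _ _ _ Dy st)); rewrite -addrA lerDl addr_ge0.
- move=> y s Dy st; apply: (le_trans (nk _ _ _ Dy st)).
  by rewrite (addrC (b n)) -addrA lerDl addr_ge0.
- move=> y s Dy st; apply: (le_trans (nk _ _ _ Dy st)).
  by rewrite lerDr addr_ge0.
Qed.

Hypothesis oddf : forall y, f (- y) = - f y.

Lemma kern_parity n t z : kern n t (- z) = (-1) ^+ n * kern n t z.
Proof.
suff [] : kern n t (- z) = (-1) ^+ n * kern n t z /\
   kern n.+1 t (- z) = (-1) ^+ n.+1 * kern n.+1 t z by [].
elim: n => [|n [IH1 IH2]].
  have E : kern 0 t (- z) = kern 0 t z by rewrite /= /kern0 sqrrN.
  by rewrite expr0 mul1r E; split => //; rewrite !kernS !mul0r !addr0 E rcN expr1; ring.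
split => //; rewrite [LHS]kernS [in RHS]kernS IH2 [n.+1.-1]/= IH1 rcN !exprS; ring.
Qed.

Lemma integral_oppr_D (h : R -> \bar R) : measurable_fun D h ->
  (\int[mu]_(y in D) h (- y)%R = \int[mu]_(y in D) h y)%E.
Proof.
move=> mh; have ge0 (g : R -> \bar R) : measurable_fun D g -> (forall x, 0 <= g x)%E ->
    (\int[mu]_(y in D) g (- y)%R = \int[mu]_(y in D) g y)%E.
  move=> mg g0; transitivity (\int[mu]_(y in (-%R : _ -> measurableTypeR R) @^-1` D)
      (g \o (-%R : _ -> measurableTypeR R)) y)%E.
    by rewrite opp_preimage_itvbndbnd /= opprK.
  rewrite -ge0_integral_pushforward//=.
  by apply: eq_measure_integral => //= A mA AS; exact: lebesgue_measureN.
have Ep := ge0 _ (measurable_funepos mh) (fun x => funepos_ge0 h x).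
have En := ge0 _ (measurable_funeneg mh) (fun x => funeneg_ge0 h x).
transitivity (\int[mu]_(y in D) (h \o -%R) y)%E; first by [].
rewrite [LHS]integralE [RHS]integralE; congr (_ - _)%E.
  by rewrite -[RHS]Ep funepos_comp.
by rewrite -[RHS]En funeneg_comp.
Qed.

Lemma cint_oppr (g : R -> C) : cintegrable D g -> cint D (fun y => g (- y)) = cint D g.
Proof.
move=> ig; have [mr mi] := cint_meas ig.
have H (h : R -> R) : measurable_fun D h ->
    \int[mu]_(y in D) h (- y) = \int[mu]_(y in D) h y.
  move=> mh; rewrite /Rintegral; congr fine.
  by rewrite (@integral_oppr_D (EFin \o h))//; exact/measurable_EFinP.
by rewrite /cint (H _ mr) (H _ mi).
Qed.

(** The even derivatives of an odd function vanish at 0. *)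
Lemma evol_even_x0 n t : 0 < t -> ~~ odd n -> evol n t 0 = 0.
Proof.
move=> t0 en; have ic := cintegrable_evol n 0 t0.
pose g y := kern n t (0 - y) * f y.
have E y : g (- y) = - g y.
  rewrite /g oddf !sub0r opprK -{1}(opprK y) kern_parity.
  by rewrite -signr_odd (negbTE en) expr0 mul1r mulrN.
have : evol n t 0 = - evol n t 0.
  have -> : evol n t 0 = cint D (fun y => g (- y)) by rewrite (cint_oppr ic).
  rewrite {2}(_ : cint D _ = evol n t 0); last exact: cint_oppr ic.
  by rewrite -cintN//; apply: eq_cint => y _; exact: E.
move=> /eqP; rewrite -subr_eq0 opprK -mulr2n mulrn_eq0/= => /eqP.
exact.
Qed.

Lemma taylor_remainder (h : nat -> R -> R) N (B x : R) : 0 <= x ->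
  (forall n y, is_derive y 1 (h n) (h n.+1 y)) ->
  (forall y, 0 <= y <= x -> `|h N y| <= B) ->
  forall y, 0 <= y <= x -> `|h 0%N y - \sum_(n < N) mon n y * h n 0| <= B * mon N y.
Proof.
move=> x0; elim: N h => [|N IH] h Dh Bh y yx.
  by rewrite big_ord0 subr0 /mon expr0 fact0 divr1 mulr1 Bh.
pose r z := h 0%N z - \sum_(n < N.+1) mon n z * h n 0.
pose r' z := h 1%N z - \sum_(n < N) mon n z * h n.+1 0.
have Dr z : is_derive z 1 r (r' z).
  have -> : r = fun z => (h 0%N z - h 0%N 0) - \sum_(n < N) mon n.+1 z * h n.+1 0.
    apply/funext => w; rewrite /r big_ord_recl /= /mon expr0 fact0 divr1 mul1r opprD addrA.
    by [].
  have Ds : is_derive z 1 (fun z => \sum_(n < N) mon n.+1 z * h n.+1 0)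
       (\sum_(n < N) mon n z * h n.+1 0).
    have := @is_derive_sum _ _ _ N (fun n z => mon n.+1 z * h n.+1 0) z 1
      (fun n => mon n z * h n.+1 0) (fun n => is_derive_scale _ (is_derive_mon n z)).
    by apply: is_derive_ext => w; rewrite fct_sumE.
  apply: is_derive_eq (is_deriveB (is_deriveB (Dh 0%N z) (is_derive_cst (h 0%N 0) z 1)) Ds) _.
  by rewrite subr0.
have Br z : 0 <= z <= x -> `|r' z| <= B * mon N z.
  by move=> zx; apply: (IH (fun n => h n.+1)) => // w; exact: Bh.
have r0 : r 0 = 0.
  rewrite /r big_ord_recl /= big1 ?addr0; last first.
    by move=> i _; rewrite /mon expr0n/= mul0r mul0r.
  by rewrite /mon expr0 fact0 divr1 mul1r subrr.
have m0 : mon N.+1 0 = 0 :> R by rewrite /mon expr0n mul0r.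
have [y0 yle] := andP yx.
(* both B y^(N+1)/(N+1)! - r and B y^(N+1)/(N+1)! + r are nondecreasing *)
have mono (sg : R) : `|sg| = 1 -> 0 <= B * mon N.+1 y - sg * r y.
  move=> sg1.
  have Dg z : is_derive z 1 (fun z => B * mon N.+1 z - sg * r z) (B * mon N z - sg * r' z).
    apply: is_derive_eq (is_deriveB (is_deriveM (is_derive_cst B z 1) (is_derive_mon N z))
       (is_deriveM (is_derive_cst sg z 1) (Dr z))) _.
    by rewrite -![_ *: _]/(_ * _) !mulr0 !addr0.
  have [z /andP[z0 zy]] := @mean_value_le R _ _ 0 y y0 (fun z _ => Dg z).
  rewrite m0 r0 !mulr0 subr0 !subr0 => ->; apply: mulr_ge0 => //.
  rewrite subr_ge0 (le_trans (ler_norm _))// normrM sg1 mul1r Br// z0.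
  exact: le_trans yle.
rewrite -/(r y) ler_norml; apply/andP; split.
  by have := mono (-1); rewrite normrN normr1 => /(_ erefl); lra.
by have := mono 1; rewrite normr1 => /(_ erefl); lra.
Qed.

Lemma csum_eq_lim (a : nat -> C) (z : C) (K : R) :
  (forall n, normc (z - \sum_(j < n) a j) <= K * (2^-1) ^+ n) -> csum a = z.
Proof.
move=> H.
have L (u : nat -> R) (v : R) : (forall n, `|v - \sum_(j < n) u j| <= K * (2^-1) ^+ n) ->
    limn (series u) = v.
  move=> Hu; apply/cvg_lim => //; apply/cvgrPdist_le => eps eps0.
  have := @cvg_geometric R K 2^-1 (half_lt1 (R := R)).
  move=> /cvgrPdist_le/(_ _ eps0); apply: filterS => n.
  rewrite sub0r normrN => Hn; rewrite /series /= big_mkord.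
  by apply: le_trans (Hu n) _; apply: le_trans (ler_norm _) Hn.
apply: cext => /=; apply: L => n.
  apply: le_trans (H n); rewrite (_ : _ - _ = Re (z - \sum_(j < n) a j)) ?normc_Re//.
  by rewrite ReB; congr (_ - _); elim/big_ind2: _ => // x1 x2 y1 y2 -> ->; rewrite ReD.
apply: le_trans (H n); rewrite (_ : _ - _ = Im (z - \sum_(j < n) a j)) ?normc_Im//.
by rewrite ImB; congr (_ - _); elim/big_ind2: _ => // x1 x2 y1 y2 -> ->; rewrite ImD.
Qed.

(** The flux at [x = 0] and its time derivatives: by the equation, each of them is
    [i] times two more derivatives in x. *)
Definition flat (n : nat) t : C := ii ^+ n * evol (2 * n + 1) t 0.

Lemma ladder_flat : ladder [set t | 0 < t] flat.
Proof.
move=> n t t0; have := cdiffZ (ii ^+ n) (cdiff_evol_t (2 * n + 1) 0 t0).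
by rewrite mulrA -exprSr /flat mulnS -addnA add2n.
Qed.

Lemma sqrt_fact_odd_le n : Num.sqrt (2 * n + 1)`!%:R <= 2 * 4 ^+ n * n`!%:R :> R.
Proof.
have -> : 2 * 4 ^+ n * n`!%:R = Num.sqrt ((2 * 4 ^+ n * n`!%:R) ^+ 2) :> R.
  by rewrite sqrtr_sqr ger0_norm// !mulr_ge0// exprn_ge0.
apply: ler_wsqrtr; rewrite -!natrX -!natrM -natrX ler_nat.
elim: n => [|n IH]; first by [].
rewrite mulnS -addnA add2n !factS (expnS 4); move: IH; set F := (2 * n + 1)`!; set G := n`!.
set P := (4 ^ n)%N => IH.
apply: (@leq_trans (16 * n.+1 ^ 2 * F)).
  by rewrite mulnA leq_mul2r; apply/orP; right; rewrite addn1; nia.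
have -> : ((2 * (4 * P) * (n.+1 * G)) ^ 2 = 16 * n.+1 ^ 2 * (2 * P * G) ^ 2)%N by nia.
by rewrite leq_mul2l IH orbT.
Qed.

(** [sqrt (2n+1)!] is of the order of [n!], up to a geometric factor: the flux is
    even real-analytic in time. *)
Lemma flat_bound (e s : R) : 0 < e -> 1 <= s -> exists M rho : R, [/\ 0 < M, 0 < rho &
  forall n t, e < t -> normc (flat n t) <= M * (n`!%:R `^ s / rho ^+ n)].
Proof.
move=> e0 s1; have [B [K [B0 K1 H]]] := evol_bound e0 (lexx 0).
have K0 : 0 < K by exact: lt_le_trans K1.
exists (2 * B * K), ((4 * K ^+ 2)^-1); split; rewrite ?invr_gt0 ?mulr_gt0 ?exprn_gt0//.
move=> n t et; rewrite /flat normcM normcX normc_i expr1n mul1r.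
apply: (le_trans (H _ t 0 et _)); first by rewrite normr0.
have F : n`!%:R <= n`!%:R `^ s :> R by rewrite le1r_powR// ler1n fact_gt0.
rewrite exprVn invrK exprMn -exprM exprD expr1.
have -> : 2 * B * K * (n`!%:R `^ s * (4 ^+ n * K ^+ (2 * n))) =
  B * (K ^+ (2 * n) * K) * (2 * 4 ^+ n * n`!%:R `^ s) by ring.
rewrite ler_wpM2l ?mulr_ge0 ?exprn_ge0 ?(ltW B0) ?(ltW K0)//.
by apply: (le_trans (sqrt_fact_odd_le n)); rewrite ler_wpM2l// mulr_ge0// exprn_ge0.
Qed.

(** The free evolution is itself a flat series: its Taylor series at [x = 0] has
    only odd terms, whose coefficients are the time derivatives of the flux.
    Hence the trajectory is given by one and the same formula before and after the
    control time. *)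
Lemma evol_series t x : 0 < t -> 0 <= x <= 1 ->
  evol 0 t x = csum (sterm flat 0 0 t x).
Proof.
move=> t0 /andP[x0 x1]; have e0 : 0 < t / 2 by rewrite divr_gt0.
have [B [K [B0 K1 H]]] := evol_bound e0 ler01.
have K0 : 0 < K by exact: lt_le_trans K1.
have [||L L0 HL] := @pow_le_fact_pow R (2 * K) (2^-1); rewrite ?invr_gt0 ?mulr_ge0 ?(ltW K0)//.
apply/esym/(@csum_eq_lim _ _ (2 * (B * L))) => n.
have S : \sum_(j < n) sterm flat 0 0 t x j = \sum_(m < 2 * n) rc (mon m x) * evol m t 0.
  elim: n => [|n IH]; first by rewrite !big_ord0.
  rewrite big_ord_recr IH mulnS add2n !big_ord_recr /= evol_even_x0//; last first.
    by rewrite mul2n odd_double.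
  rewrite mulr0 addr0; congr (_ + _).
  rewrite /sterm /flat addn0 /dmon /= subn0 addn1 mulrA.
  rewrite -(mulrA _ _ (ii ^+ n)) (mulrC _ (ii ^+ n)) mulrA -exprMn mulNr iiM opprK expr1n mul1r.
  by [].
rewrite S.
have T (g : C -> R) : (forall m y, is_derive y 1 (fun y => g (evol m t y)) (g (evol m.+1 t y))) ->
    (forall z : C, `|g z| <= normc z) ->
    `|g (evol 0 t x) - \sum_(m < 2 * n) mon m x * g (evol m t 0)| <= B * L * 2^-1 ^+ n.
  move=> Dg gn.
  have := @taylor_remainder (fun m y => g (evol m t y)) (2 * n) (B * K ^+ (2 * n) * Num.sqrt (2 * n)`!%:R) 1.
  move=> /(_ ler01 Dg _ x); rewrite x0 x1 => H1; apply: (le_trans (H1 _ isT)).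
    move=> y /andP[y0 y1]; apply: (le_trans (gn _)); apply: H; first by lra.
    by rewrite ger0_norm.
  set m := (2 * n)%N; rewrite -!mulrA ler_wpM2l ?(ltW B0)//.
  have F0 := factR_gt0 (R := R) m.
  have sF0 : 0 < Num.sqrt m`!%:R :> R by rewrite sqrtr_gt0.
  have mx : mon m x <= m`!%:R^-1.
    by rewrite /mon ler_piMl ?invr_ge0// exprn_ile1.
  apply: (@le_trans _ _ (K ^+ m * (Num.sqrt m`!%:R / m`!%:R))).
    by rewrite ler_wpM2l ?exprn_ge0 ?(ltW K0)// ler_wpM2l ?(ltW sF0).
  have -> : Num.sqrt m`!%:R / m`!%:R = (Num.sqrt m`!%:R)^-1 :> R.
    by rewrite -{2}(sqr_sqrtr (ltW F0)); field; rewrite gt_eqF.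
  rewrite ler_pdivrMr//; have := HL m; rewrite powR12_sqrt// exprMn => Hm.
  apply: (@le_trans _ _ (L * Num.sqrt m`!%:R * 2^-1 ^+ m)).
    by rewrite exprVn ler_pdivlMr ?exprn_gt0// mulrC.
  rewrite [leRHS]mulrAC; apply: ler_wpM2l; first by rewrite mulr_ge0 ?ltW.
  by rewrite ler_wiXn2l ?invr_ge0// ?invf_le1 ?ler1n// /m leq_pmull.
apply: (le_trans (normc_le _)).
have E1 := T Re (fun m y => proj1 (cdiff_evol_x m y t0)) (@normc_Re R).
have E2 := T Im (fun m y => proj2 (cdiff_evol_x m y t0)) (@normc_Im R).
have -> : 2 * (B * L) * 2^-1 ^+ n = B * L * 2^-1 ^+ n + B * L * 2^-1 ^+ n by ring.
apply: lerD.
  rewrite ReB (_ : Re (\sum_(m < 2 * n) _) = \sum_(m < 2 * n) mon m x * Re (evol m t 0))//.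
  by elim/big_ind2: _ => // [x1' x2' y1 y2 <- <-|i _]; rewrite ?ReD ?Re_rcM.
rewrite ImB (_ : Im (\sum_(m < 2 * n) _) = \sum_(m < 2 * n) mon m x * Im (evol m t 0))//.
by elim/big_ind2: _ => // [x1' x2' y1 y2 <- <-|i _]; rewrite ?ImD ?Im_rcM.
Qed.

End FreeEvolution.

(** * The fundamental theorem of calculus *)
Section FundamentalTheorem.
Context {R : realType}.
Local Notation C := R[i].
Local Notation Re := (@complex.Re R).
Local Notation Im := (@complex.Im R).
Local Notation normc := (@Normc.normc R).
Local Notation mu := (@lebesgue_measure R).
Implicit Types (a b x : R) (f F : R -> R).

Lemma within_continuous_for f a b : (forall x, a <= x <= b -> {for x, continuous f}) ->
  {within `[a, b], continuous f}.
Proof.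
move=> H; apply: continuous_in_subspaceT => x /[!inE]/=; rewrite in_itv/= => xab.
exact: H.
Qed.

Lemma rint_continuous f a b : (forall x, a <= x <= b -> {for x, continuous f}) ->
  rint `[a, b] f.
Proof.
move=> H; apply: continuous_compact_integrable; first exact: segment_compact.
exact: within_continuous_for.
Qed.

Lemma ftc F f a b : a <= b -> (forall x, a <= x <= b -> is_derive x 1 F (f x)) ->
  (forall x, a <= x <= b -> {for x, continuous f}) ->
  \int[mu]_(x in `[a, b]) f x = F b - F a.
Proof.
rewrite le_eqVlt => /predU1P[->|ab] DF cf; first by rewrite set_itv1 Rintegral_set1 subrr.
have cF x : a <= x <= b -> {for x, continuous F}.
  by move=> xab; apply: is_derive_continuous (DF x xab).
have sub x : x \in `]a, b[%R -> a <= x <= b.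
  by rewrite in_itv/= => /andP[ax xb]; rewrite !ltW.
have H := @continuous_FTC2 R f F a b ab (within_continuous_for cf).
rewrite /Rintegral H//.
- split.
  + by move=> x /sub xab; apply: ex_derive; exact: DF.
  + by apply: cvg_at_right_filter; apply: cF; rewrite lexx ltW.
  + by apply: cvg_at_left_filter; apply: cF; rewrite lexx ltW.
- by move=> x /sub xab; rewrite derive1E; apply: derive_val; exact: DF.
Qed.

Lemma cftc (F f : R -> C) a b : a <= b -> (forall x, a <= x <= b -> cdiff F (f x) x) ->
  (forall x, a <= x <= b -> exists d, cdiff f d x) ->
  cint `[a, b] f = F b - F a.
Proof.
move=> ab DF cf; apply: cext; rewrite ?ReB ?ImB /=.
  apply: (@ftc (fun x => Re (F x)) (fun x => Re (f x)) a b ab) => x xab.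
    by have [] := DF x xab.
  by have [d [H _]] := cf x xab; exact: is_derive_continuous H.
apply: (@ftc (fun x => Im (F x)) (fun x => Im (f x)) a b ab) => x xab.
  by have [] := DF x xab.
by have [d [_ H]] := cf x xab; exact: is_derive_continuous H.
Qed.

Lemma cintegrable_cdiff (f : R -> C) a b :
  (forall x, a <= x <= b -> exists d, cdiff f d x) -> cintegrable `[a, b] f.
Proof.
move=> H; split; apply: rint_continuous => x /H[d [h1 h2]].
  exact: is_derive_continuous h1.
exact: is_derive_continuous h2.
Qed.

Lemma is_derive_normc2 (f : R -> C) d x : cdiff f d x ->
  is_derive x 1 (fun y => normc (f y) ^+ 2) (2 * (Re (f x) * Re d + Im (f x) * Im d)).
Proof.
move=> [a b].
have := is_deriveD (is_deriveM a a) (is_deriveM b b).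
move=> H; apply: is_derive_eq (is_derive_ext _ H) _.
  by move=> y; rewrite /= normc2E !expr2.
by rewrite -![_ *: _]/(_ * _); ring.
Qed.

Lemma continuous_normc2 (f : R -> C) d x : cdiff f d x ->
  {for x, continuous (fun y => normc (f y) ^+ 2)}.
Proof. by move=> /is_derive_normc2 H; apply: is_derive_continuous H. Qed.

(** Differentiable only to the right of the base point, so that base points are
    chosen below to the left of the interval of interest. *)
Definition prim (q : R -> R) (a x : R) : R := \int[mu]_(y in `[a, x]) q y.

Lemma is_derive_prim (q : R -> R) a x : continuous q -> a < x -> is_derive x 1 (prim q a) (q x).
Proof.
move=> cq ax.
have iq : rint `[a, x + 1] q by apply: rint_continuous => y _; exact: cq.
have xx : x < x + 1 by rewrite ltrDl.
have [D E] := continuous_FTC1_closed xx iq ax (cq x).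
by apply: DeriveDef D _; rewrite -derive1E.
Qed.

Lemma rint_le_prim (q : R -> R) a x b : continuous q -> (forall y, 0 <= q y) -> a <= x -> x <= b ->
  prim q a x <= prim q a b.
Proof.
move=> cq q0 ax xb.
have := @Rintegral_itvB R q (BLeft a) (BRight b) x.
rewrite /prim => H; rewrite -subr_ge0 H.
- by apply: Rintegral_ge0 => y _; exact: q0.
- by apply: rint_continuous => y _; exact: cq.
- by rewrite bnd_simp.
- by rewrite bnd_simp.
Qed.

End FundamentalTheorem.

(** * Orthogonality of exponentials *)
Section Orthogonality.
Context {R : realType}.
Local Notation C := R[i].
Local Notation Re := (@complex.Re R).
Local Notation Im := (@complex.Im R).
Local Notation normc := (@Normc.normc R).
Local Notation ii := (Complex 0 1 : R[i]).
Local Notation rc := (real_complex R).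
Local Notation mu := (@lebesgue_measure R).
Implicit Types (a b x v w d L : R).

Lemma expi_neg x : expi (- x) = conjc (expi x).
Proof. by rewrite /expi cosN sinN. Qed.

Lemma expi_nat n x : expi (n%:R * x) = expi x ^+ n.
Proof.
elim: n => [|n IH]; first by rewrite mul0r expi0 expr0.
by rewrite -natr1 mulrDl mul1r expiD IH exprSr.
Qed.

Lemma conjcM (z w : C) : conjc (z * w) = conjc z * conjc w.
Proof. exact: rmorphM. Qed.

Lemma normcD2 (z w : C) :
  normc (z + w) ^+ 2 = normc z ^+ 2 + normc w ^+ 2 + 2 * Re (z * conjc w).
Proof. by case: z w => [p q] [r s]; rewrite !normc2E /=; ring. Qed.

Lemma mul_conjc (z : C) : z * conjc z = rc (normc z ^+ 2).
Proof. by apply: cext; rewrite ?ReM ?ImM normc2E; case: z => p q /=; ring. Qed.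

Lemma cdiff_expi_lin w x : cdiff (fun v => expi (w * v)) (ii * rc w * expi (w * x)) x.
Proof.
apply: cdiff_expi; have := is_derive_scale w (is_derive_id x 1).
by rewrite mul1r; apply: is_derive_ext => y; rewrite mulrC.
Qed.

Lemma cint_expi a L w : 0 <= L -> w != 0 -> expi (w * L) = 1 ->
  cint `[a, a + L] (fun v => expi (w * v)) = 0.
Proof.
move=> L0 w0 E; have aL : a <= a + L by rewrite lerDl.
have z0 : ii * rc w != 0.
  by rewrite -normc_eq0 normcM normc_i mul1r normc_rc normr_eq0.
rewrite (@cftc _ (fun v => (ii * rc w)^-1 * expi (w * v))) => // [|x _|x _].
- by rewrite mulrDr expiD E mulr1 subrr.
- by have := cdiffZ (ii * rc w)^-1 (cdiff_expi_lin w x); rewrite mulrA mulVf// mul1r.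
- by eexists; exact: cdiff_expi_lin.
Qed.

Definition tpoly (N : nat) (c : nat -> C) (k : nat -> R) v : C :=
  \sum_(n < N) c n * expi (k n * v).

Lemma cdiff_tpoly N c k x : cdiff (tpoly N c k) (tpoly N (fun n => ii * rc (k n) * c n) k x) x.
Proof.
elim: N => [|N IH].
  rewrite /tpoly big_ord0; apply: cdiff_ext (cdiff_cst 0 x) => y.
  by rewrite big_ord0.
have := cdiffD IH (cdiffZ (c N) (cdiff_expi_lin (k N) x)).
rewrite /tpoly [in X in _ -> X]big_ord_recr /=.
have -> : c N * (ii * rc (k N) * expi (k N * x)) = ii * rc (k N) * c N * expi (k N * x) by ring.
by apply: cdiff_ext => y; rewrite big_ord_recr.
Qed.

(** Induction on the number of terms: the new frequency differs from the previous
    ones by nonzero multiples of [w], whose exponentials have mean zero over the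
    period [L]. *)
Lemma tpoly_orth a L w d c N : 0 <= L -> w != 0 -> expi (w * L) = 1 ->
  \int[mu]_(v in `[a, a + L]) normc (tpoly N c (fun n => n%:R * w + d) v) ^+ 2 =
  L * \sum_(n < N) normc (c n) ^+ 2.
Proof.
move=> L0 w0 E; set k := fun n => n%:R * w + d.
have aL : a <= a + L by rewrite lerDl.
have cP M : rint `[a, a + L] (fun v => normc (tpoly M c k v) ^+ 2).
  by apply: rint_continuous => x _; apply: continuous_normc2 (cdiff_tpoly _ _ _ _).
elim: N => [|N IH].
  rewrite big_ord0 mulr0 (@eq_Rintegral _ _ _ _ _ (fun=> 0)); last first.
    by move=> x _; rewrite /tpoly big_ord0 normc0 expr0n.
  by rewrite Rintegral_cst// mul0r.
pose X v : C := tpoly N c k v * conjc (c N * expi (k N * v)).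
have XE v : X v = \sum_(n < N) c n * conjc (c N) * expi ((k n - k N) * v).
  rewrite /X /tpoly mulr_suml; apply: eq_bigr => n _.
  by rewrite conjcM -expi_neg mulrBl expiD; ring.
have ie z : cintegrable `[a, a + L] (fun v => expi (z * v)).
  by apply: cintegrable_cdiff => x _; eexists; exact: cdiff_expi_lin.
have X0 : cint `[a, a + L] X = 0.
  under eq_cint => v _ do rewrite XE.
  rewrite cint_sum//; last by move=> n; exact: cintegrableZ.
  rewrite big1// => n _; rewrite cintZ//.
  have nN : k n - k N = - ((N - n)%N%:R * w).
    by rewrite /k natrB; [ring|exact: ltnW].
  rewrite cint_expi ?mulr0// nN.
    by rewrite oppr_eq0 mulf_neq0// pnatr_eq0 subn_eq0 -ltnNge.
  by rewrite mulNr expi_neg -mulrA expi_nat E expr1n conjc1.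
have iX : cintegrable `[a, a + L] X.
  rewrite (_ : X = fun v => \sum_(n < N) c n * conjc (c N) * expi ((k n - k N) * v)).
    by apply: cintegrable_sum => // n; exact: cintegrableZ.
  by apply/funext.
have -> : \int[mu]_(v in `[a, a + L]) normc (tpoly N.+1 c k v) ^+ 2 =
  \int[mu]_(v in `[a, a + L]) ((normc (tpoly N c k v) ^+ 2 + normc (c N) ^+ 2) + 2 * Re (X v)).
  apply: eq_Rintegral => v _; rewrite {1}/tpoly big_ord_recr /= normcD2 -/(tpoly N c k v).
  by rewrite (normcM (c N)) normc_expi mulr1.
have i1 : rint `[a, a + L] (fun=> normc (c N) ^+ 2) by exact: rint_cst.
rewrite RintegralD//; [|exact: rintD|exact: rintZ (proj1 iX)].
rewrite RintegralD//; last exact: (cP N).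
have -> : \int[mu]_(v in `[a, a + L]) (2 * Re (X v)) = 2 * \int[mu]_(v in `[a, a + L]) Re (X v).
  exact: RintegralZl (proj1 iX).
have -> : \int[mu]_(v in `[a, a + L]) Re (X v) = 0.
  by have := congr1 Re X0; rewrite /cint /=.
rewrite mulr0 addr0 IH Rintegral_cst// big_ord_recr /= mulrDr; congr (_ + _).
rewrite lebesgue_measure_itv/= lte_fin ltrDl; case: ltgtP L0 => // [L1|L1] _.
  by rewrite -EFinB /= addrC addKr mulrC.
by rewrite -L1 /= mulr0 mul0r.
Qed.

(** A bound on the sums over all the translates of a grid of step [h] integrates,
    in the translation [d], to a bound on the integral. *)
Lemma sampling (G q : R -> R) (h B : R) N : 0 <= h ->
  (forall x, 0 <= x -> is_derive x 1 G (q x)) ->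
  (forall d, 0 <= d <= h -> \sum_(n < N) q (n%:R * h + d) <= B) ->
  G (N%:R * h) - G 0 <= h * B.
Proof.
move=> h0 DG HB.
pose F d := \sum_(n < N) G (n%:R * h + d).
have DF d : 0 <= d <= h -> is_derive d 1 F (\sum_(n < N) q (n%:R * h + d)).
  move=> /andP[d0 _].
  have H (n : 'I_N) : is_derive d 1 (fun d => G (n%:R * h + d)) (q (n%:R * h + d)).
    have P : 0 <= n%:R * h + d by rewrite addr_ge0// mulr_ge0.
    have D1 : is_derive d 1 (fun d => n%:R * h + d) 1.
      by apply: is_derive_eq (is_deriveD (is_derive_cst (n%:R * h) d 1) (is_derive_id d 1)) _; rewrite add0r.
    by have := is_derive1_comp (DG _ P) D1; rewrite mulr1.
  have := @is_derive_sum _ _ _ N (fun n d => G (n%:R * h + d)) d 1 _ H.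
  by apply: is_derive_ext => y; rewrite fct_sumE.
have [z zh Ez] := mean_value_le h0 DF.
have <- : F h - F 0 = G (N%:R * h) - G 0.
  rewrite /F -sumrB; elim: (N) => [|m IH]; first by rewrite big_ord0 mul0r subrr.
  by rewrite big_ord_recr /= IH addr0 -natr1 mulrDl mul1r; ring.
by rewrite Ez subr0 mulrC ler_wpM2l// HB.
Qed.

End Orthogonality.

(** * Sampled oscillatory integrals *)
Section Bessel.
Context {R : realType}.
Local Notation C := R[i].
Local Notation Re := (@complex.Re R).
Local Notation Im := (@complex.Im R).
Local Notation normc := (@Normc.normc R).
Local Notation rc := (real_complex R).
Local Notation mu := (@lebesgue_measure R).
Implicit Types (a x v w d L : R).

Lemma amgm (l x y : R) : 0 < l -> x * y <= l / 2 * x ^+ 2 + (2 * l)^-1 * y ^+ 2.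
Proof.
move=> l0; rewrite -subr_ge0.
have -> : l / 2 * x ^+ 2 + (2 * l)^-1 * y ^+ 2 - x * y = (2 * l)^-1 * (l * x - y) ^+ 2.
  by field; rewrite gt_eqF.
by rewrite mulr_ge0 ?sqr_ge0// invr_ge0 mulr_ge0// ltW.
Qed.

Variables (D : set R) (phi : R -> R) (G : R -> C).
Hypotheses (mD : measurable D) (mphi : measurable_fun setT phi) (mG : cmeas D G).
Hypothesis i1 : rint D (fun=> 1).
Hypothesis iG : rint D (fun y => normc (G y) ^+ 2).

Definition osc (s : R) : C := cint D (fun y => expi (s * phi y) * G y).

Let N2 := \int[mu]_(y in D) normc (G y) ^+ 2.

Lemma cintegrable_sqr : cintegrable D G.
Proof.
apply: (@cintegrable_dom _ _ _ (fun y => 1 + normc (G y) ^+ 2)) => //; last exact: rintD.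
by move=> y _; have := sqr_ge0 (normc (G y) - 1); rewrite sqrrB; have := normc_ge0 (G y); lra.
Qed.

Lemma cmeas_cont (E : set R) (f d : R -> C) (g : R -> R) : (forall x, cdiff f (d x) x) ->
  measurable_fun E g -> cmeas E (fun y => f (g y)).
Proof.
move=> H mg; have [a b] := @cmeas_cdiff R setT f d measurableT H.
by split; [exact: (measurableT_comp a mg)|exact: (measurableT_comp b mg)].
Qed.

Lemma cmeas_expi (k : R) : cmeas D (fun y => expi (k * phi y)).
Proof.
apply: (@cmeas_cont _ (fun v => expi (k * v)) _ phi (cdiff_expi_lin k)).
exact: measurable_funS mphi.
Qed.

Lemma cintegrable_osc k (z : C) : cintegrable D (fun y => expi (k * phi y) * (z * G y)).
Proof.
apply: (@cintegrable_bounded _ _ _ _ 1) => //; first exact: cmeas_expi.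
  exact: cintegrableZ cintegrable_sqr.
by move=> y _; rewrite normc_expi.
Qed.

Lemma tpoly_bounded N c k v : normc (tpoly N c k v) <= \sum_(n < N) normc (c n).
Proof.
apply: (le_trans (normc_sum _ _)); apply: ler_sum => n _.
by rewrite normcM normc_expi mulr1.
Qed.

Lemma cmeas_tpoly N c k (g : R -> R) : measurable_fun D g ->
  cmeas D (fun y => tpoly N c k (g y)).
Proof. by move=> mg; apply: (cmeas_cont (cdiff_tpoly N c k) mg). Qed.

Lemma rint_tpoly N c k (g : R -> R) : measurable_fun D g ->
  rint D (fun y => normc (tpoly N c k (g y)) ^+ 2).
Proof.
move=> mg; apply: (@rint_dom _ _ _ (fun=> (\sum_(n < N) normc (c n)) ^+ 2 * 1)) => //.
- exact: measurable_normc2 (cmeas_tpoly _ _ _ mg).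
- move=> y _; rewrite mulr1 ger0_norm ?sqr_ge0// lerXn2r ?nnegrE ?normc_ge0 ?tpoly_bounded//.
  by apply: sumr_ge0 => n _; exact: normc_ge0.
- exact: rintZ.
Qed.

Lemma sum_osc N (c : nat -> C) (k : nat -> R) : \sum_(n < N) c n * osc (k n) =
  cint D (fun y => tpoly N c k (phi y) * G y).
Proof.
have E n : c n * osc (k n) = cint D (fun y => expi (k n * phi y) * (c n * G y)).
  rewrite -cintZ//; first by apply: eq_cint => y _; rewrite mulrCA.
  by have := cintegrable_osc (k n) 1; under eq_fun do rewrite mul1r.
under eq_bigr => n _ do rewrite E.
transitivity (cint D (fun y => \sum_(n < N) expi (k n * phi y) * (c n * G y))).
  rewrite (cint_sum _ mD (F := fun (n : 'I_N) y => expi (k n * phi y) * (c n * G y)))//.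
  by move=> n; exact: cintegrable_osc.
by apply: eq_cint => y _; rewrite /tpoly mulr_suml; apply: eq_bigr => n _; ring.
Qed.

Lemma osc_self N (k : nat -> R) (z : nat -> C) :
  rc (\sum_(n < N) normc (z n) ^+ 2) = \sum_(n < N) conjc (z n) * z n.
Proof.
rewrite rmorph_sum /=; apply: eq_bigr => n _.
by rewrite mulrC mul_conjc.
Qed.

Variables (kap L w d : R).
Hypotheses (kap0 : 0 < kap) (L0 : 0 < L) (w0 : w != 0) (wL : expi (w * L) = 1).
Local Notation k := (fun n : nat => n%:R * w + d).

(** Duality: with [c n] the conjugates of the samples, the sum [A] of their squares
    is the integral of the trigonometric polynomial [P] with coefficients [c]
    against [G], and the hypothesis with orthogonality bounds [P] in L^2 by
    [kap * L * A]. The weight [l] in the inequality of the means is chosen so that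
    half of [A] is absorbed. *)
Lemma bessel a N :
  (forall c, \int[mu]_(y in D) normc (tpoly N c k (phi y)) ^+ 2 <=
    kap * \int[mu]_(v in `[a, a + L]) normc (tpoly N c k v) ^+ 2) ->
  \sum_(n < N) normc (osc (k n)) ^+ 2 <= 4 * kap * L * N2.
Proof.
move=> H; set A := (X in X <= _).
have A0 : 0 <= A by apply: sumr_ge0 => n _; exact: sqr_ge0.
pose c n := conjc (osc (k n)).
have cE n : normc (c n) = normc (osc (k n)).
  by rewrite /c /osc; case: (cint _ _) => p q /=; rewrite sqrrN.
have EA : rc A = cint D (fun y => tpoly N c k (phi y) * G y).
  by rewrite -sum_osc; exact: (osc_self N k (fun n => osc (k n))).
have kL : 0 < kap * L by exact: mulr_gt0.
pose l := (2 * (kap * L))^-1.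
have l0 : 0 < l by rewrite invr_gt0 mulr_gt0.
have mp : measurable_fun D phi by exact: measurable_funS mphi.
have : A <= 2 * \int[mu]_(y in D) (l / 2 * normc (tpoly N c k (phi y)) ^+ 2
     + (2 * l)^-1 * normc (G y) ^+ 2).
  rewrite -[leLHS](ger0_norm A0) -normc_rc EA; apply: normc_cint_le => //.
  - by apply: cmeasM => //; exact: cmeas_tpoly.
  - by move=> y _; rewrite normcM; exact: amgm.
  - by apply: rintD => //; apply: rintZ => //; exact: rint_tpoly.
rewrite RintegralD//; [|by apply: rintZ => //; exact: rint_tpoly|exact: rintZ].
rewrite RintegralZl//; last exact: rint_tpoly.
rewrite RintegralZl// -/N2.
have := H c; rewrite (tpoly_orth a d c N (ltW L0) w0 wL).
under eq_bigr do rewrite cE.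
rewrite -/A => HA HB.
have E1 : l * (kap * (L * A)) = A / 2 by rewrite /l; field; rewrite !gt_eqF.
have E2 : (2 * l)^-1 = kap * L by rewrite /l; field; rewrite !gt_eqF.
have := ler_wpM2l (ltW l0) HA; rewrite E1.
rewrite E2 in HB; set I := Rintegral _ _ _ in HB * => h.
have : A <= 2 * ((l * I) / 2 + kap * L * N2) by apply: (le_trans HB); lra.
lra.
Qed.

(** The same duality one level up. The square of a sample is an oscillatory
    integral over [D * D] with phase [phi y + phi z]; so it suffices to bound a
    trigonometric polynomial evaluated at the sum of two phases. *)
Lemma bessel4 a N :
  (forall c, rint D (fun y => \int[mu]_(z in D) normc (tpoly N c k (phi y + phi z)) ^+ 2)) ->
  (forall c, \int[mu]_(y in D) \int[mu]_(z in D) normc (tpoly N c k (phi y + phi z)) ^+ 2 <=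
    kap * \int[mu]_(v in `[a, a + L]) normc (tpoly N c k v) ^+ 2) ->
  \sum_(n < N) normc (osc (k n)) ^+ 4 <= 16 * kap * L * N2 ^+ 2.
Proof.
move=> iJ H.
have -> : \sum_(n < N) normc (osc (k n)) ^+ 4 = \sum_(n < N) normc (osc (k n) ^+ 2) ^+ 2.
  by apply: eq_bigr => n _; rewrite normcX -exprM.
set A := (X in X <= _).
have A0 : 0 <= A by apply: sumr_ge0 => n _; exact: sqr_ge0.
pose c n := conjc (osc (k n) ^+ 2).
have cE n : normc (c n) = normc (osc (k n) ^+ 2).
  by rewrite /c; case: (_ ^+ 2) => p q /=; rewrite sqrrN.
have mp : measurable_fun D phi by exact: measurable_funS mphi.
have shiftE y : cint D (fun z => tpoly N c k (phi y + phi z) * G z) =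
    tpoly N (fun n => c n * osc (k n)) k (phi y).
  transitivity (cint D (fun z => tpoly N (fun n => c n * expi (k n * phi y)) k (phi z) * G z)).
    apply: eq_cint => z _; congr (_ * _); apply: eq_bigr => n _.
    by rewrite mulrDr expiD mulrA.
  by rewrite -sum_osc; apply: eq_bigr => n _; rewrite mulrAC.
have EA : rc A = cint D (fun y => tpoly N (fun n => c n * osc (k n)) k (phi y) * G y).
  rewrite -sum_osc [LHS](osc_self N k (fun n => osc (k n) ^+ 2)); apply: eq_bigr => n _.
  by rewrite -mulrA -expr2.
have kL : 0 < kap * L by exact: mulr_gt0.
pose l := (4 * (kap * L))^-1.
have l0 : 0 < l by rewrite invr_gt0 mulr_gt0.
pose J y := \int[mu]_(z in D) normc (tpoly N c k (phi y + phi z)) ^+ 2.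
have myz y : measurable_fun D (fun z => phi y + phi z).
  by apply: measurable_funD => //; exact: measurable_cst.
have B y : normc (tpoly N (fun n => c n * osc (k n)) k (phi y) * G y) <=
   l * J y + l^-1 * N2 * normc (G y) ^+ 2.
  rewrite normcM -shiftE.
  apply: (@le_trans _ _ (2 * \int[mu]_(z in D) (l / 2 * normc (tpoly N c k (phi y + phi z)) ^+ 2
      + ((2 * l)^-1 * normc (G y) ^+ 2) * normc (G z) ^+ 2))).
    rewrite mulrC; have -> : normc (G y) * normc (cint D (fun z => tpoly N c k (phi y + phi z) * G z))
       = normc (cint D (fun z => G y * (tpoly N c k (phi y + phi z) * G z))).
      rewrite cintZ ?normcM//; apply: (@cintegrable_bounded _ _ _ _ (\sum_(n < N) normc (c n))) => //.
      - exact: cmeas_tpoly.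
      - exact: cintegrable_sqr.
      - by move=> z _; exact: tpoly_bounded.
    apply: normc_cint_le => //.
    - apply: cmeasM; first exact: cmeas_cst.
      by apply: cmeasM => //; exact: cmeas_tpoly.
    - move=> z _; rewrite !normcM mulrCA; apply: (le_trans (amgm _ _ l0)).
      by rewrite exprMn (mulrA (2 * l)^-1).
    - by apply: rintD => //; apply: rintZ => //; exact: rint_tpoly.
  rewrite RintegralD//; [|by apply: rintZ => //; exact: rint_tpoly|exact: rintZ].
  rewrite RintegralZl//; last exact: rint_tpoly.
  rewrite RintegralZl// -/N2 -/(J y) invfM le_eqVlt; apply/orP; left; apply/eqP.
  by field; rewrite gt_eqF.
have iJc : rint D J by exact: iJ.
have : A <= 2 * \int[mu]_(y in D) (l * J y + l^-1 * N2 * normc (G y) ^+ 2).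
  rewrite -[leLHS](ger0_norm A0) -normc_rc EA; apply: normc_cint_le => //.
  - by apply: cmeasM => //; exact: cmeas_tpoly.
  - by apply: rintD => //; exact: rintZ.
rewrite RintegralD//; [|exact: rintZ|exact: rintZ].
rewrite RintegralZl// RintegralZl// -/N2.
have := H c; rewrite (tpoly_orth a d c N (ltW L0) w0 wL).
under eq_bigr do rewrite cE.
rewrite -/A => HA HB.
have : l * (kap * (L * A)) = A / 4 by rewrite /l; field; rewrite !gt_eqF.
have : l^-1 = 4 * (kap * L) by rewrite invrK.
have := ler_wpM2l (ltW l0) HA.
rewrite -mulrA -expr2 in HB; rewrite -/(J _).
have -> : \int[mu]_(x in D) J x = \int[mu]_(y in D) \int[mu]_(z in D) normc (tpoly N c k (phi y + phi z)) ^+ 2 by [].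
set I := Rintegral _ _ _ => h1 h2 h3; rewrite h2 in HB.
have : A <= 2 * (A / 4 + 4 * (kap * L) * N2 ^+ 2).
  by apply: (le_trans HB); rewrite ler_pM2l// lerD2r -h3.
lra.
Qed.

End Bessel.

(** * The distribution of a sum of two squares *)
Section DoubleIntegral.
Context {R : realType}.
Local Notation mu := (@lebesgue_measure R).
Local Notation MR := (measurableTypeR R).
Implicit Types (a b x y : R).

Lemma is_derive_linear (c x : R) : is_derive x 1 (fun y => c * y) c.
Proof.
have := is_derive_scale c (is_derive_id x 1).
by rewrite mul1r; apply: is_derive_ext => y; rewrite mulrC.
Qed.

Lemma integral_EFin_Rintegral (D : set R) (u : R -> R) : measurable D -> rint D u ->
  (\int[mu]_(x in D) (u x)%:E)%E = (\int[mu]_(x in D) u x)%:E.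
Proof.
by move=> mD iu; rewrite /Rintegral fineK//; exact: (integrable_fin_num (mu := mu) mD iu).
Qed.

Let mfst : measurable_fun setT (fst : MR * MR -> MR). Proof. exact: measurable_fst. Qed.
Let msnd : measurable_fun setT (snd : MR * MR -> MR). Proof. exact: measurable_snd. Qed.

Lemma measurable_indic1 (D : set MR) : measurable D -> measurable_fun setT (\1_D : MR -> R).
Proof. exact: measurable_indic. Qed.

Lemma tonelli (f : MR * MR -> R) (D1 D2 : set MR) : measurable D1 -> measurable D2 ->
  measurable_fun setT f -> (forall z, 0 <= f z) ->
  (\int[mu]_(x in D1) \int[mu]_(y in D2) (f (x, y))%:E =
   \int[mu]_(y in D2) \int[mu]_(x in D1) (f (x, y))%:E)%E.
Proof.
move=> m1 m2 mf f0.
pose g (z : MR * MR) := f z * (\1_D1 z.1 * \1_D2 z.2).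
have mg : measurable_fun setT g.
  apply: measurable_funM => //; apply: measurable_funM.
    exact: (measurableT_comp (measurable_indic1 m1) mfst).
  exact: (measurableT_comp (measurable_indic1 m2) msnd).
have g0 z : (0 <= (g z)%:E)%E by rewrite lee_fin !mulr_ge0.
transitivity (\int[mu]_x \int[mu]_y (g (x, y))%:E)%E.
  rewrite integral_mkcond; apply: eq_integral => x _; rewrite patchE; case: ifPn => xD.
    rewrite integral_mkcond; apply: eq_integral => y _; rewrite patchE /g /= !indicE xD mul1r.
    by case: ifPn => yD; rewrite ?mulr1 ?mulr0.
  by rewrite integral0_eq// => y _; rewrite /g /= !indicE (negbTE xD) mul0r mulr0.
transitivity (\int[mu]_y \int[mu]_x (g (x, y))%:E)%E.
  apply: (@fubini_tonelli _ _ _ _ R mu mu (fun z => (g z)%:E)) => //.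
  exact/measurable_EFinP.
symmetry; rewrite integral_mkcond; apply: eq_integral => y _; rewrite patchE; case: ifPn => yD.
  rewrite integral_mkcond; apply: eq_integral => x _; rewrite patchE /g /= !indicE yD mulr1.
  by case: ifPn => xD; rewrite ?mulr1 ?mulr0.
by rewrite integral0_eq// => x _; rewrite /g /= !indicE (negbTE yD) !mulr0.
Qed.

Lemma measurable_tonelli (f : MR * MR -> R) (D2 : set MR) : measurable D2 ->
  measurable_fun setT f -> (forall z, 0 <= f z) ->
  measurable_fun setT (fun x => \int[mu]_(y in D2) (f (x, y))%:E)%E.
Proof.
move=> m2 mf f0.
pose g (z : MR * MR) := f z * \1_D2 z.2.
have mg : measurable_fun setT g.
  apply: measurable_funM => //.
  exact: (measurableT_comp (measurable_indic1 m2) msnd).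
have g0 z : (0 <= (g z)%:E)%E by rewrite lee_fin !mulr_ge0.
have mge : measurable_fun setT (fun z => (g z)%:E) by exact/measurable_EFinP.
have := @measurable_fun_fubini_tonelli_F _ _ MR MR R mu _ mge g0.
rewrite /fubini_F (_ : (fun x => _) = (fun x => \int[mu]_(y in D2) (f (x, y))%:E)%E)//.
apply/funext => x; rewrite [RHS]integral_mkcond; apply: eq_integral => y _.
by rewrite patchE /g /= indicE; case: ifPn => yD; rewrite ?mulr1 ?mulr0.
Qed.

Lemma measurable_comp2 (q : R -> R) (p : MR * MR -> R) : continuous q ->
  measurable_fun setT p -> measurable_fun setT (fun z => q (p z)).
Proof.
by move=> cq mp; exact: (measurableT_comp (continuous_measurable_fun cq) mp).
Qed.

Lemma measurable_fst2 : measurable_fun setT (fun z : MR * MR => z.1 ^+ 2 : R).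
Proof. by apply: measurable_funX; exact: measurable_fst. Qed.
Lemma measurable_snd2 : measurable_fun setT (fun z : MR * MR => z.2 ^+ 2 : R).
Proof. by apply: measurable_funX; exact: measurable_snd. Qed.

Variable q : R -> R.
Hypotheses (cq : continuous q) (q0 : forall x, 0 <= q x).

(** Substitution, stated with primitives so that it follows from the chain rule
    and the fundamental theorem. *)
Lemma prim_chain (r : R -> R) (g dg : R -> R) a b e : a <= b -> continuous r ->
  (forall x, a <= x <= b -> e < g x) ->
  (forall x, a <= x <= b -> is_derive x 1 g (dg x)) ->
  (forall x, a <= x <= b -> {for x, continuous dg}) ->
  \int[mu]_(x in `[a, b]) (r (g x) * dg x) = prim r e (g b) - prim r e (g a).
Proof.
move=> ab cr ge Dg cdg.
apply: (@ftc _ (fun x => prim r e (g x))) => // x xab.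
  exact: (is_derive1_comp (is_derive_prim cr (ge x xab)) (Dg x xab)).
have cg := is_derive_continuous (Dg x xab).
apply: continuousM; last exact: cdg.
by apply: continuous_comp => //; exact: cr.
Qed.

Lemma continuous_comp_derive (p : R -> R) x d : is_derive x 1 p d ->
  {for x, continuous (fun y => q (p y))}.
Proof.
move=> H; apply: (@continuous_comp _ _ _ p q); last exact: cq.
exact: is_derive_continuous H.
Qed.

(** The quarter disc of radius [r] has area proportional to [r^2], so [a^2 + b^2] has
    bounded density. To see it, on the triangle [b <= a] put
    [b = a m] and then, for fixed [m], [v = a^2 (1 + m^2)], which stays below 8. *)
Lemma triangle_integral :
  (\int[mu]_(a in `[0%R, 2%R]) \int[mu]_(b in `[0%R, a]) (q (a ^+ 2 + b ^+ 2))%:E <=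
   (2^-1 * \int[mu]_(v in `[0, 8]) q v)%:E)%E.
Proof.
have ccst (c x : R) : {for x, continuous (fun _ : R => c)}.
  exact: is_derive_continuous (is_derive_cst c x 1).
have cql a : continuous (fun m : R => q (a ^+ 2 + (a * m) ^+ 2)).
  move=> m; have D : is_derive m 1 (fun m => a ^+ 2 + (a * m) ^+ 2) (a * (2 * (a * m))).
    have H := is_derive_linear a m.
    apply: is_derive_eq (is_deriveD (is_derive_cst (a ^+ 2) m 1) (is_derive1_comp (is_derive_sqr _) H)) _.
    by rewrite add0r mulrC.
  exact: continuous_comp_derive D.
have cqa a : continuous (fun b : R => q (a ^+ 2 + b ^+ 2)).
  move=> m.
  exact: continuous_comp_derive (is_deriveD (is_derive_cst (a ^+ 2) m 1) (is_derive_sqr m)).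
have S2 a : a \in `[0, 2] -> (\int[mu]_(b in `[0%R, a]) (q (a ^+ 2 + b ^+ 2))%:E =
    \int[mu]_(m in `[0%R, 1%R]) (`|a| * q (a ^+ 2 + (a * m) ^+ 2))%:E)%E.
  rewrite in_itv/= => /andP[a0 _].
  have H1 : rint `[0, a] (fun b => q (a ^+ 2 + b ^+ 2)).
    by apply: rint_continuous => x _; exact: cqa.
  have H2 : rint `[0, 1] (fun m => `|a| * q (a ^+ 2 + (a * m) ^+ 2)).
    by apply: rintZ => //; apply: rint_continuous => x _; exact: cql.
  rewrite !integral_EFin_Rintegral//; congr (_%:E).
  have Hid x : is_derive x 1 (fun b : R => b) 1 by exact: is_derive_id.
  have Ha x := is_derive_linear a x.
  have E1 := @prim_chain (fun b => q (a ^+ 2 + b ^+ 2)) (fun b => b) (fun=> 1) 0 a (-1) a0 (cqa a)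
    _ (fun x _ => Hid x) (fun x _ => ccst _ x).
  have E2 := @prim_chain (fun b => q (a ^+ 2 + b ^+ 2)) (fun m => a * m) (fun=> a) 0 1 (-1) ler01 (cqa a)
    _ (fun x _ => Ha x) (fun x _ => ccst _ x).
  transitivity (\int[mu]_(x in `[0, a]) (q (a ^+ 2 + x ^+ 2) * 1)).
    by apply: eq_Rintegral => x _; rewrite mulr1.
  rewrite E1; last by move=> x /andP[x0 _]; rewrite (lt_le_trans _ x0)// ltrN10.
  transitivity (\int[mu]_(x in `[0, 1]) (q (a ^+ 2 + (a * x) ^+ 2) * a)).
    rewrite E2 ?mulr1 ?mulr0// => x /andP[x0 _].
    by apply: (@lt_le_trans _ _ 0); rewrite ?ltrN10// mulr_ge0.
  by apply: eq_Rintegral => x _; rewrite mulrC ger0_norm.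
under eq_integral => a a02 do rewrite (S2 a (set_mem a02)).
have mf : measurable_fun setT (fun z : MR * MR => `|z.1| * q (z.1 ^+ 2 + (z.1 * z.2) ^+ 2)).
  apply: measurable_funM; first by apply: measurableT_comp => //; exact: measurable_fst.
  apply: measurable_comp2 => //; apply: measurable_funD; first exact: measurable_fst2.
  apply: measurable_funX; apply: measurable_funM; [exact: measurable_fst|exact: measurable_snd].
rewrite (@tonelli (fun z => `|z.1| * q (z.1 ^+ 2 + (z.1 * z.2) ^+ 2)))//; last first.
  by move=> z; rewrite mulr_ge0.
pose I8 := \int[mu]_(v in `[0, 8]) q v.
have S3 m : m \in `[0, 1] -> (\int[mu]_(a in `[0%R, 2%R]) (`|a| * q (a ^+ 2 + (a * m) ^+ 2))%:E <=
   (2^-1 * I8)%:E)%E.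
  rewrite in_itv/= => /andP[m0 m1].
  pose k := 1 + m ^+ 2; have k1 : 1 <= k by rewrite lerDl sqr_ge0.
  have k0 : 0 < k by exact: lt_le_trans k1.
  have k2 : k <= 2.
    have : m ^+ 2 <= 1 by rewrite expr_le1.
    by rewrite /k; lra.
  have Dk x : is_derive x 1 (fun a => a ^+ 2 * k) (2 * x * k).
    exact: is_derive_scale (is_derive_sqr x).
  have ck : continuous (fun x => 2 * x * k).
    move=> x; have H : is_derive x 1 (fun x => 2 * x * k) (2 * k).
      exact: is_derive_scale (is_derive_linear 2 x).
    exact: is_derive_continuous H.
  have E := @prim_chain q (fun a => a ^+ 2 * k) (fun a => 2 * a * k) 0 2 (-1) (ler0n R 2) cq
    _ (fun x _ => Dk x) (fun x _ => ck x).
  have g0 x : 0 <= x <= 2 -> -1 < x ^+ 2 * k.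
    move=> _; apply: (@lt_le_trans _ _ 0); first exact: ltrN10.
    by rewrite mulr_ge0 ?sqr_ge0// ltW.
  have {E} := E g0; rewrite expr0n/= mul0r => E.
  have cr : continuous (fun x => q (x ^+ 2 * k) * (2 * x * k)).
    move=> x; apply: (@continuousM _ _ (fun x => q (x ^+ 2 * k)) _); last exact: ck.
    exact: continuous_comp_derive (Dk x).
  have ir : rint `[0, 2] (fun x => q (x ^+ 2 * k) * (2 * x * k)).
    by apply: rint_continuous => x _; exact: cr.
  rewrite (_ : (\int[mu]_(a in _) _)%E = ((2 * k)^-1 * (prim q (-1) (2 ^+ 2 * k) - prim q (-1) 0))%:E).
    rewrite lee_fin; apply: (@le_trans _ _ (2^-1 * (prim q (-1) 8 - prim q (-1) 0))).
      apply: ler_pM.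
      - by rewrite invr_ge0 mulr_ge0// ltW.
      - rewrite subr_ge0; apply: rint_le_prim => //.
        by rewrite mulr_ge0 ?exprn_ge0// ltW.
      - by rewrite lef_pV2 ?posrE ?mulr_gt0// ler_peMr.
      - rewrite lerD2r; apply: rint_le_prim => //; first by apply: (@le_trans _ _ 0) => //; rewrite mulr_ge0 ?exprn_ge0// ltW.
        by rewrite -natrX; lra.
    rewrite ler_wpM2l ?invr_ge0// /I8.
    have -> : \int[mu]_(v in `[0, 8]) q v = \int[mu]_(v in `[0, 8]) (q v * 1).
      by apply: eq_Rintegral => x _; rewrite mulr1.
    have Hid x : is_derive x 1 (fun b : R => b) 1 by exact: is_derive_id.
    rewrite (@prim_chain q (fun b => b) (fun=> 1) 0 8 (-1) (ler0n R 8) cq _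
      (fun x _ => Hid x) (fun x _ => ccst _ x))//.
    by move=> x /andP[x0 _]; rewrite (lt_le_trans _ x0)// ltrN10.
  rewrite -E; transitivity (\int[mu]_(a in `[0%R, 2%R]) ((2 * k)^-1 * (q (a ^+ 2 * k) * (2 * a * k)))%:E)%E.
    apply: eq_integral => x; rewrite inE/= in_itv/= => /andP[x0 _]; congr (_%:E).
    rewrite ger0_norm// exprMn -{1}(mulr1 (x ^+ 2)) -mulrDr -/k.
    by field; rewrite gt_eqF.
  by rewrite (integral_EFin_Rintegral _ (rintZ _ _ ir))// (RintegralZl _ _ ir).
apply: (@le_trans _ _ (\int[mu]_(m in `[0%R, 1%R]) (2^-1 * I8)%:E)%E).
  apply: ge0_le_integral => //.
  - by move=> m _; apply: integral_ge0 => a _; rewrite lee_fin mulr_ge0.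
  - apply: (@measurable_funS _ _ _ _ setT) => //.
    apply: (@measurable_tonelli (fun z => `|z.2| * q (z.2 ^+ 2 + (z.2 * z.1) ^+ 2))) => //.
      apply: measurable_funM; first by apply: measurableT_comp => //; exact: measurable_snd.
      apply: measurable_comp2 => //; apply: measurable_funD; first exact: measurable_snd2.
      apply: measurable_funX; apply: measurable_funM; [exact: measurable_snd|exact: measurable_fst].
    by move=> z; rewrite mulr_ge0.
rewrite integral_cst//= lebesgue_measure_itv/= lte_fin ltr01 -EFinB -EFinM lee_fin subr0 mulr1.
exact: lexx.
Qed.

Let S21 : set (MR * MR) := [set z | (z.2 : R) <= z.1].

Lemma measurable_S21 : measurable S21.
Proof.
have := @measurable_fun_ler _ _ R setT (snd : MR * MR -> R) (fst : MR * MR -> R) msnd mfst.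
move=> /(_ measurableT [set true] _); rewrite setTI (_ : _ @^-1` _ = S21); first exact.
by apply/seteqP; split => z.
Qed.

Let f1 (z : MR * MR) : R := q (z.1 ^+ 2 + z.2 ^+ 2) * \1_S21 z.

(** The square is the union of two triangles exchanged by symmetry. *)
Lemma square_integral :
  (\int[mu]_(a in `[0%R, 2%R]) \int[mu]_(b in `[0%R, 2%R]) (q (a ^+ 2 + b ^+ 2))%:E <=
   (\int[mu]_(v in `[0, 8]) q v)%:E)%E.
Proof.
have mq : measurable_fun setT (fun z : MR * MR => q (z.1 ^+ 2 + z.2 ^+ 2)).
  by apply: measurable_comp2 => //; apply: measurable_funD; [exact: measurable_fst2|exact: measurable_snd2].
have mi : measurable_fun setT (\1_S21 : MR * MR -> R) by exact: measurable_indic measurable_S21.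
have m1 : measurable_fun setT f1 by exact: measurable_funM.
have f10 z : 0 <= f1 z by rewrite mulr_ge0.
pose f2 (z : MR * MR) : R := f1 (z.2, z.1).
have m2 : measurable_fun setT f2.
  apply: (measurableT_comp m1); apply/measurable_fun_pairP; split; [exact: msnd|exact: mfst].
have f20 z : 0 <= f2 z by exact: f10.
have T1 : (\int[mu]_(a in `[0%R, 2%R]) \int[mu]_(b in `[0%R, 2%R]) (f1 (a, b))%:E <=
    (2^-1 * \int[mu]_(v in `[0, 8]) q v)%:E)%E.
  apply: le_trans triangle_integral; rewrite le_eqVlt; apply/orP; left; apply/eqP.
  apply: eq_integral => a; rewrite inE/= in_itv/= => /andP[a0 a2].
  rewrite (_ : `[0, a]%classic = `[0, 2]%classic `&` [set b | b <= a]); last first.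
    apply/seteqP; split => b /=; rewrite !in_itv/=; last by move=> [/andP[-> _] ->].
    by move=> /andP[-> ba]; rewrite ba (le_trans ba).
  rewrite integral_mkcondr; apply: eq_integral => b _; rewrite patchE /f1 indicE /=.
  have -> : ((a, b) \in S21) = (b \in [set b | b <= a]) by apply/idP/idP => /set_mem H; exact: mem_set.
  by case: ifPn => H; rewrite ?mulr1 ?mulr0.
have T2 : (\int[mu]_(a in `[0%R, 2%R]) \int[mu]_(b in `[0%R, 2%R]) (f2 (a, b))%:E <=
    (2^-1 * \int[mu]_(v in `[0, 8]) q v)%:E)%E.
  by rewrite tonelli.
have in1 a : (0 <= \int[mu]_(b in `[0%R, 2%R]) (f1 (a, b))%:E)%E.
  by apply: integral_ge0 => b _; rewrite lee_fin.
have in2 a : (0 <= \int[mu]_(b in `[0%R, 2%R]) (f2 (a, b))%:E)%E.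
  by apply: integral_ge0 => b _; rewrite lee_fin.
have M1 : @measurable_fun _ _ MR _ `[0%R, 2%R] (fun a => \int[mu]_(b in `[0%R, 2%R]) (f1 (a, b))%:E)%E.
  by apply: (@measurable_funS _ _ _ _ setT) => //; exact: measurable_tonelli.
have M2 : @measurable_fun _ _ MR _ `[0%R, 2%R] (fun a => \int[mu]_(b in `[0%R, 2%R]) (f2 (a, b))%:E)%E.
  by apply: (@measurable_funS _ _ _ _ setT) => //; exact: measurable_tonelli.
have sec (f : MR * MR -> R) (a : MR) : measurable_fun setT f -> @measurable_fun _ _ MR _ `[0%R, 2%R] (fun b => (f (a, b))%:E).
  move=> mf; apply/measurable_EFinP; apply: (@measurable_funS _ _ _ _ setT) => //.
  exact: (measurableT_comp mf (measurable_pair1 a)).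
apply: (@le_trans _ _ (\int[mu]_(a in `[0%R, 2%R])
   (\int[mu]_(b in `[0%R, 2%R]) (f1 (a, b))%:E + \int[mu]_(b in `[0%R, 2%R]) (f2 (a, b))%:E))%E).
  apply: ge0_le_integral => //.
  - by move=> a _; apply: integral_ge0 => b _; rewrite lee_fin.
  - apply: (@measurable_funS _ _ _ _ setT) => //.
    exact: (@measurable_tonelli (fun z => q (z.1 ^+ 2 + z.2 ^+ 2))).
  - exact: emeasurable_funD.
  - move=> a _; rewrite -ge0_integralD//; [|by move=> b _; rewrite lee_fin|exact: sec|by move=> b _; rewrite lee_fin|exact: sec].
    apply: ge0_le_integral => //.
    + by move=> b _; rewrite lee_fin.
    + exact: (sec (fun z => q (z.1 ^+ 2 + z.2 ^+ 2))).
    + by apply: emeasurable_funD; exact: sec.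
    + move=> b _; rewrite -EFinD lee_fin /f2 /f1 /= (addrC (b ^+ 2)) -mulrDr ler_peMr// !indicE.
      have [ba|ab] := leP b a; first by rewrite mem_set// lerDl.
      have -> : (b, a) \in S21 by apply/mem_set; exact: ltW.
      by rewrite lerDr.
rewrite ge0_integralD//; try by move=> a _; [exact: in1|exact: in2].
apply: (le_trans (leeD T1 T2)); rewrite -EFinD lee_fin; lra.
Qed.

End DoubleIntegral.

(** * Moving the square to the interval [[-1, 1]] *)
Section Reflection.
Context {R : realType}.
Local Notation mu := (@lebesgue_measure R).
Local Notation MR := (measurableTypeR R).

Lemma onem_preimage (a b : R) : (fun y : R => 1 - y) @^-1` `]a, b]%classic = `[1 - b, 1 - a[%classic.
Proof.
by apply/seteqP; split => y /=; rewrite !in_itv/= => /andP[h1 h2]; apply/andP; split; lra.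
Qed.

Definition reflect1 : MR -> MR := fun y => 1 - y.

Lemma measurable_onem (D : set MR) : measurable_fun D reflect1.
Proof.
apply: (@measurable_funS _ _ _ _ setT) => //.
by apply: (@measurable_funB _ _ R setT (fun=> 1) id) => //; exact: measurable_cst.
Qed.

HB.instance Definition _ := isMeasurableFun.Build _ _ MR MR reflect1 (@measurable_onem setT).

Lemma lebesgue_measure_onem (A : set R) : measurable A ->
  pushforward mu reflect1 A = mu A.
Proof.
move=> mA; 
apply/esym/(@lebesgue_measure_unique R (pushforward mu reflect1)) => //= _ [[a b]] _ <-.
rewrite /pushforward onem_preimage/= !lebesgue_measure_itv/= !lte_fin ltrD2l ltrN2.
by case: ifP => // _; rewrite -!EFinB; congr EFin; ring.
Qed.

Lemma ge0_integral_onem (h : R -> \bar R) : measurable_fun setT h -> (forall x, (0 <= h x)%E) ->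
  (\int[mu]_(y in `[(-1)%R, 1%R]) h (1 - y)%R = \int[mu]_(a in `[0%R, 2%R]) h a)%E.
Proof.
move=> mh h0.
transitivity (\int[mu]_(y in reflect1 @^-1` `[0%R, 2%R]) (h \o reflect1) y)%E.
  congr (integral _ _ _); apply/seteqP; rewrite /reflect1.
  by split => y /=; rewrite !in_itv/= => /andP[h1 h2]; apply/andP; split; lra.
rewrite -ge0_integral_pushforward//=.
  by apply: eq_measure_integral => //= A mA AS; have := lebesgue_measure_onem mA; idtac.
exact: measurable_funS mh.
Qed.

Variable q : R -> R.
Hypotheses (cq : continuous q) (q0 : forall x, 0 <= q x).

Lemma square_estimate :
  let J y := \int[mu]_(z in `[-1, 1]) q ((1 - y) ^+ 2 + (1 - z) ^+ 2) in
  rint `[-1, 1] J /\ \int[mu]_(y in `[-1, 1]) J y <= \int[mu]_(v in `[0, 8]) q v.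
Proof.
move=> J.
pose H a := (\int[mu]_(b in `[0%R, 2%R]) (q (a ^+ 2 + b ^+ 2))%:E)%E.
have mq : measurable_fun setT (fun z : MR * MR => q (z.1 ^+ 2 + z.2 ^+ 2)).
  by apply: measurable_comp2 => //; apply: measurable_funD; [exact: measurable_fst2|exact: measurable_snd2].
have mH : measurable_fun setT H by exact: (@measurable_tonelli _ (fun z => q (z.1 ^+ 2 + z.2 ^+ 2))).
have H0 a : (0 <= H a)%E by apply: integral_ge0 => b _; rewrite lee_fin.
have cqa (c : R) : continuous (fun b : R => q (c + b ^+ 2)).
  by move=> m; apply: (@continuous_comp_derive _ _ cq (fun b => c + b ^+ 2) m).
have JE y : (J y)%:E = H (1 - y).
  rewrite /J -integral_EFin_Rintegral//; last first.
    by apply: rint_continuous => z _; apply: (@continuous_comp_derive _ _ (cqa _) (fun z => 1 - z) z).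
  rewrite (@ge0_integral_onem (fun b => (q ((1 - y) ^+ 2 + b ^+ 2))%:E))//; last by move=> b; rewrite lee_fin.
  by apply/measurable_EFinP; exact: continuous_measurable_fun (cqa _).
have mJ : measurable_fun setT J.
  apply/measurable_EFinP; rewrite (_ : EFin \o J = fun y => H (1 - y)); last by apply/funext => y; exact: JE.
  exact: (measurableT_comp mH (@measurable_onem setT)).
have J0 y : 0 <= J y by apply: Rintegral_ge0 => z _; exact: q0.
have B : (\int[mu]_(y in `[(-1)%R, 1%R]) (J y)%:E <= (\int[mu]_(v in `[0, 8]) q v)%:E)%E.
  under eq_integral => y _ do rewrite JE.
  by rewrite ge0_integral_onem//; exact: square_integral.
have iJ : rint `[-1, 1] J.
  apply/integrableP; split; first by apply/measurable_EFinP; exact: measurable_funS mJ.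
  rewrite (_ : (fun x => _) = (fun x => (J x)%:E)); last first.
    by apply/funext => x /=; rewrite ger0_norm.
  by apply: le_lt_trans B _; rewrite ltry.
by split => //; rewrite -lee_fin -integral_EFin_Rintegral.
Qed.

End Reflection.

(** * Dispersive estimates for the free evolution *)
Section Dispersive.
Context {R : realType}.
Local Notation C := R[i].
Local Notation Re := (@complex.Re R).
Local Notation Im := (@complex.Im R).
Local Notation normc := (@Normc.normc R).
Local Notation ii := (Complex 0 1 : R[i]).
Local Notation rc := (real_complex R).
Local Notation mu := (@lebesgue_measure R).
Local Notation D := (`[(-1)%R, 1%R]%classic : set R).
Implicit Types (x y t s : R).

Lemma cmeas_open (U : set R) (F : R -> C) : open U ->
  (forall x, U x -> exists d, cdiff F d x) -> cmeas U F.
Proof.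
move=> oU H; split; apply: open_continuous_measurable_fun => // x /set_mem Ux;
    have [d [h1 h2]] := H x Ux.
  exact: is_derive_continuous h1.
exact: is_derive_continuous h2.
Qed.

Variable f : R -> C.
Hypotheses (mf : cmeas D f) (if2 : rint D (fun y => normc (f y) ^+ 2)).
Let N2 := \int[mu]_(y in D) normc (f y) ^+ 2.

Let i1 : rint D (fun=> 1). Proof. exact: rint_cst. Qed.
Let mD : measurable D. Proof. exact: measurable_itv. Qed.

Lemma intf_of_L2 : cintegrable D f.
Proof. exact: (cintegrable_sqr mD mf i1 if2). Qed.

Lemma kern_factor t x y : 0 < t -> kern 0 t (x - y) =
  kconst * rc (Num.sqrt t)^-1 * expi (x ^+ 2 / (4 * t)) *
  (expi ((- x / (2 * t)) * y) * expi (y ^+ 2 / (4 * t))).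
Proof.
move=> t0; rewrite [kern 0 t _]/(kern0 t _) /kern0 -!mulrA -!expiD; congr (_ * (_ * expi _)).
by field; rewrite gt_eqF.
Qed.

Lemma expi_2pi : expi (2 * pi : R) = 1.
Proof. by rewrite /expi mulr_natl cos2pi sin2pi. Qed.

Lemma osc_integrable (k : R) (phi : R -> R) (G : R -> C) : measurable_fun setT phi -> cmeas D G ->
  rint D (fun y => normc (G y) ^+ 2) -> cintegrable D (fun y => expi (k * phi y) * G y).
Proof.
move=> mp mG iG; have := cintegrable_osc mD mp mG i1 iG k 1.
by rewrite (_ : (fun y => _) = (fun y => expi (k * phi y) * G y))//; apply/funext => y; rewrite mul1r.
Qed.

(** In [(x - y)^2 / 4t] only the cross term couples [x] and [y]; the other two give
    factors of modulus one. Hence the values of the evolution on a grid of step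
    [2 pi t] are Fourier coefficients on an interval of length 2, and Bessel's
    inequality bounds their sum uniformly in the position of the grid. *)
Lemma evol_L2_bound t : 0 < t ->
  \int[mu]_(x in `[0, 1]) normc (evol f 0 t x) ^+ 2 <= 16 * pi * normc kconst ^+ 2 * N2.
Proof.
move=> t0; pose q x := normc (evol f 0 t x) ^+ 2.
pose G y := expi (y ^+ 2 / (4 * t)) * f y.
have mG : cmeas D G.
  apply: cmeasM mf; apply: cmeas_cdiff => // x.
  exact: cdiff_expi (is_derive_scale _ (is_derive_sqr x)).
have nG y : normc (G y) = normc (f y) by rewrite normcM normc_expi mul1r.
have iG : rint D (fun y => normc (G y) ^+ 2) by rewrite (_ : (fun y => _) = (fun y => normc (f y) ^+ 2))//; apply/funext => y; rewrite nG.
have EN : \int[mu]_(y in D) normc (G y) ^+ 2 = N2 by under eq_Rintegral do rewrite nG.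
have mid : measurable_fun setT (fun y : R => y) by exact: measurable_id.
have cq : continuous q by move=> x; exact: (continuous_normc2 (cdiff_evol_x intf_of_L2 0 x t0)).
have Eq x : q x = normc kconst ^+ 2 / t * normc (osc D (fun y => y) G (- x / (2 * t))) ^+ 2.
  rewrite /q /evol; under eq_cint => y _ do rewrite kern_factor// -[_ * f y]mulrA -[_ * f y]mulrA.
  rewrite cintZ//; last exact: (osc_integrable (- x / (2 * t)) mid mG iG).
  rewrite !normcM normc_expi mulr1 normc_rc !exprMn -/(osc _ _ _ _).
  have -> : `|(Num.sqrt t)^-1| ^+ 2 = t^-1.
    by rewrite ger0_norm ?invr_ge0 ?sqrtr_ge0// exprVn sqr_sqrtr// ltW.
  by [].
pose h := 2 * pi * t; have h0 : 0 < h by rewrite !mulr_gt0 ?pi_gt0.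
pose B := normc kconst ^+ 2 / t * (8 * N2).
pose N := (Num.trunc h^-1).+1.
have Nh : 1 <= N%:R * h.
  by rewrite -ler_pdivrMr// div1r ltW// truncnS_gt.
have S := @sampling _ (prim q (-1)) q h B N (ltW h0).
apply: (@le_trans _ _ (prim q (-1) (N%:R * h) - prim q (-1) 0)).
  have Hid x : is_derive x 1 (fun b : R => b) 1 by exact: is_derive_id.
  have -> : \int[mu]_(x in `[0, 1]) normc (evol f 0 t x) ^+ 2 = \int[mu]_(x in `[0, 1]) (q x * 1).
    by apply: eq_Rintegral => x _; rewrite mulr1.
  rewrite (@prim_chain _ q (fun b => b) (fun=> 1) 0 1 (-1) ler01 cq _
      (fun x _ => Hid x) (fun x _ => is_derive_continuous (is_derive_cst (1 : R) x 1)))//; last first.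
    by move=> x /andP[x0 _]; rewrite (lt_le_trans _ x0)// ltrN10.
  by rewrite lerD2r; apply: rint_le_prim => //; move=> y; rewrite sqr_ge0.
apply: (@le_trans _ _ (h * B)); last first.
  rewrite /h /B le_eqVlt; apply/orP; left; apply/eqP.
  by field; rewrite gt_eqF.
apply: S.
  by move=> x x0; apply: is_derive_prim => //; rewrite (lt_le_trans _ x0)// ltrN10.
move=> d _; under eq_bigr do rewrite Eq.
rewrite -mulr_sumr; apply: ler_wpM2l; first by rewrite mulr_ge0 ?sqr_ge0// invr_ge0 ltW.
have -> : \sum_(n < N) normc (osc D (fun y => y) G (- (n%:R * h + d) / (2 * t))) ^+ 2 =
    \sum_(n < N) normc (osc D (fun y => y) G (n%:R * (- pi) + (- d / (2 * t)))) ^+ 2.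
  apply: eq_bigr; move=> n _; congr (normc (osc _ _ _ _) ^+ 2); rewrite /h.
  by field; rewrite gt_eqF.
apply: le_trans (@bessel _ D (fun y => y) G mD mid mG i1 iG 1 2 (- pi) (- d / (2 * t)) ltr01 (ltr0n _ 2) _ _ (-1) N _) _ => //.
- by rewrite oppr_eq0 gt_eqF ?pi_gt0.
- by rewrite mulNr expi_neg mulrC expi_2pi; apply: cext; rewrite /= ?oppr0.
- by move=> c; rewrite mul1r (_ : -1 + 2 = 1)//; lra.
- by rewrite EN; have -> : 4 * 1 * 2 = 8 :> R by ring.
Qed.

Lemma cdiff_osc (phi : R -> R) (P s : R) (G : R -> C) : measurable_fun setT phi -> cintegrable D G ->
  (forall y, D y -> `|phi y| <= P) ->
  cdiff (osc D phi G) (cint D (fun y => ii * rc (phi y) * expi (s * phi y) * G y)) s.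
Proof.
move=> mphi iG bP.
have mE k : cmeas D (fun y => expi (k * phi y)) by exact: cmeas_expi.
have mP : cmeas D (fun y => rc (phi y)) by apply: cmeas_rc; exact: measurable_funS mphi.
have P0 : 0 <= P by apply: le_trans (bP 0 _) => //=; rewrite in_itv/= lerN10 ler01.
have E k y : cdiff (fun k => expi (k * phi y)) (ii * rc (phi y) * expi (k * phi y)) k.
  by have := cdiff_expi (is_derive_scale (phi y) (is_derive_id k 1)); rewrite mul1r.
apply: (@cdiff_cint _ D (fun s y => expi (s * phi y)) (fun s y => ii * rc (phi y) * expi (s * phi y))
  (fun s y => ii * rc (phi y) * (ii * rc (phi y) * expi (s * phi y))) G s 1 (1 + P + P ^+ 2)) => //.
- by move=> y _; apply: cmeasM => //; apply: cmeasM => //; exact: cmeas_cst.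
- by move=> y k _ _; have := cdiffZ (ii * rc (phi y)) (E k y).
- by move=> y k Dy _; rewrite normc_expi -addrA lerDl addr_ge0 ?sqr_ge0.
- move=> y k Dy _; rewrite !normcM normc_i mul1r normc_rc normc_expi mulr1.
  apply: le_trans (bP y Dy) _; have := sqr_ge0 P; lra.
- move=> y k Dy _; rewrite !normcM normc_i !mul1r normc_rc normc_expi mulr1 -expr2.
  have : `|phi y| ^+ 2 <= P ^+ 2 by rewrite lerXn2r ?nnegrE// bP.
  lra.
Qed.

Definition phi1 y : R := (1 - y) ^+ 2.

Lemma Dphi1 y : is_derive y 1 phi1 (2 * (y - 1)).
Proof.
have H : is_derive y 1 (fun z : R => 1 - z) (0 - 1).
  exact: is_deriveB (is_derive_cst (1 : R) y 1) (is_derive_id y 1).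
apply: is_derive_eq (is_derive1_comp (is_derive_sqr _) H) _.
by rewrite /=; ring.
Qed.

Lemma mphi1 : measurable_fun setT phi1.
Proof. by apply: continuous_measurable_fun => y; exact: is_derive_continuous (Dphi1 y). Qed.

(** In the variable [s = 1 / 4t] the trace at [x = 1] is, up to a constant,
    [sqrt s] times an oscillatory integral with phase [(1 - y)^2], and
    [dt = - ds / 4s^2] cancels the fourth power of [sqrt s]. The sum of two phases
    ranges over [[0, 8]]; this is the period used in [bessel4], whose hypothesis is
    [square_estimate]. *)
Lemma trace_L4_bound (a b : R) : 0 < a -> a <= b ->
  \int[mu]_(t in `[a, b]) normc (evol f 0 t 1) ^+ 4 <= 128 * pi * normc kconst ^+ 4 * N2 ^+ 2.
Proof.
move=> a0 ab; have b0 : 0 < b by exact: lt_le_trans ab.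
have intf := intf_of_L2.
pose O s := osc D phi1 f s.
have b4 y : D y -> `|phi1 y| <= 4.
  rewrite /= in_itv/= => /andP[y1 y2].
  rewrite /phi1 ger0_norm ?sqr_ge0// (_ : 4 = 2 ^+ 2); last by rewrite -natrX.
  by rewrite lerXn2r ?nnegrE//; lra.
have DO s := cdiff_osc s mphi1 intf b4.
have cO s : {for s, continuous (fun s => normc (O s) ^+ 2)}.
  exact: continuous_normc2 (DO s).
pose Q s := normc (O s) ^+ 4.
have cQ : continuous Q.
  move=> s; rewrite /Q (_ : (fun s => _) = (fun s => normc (O s) ^+ 2 * normc (O s) ^+ 2)).
    exact: (@continuousM R R (fun s => normc (O s) ^+ 2) (fun s => normc (O s) ^+ 2) s (cO s) (cO s)).
  by apply/funext => z; rewrite -exprD.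
pose si t : R := t^-1 * 4^-1.
have Dsi t : 0 < t -> is_derive t 1 si (- (t ^- 2) * 4^-1).
  by move=> t0; apply: is_derive_scale; apply: is_derive_inv; rewrite gt_eqF.
have si0 t : 0 < t -> 0 < si t by move=> t0; rewrite mulr_gt0 ?invr_gt0.
have Eu t : 0 < t -> normc (evol f 0 t 1) ^+ 4 = normc kconst ^+ 4 * (t ^- 2) * Q (si t).
  move=> t0; rewrite /evol.
  rewrite (@eq_cint _ _ _ (fun y => kconst * rc (Num.sqrt t)^-1 * (expi (si t * phi1 y) * (1 * f y)))).
    under eq_cint => y _ do rewrite mul1r.
    rewrite cintZ//; last exact: (osc_integrable (si t) mphi1 mf if2).
    rewrite !normcM normc_rc /Q /O /osc exprMn.
    congr (_ * _); rewrite exprMn; congr (_ * _).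
    have -> : `|(Num.sqrt t)^-1| ^+ 4 = t ^- 2; last by [].
    rewrite ger0_norm ?invr_ge0 ?sqrtr_ge0// exprVn (_ : 4%N = (2 * 2)%N)// exprM sqr_sqrtr//.
    exact: ltW.
  move=> y _; rewrite [kern 0 t _]/(kern0 t _) /kern0 mul1r -!mulrA; congr (_ * (_ * (expi _ * _))).
  by rewrite /si /phi1; field; rewrite gt_eqF.
pose P := prim Q (-1).
have DP s : 0 <= s -> is_derive s 1 P (Q s).
  by move=> s0; apply: is_derive_prim => //; rewrite (lt_le_trans _ s0)// ltrN10.
pose W (t : R) : R := - 4 * normc kconst ^+ 4 * P (si t).
have F : \int[mu]_(t in `[a, b]) normc (evol f 0 t 1) ^+ 4 =
    W b - W a.
  apply: (@ftc R W (fun t => normc (evol f 0 t 1) ^+ 4) a b ab).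
    move=> t /andP[at_ _]; have t0 : 0 < t by exact: lt_le_trans at_.
    have H := is_derive1_comp (DP _ (ltW (si0 t t0))) (Dsi t t0).
    have H2 := is_derive1_comp (is_derive_linear (- 4 * normc kconst ^+ 4) _) H.
    apply: is_derive_eq H2 _; rewrite Eu//.
    by field; rewrite gt_eqF.
  move=> t /andP[at_ _]; have t0 : 0 < t by exact: lt_le_trans at_.
  have H := continuous_normc2 (cdiff_evol_t intf 0 1 t0).
  rewrite (_ : (fun t => _) = (fun t => normc (evol f 0 t 1) ^+ 2 * normc (evol f 0 t 1) ^+ 2)).
    exact: (@continuousM R R (fun s => normc (evol f 0 s 1) ^+ 2) (fun s => normc (evol f 0 s 1) ^+ 2) t H H).
  by apply/funext => z; rewrite -exprD.
rewrite F /W; pose s0 := si b; have s00 : 0 < s0 by exact: si0.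
(* [8 h = 2 pi]: the grid dual to the period 8 *)
pose h : R := pi / 4; have h0 : 0 < h by rewrite divr_gt0 ?pi_gt0.
pose N := (Num.trunc (si a / h)).+1.
have Nh : si a <= N%:R * h by rewrite -ler_pdivrMr// ltW// truncnS_gt.
pose B := 128 * N2 ^+ 2.
have S := @sampling _ (fun x => P (s0 + x)) (fun x => Q (s0 + x)) h B N (ltW h0).
have {}S : P (s0 + N%:R * h) - P (s0 + 0) <= h * B.
  apply: S => [x x0|d _].
    have H := is_deriveD (is_derive_cst s0 x 1) (is_derive_id x 1).
    have DPs : is_derive (s0 + x) 1 P (Q (s0 + x)) by apply: DP; rewrite addr_ge0// ltW.
    by apply: is_derive_eq (is_derive1_comp DPs H) _; rewrite add0r mulr1.
  have -> : \sum_(n < N) Q (s0 + (n%:R * h + d)) =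
      \sum_(n < N) normc (osc D phi1 f (n%:R * h + (d + s0))) ^+ 4.
    apply: eq_bigr; by move=> n _; rewrite /Q /O; congr (normc (osc _ _ _ _) ^+ 4); ring.
  have sq c := square_estimate (q := fun v => normc (tpoly N c (fun n : nat => n%:R * h + (d + s0)) v) ^+ 2)
     (fun v => continuous_normc2 (cdiff_tpoly N c _ v)) (fun v => sqr_ge0 _).
  apply: le_trans (@bessel4 _ D phi1 f mD mphi1 mf i1 if2 1 8 h (d + s0) ltr01 (ltr0n _ 8) _ _ 0 N _ _) _ => //.
  - by rewrite gt_eqF.
  - by rewrite (_ : h * 8 = 2 * pi) ?expi_2pi// /h; lra.
  - by move=> c; exact: (proj1 (sq c)).
  - by move=> c; rewrite mul1r add0r; exact: (proj2 (sq c)).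
  - by rewrite /B -/N2; have -> : 16 * 1 * 8 = 128 :> R by ring.
have PaN : P (si a) <= P (s0 + N%:R * h).
  apply: rint_le_prim => //.
  - by move=> y; rewrite exprn_ge0// normc_ge0.
  - by rewrite (le_trans (lerN10 _))// ltW// si0.
  - by rewrite (le_trans Nh)// lerDr ltW.
rewrite addr0 in S.
have k4 : 0 <= normc kconst ^+ 4 by rewrite exprn_ge0// normc_ge0.
apply: (@le_trans _ _ (4 * normc kconst ^+ 4 * (P (si a) - P s0))); first by rewrite /s0; lra.
apply: (@le_trans _ _ (4 * normc kconst ^+ 4 * (h * B))).
  by apply: ler_wpM2l; [rewrite mulr_ge0|lra].
by rewrite /h /B; lra.
Qed.

(** The previous bound does not depend on the lower end [a], which tends to 0. *)
Lemma trace_L4 (b : R) : 0 < b ->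
  (\int[mu]_(t in `]0%R, b]) (normc (evol f 0 t 1) ^+ 4)%:E < +oo)%E.
Proof.
move=> b0; pose F (n : nat) := `[b / n.+1%:R, b]%classic : set (measurableTypeR R).
have mt : measurable_fun (`]0, +oo[%classic : set R) (fun t => normc (evol f 0 t 1) ^+ 4).
  have [m1 m2] : cmeas (`]0, +oo[%classic : set R) (fun t => evol f 0 t 1).
    apply: cmeas_open; first exact: interval_open.
    move=> t; rewrite /= in_itv/= andbT => t0; exists (ii * evol f 2 t 1).
    exact: (cdiff_evol_t intf_of_L2 0 1 t0).
  by apply: measurable_funX; exact: measurable_normc.
have UF : `]0%R, b]%classic = \bigcup_n F n.
  apply/seteqP; split => t /=; rewrite in_itv/=; last first.
    move=> [n _]; rewrite /F/= in_itv/= => /andP[+ ->]; rewrite andbT; apply: lt_le_trans.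
    by rewrite divr_gt0.
  move=> /andP[t0 tb]; exists (Num.trunc (b / t)) => //; rewrite /F/= in_itv/= tb andbT.
  by rewrite ler_pdivrMr// mulrC -ler_pdivrMr// ltW// truncnS_gt.
have := @ge0_nondecreasing_set_cvg_integral _ (measurableTypeR R) R F (fun t => (normc (evol f 0 t 1) ^+ 4)%:E) mu.
rewrite -UF => /(_ _ (fun i => measurable_itv _)) C.
set K := 128 * pi * normc kconst ^+ 4 * N2 ^+ 2.
have H n : (\int[mu]_(t in F n) (normc (evol f 0 t 1) ^+ 4)%:E <= K%:E)%E.
  have an : 0 < b / n.+1%:R by rewrite divr_gt0.
  rewrite integral_EFin_Rintegral; [|exact: measurable_itv|].
    by rewrite lee_fin; apply: trace_L4_bound => //; rewrite ler_pdivrMr// ler_peMr ?ler1n// ltW.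
  apply: rint_continuous => t /andP[at_ _]; have t0 : 0 < t by exact: lt_le_trans at_.
  have H := continuous_normc2 (cdiff_evol_t intf_of_L2 0 1 t0).
  rewrite (_ : (fun t => _) = (fun t => normc (evol f 0 t 1) ^+ 2 * normc (evol f 0 t 1) ^+ 2)).
    exact: (@continuousM R R (fun s => normc (evol f 0 s 1) ^+ 2) (fun s => normc (evol f 0 s 1) ^+ 2) t H H).
  by apply/funext => z; rewrite -exprD.
have {}C : (\int[mu]_(x in F i) (normc (evol f 0 x 1) ^+ 4)%:E)%E @[i --> \oo] -->
    (\int[mu]_(x in `]0%R, b]) (normc (evol f 0 x 1) ^+ 4)%:E)%E.
  apply: C => [n m nm|n|n x _].
  - apply/subsetPset => t /=; rewrite /F/= !in_itv/= => /andP[+ ->]; rewrite andbT; apply: le_trans.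
    by rewrite ler_pM2l// lef_pV2 ?posrE// ler_nat.
  - apply/measurable_EFinP; apply: measurable_funS mt => // t /=.
    rewrite /F/= !in_itv/= andbT => /andP[+ _]; apply: lt_le_trans.
    by rewrite divr_gt0.
  - by rewrite lee_fin exprn_ge0// normc_ge0.
apply: (@le_lt_trans _ _ K%:E); last exact: ltry.
rewrite -(cvg_lim _ C)//.
apply: lime_le; last by near=> n; exact: H.
by apply/cvg_ex; eexists; exact: C.
Unshelve. all: by end_near.
Qed.

End Dispersive.

(** * Fresnel's integral *)
Section Fresnel.
Context {R : realType}.
Local Notation C := R[i].
Local Notation Re := (@complex.Re R).
Local Notation Im := (@complex.Im R).
Local Notation normc := (@Normc.normc R).
Local Notation ii := (Complex 0 1 : R[i]).
Local Notation rc := (real_complex R).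
Local Notation mu := (@lebesgue_measure R).
Local Notation D := (`[(-1)%R, 1%R]%classic : set R).
Implicit Types (x y t m s : R).

Let mD : measurable D. Proof. exact: measurable_itv. Qed.

Let Dbound m : D m -> `|m| <= 1.
Proof. by rewrite /= in_itv/= => /andP[a b]; rewrite ler_norml a b. Qed.

Let Dsqr m : D m -> m ^+ 2 <= 1.
Proof. by move=> /Dbound h; rewrite -real_normK ?num_real// expr_le1. Qed.

Let msqr : measurable_fun setT (fun m : R => m ^+ 2).
Proof. by apply: measurable_funX; exact: measurable_id. Qed.

Let msqr1 : measurable_fun setT (fun m : R => 1 + m ^+ 2).
Proof. by apply: measurable_funD => //; exact: measurable_cst. Qed.

Definition lorentz m : R := (1 + m ^+ 2)^-1.

Lemma lorentz_den m : 0 < 1 + m ^+ 2 :> R.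
Proof. by rewrite ltr_pwDl// sqr_ge0. Qed.

Lemma lorentz_bound m : 0 <= lorentz m <= 1.
Proof.
rewrite invr_ge0 ltW ?lorentz_den//= invf_le1 ?lorentz_den//.
by rewrite lerDl sqr_ge0.
Qed.

Lemma is_derive_lorentz m : is_derive m 1 lorentz (- (2 * m) * lorentz m ^+ 2).
Proof.
have H : is_derive m 1 (fun m : R => 1 + m ^+ 2) (0 + 2 * m).
  exact: is_deriveD (is_derive_cst (1 : R) m 1) (is_derive_sqr m).
have nz : 1 + m ^+ 2 != 0 by rewrite gt_eqF ?lorentz_den.
have H2 := @is_derive1_comp R (fun y => y^-1) (fun m : R => 1 + m ^+ 2) m _ _ (is_derive_inv nz) H.
apply: is_derive_eq H2 _.
by rewrite /lorentz -exprVn; ring.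
Qed.

Let i1 : cintegrable D (fun=> 1 : C).
Proof. by apply: cintegrable_cdiff => x _; exists 0; exact: cdiff_cst. Qed.

Let ih : cintegrable D (fun m => rc (lorentz m)).
Proof. by apply: cintegrable_cdiff => x _; eexists; exact: cdiff_rc (is_derive_lorentz x). Qed.

(** The integral of [expi (w ^ 2)] over [[0, t]], written over the fixed interval
    [[-1, 1]] by [w = t m] and parity; being a function of [t ^ 2] times [t], it is
    defined and smooth for every real [t]. *)
Definition fresnel t : C := rc (t / 2) * osc D (fun m => m ^+ 2) (fun=> 1) (t ^+ 2).

(** Half the integral over [[-1, 1]] of [expi (t^2 (1 + m^2)) / (1 + m^2)], as
    in the classical evaluation of the Gaussian integral by a single integral. *)
Definition fresnel_error t : C :=
  2^-1 * osc D (fun m => 1 + m ^+ 2) (fun m => rc (lorentz m)) (t ^+ 2).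

Let E t := fun m => expi (t ^+ 2 * m ^+ 2).

Let cdE t m : cdiff (E t) (ii * rc (t ^+ 2 * (2 * m)) * E t m) m.
Proof.
apply: cdiff_expi.
exact: is_derive1_comp (is_derive_linear _ _) (is_derive_sqr m).
Qed.

Let iE t : cintegrable D (E t).
Proof. by apply: cintegrable_cdiff => x _; eexists; exact: cdE. Qed.

Lemma fresnelE t : fresnel t = rc (t / 2) * cint D (E t).
Proof. by rewrite /fresnel /osc; congr (_ * _); apply: eq_cint => m _; rewrite mulr1. Qed.

Lemma fresnelN t : fresnel (- t) = - fresnel t.
Proof. by rewrite !fresnelE /E sqrrN mulNr rcN mulNr. Qed.

Lemma fresnel0 : fresnel 0 = 0.
Proof. by rewrite fresnelE mul0r mul0r. Qed.

Lemma cdiff_fresnel t : cdiff fresnel (expi (t ^+ 2)) t.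
Proof.
have bP m : D m -> `|m ^+ 2| <= 1 by move=> Dm; rewrite ger0_norm ?sqr_ge0// Dsqr.
have H1 := cdiff_osc (t ^+ 2) msqr i1 bP.
have H2 := cdiff_comp (g := fun t : R => t ^+ 2) H1 (is_derive_sqr t).
have H3 : cdiff (fun t => rc (t / 2)) (rc 2^-1) t.
  by have := cdiff_rc (is_derive_scale 2^-1 (is_derive_id t 1)); rewrite mul1r.
have H4 := cdiffM H3 H2.
suff <- : rc 2^-1 * osc D (fun m : R => m ^+ 2) (fun=> 1) (t ^+ 2) +
   rc (t / 2) * (rc (2 * t) * cint D (fun y : R => ii * rc (y ^+ 2) * expi (t ^+ 2 * y ^+ 2) * 1)) =
   expi (t ^+ 2) by exact: H4.
have -> : osc D (fun m : R => m ^+ 2) (fun=> 1) (t ^+ 2) = cint D (E t).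
  by rewrite /osc; apply: eq_cint => m _; rewrite mulr1.
have F := @cftc R (fun m => rc m * E t m) (fun m => E t m + rc (2 * t ^+ 2) * (ii * rc (m ^+ 2) * E t m)) (-1) 1.
have i2 : cintegrable D (fun m => ii * rc (m ^+ 2) * E t m).
  apply: cintegrable_cdiff => x _; eexists; apply: cdiffM (cdE t x).
  by apply: cdiffZ; apply: cdiff_rc; exact: is_derive_sqr.
have -> : cint D (fun y : R => ii * rc (y ^+ 2) * expi (t ^+ 2 * y ^+ 2) * 1) =
    cint D (fun m => ii * rc (m ^+ 2) * E t m) by apply: eq_cint => m _; rewrite mulr1.
have {}F : cint D (E t) + rc (2 * t ^+ 2) * cint D (fun m => ii * rc (m ^+ 2) * E t m) = 2 * expi (t ^+ 2).
  rewrite -cintZ// -cintD//; last exact: cintegrableZ.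
  rewrite F.
  - by rewrite /E sqrrN expr1n mulr1 rcN mulNr mul1r opprK; ring.
  - lra.
  - move=> m _.
    have := cdiffM (cdiff_rc (is_derive_id m 1)) (cdE t m).
    rewrite -[rc 1]/(1 : C) mul1r; congr cdiff; congr (_ + _).
    rewrite (_ : rc (t ^+ 2 * (2 * m)) = rc (2 * t ^+ 2) * rc m); last by rewrite -rcM; congr rc; ring.
    by rewrite rcX; ring.
  - move=> m _; eexists; apply: cdiffD; first exact: cdE.
    apply: cdiffZ; apply: cdiffM (cdE t m).
    by apply: cdiffZ; apply: cdiff_rc; exact: is_derive_sqr.
have h2 : rc 2^-1 * 2 = 1 :> C by rewrite natcE -rcM mulVf.
have -> : rc (t / 2) * (rc (2 * t) * cint D (fun m => ii * rc (m ^+ 2) * E t m)) =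
   rc 2^-1 * (rc (2 * t ^+ 2) * cint D (fun m => ii * rc (m ^+ 2) * E t m)).
  by rewrite !mulrA -!rcM; congr (rc _ * _); ring.
by rewrite -mulrDr F mulrA h2 mul1r.
Qed.

Lemma cdiff_fresnel_error t :
  cdiff fresnel_error (2 * ii * expi (t ^+ 2) * fresnel t) t.
Proof.
have bP m : D m -> `|1 + m ^+ 2| <= 2.
  by move=> Dm; rewrite ger0_norm; [have := Dsqr Dm; lra|exact: ltW (lorentz_den m)].
have H1 := cdiff_osc (t ^+ 2) msqr1 ih bP.
have H2 := cdiffZ 2^-1 (cdiff_comp (g := fun t : R => t ^+ 2) H1 (is_derive_sqr t)).
suff <- : 2^-1 * (rc (2 * t) * cint D (fun y => ii * rc (1 + y ^+ 2) * expi (t ^+ 2 * (1 + y ^+ 2)) * rc (lorentz y))) =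
   2 * ii * expi (t ^+ 2) * fresnel t by exact: H2.
rewrite (@eq_cint _ _ _ (fun y => (ii * expi (t ^+ 2)) * E t y)); last first.
  move=> y _; rewrite mulrDr mulr1 expiD -/(E t y).
  have -> : ii * rc (1 + y ^+ 2) * (expi (t ^+ 2) * E t y) * rc (lorentz y) =
    (rc (1 + y ^+ 2) * rc (lorentz y)) * (ii * expi (t ^+ 2) * E t y) by ring.
  by rewrite -rcM mulfV ?mul1r// gt_eqF ?lorentz_den.
rewrite cintZ// fresnelE.
have -> : rc (2 * t) = 4 * rc (t / 2) by rewrite natcE -rcM; congr rc; field.
have -> : 4 = 2 * 2 :> C by rewrite -natrM.
rewrite !mulrA mulVf ?mul1r; last by rewrite pnatr_eq0.
by ring.
Qed.

(** The left-hand side has zero derivative, and at [t = 0] it is [i] times the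
    integral of [1 / (1 + m^2)] over [[0, 1]]. *)
Lemma fresnel_sqr t : fresnel t ^+ 2 + ii * fresnel_error t = ii * rc (pi / 4).
Proof.
pose F t := fresnel t ^+ 2 + ii * fresnel_error t.
have DF x : cdiff F 0 x.
  have H := cdiffD (cdiffM (cdiff_fresnel x) (cdiff_fresnel x)) (cdiffZ ii (cdiff_fresnel_error x)).
  have {}H : cdiff F (expi (x ^+ 2) * fresnel x + fresnel x * expi (x ^+ 2) +
    ii * (2 * ii * expi (x ^+ 2) * fresnel x)) x by exact: cdiff_ext H.
  have E0 : expi (x ^+ 2) * fresnel x + fresnel x * expi (x ^+ 2) +
    ii * (2 * ii * expi (x ^+ 2) * fresnel x) = (1 + ii * ii) * (2 * expi (x ^+ 2) * fresnel x) by ring.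
  by move: H; rewrite E0 iiM subrr mul0r.
have : normc (F t - F 0) <= 2 * 0 * `|t - 0|.
  by apply: (@clipschitz _ _ (fun=> 0)) => z _; rewrite ?normc0.
rewrite mulr0 mul0r => H.
have : normc (F t - F 0) == 0 by rewrite eq_le H normc_ge0.
rewrite normc_eq0 subr_eq0 => /eqP E0; rewrite -/(F t) E0.
rewrite /F fresnel0 expr0n/= add0r; congr (_ * _).
rewrite /fresnel_error /osc (@eq_cint _ _ _ (fun y => rc (lorentz y))); last first.
  by move=> y _; rewrite expr0n/= mul0r expi0 mul1r.
have D1 m : -1 <= m <= 1 -> cdiff (fun m => rc (atan m)) (rc (lorentz m)) m.
  by move=> _; apply: cdiff_rc; exact: is_derive1_atan.
rewrite (cftc _ D1); last by move=> m _; eexists; exact: cdiff_rc (is_derive_lorentz m).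
- rewrite atanN atan1 -!rcN -rcD natcE -rcV -rcM; congr rc.
  by field.
- lra.
Qed.

Lemma Rintegral_cst_D k : \int[mu]_(m in D) k = k * 2.
Proof.
have -> : 2 = fine (mu D); last by rewrite Rintegral_cst.
by rewrite /= lebesgue_measure_itv/= lte_fin (_ : -1 < 1)//= ?opprK//; lra.
Qed.

Lemma normc_osc_le (phi : R -> R) (h : R -> R) s : measurable_fun setT phi -> cmeas D (fun m => rc (h m)) ->
  (forall m, D m -> 0 <= h m <= 1) -> normc (osc D phi (fun m => rc (h m)) s) <= 4.
Proof.
move=> mphi mh h01; apply: (le_trans (@normc_cint_le _ D _ (fun=> 1) mD _ _ _)).
- by apply: cmeasM mh; exact: cmeas_expi.
- by move=> m Dm; rewrite normcM normc_expi mul1r normc_rc ger0_norm; have /andP[] := h01 m Dm.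
- exact: rint_cst.
- by rewrite Rintegral_cst_D; lra.
Qed.

Lemma normc_fresnel_error_le t : normc (fresnel_error t) <= 2.
Proof.
have := normc_osc_le (t ^+ 2) msqr1 (cint_meas ih) (fun m _ => lorentz_bound m).
by rewrite /fresnel_error normcM normcV normc_nat; lra.
Qed.

Lemma normc_fresnel_le t : normc (fresnel t) <= 2.
Proof.
have h : fresnel t ^+ 2 = ii * rc (pi / 4) - ii * fresnel_error t.
  by rewrite -(fresnel_sqr t) addrK.
rewrite -(@ler_pXn2r _ 2)// ?nnegrE ?normc_ge0// -normcX h.
apply: le_trans (normcDB _ _) _; rewrite normcM [normc (_ * fresnel_error _)]normcM normc_i !mul1r normc_rc.
have := normc_fresnel_error_le t.
have p4 : (pi : R) <= 4 by have := @pihalf_lt2 R; lra.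
rewrite ger0_norm ?divr_ge0 ?pi_ge0// => e2.
have -> : 2 ^+ 2 = 4 :> R by ring.
lra.
Qed.

(** One integration by parts: [m |-> fresnel (t m) / t] is a bounded primitive, of
    size [1 / t], of the oscillating factor. *)
Lemma fresnel_error_decay t : 0 < t -> normc (fresnel_error t) <= 10 / t.
Proof.
move=> t0; have tn : t != 0 by rewrite gt_eqF.
pose P m := rc t^-1 * fresnel (t * m).
have DP m : cdiff P (E t m) m.
  have -> : E t m = rc t^-1 * (rc t * expi ((t * m) ^+ 2)).
    by rewrite mulrA -rcM mulVf// exprMn mul1r.
  have A := cdiff_comp (g := fun m : R => t * m) (cdiff_fresnel (t * m)) (is_derive_linear t m).
  exact: cdiffZ A.
have nP m : normc (P m) <= 2 / t.
  have it : 0 < t^-1 by rewrite invr_gt0.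
  rewrite normcM normc_rc (gtr0_norm it) mulrC; apply: ler_wpM2r; first exact: ltW.
  exact: normc_fresnel_le.
pose h1 m : R := - (2 * m) * lorentz m ^+ 2.
have Dh1 m : exists d, cdiff (fun m => rc (h1 m)) d m.
  have A : is_derive m 1 (fun m : R => - (2 * m)) (- 2).
    exact: is_deriveN (is_derive_linear 2 m).
  have B := @is_derive1_comp R (fun y => y ^+ 2) lorentz m _ _ (is_derive_sqr _) (is_derive_lorentz m).
  by exists (rc (- (2 * m) * (2 * lorentz m * (- (2 * m) * lorentz m ^+ 2)) + lorentz m ^+ 2 * (- 2))); exact: cdiff_rc (is_deriveM A B).
have i2 : cintegrable D (fun m => P m * rc (h1 m)).
  by apply: cintegrable_cdiff => m _; have [d Hd] := Dh1 m; eexists; exact: cdiffM (DP m) Hd.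
have i3 : cintegrable D (fun m => E t m * rc (lorentz m)).
  apply: cintegrable_cdiff => m _; eexists; apply: cdiffM (cdE t m) _; exact: cdiff_rc (is_derive_lorentz m).
have F : cint D (fun m => E t m * rc (lorentz m)) + cint D (fun m => P m * rc (h1 m)) = P 1.
  rewrite -cintD// (@cftc R (fun m => P m * rc (lorentz m))); last first.
  - move=> m _; have [d Hd] := Dh1 m; eexists; apply: cdiffD.
      apply: cdiffM (cdE t m) _; exact: cdiff_rc (is_derive_lorentz m).
    exact: cdiffM (DP m) Hd.
  - by move=> m _; apply: cdiffM (DP m) _; exact: cdiff_rc (is_derive_lorentz m).
  - lra.
  rewrite /P mulrN1 fresnelN mulr1 /lorentz sqrrN expr1n mulrN mulNr opprK -mulrDr -rcD.
  by rewrite (_ : (1 + 1)^-1 + (1 + 1)^-1 = 1 :> R) ?mulr1//; field.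
have -> : fresnel_error t = 2^-1 * expi (t ^+ 2) * (P 1 - cint D (fun m => P m * rc (h1 m))).
  rewrite -F addrK /fresnel_error -mulrA; congr (_ * _).
  rewrite -cintZ// /osc; apply: eq_cint => m _.
  by rewrite mulrDr mulr1 expiD mulrA.
rewrite !normcM normc_expi mulr1 normcV normc_nat.
have B1 := nP 1.
have B2 : normc (cint D (fun m => P m * rc (h1 m))) <= 2 * \int[mu]_(m in D) (2 / t * 2).
  apply: normc_cint_le => //; first exact: cint_meas i2.
    move=> m Dm; rewrite normcM ler_pM ?normc_ge0// normc_rc /h1 normrM normrN normrM.
    have /andP[l0 l1] := lorentz_bound m.
    rewrite [`|lorentz m ^+ 2|]ger0_norm ?sqr_ge0// (@ger0_norm _ 2)// -[X in _ <= X]mulr1.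
    rewrite ler_pM ?mulr_ge0 ?sqr_ge0//; first by have := Dbound Dm; lra.
    by rewrite expr_le1.
  exact: rint_cst.
have B3 : \int[mu]_(m in D) (2 / t * 2) = 8 / t.
  by rewrite Rintegral_cst_D; field.
rewrite B3 in B2; have := normcDB (P 1) (cint D (fun m => P m * rc (h1 m))).
have it : 0 < t^-1 by rewrite invr_gt0.
lra.
Qed.

(** The identity [fresnel_sqr] determines the limit up to sign only. The sign comes
    from integrating [sin (w^2)] by parts against the primitive [1 - cos] of [sin],
    which is nonnegative. *)
Lemma Im_fresnel_ge0 t : 0 < t -> 0 <= Im (fresnel t).
Proof.
move=> t0; pose V t := Im (fresnel t) - (1 - cos (t ^+ 2)) * (t^-1 * 2^-1).
have cos1 x : 0 <= x -> 1 - cos x <= x.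
  move=> x0; have := @lipschitz_of_derive R cos (fun z => - sin z) 1 0 x (fun z _ => is_derive_cos z) _.
  rewrite cos0 subr0 (ger0_norm x0) mul1r => H.
  apply: le_trans (H _); first by rewrite distrC ler_norm.
  by move=> z _; rewrite normrN sin_max.
suff Vt : 0 <= V t.
  have H : 0 <= (1 - cos (t ^+ 2)) * (t^-1 * 2^-1).
    apply: mulr_ge0; first by rewrite subr_ge0 cos_le1.
    by rewrite ltW// mulr_gt0 ?invr_gt0.
  by move: Vt; rewrite /V; lra.
have DV x : 0 < x -> is_derive x 1 V ((1 - cos (x ^+ 2)) * (2 * x ^+ 2)^-1).
  move=> x0; have xn : x != 0 by rewrite gt_eqF.
  have H1 := (cdiff_fresnel x).2.
  have H2 : is_derive x 1 (fun x => 1 - cos (x ^+ 2)) (0 - (- sin (x ^+ 2) * (2 * x))).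
    exact: is_deriveB (is_derive_cst (1 : R) x 1) (is_derive1_comp (is_derive_cos _) (is_derive_sqr x)).
  have H3 := is_derive_scale 2^-1 (is_derive_inv xn).
  apply: is_derive_eq (is_deriveB H1 (is_deriveM H2 H3)) _.
  rewrite -![_ *: _]/(_ * _) /=.
  by field.
suff H e : 0 < e -> - 3 * e <= V t.
  rewrite leNgt; apply/negP => Vn.
  by have := H (- V t / 4) _; rewrite divr_gt0 ?oppr_gt0// => /(_ isT); lra.
move=> e0; pose d := Num.min e t.
have d0 : 0 < d by rewrite lt_min e0 t0.
have dt : d <= t by rewrite ge_min lexx orbT.
have de : d <= e by rewrite ge_min lexx.
have [z /andP[dz _] Ez] := mean_value_le dt (fun z zd => DV z (lt_le_trans d0 (andP zd).1)).
have z0 : 0 < z by exact: lt_le_trans dz.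
have : V d <= V t.
  rewrite -subr_ge0 Ez; apply: mulr_ge0; last by rewrite subr_ge0.
  apply: mulr_ge0; first by rewrite subr_ge0 cos_le1.
  by rewrite invr_ge0 mulr_ge0// sqr_ge0.
apply: le_trans; rewrite /V.
have B1 : - (2 * d) <= Im (fresnel d).
  have n4 : normc (osc D (fun m : R => m ^+ 2) (fun=> 1) (d ^+ 2)) <= 4.
    by apply: (@normc_osc_le (fun m => m ^+ 2) (fun=> 1) (d ^+ 2)) => // m _; rewrite ler01 lexx.
  have : normc (fresnel d) <= 2 * d.
    rewrite normcM normc_rc gtr0_norm ?divr_gt0//.
    apply: le_trans (ler_wpM2l _ n4) _; [by rewrite divr_ge0// ltW|lra].
  move=> /(le_trans (normc_Im _)); rewrite ler_norml => /andP[+ _]; exact.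
have B2 : (1 - cos (d ^+ 2)) * (d^-1 * 2^-1) <= d * 2^-1.
  apply: le_trans (ler_wpM2r _ (cos1 (d ^+ 2) (sqr_ge0 d))) _.
    by rewrite mulr_ge0// invr_ge0 ltW.
  by rewrite mulrA ler_pM2r// expr2 mulfK// gt_eqF.
lra.
Qed.

Definition fresnel_limit : C := rc (Num.sqrt (2 * pi) / 4) * (1 + ii).

Lemma kconst_fresnel_limit : 4 * kconst * fresnel_limit = 1.
Proof.
rewrite /kconst /fresnel_limit rcM rcV invfM -natcE.
have h1 : rc (Num.sqrt (2 * pi)) != 0 by rewrite fmorph_eq0 gt_eqF ?sqrt2pi_gt0.
have h2 := @onei_neq0 R.
have h3 : 4 != 0 :> C by rewrite pnatr_eq0.
have -> : 4 * ((rc (Num.sqrt (2 * pi)))^-1 * (1 + ii)^-1) * (rc (Num.sqrt (2 * pi)) * 4^-1 * (1 + ii)) =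
  (4 / 4) * ((rc (Num.sqrt (2 * pi)))^-1 * rc (Num.sqrt (2 * pi))) * ((1 + ii)^-1 * (1 + ii)) by ring.
by rewrite mulfV// !mulVf// !mulr1.
Qed.

Lemma fresnel_limit_sqr : fresnel_limit ^+ 2 = ii * rc (pi / 4).
Proof.
rewrite /fresnel_limit exprMn -rcX exprMn sqr_sqrtr; last by rewrite mulr_ge0 ?pi_ge0.
have -> : (1 + ii) ^+ 2 = ii * 2 + (1 + ii * ii) by ring.
rewrite iiM subrr addr0 mulrC -mulrA natcE -rcM; congr (_ * rc _).
by field.
Qed.

(** [fresnel - limit] is [fresnel^2 - limit^2] divided by [fresnel + limit], which is
    bounded away from 0: the limit has positive imaginary part, and [fresnel] a
    nonnegative one. *)
Lemma fresnel_cvg : exists2 K, 0 < K & forall t, 0 < t -> normc (fresnel t - fresnel_limit) <= K / t.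
Proof.
pose l : R := Num.sqrt (2 * pi) / 4.
have l0 : 0 < l by rewrite divr_gt0 ?sqrt2pi_gt0.
exists (10 / l); first by rewrite divr_gt0.
move=> t t0.
have H : normc (fresnel t - fresnel_limit) * normc (fresnel t + fresnel_limit) <= 10 / t.
  rewrite -normcM -subr_sqr fresnel_limit_sqr -(fresnel_sqr t) opprD addrA subrr sub0r normcN.
  by rewrite normcM normc_i mul1r fresnel_error_decay.
have G : l <= normc (fresnel t + fresnel_limit).
  apply: le_trans (normc_Im _); apply: le_trans (ler_norm _).
  have := Im_fresnel_ge0 t0; rewrite ImD /fresnel_limit Im_rcM /= -/l; lra.
have -> : 10 / l / t = 10 / t / l by ring.
rewrite ler_pdivlMr//; apply: le_trans H.
by rewrite ler_wpM2l ?normc_ge0.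
Qed.

End Fresnel.

(** * Square-integrable functions *)
Section SquareIntegrable.
Context {R : realType}.
Local Notation C := R[i].
Local Notation Re := (@complex.Re R).
Local Notation Im := (@complex.Im R).
Local Notation normc := (@Normc.normc R).
Local Notation mu := (@lebesgue_measure R).
Implicit Types (f g : R -> C) (E : set R).

Definition sqint E f := cmeas E f /\ rint E (fun x => normc (f x) ^+ 2).
Definition nsq E f : R := \int[mu]_(x in E) normc (f x) ^+ 2.

Lemma RintZ E (k : R) (u : R -> R) : measurable E -> rint E u ->
  \int[mu]_(x in E) (k * u x) = k * \int[mu]_(x in E) u x.
Proof. by move=> mE iu; rewrite RintegralZl. Qed.

Lemma normcD_sqr_le (z w : C) : normc (z + w) ^+ 2 <= 2 * normc z ^+ 2 + 2 * normc w ^+ 2.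
Proof.
have := normcD z w; have := normc_ge0 (z + w); have := normc_ge0 z; have := normc_ge0 w.
have := sqr_ge0 (normc z - normc w); nra.
Qed.

Lemma nsq_ge0 E f : 0 <= nsq E f.
Proof. by apply: Rintegral_ge0 => x _; exact: sqr_ge0. Qed.

Lemma sqint_dom E f (u : R -> R) : measurable E -> cmeas E f ->
  (forall x, E x -> normc (f x) ^+ 2 <= u x) -> rint E u -> sqint E f.
Proof.
move=> mE mf fu iu; split => //; apply: rint_dom iu => //; first exact: measurable_normc2.
by move=> x Ex; rewrite ger0_norm ?sqr_ge0 ?fu.
Qed.

Lemma nsq_dom E f (u : R -> R) : measurable E -> sqint E f ->
  (forall x, E x -> normc (f x) ^+ 2 <= u x) -> rint E u -> nsq E f <= \int[mu]_(x in E) u x.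
Proof. by move=> mE [mf if2] fu iu; apply: le_Rintegral. Qed.

Lemma sqintD E f g : measurable E -> sqint E f -> sqint E g -> sqint E (fun x => f x + g x).
Proof.
move=> mE [mf if2] [mg ig2]; apply: (@sqint_dom _ _ (fun x => 2 * normc (f x) ^+ 2 + 2 * normc (g x) ^+ 2)) => //.
- exact: cmeasD.
- by move=> x _; exact: normcD_sqr_le.
- by apply: rintD => //; apply: rintZ.
Qed.

Lemma nsqD_le E f g : measurable E -> sqint E f -> sqint E g ->
  nsq E (fun x => f x + g x) <= 2 * nsq E f + 2 * nsq E g.
Proof.
move=> mE sf sg; have [mf if2] := sf; have [mg ig2] := sg.
have i1 : rint E (fun x => 2 * normc (f x) ^+ 2) by exact: rintZ.
have i2 : rint E (fun x => 2 * normc (g x) ^+ 2) by exact: rintZ.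
apply: le_trans (nsq_dom mE (sqintD mE sf sg) (fun x _ => normcD_sqr_le _ _) (rintD mE i1 i2)) _.
by rewrite RintegralD// !RintegralZl.
Qed.

Lemma sqintZ E z f : measurable E -> sqint E f -> sqint E (fun x => z * f x).
Proof.
move=> mE [mf if2]; apply: (@sqint_dom _ _ (fun x => normc z ^+ 2 * normc (f x) ^+ 2)) => //.
- by apply: cmeasM => //; exact: cmeas_cst.
- by move=> x _; rewrite normcM exprMn.
- exact: rintZ.
Qed.

Lemma nsqZ E z f : measurable E -> sqint E f -> nsq E (fun x => z * f x) = normc z ^+ 2 * nsq E f.
Proof.
move=> mE [mf if2]; rewrite /nsq -RintegralZl//.
by apply: eq_Rintegral => x _; rewrite normcM exprMn.
Qed.

Lemma eq_nsq E f g : (forall x, E x -> normc (f x) = normc (g x)) -> nsq E f = nsq E g.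
Proof. by move=> H; apply: eq_Rintegral => x /set_mem Ex; rewrite H. Qed.

Lemma sqintN E f : measurable E -> sqint E f -> sqint E (fun x => - f x).
Proof.
move=> mE [mf if2]; split; first exact: cmeasN.
by rewrite (_ : (fun x => _) = (fun x => normc (f x) ^+ 2))//; apply/funext => x; rewrite normcN.
Qed.

Lemma sqintB E f g : measurable E -> sqint E f -> sqint E g -> sqint E (fun x => f x - g x).
Proof. by move=> mE sf sg; apply: (sqintD mE sf); exact: sqintN. Qed.

Lemma nsqC E f g : nsq E (fun x => f x - g x) = nsq E (fun x => g x - f x).
Proof. by apply: eq_nsq => x _; rewrite normcB. Qed.

Lemma sqintS D E f : measurable D -> measurable E -> E `<=` D -> sqint D f -> sqint E f.
Proof. by move=> mD mE ED [mf if2]; split; [exact: cmeasS mf|exact: rintS if2]. Qed.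

Lemma nsqS D E f : measurable D -> measurable E -> E `<=` D -> sqint D f -> nsq E f <= nsq D f.
Proof.
move=> mD mE ED [mf if2]; rewrite /nsq /Rintegral fine_le//.
- by apply: integrable_fin_num => //; exact: rintS if2.
- exact: integrable_fin_num.
- apply: ge0_subset_integral => //; first by case/integrableP: if2.
  by move=> x _; rewrite lee_fin sqr_ge0.
Qed.

Lemma sqint_cdiff f a b : (forall x, a <= x <= b -> exists d, cdiff f d x) -> sqint `[a, b] f.
Proof.
move=> H; split; first exact: cint_meas (cintegrable_cdiff H).
by apply: rint_continuous => x xab; have [d Hd] := H x xab; exact: continuous_normc2 Hd.
Qed.

End SquareIntegrable.

(** * The free evolution at small times *)
Section InitialTrace.
Context {R : realType}.
Local Notation C := R[i].
Local Notation Re := (@complex.Re R).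
Local Notation Im := (@complex.Im R).
Local Notation normc := (@Normc.normc R).
Local Notation rc := (real_complex R).
Local Notation mu := (@lebesgue_measure R).
Local Notation D := (`[(-1)%R, 1%R]%classic : set R).
Local Notation I := (`[0%R, 1%R]%classic : set R).
Implicit Types (f g : R -> C) (u : R -> R) (x y t a : R).

Let mD : measurable D. Proof. exact: measurable_itv. Qed.
Let mI : measurable I. Proof. exact: measurable_itv. Qed.
Let ID : I `<=` D.
Proof. by move=> x /=; rewrite !in_itv/= => /andP[x0 ->]; rewrite andbT (le_trans _ x0)// lerN10. Qed.

Lemma sqint_cintegrable f : sqint D f -> cintegrable D f.
Proof. by move=> [mf if2]; apply: (cintegrable_sqr mD mf _ if2); exact: rint_cst. Qed.

Lemma sqint_evol f t : sqint D f -> 0 < t -> sqint I (evol f 0 t).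
Proof.
move=> sf t0; apply: sqint_cdiff => x _; eexists.
exact: (cdiff_evol_x (sqint_cintegrable sf) 0 x t0).
Qed.

Lemma evolD f g n t x : cintegrable D f -> cintegrable D g -> 0 < t ->
  evol (fun y => f y + g y) n t x = evol f n t x + evol g n t x.
Proof.
move=> jf jg t0; rewrite /evol -cintD//; try exact: cintegrable_evol.
by apply: eq_cint => y _; rewrite mulrDr.
Qed.

Lemma evolZ f z n t x : cintegrable D f -> 0 < t ->
  evol (fun y => z * f y) n t x = z * evol f n t x.
Proof.
move=> jf t0; rewrite /evol -cintZ//; last exact: cintegrable_evol.
by apply: eq_cint => y _; rewrite mulrCA.
Qed.

(** Only the unit interval matters for the controlled system, although the datum
    lives on [[-1, 1]]. *)
Definition initial_cvg f := forall e : R, 0 < e -> exists2 d : R, 0 < d &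
  forall t, 0 < t < d -> nsq I (fun x => evol f 0 t x - f x) <= e.

Let sqerr f t : sqint D f -> 0 < t -> sqint I (fun x => evol f 0 t x - f x).
Proof. by move=> sf t0; apply: sqintB => //; [exact: sqint_evol|exact: sqintS sf]. Qed.

Lemma initial_cvgD f g : sqint D f -> sqint D g -> initial_cvg f -> initial_cvg g ->
  initial_cvg (fun x => f x + g x).
Proof.
move=> sf sg cf cg e e0; have e4 : 0 < e / 4 by rewrite divr_gt0.
have [d1 d10 H1] := cf _ e4; have [d2 d20 H2] := cg _ e4.
exists (Num.min d1 d2) => [|t]; first by rewrite lt_min d10.
rewrite lt_min => /and3P[t0 t1 t2].
rewrite (@eq_nsq _ _ _ (fun x => (evol f 0 t x - f x) + (evol g 0 t x - g x))); last first.
  move=> x _; rewrite (evolD 0 x (sqint_cintegrable sf) (sqint_cintegrable sg) t0).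
  by congr normc; rewrite opprD addrACA.
apply: le_trans (nsqD_le mI (sqerr sf t0) (sqerr sg t0)) _.
by have := H1 t; have := H2 t; rewrite t0 t1 t2 => /(_ isT) h1 /(_ isT) h2; lra.
Qed.

Lemma initial_cvgZ z f : sqint D f -> initial_cvg f -> initial_cvg (fun x => z * f x).
Proof.
move=> sf cf e e0; have k0 : 0 < normc z ^+ 2 + 1 by rewrite ltr_wpDl ?sqr_ge0.
have [|d d0 H] := cf (e / (normc z ^+ 2 + 1)); first by rewrite divr_gt0.
exists d => // t /andP[t0 td].
rewrite (@eq_nsq _ _ _ (fun x => z * (evol f 0 t x - f x))); last first.
  by move=> x _; rewrite (evolZ z 0 x (sqint_cintegrable sf) t0) mulrBr.
rewrite nsqZ//; last exact: sqerr.
have := H t; rewrite t0 td => /(_ isT) h.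
apply: le_trans (ler_wpM2l (sqr_ge0 _) h) _.
rewrite mulrCA; apply: ler_piMr; first exact: ltW.
by rewrite ler_pdivrMr// mul1r lerDl.
Qed.

(** The uniform L^2 bound on the evolution reduces the convergence to a dense set
    of data. *)
Lemma initial_cvg_approx f : sqint D f ->
  (forall e : R, 0 < e -> exists2 g, sqint D g /\ initial_cvg g & nsq D (fun x => f x - g x) <= e) ->
  initial_cvg f.
Proof.
move=> sf H e e0; pose k : R := 16 * pi * normc kconst ^+ 2.
have k0 : 0 <= k by rewrite /k mulr_ge0 ?sqr_ge0// mulr_ge0// pi_ge0.
pose e1 := e / (4 * k + 8).
have k8 : 0 < 4 * k + 8 by lra.
have e10 : 0 < e1 by rewrite divr_gt0.
have [g [sg cg] Hg] := H _ e10.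
have [d d0 Hd] := cg _ e10; exists d => // t td; have /andP[t0 _] := td.
have sfg := sqintB mD sf sg.
have sgf := sqintB mD sg sf.
have s1 : sqint I (evol (fun y => f y - g y) 0 t) by exact: sqint_evol.
have s2 := sqerr sg t0.
have s3 : sqint I (fun x => g x - f x) by exact: sqintS sgf.
rewrite (@eq_nsq _ _ _ (fun x => evol (fun y => f y - g y) 0 t x + ((evol g 0 t x - g x) + (g x - f x)))); last first.
  move=> x _; have -> : evol (fun y => f y - g y) 0 t x = evol f 0 t x - evol g 0 t x.
    have -> : (fun y => f y - g y) = (fun y => f y + (-1) * g y).
      by apply/funext => y; rewrite mulN1r.
    have jg := sqint_cintegrable sg.
    by rewrite (evolD 0 x (sqint_cintegrable sf) (sqint_cintegrable (sqintZ (-1) mD sg)) t0) (evolZ (-1) 0 x jg t0) mulN1r.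
  by congr normc; ring.
apply: le_trans (nsqD_le mI s1 (sqintD mI s2 s3)) _.
have := nsqD_le mI s2 s3; have := Hd t td.
have : nsq I (fun x => g x - f x) <= e1.
  by apply: le_trans (nsqS mD mI ID sgf) _; rewrite nsqC.
have : nsq I (evol (fun y => f y - g y) 0 t) <= k * e1.
  apply: le_trans (evol_L2_bound (proj1 sfg) (proj2 sfg) t0) _.
  by apply: ler_wpM2l.
have : e1 * (4 * k + 8) = e by rewrite /e1 divfK// gt_eqF.
have : 0 <= k * e1 by rewrite mulr_ge0// ltW.
lra.
Qed.

Definition heaviside a y : C := if a <= y then 1 else 0.

Lemma sqint_bounded f K : cmeas D f -> (forall x, D x -> normc (f x) <= K) -> sqint D f.
Proof.
move=> mf fK; apply: (@sqint_dom _ _ _ (fun=> K ^+ 2)) => //; last exact: rint_cst.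
by move=> x Dx; rewrite lerXn2r ?nnegrE ?normc_ge0 ?fK// (le_trans (normc_ge0 (f x)))// fK.
Qed.

Lemma sqint_heaviside a : sqint D (heaviside a).
Proof.
apply: (@sqint_bounded _ 1); last first.
  by move=> x _; rewrite /heaviside; case: ifP; rewrite ?normc1 ?normc0.
have m : measurable_fun D (\1_(`[a, +oo[%classic) : R -> R) by exact: measurable_indic.
have := cmeas_rc m; congr cmeas; apply/funext => y.
by rewrite /heaviside indicE mem_setE in_itv/= andbT; case: ifP.
Qed.

Lemma cint_heaviside f a : -1 <= a <= 1 ->
  cint D (fun y => f y * heaviside a y) = cint `[a, 1] f.
Proof.
move=> /andP[a1 a2].
have E : (`[a, 1]%classic : set R) = D `&` `[a, +oo[%classic.
  apply/seteqP; split => y /=; rewrite !in_itv/= ?andbT; last by move=> [/andP[_ ->] ->].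
  by move=> /andP[ay ->]; rewrite (le_trans a1 ay) ay.
rewrite /cint; congr Complex; rewrite E /Rintegral integral_mkcondr; congr fine;
  apply: eq_integral => y _; rewrite patchE mem_setE in_itv/= andbT /heaviside;
  by case: ifP; rewrite ?mulr1 ?mulr0.
Qed.

(** The kernel at time [t] is the derivative of a rescaled Fresnel integral. *)
Lemma evol_heaviside a t x : -1 <= a <= 1 -> 0 < t ->
  evol (heaviside a) 0 t x =
  2 * kconst * (fresnel ((1 - x) / (2 * Num.sqrt t)) - fresnel ((a - x) / (2 * Num.sqrt t))).
Proof.
move=> a11 t0; have /andP[a1 a2] := a11.
have s0 : 0 < Num.sqrt t by rewrite sqrtr_gt0.
rewrite /evol cint_heaviside// mulrBr.
pose k := (2 * Num.sqrt t)^-1.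
have D1 y : cdiff (fun y => 2 * kconst * fresnel ((y - x) / (2 * Num.sqrt t))) (kern 0 t (x - y)) y.
  have A : is_derive y 1 (fun y : R => (y - x) * k) ((1 - 0) * k).
    apply: is_derive_scale; exact: is_deriveB (is_derive_id y 1) (is_derive_cst x y 1).
  have B := cdiffZ (2 * kconst) (cdiff_comp (g := fun y : R => (y - x) * k) (cdiff_fresnel _) A).
  rewrite (_ : kern 0 t (x - y) = 2 * kconst * (rc ((1 - 0) * k) * expi (((y - x) * k) ^+ 2)))//.
  rewrite [kern 0 t _]/(kern0 t _) /kern0 mulrA; congr (_ * expi _).
    rewrite subr0 mul1r /k invfM rcM natcE.
    have -> : rc 2 * kconst * (rc 2^-1 * rc (Num.sqrt t)^-1) = (rc 2 * rc 2^-1) * (kconst * rc (Num.sqrt t)^-1) by ring.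
    by rewrite -rcM mulfV// mul1r.
  rewrite exprMn /k exprVn exprMn sqr_sqrtr ?ltW// -[in RHS]sqrrN opprB.
  by congr (_ / (_ * _)); rewrite -natrX.
rewrite (@cftc _ _ _ a 1 a2 (fun y _ => D1 y))//.
move=> y _; eexists.
apply: (cdiff_ext (f := fun y => kern 0 t (1 * x + (-1) * y))); first by move=> z; rewrite mul1r mulN1r.
apply: cdiff_comp (cdiff_kern_z _ _ t0) _.
Qed.

Let kap : R := normc (@kconst R).

Lemma Rintegral_indic_itv (b c : R) : b <= c -> \int[mu]_(x in I) (\1_(`[b, c]%classic) x : R) <= c - b.
Proof.
move=> bc; rewrite /Rintegral integral_indic//.
have le1 : (mu (`[b, c]%classic `&` I) <= mu `[b, c]%classic)%E.
  by apply: le_measure; rewrite ?inE//; exact: measurableI.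
have fin : (mu `[b, c]%classic < +oo)%E by rewrite lebesgue_measure_itv/=; case: ifP; rewrite ?ltry.
apply: (@le_trans _ _ (fine (mu `[b, c]%classic))).
  apply: fine_le.
  - by rewrite ge0_fin_numE//; apply: (le_lt_trans le1).
  - by rewrite ge0_fin_numE.
  - exact: le1.
by rewrite lebesgue_measure_itv/= lte_fin; case: ltP => // _; rewrite ?subr_ge0.
Qed.

(** Away from the jump at [a] and from the end-point 1, both arguments of the
    Fresnel integrals are large, and the two limits add up to the value of the
    step by [kconst_fresnel_limit]; the error is [O(sqrt t)]. Near these two points
    the error is merely bounded, on a set of small measure. *)
Lemma initial_cvg_heaviside a : -1 <= a <= 1 -> initial_cvg (heaviside a).
Proof.
move=> a11; have [K K0 HK] := @fresnel_cvg R.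
have kap0 : 0 < kap by exact: normc_kconst_gt0.
pose M := 8 * kap + 1; have M0 : 0 < M by rewrite /M; lra.
have errM t x : 0 < t -> normc (evol (heaviside a) 0 t x - heaviside a x) <= M.
  move=> t0; rewrite evol_heaviside//; apply: le_trans (normcDB _ _) _.
  apply: lerD; last by rewrite /heaviside; case: ifP; rewrite ?normc1 ?normc0.
  rewrite !normcM normc_nat -/kap.
  set u := fresnel _; set v := fresnel _.
  have := normcDB u v; have : normc u <= 2 by exact: normc_fresnel_le.
  have : normc v <= 2 by exact: normc_fresnel_le.
  nra.
have errd t x (de : R) : 0 < t -> 0 < de -> de <= 1 - x -> de <= `|x - a| ->
    normc (evol (heaviside a) 0 t x - heaviside a x) <= 8 * kap * K * Num.sqrt t / de.
  move=> t0 de0 d1 d2; rewrite evol_heaviside//.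
  have s0 : 0 < Num.sqrt t by rewrite sqrtr_gt0.
  have F (z : R) : de <= z -> normc (fresnel (z / (2 * Num.sqrt t)) - fresnel_limit) <= 2 * K * Num.sqrt t / de.
    move=> dz; have z0 : 0 < z by exact: lt_le_trans dz.
    apply: le_trans (HK _ _) _; first by rewrite divr_gt0// mulr_gt0.
    have -> : K / (z / (2 * Num.sqrt t)) = 2 * K * Num.sqrt t / z.
      by field; rewrite !gt_eqF.
    by apply: ler_wpM2l; rewrite ?lef_pV2 ?posrE// ltW// !mulr_gt0.
  have F1 := F _ d1.
  pose w z : C := fresnel (z / (2 * Num.sqrt t)) - fresnel_limit.
  have comb z1 z2 : normc (w z1) <= 2 * K * Num.sqrt t / de -> normc (w z2) <= 2 * K * Num.sqrt t / de ->
     normc (2 * kconst * w z1 + 2 * kconst * w z2) <= 8 * kap * K * Num.sqrt t / de /\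
     normc (2 * kconst * w z1 - 2 * kconst * w z2) <= 8 * kap * K * Num.sqrt t / de.
    move=> h1 h2; have E : 8 * kap * K * Num.sqrt t / de = 2 * kap * (2 * K * Num.sqrt t / de) + 2 * kap * (2 * K * Num.sqrt t / de) by ring.
    have k2 : 0 <= 2 * kap by rewrite mulr_ge0// ltW.
    have n1 : normc (2 * kconst * w z1) <= 2 * kap * (2 * K * Num.sqrt t / de).
      by rewrite !normcM normc_nat -/kap; apply: ler_wpM2l.
    have n2 : normc (2 * kconst * w z2) <= 2 * kap * (2 * K * Num.sqrt t / de).
      by rewrite !normcM normc_nat -/kap; apply: ler_wpM2l.
    rewrite E; split; [apply: le_trans (normcD _ _) _|apply: le_trans (normcDB _ _) _]; exact: lerD.
  have kL : 2 * kconst * fresnel_limit + 2 * kconst * fresnel_limit = 1 :> C.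
    by apply: etrans (@kconst_fresnel_limit R); ring.
  have kL1 (z : C) : z - 1 = z - (2 * kconst * fresnel_limit + 2 * kconst * fresnel_limit) by rewrite kL.
  rewrite /heaviside; case: ifPn => ax.
    have d2' : de <= x - a by rewrite -(ger0_norm (_ : 0 <= x - a)) ?subr_ge0.
    have [+ _] := comb (1 - x) (x - a) F1 (F _ d2').
    rewrite kL1 (_ : (a - x) / (2 * Num.sqrt t) = - ((x - a) / (2 * Num.sqrt t))); last by ring.
    by rewrite fresnelN /w; congr (normc _ <= _); ring.
  have d2' : de <= a - x.
    by move: ax d2; rewrite -ltNge => ax; rewrite distrC ger0_norm// subr_ge0 ltW.
  have [_ +] := comb (1 - x) (a - x) F1 (F _ d2').
  by rewrite /w; congr (normc _ <= _); ring.
(* half of [e] pays for two strips of width [2 de], the other half for the bulk *)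
move=> e e0; pose de := e / (8 * M ^+ 2).
have M2 : 0 < M ^+ 2 by rewrite exprn_gt0.
have de0 : 0 < de by rewrite divr_gt0// mulr_gt0.
pose B := (8 * kap * K / de) ^+ 2.
have B0 : 0 < B by rewrite exprn_gt0// divr_gt0// !mulr_gt0.
exists (e / (2 * B)); first by rewrite divr_gt0// mulr_gt0.
move=> t /andP[t0 td].
pose i1 x : R := \1_(`[a - de, a + de]%classic) x; pose i2 x : R := \1_(`[1 - de, 1 + de]%classic) x.
have ri (b c : R) : rint I (\1_(`[b, c]%classic) : R -> R).
  apply: (@rint_dom _ _ _ (fun=> 1)) => //; last exact: rint_cst.
  by move=> x _; rewrite indicE; case: (_ \in _); rewrite ?normr1 ?normr0.
have r1 : rint I (fun x => M ^+ 2 * i1 x) by apply: rintZ => //; exact: ri.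
have r2 : rint I (fun x => M ^+ 2 * i2 x) by apply: rintZ => //; exact: ri.
have r3 : rint I (fun x => B * t) by exact: rint_cst.
apply: (le_trans (nsq_dom mI (sqerr (sqint_heaviside a) t0) _ (rintD mI (rintD mI r1 r2) r3))).
  move=> x; rewrite /= in_itv/= => /andP[x0 x1].
  have Bt : 0 <= B * t by rewrite ltW// mulr_gt0.
  have [h1|h1] := boolP (x \in `[a - de, a + de]).
    rewrite /i1 indicE mem_setE h1 mulr1.
    have : 0 <= M ^+ 2 * i2 x by rewrite /i2 indicE mulr_ge0// ltW.
    have : normc (evol (heaviside a) 0 t x - heaviside a x) ^+ 2 <= M ^+ 2.
      by rewrite lerXn2r ?nnegrE ?normc_ge0 ?errM// ltW.
    lra.
  have [h2|h2] := boolP (x \in `[1 - de, 1 + de]).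
    rewrite /i2 indicE mem_setE h2 mulr1.
    have : 0 <= M ^+ 2 * i1 x by rewrite /i1 indicE mulr_ge0// ltW.
    have : normc (evol (heaviside a) 0 t x - heaviside a x) ^+ 2 <= M ^+ 2.
      by rewrite lerXn2r ?nnegrE ?normc_ge0 ?errM// ltW.
    lra.
  rewrite /i1 /i2 !indicE !mem_setE (negbTE h1) (negbTE h2) !mulr0 !add0r.
  have d1 : de <= 1 - x.
    by move: h2; rewrite in_itv/= negb_and -!ltNge => /orP[] h; lra.
  have d2 : de <= `|x - a|.
    move: h1; rewrite in_itv/= negb_and -!ltNge => /orP[] h.
      by rewrite distrC (le_trans _ (ler_norm _))//; lra.
    by rewrite (le_trans _ (ler_norm _))//; lra.
  have -> : B * t = (8 * kap * K * Num.sqrt t / de) ^+ 2.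
    rewrite /B (_ : 8 * kap * K * Num.sqrt t / de = 8 * kap * K / de * Num.sqrt t); last by ring.
    by rewrite [RHS]exprMn sqr_sqrtr// ltW.
  rewrite lerXn2r ?nnegrE ?normc_ge0 ?errd//.
  by rewrite ltW// divr_gt0// !mulr_gt0// sqrtr_gt0.
rewrite RintegralD//; last exact: rintD.
rewrite RintegralD// (RintZ _ mI (ri _ _)) (RintZ _ mI (ri _ _)).
have J1 : \int[mu]_(x in I) i1 x <= (a + de) - (a - de) by apply: Rintegral_indic_itv; lra.
have J2 : \int[mu]_(x in I) i2 x <= (1 + de) - (1 - de) by apply: Rintegral_indic_itv; lra.
have -> : \int[mu]_(x in I) (B * t) = B * t.
  have : 1 = fine (mu I) by rewrite /= lebesgue_measure_itv/= lte_fin ltr01/= subr0.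
  by move=> m1; rewrite Rintegral_cst// -m1 mulr1.
have J3 : B * t <= e / 2.
  clear -td B0; clearbody B; move: td; rewrite ltr_pdivlMr ?mulr_gt0// => td.
  have -> : B * t = (t * (2 * B)) / 2 by field.
  by rewrite ler_pM2r ?invr_gt0// ltW.
have J4 : M ^+ 2 * de = e / 8 by rewrite /de; field; rewrite gt_eqF.
have : M ^+ 2 * \int[mu]_(x in I) i1 x <= M ^+ 2 * (2 * de) by apply: ler_wpM2l; [exact: ltW|lra].
have : M ^+ 2 * \int[mu]_(x in I) i2 x <= M ^+ 2 * (2 * de) by apply: ler_wpM2l; [exact: ltW|lra].
lra.
Qed.

End InitialTrace.

(** * Density of step functions *)
Section Density.
Context {R : realType}.
Local Notation C := R[i].
Local Notation Re := (@complex.Re R).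
Local Notation Im := (@complex.Im R).
Local Notation normc := (@Normc.normc R).
Local Notation ii := (Complex 0 1 : R[i]).
Local Notation rc := (real_complex R).
Local Notation mu := (@lebesgue_measure R).
Local Notation D := (`[(-1)%R, 1%R]%classic : set R).
Implicit Types (f g : R -> C) (u : R -> R) (x y t a : R).

Let mD : measurable D. Proof. exact: measurable_itv. Qed.

Lemma uniformly_continuous_itv u (a b : R) : continuous u -> forall e, 0 < e -> exists2 d, 0 < d &
  forall x y, a <= x <= b -> `|x - y| < d -> `|u x - u y| < e.
Proof.
move=> cu e e0; have e2 : 0 < e / 2 by rewrite divr_gt0.
have := @segment_compact R a b; rewrite compact_near_coveringP.
move=> /(_ R (0 : R)^'+ (fun d x => forall y, `|x - y| < d -> `|u x - u y| < e) _) H.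
have [|d] := @filter_ex _ ((0 : R)^'+) _ _ (filterI (H _) (nbhs_right_gt (0 : R))).
  move=> x _; have := cu x => /cvgrPdist_lt/(_ _ e2) [r /= r0 Hr].
  near=> z d => /= y zy.
  have zx : `|x - z| < r / 2 by near: z; apply: cvgr_dist_lt; rewrite ?divr_gt0//.
  have dr : d < r / 2 by near: d; apply: nbhs_right_lt; rewrite divr_gt0.
  have h1 : `|u x - u z| < e / 2 by apply: Hr => /=; apply: lt_trans zx _; lra.
  have h2 : `|u x - u y| < e / 2.
    apply: Hr => /=; have := ler_distD z x y; lra.
  by have := ler_distD (u x) (u z) (u y); rewrite (distrC (u z) (u x)); lra.
move=> [Hd d0]; exists d => // x y xab; apply: Hd; by rewrite /= in_itv.
Unshelve. all: by end_near.
Qed.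

Lemma sqint_rc u K : measurable_fun D u -> (forall x, D x -> `|u x| <= K) -> sqint D (fun x => rc (u x)).
Proof.
by move=> mu uK; apply: (@sqint_bounded _ _ K); [exact: cmeas_rc|move=> x Dx; rewrite normc_rc uK].
Qed.

(** A step function interpolating [u] on a fine grid is built from left to right,
    one jump at a time; [S] says that after [m] steps it is close to [u] up to the
    grid point [p m] and constant from there on. *)
Lemma initial_cvg_continuous u : continuous u -> initial_cvg (fun x => rc (u x)).
Proof.
move=> cu.
have mu_ : measurable_fun D u.
  by apply: (@measurable_funS _ _ _ _ setT) => //; exact: continuous_measurable_fun.
have su : sqint D (fun x => rc (u x)).
  split; first exact: cmeas_rc.
  apply: rint_continuous => x _; rewrite (_ : (fun x => _) = (fun x => u x * u x)).
    by apply: continuousM; exact: cu.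
  by apply/funext => y; rewrite normc_rc real_normK ?num_real.
apply: initial_cvg_approx => // e e0.
pose eta := Num.min 1 (e / 2); have eta0 : 0 < eta by rewrite lt_min ltr01 divr_gt0.
have [d d0 ud] := @uniformly_continuous_itv u (-1) 1 cu _ eta0.
pose h := d / 2; have h0 : 0 < h by rewrite divr_gt0.
pose p (m : nat) : R := -1 + m%:R * h.
suff S m : exists g, [/\ sqint D g, initial_cvg g & forall y, D y ->
    (y <= p m -> normc (rc (u y) - g y) <= eta) /\ (p m <= y -> g y = rc (u (p m)))].
  pose m := (Num.trunc (2 / h)).+1.
  have [g [sg cg Hg]] := S m; exists g => //.
  have pm y : D y -> y <= p m.
    rewrite /= in_itv/= => /andP[_ y1]; apply: le_trans y1 _; rewrite /p.
    have : 2 <= m%:R * h by rewrite -ler_pdivrMr// ltW// truncnS_gt.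
    lra.
  have eta2 : eta ^+ 2 <= e / 2.
    apply: (@le_trans _ _ eta); last by rewrite ge_min lexx orbT.
    by rewrite expr2; apply: ler_piMr; [exact: ltW|rewrite ge_min lexx].
  apply: le_trans (nsq_dom (u := fun=> e / 2) mD (sqintB mD su sg) _ (rint_cst _ _ _)) _.
    move=> x Dx; apply: le_trans eta2; rewrite lerXn2r ?nnegrE ?normc_ge0 ?(ltW eta0)//.
    exact: (proj1 (Hg x Dx)) (pm x Dx).
  by rewrite Rintegral_cst_D; lra.
elim: m => [|m [g [sg cg Hg]]].
  exists (fun y => rc (u (-1)) * heaviside (-1) y); split.
  - by apply: sqintZ => //; exact: sqint_heaviside.
  - apply: initial_cvgZ; first exact: sqint_heaviside.
    by apply: initial_cvg_heaviside; rewrite lexx; lra.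
  - move=> y Dy; have y1 : -1 <= y by move: Dy; rewrite /= in_itv/= => /andP[].
    rewrite /p mul0r addr0 /heaviside y1 mulr1; split => // yN.
    have -> : y = -1 by apply/eqP; rewrite eq_le yN y1.
    by rewrite subrr normc0 ltW.
have pS : p m.+1 = p m + h by rewrite /p -natr1; ring.
have pm1 : -1 <= p m by rewrite /p lerDl mulr_ge0// ltW.
have step y : D y -> p m < y -> y < p m.+1 -> normc (rc (u y) - g y) <= eta.
  move=> Dy y1 y2; rewrite (proj2 (Hg y Dy) (ltW y1)) -rcN -rcD normc_rc ltW//.
  apply: ud; first by move: Dy; rewrite /= in_itv.
  by rewrite gtr0_norm; move: y2; rewrite pS /h; lra.
have [big|small] := ltP 1 (p m.+1).
  exists g; split => // y Dy; have y1 : y < p m.+1.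
    by apply: le_lt_trans big; move: Dy; rewrite /= in_itv/= => /andP[].
  split=> [_|]; last by rewrite leNgt y1.
  by have [/(proj1 (Hg y Dy))//|ym] := leP y (p m); exact: step.
pose c : C := rc (u (p m.+1)) - rc (u (p m)).
exists (fun y => g y + c * heaviside (p m.+1) y).
have sh := sqintZ c mD (sqint_heaviside (p m.+1)).
split; first exact: sqintD.
  apply: initial_cvgD => //; apply: initial_cvgZ; first exact: sqint_heaviside.
  by apply: initial_cvg_heaviside; rewrite small pS; lra.
move=> y Dy; rewrite /heaviside; have [yp|yp] := leP (p m.+1) y.
  have -> : g y = rc (u (p m)) by apply: (proj2 (Hg y Dy)); move: yp; rewrite pS; lra.
  have -> : rc (u (p m)) + c * 1 = rc (u (p m.+1)) by rewrite /c; ring.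
  split => // yp'.
  have -> : y = p m.+1 by apply/eqP; rewrite eq_le yp yp'.
  by rewrite subrr normc0 ltW.
rewrite mulr0 addr0; split=> // _.
by have [/(proj1 (Hg y Dy))//|ym] := leP y (p m); exact: step.
Qed.

(** Truncation: on bounded functions, approximation in L^1 by continuous functions
    gives approximation in L^2. *)
Definition clamp (n v : R) := Num.max (- n) (Num.min n v).

Variant clamp_spec (n v : R) : R -> Prop :=
  | ClampLow of v < - n : clamp_spec n v (- n)
  | ClampMid of - n <= v & v <= n : clamp_spec n v v
  | ClampHigh of n < v : clamp_spec n v n.

Lemma clampP (n v : R) : 0 <= n -> clamp_spec n v (clamp n v).
Proof.
move=> n0; rewrite /clamp; have [nv|nv] := leP n v.
  rewrite max_r; last lra.
  by move: nv; rewrite le_eqVlt => /predU1P[<-|/ClampHigh//]; apply: ClampMid; lra.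
have [vn|vn] := leP v (- n); last by apply: ClampMid; exact: ltW.
by move: vn; rewrite le_eqVlt => /predU1P[->|/ClampLow//]; apply: ClampMid; lra.
Qed.

Lemma clamp_bound n v : 0 <= n -> `|clamp n v| <= n.
Proof. by move=> n0; case: clampP => // *; rewrite ler_norml; apply/andP; split; lra. Qed.

Lemma clamp_id n v : `|v| <= n -> clamp n v = v.
Proof.
move=> vn; have n0 : 0 <= n by exact: le_trans vn.
by move: vn; rewrite ler_norml => /andP[h1 h2]; case: clampP => // *; lra.
Qed.

Lemma clamp_lip n v w : 0 <= n -> `|clamp n v - clamp n w| <= `|v - w|.
Proof.
move=> n0; have := ler_norm (v - w); have := ler_norm (- (v - w)); rewrite normrN => h1 h2.
by case: clampP => // *; case: clampP => // *; rewrite ler_norml; apply/andP; split; lra.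
Qed.

Lemma continuous_clamp n : 0 <= n -> continuous (clamp n).
Proof.
move=> n0 x; apply/cvgrPdist_lt => e e0; near=> y.
apply: le_lt_trans (clamp_lip _ _ n0) _; near: y.
by apply: cvgr_dist_lt.
Unshelve. all: by end_near.
Qed.

Lemma clamp_sqr_cvg u e : measurable_fun D u -> rint D (fun x => u x ^+ 2) -> 0 < e ->
  exists2 n : R, 0 < n & \int[mu]_(x in D) (u x - clamp n (u x)) ^+ 2 <= e.
Proof.
move=> mu_ iu2 e0.
have mc n : 0 <= n -> measurable_fun D (fun x => clamp n (u x)).
  by move=> n0; apply: measurableT_comp mu_; exact: continuous_measurable_fun (continuous_clamp n0).
have mF (n : nat) : measurable_fun D (fun x => (u x - clamp n.+1%:R (u x)) ^+ 2).
  by apply: measurable_funX; apply: measurable_funB => //; exact: mc.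
have dom (n : nat) x : (u x - clamp n.+1%:R (u x)) ^+ 2 <= u x ^+ 2.
  have n0 : 0 <= n.+1%:R :> R by [].
  rewrite -real_normK ?num_real// -[leRHS]real_normK ?num_real// lerXn2r ?nnegrE//.
  have := ler_norm (u x); have := ler_norm (- u x); rewrite normrN => h1 h2.
  by case: clampP => // *; rewrite ler_norml; apply/andP; split; lra.
have [||_ _] := @dominated_convergence _ _ _ mu D mD
  (fun n x => ((u x - clamp n.+1%:R (u x)) ^+ 2)%:E) (fun=> 0%E) (fun x => (u x ^+ 2)%:E)
  (fun n => proj2 (measurable_EFinP _ _) (mF n)) (measurable_cst _) _ iu2.
- apply: aeW => x _; apply: cvg_near_cst; near=> n; congr (_%:E).
  rewrite clamp_id ?subrr ?expr0n//.
  apply: (@le_trans _ _ n%:R); last by rewrite ler_nat.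
  by near: n; exact: nbhs_infty_ger.
- by apply: aeW => x n _ /=; rewrite lee_fin ger0_norm ?sqr_ge0.
rewrite integral0 => /fine_cvgP[_] /cvgrPdist_le/(_ _ e0) [N _ HN].
exists N.+1%:R => //; have := HN N (leqnn N); rewrite /= sub0r normrN; apply: le_trans; exact: ler_norm.
Unshelve. all: by end_near.
Qed.

Lemma initial_cvg_real u : sqint D (fun x => rc (u x)) -> initial_cvg (fun x => rc (u x)).
Proof.
move=> su; have [[mu_ _] iu] := su.
have {}iu : rint D (fun x => u x ^+ 2).
  rewrite (_ : (fun x => _) = (fun x => normc (rc (u x)) ^+ 2))//.
  by apply/funext => x; rewrite normc_rc real_normK ?num_real.
have nsqr (v w : R -> R) : nsq D (fun x => rc (v x) - rc (w x)) = \int[mu]_(x in D) (v x - w x) ^+ 2.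
  by apply: eq_Rintegral => x _; rewrite -rcN -rcD normc_rc real_normK ?num_real.
apply: initial_cvg_approx => // e e0.
(* truncate first; the truncated function is then approximated in L^1 by a
   continuous one, itself truncated, and the squared error is at most [2 n] times
   the error *)
have [n n0 Hn] := clamp_sqr_cvg mu_ iu e0.
have mc : measurable_fun D (fun x => clamp n (u x)).
  by apply: measurableT_comp mu_; exact: continuous_measurable_fun (continuous_clamp (ltW n0)).
have sc : sqint D (fun x => rc (clamp n (u x))).
  by apply: (sqint_rc mc) => x _; exact: clamp_bound (ltW n0).
exists (fun x => rc (clamp n (u x))); last by rewrite nsqr.
split=> //; apply: initial_cvg_approx => // e1 e10.
have ic : rint D (fun x => clamp n (u x)).
  apply: (@rint_dom _ _ _ (fun=> n)) => //; last exact: rint_cst.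
  by move=> x _; exact: clamp_bound (ltW n0).
have [|g_ [cg ig]] := approximation_continuous_integrable mD _ ic.
  by rewrite /= lebesgue_measure_itv/=; case: ifP; rewrite ?ltry.
have en : 0 < e1 / (2 * n) by rewrite divr_gt0// mulr_gt0.
move=> /fine_cvgP[_] /cvgrPdist_le/(_ _ en) [N _ HN].
pose g (x : R) : R := clamp n (g_ N x).
have cg' : continuous g by move=> x; apply: (@continuous_comp R R R (g_ N) (clamp n) x (cg N x)); exact: continuous_clamp (ltW n0) _.
have mg : measurable_fun D g by apply: (@measurable_funS _ _ _ _ setT) => //; exact: continuous_measurable_fun.
exists (fun x => rc (g x)).
  split; last exact: initial_cvg_continuous.
  by apply: (sqint_rc mg) => x _; exact: clamp_bound (ltW n0).
have id1 : rint D (fun x => `|clamp n (u x) - g_ N x|).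
  by apply: rint_norm; apply: rintB => //; exact: ig.
rewrite nsqr; apply: (@le_trans _ _ (\int[mu]_(x in D) (2 * n * `|clamp n (u x) - g_ N x|))).
  apply: le_Rintegral => //.
  - have := sqintB mD sc (sqint_rc mg (fun x _ => clamp_bound _ (ltW n0))) => -[_].
    rewrite (_ : (fun x => _) = (fun x => (clamp n (u x) - g x) ^+ 2))//.
    by apply/funext => x; rewrite -rcN -rcD normc_rc real_normK ?num_real.
  - exact: rintZ.
  - move=> x _; rewrite -real_normK ?num_real// expr2; apply: ler_pM => //.
      apply: le_trans (ler_normB _ _) _.
      by have := clamp_bound (u x) (ltW n0); have := clamp_bound (g_ N x) (ltW n0); rewrite /g; lra.
    have -> : clamp n (u x) = clamp n (clamp n (u x)) by rewrite (@clamp_id n (clamp n _))// clamp_bound// ltW.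
    have n1 := ltW n0; rewrite [in leRHS](@clamp_id n (clamp n _)) ?clamp_bound//.
    exact: clamp_lip.
rewrite RintegralZl//; have := HN N (leqnn N); rewrite /= sub0r normrN => H.
have {}H : \int[mu]_(x in D) `|clamp n (u x) - g_ N x| <= e1 / (2 * n).
  by apply: le_trans (ler_norm _) H.
by rewrite -ler_pdivlMl ?mulr_gt0// mulrC.
Qed.

Lemma initial_cvg_sqint f : sqint D f -> initial_cvg f.
Proof.
move=> [mf if2]; have [m1 m2] := mf.
have s1 : sqint D (fun x => rc (Re (f x))).
  apply: (sqint_dom mD (cmeas_rc m1) _ if2) => x _.
  by rewrite normc_rc lerXn2r ?nnegrE ?normc_ge0// normc_Re.
have s2 : sqint D (fun x => rc (Im (f x))).
  apply: (sqint_dom mD (cmeas_rc m2) _ if2) => x _.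
  by rewrite normc_rc lerXn2r ?nnegrE ?normc_ge0// normc_Im.
have -> : f = (fun x => rc (Re (f x)) + ii * rc (Im (f x))) by apply/funext => x; exact: rcE.
apply: initial_cvgD => //; first exact: sqintZ.
  exact: initial_cvg_real.
by apply: initial_cvgZ => //; exact: initial_cvg_real.
Qed.

End Density.

(** * Functions on the unit interval *)
Section UnitInterval.
Context {R : realType}.
Local Notation C := R[i].
Local Notation Re := (@complex.Re R).
Local Notation Im := (@complex.Im R).
Local Notation normc := (@Normc.normc R).
Local Notation mu := (@lebesgue_measure R).
Local Notation I := (`[0%R, 1%R]%classic : set R).
Local Notation J := (@J01 R).
Implicit Types (f g h : R -> C) (u : R -> R) (x y t a : R).

Lemma measurable_J01 : measurable J. Proof. exact: measurable_itv. Qed.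
Let mJ := measurable_J01.
Let mI : measurable I. Proof. exact: measurable_itv. Qed.

Lemma J01_sub : J `<=` I.
Proof. by move=> x; rewrite /J01/= !in_itv/= => /andP[x0 x1]; rewrite !ltW. Qed.

Lemma Rintegral_J01 u : measurable_fun J u ->
  \int[mu]_(x in J) u x = \int[mu]_(x in I) u x.
Proof.
move=> m; rewrite /Rintegral; congr fine; symmetry.
by apply: integral_itv_bndoo; apply/measurable_EFinP.
Qed.

Lemma cint_J01 f : cmeas I f -> cint J f = cint I f.
Proof.
by move=> [m1 m2]; rewrite /cint !Rintegral_J01//; apply: measurable_funS; try exact: J01_sub; eauto.
Qed.

Lemma cint_J01_cdiff f : (forall x, exists d, cdiff f d x) -> cint J f = cint I f.
Proof.
move=> H; apply: cint_J01; apply: cint_meas; apply: cintegrable_cdiff => x _; exact: H.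
Qed.

Lemma rint_J01_cst k : rint J (fun=> k).
Proof. exact: rintS mI mJ J01_sub (rint_cst 0 1 k). Qed.

Lemma Rintegral_J01_cst k : \int[mu]_(x in J) k = k.
Proof.
have m1 : 1 = fine (mu J) by rewrite /J01/= lebesgue_measure_itv/= lte_fin ltr01/= subr0.
by rewrite Rintegral_cst// -m1 mulr1.
Qed.

Lemma sqint_cintegrableJ f : sqint J f -> cintegrable J f.
Proof. by move=> [mf if2]; apply: (cintegrable_sqr mJ mf _ if2); exact: rint_J01_cst. Qed.

Lemma nsq_J01 f : sqint I f -> nsq J f = nsq I f.
Proof.
move=> [mf _]; apply: Rintegral_J01; apply: measurable_normc2.
by apply: cmeasS mf => //; exact: J01_sub.
Qed.

Lemma memL_sqint f : memL 2 J f <-> sqint J f.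
Proof.
split=> [[m1 m2 fin]|[[m1 m2] i2]].
  split=> //; apply/integrableP; split.
    by apply/measurable_EFinP; exact: measurable_normc2.
  rewrite (_ : (fun x => _) = (fun x => (normc (f x) ^+ 2)%:E))//.
  by apply/funext => x /=; rewrite ger0_norm ?sqr_ge0.
split=> //; have /integrableP[_] := i2.
rewrite (_ : (fun x => _) = (fun x => (normc (f x) ^+ 2)%:E))//.
by apply/funext => x /=; rewrite ger0_norm ?sqr_ge0.
Qed.

Lemma L2norm_lt f e : 0 < e -> nsq J f < e ^+ 2 -> L2norm f < e.
Proof.
move=> e0 H; rewrite /L2norm -[e]gtr0_norm// -sqrtr_sqr.
by rewrite ltr_sqrt// exprn_gt0.
Qed.

Lemma nsq_lt f e : L2norm f < e -> nsq J f < e ^+ 2.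
Proof.
move=> H; have e0 : 0 < e by apply: le_lt_trans H; exact: sqrtr_ge0.
rewrite -(sqr_sqrtr (nsq_ge0 J f)) ltrXn2r ?nnegrE ?sqrtr_ge0// ltW //.
Qed.

Lemma cintegrable_bddJ h f K : cmeas J h -> (forall x, J x -> normc (h x) <= K) ->
  cintegrable J f -> cintegrable J (fun x => h x * f x).
Proof. by move=> mh hK jf; exact: cintegrable_bounded hK. Qed.

(** The Cauchy-Schwarz inequality, up to constants, through the inequality of the
    means. *)
Lemma cint_small h g K e : cmeas J h -> (forall x, J x -> normc (h x) <= K) -> 0 <= K ->
  sqint J g -> 0 < e -> nsq J g <= e ^+ 2 -> normc (cint J (fun x => h x * g x)) <= 2 * K * e.
Proof.
move=> mh hK K0 sg e0 ng; have [mg ig] := sg.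
have i1 := rint_J01_cst (K * (e / 2)).
have i2 : rint J (fun x => K / (2 * e) * normc (g x) ^+ 2) by exact: rintZ.
apply: le_trans (@normc_cint_le _ J _ (fun x => K * (e / 2) + K / (2 * e) * normc (g x) ^+ 2) mJ _ _ _) _.
- exact: cmeasM.
- move=> x Jx; rewrite normcM.
  apply: le_trans (ler_wpM2r (normc_ge0 _) (hK x Jx)) _.
  rewrite -[K / _ * _]mulrA -mulrDr; apply: ler_wpM2l => //.
  by have := amgm 1 (normc (g x)) e0; rewrite mul1r expr1n mulr1.
- exact: rintD.
- rewrite RintegralD// Rintegral_J01_cst RintZ//.
  have : K / (2 * e) * nsq J g <= K / (2 * e) * e ^+ 2.
    by apply: ler_wpM2l => //; rewrite divr_ge0// mulr_ge0// ltW.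
  have -> : K / (2 * e) * e ^+ 2 = K * (e / 2) by field; rewrite gt_eqF.
  rewrite /nsq; lra.
Qed.

Lemma cint_parts f df g dg a b : a <= b -> (forall x, cdiff f (df x) x) -> (forall x, cdiff g (dg x) x) ->
  (forall x, exists d, cdiff df d x) -> (forall x, exists d, cdiff dg d x) ->
  cint `[a, b] (fun x => f x * dg x) = f b * g b - f a * g a - cint `[a, b] (fun x => df x * g x).
Proof.
move=> ab Df Dg Ddf Ddg.
have i1 : cintegrable `[a, b] (fun x => f x * dg x).
  by apply: cintegrable_cdiff => x _; have [d Hd] := Ddg x; eexists; exact: cdiffM (Df x) Hd.
have i2 : cintegrable `[a, b] (fun x => df x * g x).
  by apply: cintegrable_cdiff => x _; have [d Hd] := Ddf x; eexists; exact: cdiffM Hd (Dg x).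
apply/eqP; rewrite -subr_eq opprK -cintD//; apply/eqP.
rewrite (@eq_cint _ _ _ (fun x => df x * g x + f x * dg x)); last by move=> x _; rewrite addrC.
rewrite (@cftc _ (fun x => f x * g x))// => x _; first exact: cdiffM.
have [d1 H1] := Ddf x; have [d2 H2] := Ddg x; eexists.
by apply: cdiffD; [exact: cdiffM H1 (Dg x)|exact: cdiffM (Df x) H2].
Qed.

Lemma cderive1E f d x : cdiff f d x -> cderive 1 f x = d.
Proof. by move=> H; exact: cdiff_unique (cderivable_cdiff (cdiff_cderivable H)) H. Qed.

Lemma cmeas_smooth (E : set R) f : measurable E -> (forall x, exists d, cdiff f d x) -> cmeas E f.
Proof.
move=> mE H; apply: (@cmeas_cdiff _ _ _ (cderive 1 f)) => // x.
by have [d Hd] := H x; rewrite (cderive1E Hd).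
Qed.

Lemma cdiff_bounded f a b : (forall x, exists d, cdiff f d x) ->
  exists2 K, 0 <= K & forall x, a <= x <= b -> normc (f x) <= K.
Proof.
move=> H; have [ab|ba] := leP a b; last first.
  by exists 0 => // x /andP[ax xb]; have := le_trans ax xb; rewrite leNgt ba.
have cu : {within `[a, b], continuous (fun x => normc (f x) ^+ 2)}.
  by apply: within_continuous_for => x _; have [d Hd] := H x; exact: continuous_normc2 Hd.
have [c cab Hc] := EVT_max ab cu.
exists (normc (f c)); first exact: normc_ge0.
move=> x xab; rewrite -(@ler_pXn2r _ 2)// ?nnegrE ?normc_ge0//.
by apply: Hc; rewrite in_itv.
Qed.

Lemma test_functionP eta : test_function eta ->
  [/\ forall x, cdiff eta (cderive 1 eta x) x, forall x, cdiff (cderive 1 eta) (cderive 2 eta x) x,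
      eta 0 = 0 & eta 1 = 0].
Proof.
move=> [S [K [_ KJ E]]].
have L := csmooth_ladder S; split.
- move=> x; have := L 0 x Logic.I; apply: cdiff_ext => y.
  by rewrite /cderive /=; case: (eta y).
- by move=> x; exact: (L 1 x Logic.I).
- by apply: E => /KJ; rewrite /J01/= in_itv/= ltxx.
- by apply: E => /KJ; rewrite /J01/= in_itv/= ltxx andbF.
Qed.

Lemma smooth_weak_derivative h dh : (forall x, cdiff h (dh x) x) -> (forall x, exists d, cdiff dh d x) ->
  weak_derivative h dh.
Proof.
move=> Dh Ddh eta /test_functionP[D1 D2 e0 e1].
have s1 x : exists d, cdiff (fun x => h x * cderive 1 eta x) d x.
  by eexists; exact: cdiffM (Dh x) (D2 x).
have s2 x : exists d, cdiff (fun x => dh x * eta x) d x.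
  by have [d Hd] := Ddh x; eexists; exact: cdiffM Hd (D1 x).
rewrite !cint_J01_cdiff// (cint_parts ler01 Dh D1 Ddh).
  by rewrite e0 e1 !mulr0 subr0 sub0r.
by move=> x; eexists; exact: D2.
Qed.

Lemma cint_mult_cvg0_ae (D : set R) (F : R -> C) (w : nat -> R -> C) (B : R) : measurable D -> cintegrable D F ->
  (forall n, cmeas D (w n)) -> (forall n x, D x -> normc (w n x) <= B) ->
  {ae mu, forall x, D x -> forall d : R, 0 < d -> exists N : nat, forall n, (N <= n)%N -> normc (w n x) <= d} ->
  forall d : R, 0 < d -> exists N : nat, forall n, (N <= n)%N -> normc (cint D (fun x => w n x * F x)) <= d.
Proof.
move=> mD iF mw Bw w0 d d0.
have iN := cintegrable_normc mD iF.
have mF : cmeas D F by exact: cint_meas.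
have mu_ n : measurable_fun D (fun x => normc (w n x * F x)).
  by apply: measurable_normc; exact: cmeasM.
have bd n x : D x -> normc (w n x * F x) <= B * normc (F x).
  by move=> Dx; rewrite normcM; apply: ler_wpM2r; [exact: normc_ge0|exact: Bw].
have iB : rint D (fun x => B * normc (F x)) by exact: rintZ.
have [||_ _] := @dominated_convergence _ _ _ mu D mD
  (fun n x => (normc (w n x * F x))%:E) (fun=> 0%E) (fun x => (B * normc (F x))%:E)
  (fun n => proj2 (measurable_EFinP _ _) (mu_ n)) (measurable_cst _) _ iB.
- apply: filterS w0; first exact: (ae_filter_ringOfSetsType mu).
  move=> x w0 Dx; apply: cvg_EFin; first by near=> n.
  apply/cvgrPdist_le => k k0; pose M := normc (F x) + 1.
  have M0 : 0 < M by rewrite /M; have := normc_ge0 (F x); lra.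
  have [|N HN] := w0 Dx (k / M); first by rewrite divr_gt0.
  exists N => // n /= Nn; rewrite sub0r normrN ger0_norm ?normc_ge0// normcM.
  have -> : k = k / M * M by rewrite divfK// gt_eqF.
  by apply: ler_pM; [exact: normc_ge0|exact: normc_ge0|exact: HN|rewrite /M lerDl].
- by apply: aeW => x n Dx /=; rewrite lee_fin ger0_norm ?normc_ge0 ?bd.
rewrite integral0 => /fine_cvgP[_].
have d2 : 0 < d / 2 by rewrite divr_gt0.
move=> /cvgrPdist_le/(_ _ d2) [N _ HN]; exists N => n Nn.
have := HN n Nn; rewrite /= sub0r normrN => H.
have {}H : \int[mu]_(x in D) normc (w n x * F x) <= d / 2 by apply: le_trans (ler_norm _) H.
apply: le_trans (@normc_cint_le _ D _ (fun x => normc (w n x * F x)) mD _ _ _) _ => //.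
- exact: cmeasM.
- by apply: rint_dom mD (mu_ n) _ iB => x Dx; rewrite ger0_norm ?normc_ge0// bd.
- by rewrite mulrC -ler_pdivlMr.
Unshelve. all: by end_near.
Qed.

Lemma cint_mult_cvg0 (D : set R) (F : R -> C) (w : nat -> R -> C) (B : R) : measurable D -> cintegrable D F ->
  (forall n, cmeas D (w n)) -> (forall n x, D x -> normc (w n x) <= B) ->
  (forall x, D x -> exists N : nat, forall n, (N <= n)%N -> w n x = 0) ->
  forall d : R, 0 < d -> exists N : nat, forall n, (N <= n)%N -> normc (cint D (fun x => w n x * F x)) <= d.
Proof.
move=> mD iF mw Bw w0; apply: cint_mult_cvg0_ae mD iF mw Bw _.
apply: aeW => x Dx d d0; have [N HN] := w0 x Dx; exists N => n Nn.
by rewrite HN// normc0 ltW.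
Qed.

Definition eps (n : nat) : R := (n + 4)%:R^-1.

Lemma eps_gt0 n : 0 < eps n. Proof. by rewrite invr_gt0 ltr0n addn4. Qed.
Lemma eps_le4 n : eps n <= 1 / 4.
Proof. by rewrite div1r lef_pV2 ?posrE ?ltr0n ?addn4// ler_nat. Qed.

Lemma eps_small d : 0 < d -> exists N : nat, forall n, (N <= n)%N -> eps n < d.
Proof.
move=> d0; exists (Num.trunc d^-1).+1 => n Nn.
rewrite -[d]invrK ltf_pV2 ?posrE ?invr_gt0 ?ltr0n ?addn4//.
apply: lt_le_trans (truncnS_gt _) _; rewrite ler_nat.
by apply: leq_trans Nn _; rewrite -addn4 leq_addr.
Qed.

End UnitInterval.

(** * Cut-offs, Green's formula and approximation in H^1 *)
Section WeakForm.
Context {R : realType}.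
Local Notation C := R[i].
Local Notation Re := (@complex.Re R).
Local Notation Im := (@complex.Im R).
Local Notation normc := (@Normc.normc R).
Local Notation rc := (real_complex R).
Local Notation mu := (@lebesgue_measure R).
Local Notation I := (`[0%R, 1%R]%classic : set R).
Local Notation J := (@J01 R).
Implicit Types (f g h : R -> C) (u : R -> R) (x y t a e : R).

Let mJ := @measurable_J01 R.
Let mI : measurable I. Proof. exact: measurable_itv. Qed.

Lemma ladder_affine (P : nat -> R -> C) (a b : R) : ladder setT P ->
  ladder setT (fun n x => rc a ^+ n * P n (a * x + b)).
Proof.
move=> L n x _.
have A : is_derive x 1 (fun y : R => a * y + b) a.
  by have := is_deriveD (is_derive_linear a x) (is_derive_cst b x 1); rewrite addr0.
rewrite exprSr -mulrA.
exact: cdiffZ (cdiff_comp (g := fun y : R => a * y + b) (L n _ Logic.I) A).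
Qed.

(** The smooth step [P 0], rescaled, provides cut-offs near both end-points. *)
Variable P : nat -> R -> C.
Hypothesis (LP : ladder setT P).
Hypotheses (P1 : forall x, x <= 0 -> P 0 x = 1) (P0 : forall x, 1 <= x -> P 0 x = 0).
Variable K : R.
Hypotheses (K1 : 1 <= K) (BP : forall x, normc (P 0 x) <= K /\ normc (P 1 x) <= K).

(** [cutl e] goes from 0 to 1 across [[e, 2 e]], and [cutr e] from 1 to 0 across
    [[1 - 2 e, 1 - e]]; their sum minus 1 is the cut-off [cut e]. *)
Definition cutl e n x : C := rc (- e^-1) ^+ n * P n (- e^-1 * x + 2).
Definition cutr e n x : C := rc e^-1 ^+ n * P n (e^-1 * x + (2 - e^-1)).
Definition cut e n x : C := cutl e n x + cutr e n x - (if n == 0%N then 1 else 0).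

Lemma ladder_cutl e : ladder setT (cutl e).
Proof. exact: ladder_affine. Qed.

Lemma ladder_cutr e : ladder setT (cutr e).
Proof. exact: ladder_affine. Qed.

Lemma ladder_cut e : ladder setT (cut e).
Proof.
move=> n x _; have H := cdiffB (cdiffD (@ladder_cutl e n x Logic.I) (@ladder_cutr e n x Logic.I)) (cdiff_cst (if n == 0%N then 1 else 0) x).
exact: H.
Qed.

Lemma ladder_const0 (F : nat -> R -> C) x (U : set R) n k : ladder setT F -> open U -> U x ->
  (forall y, U y -> F 0%N y = k) -> (0 < n)%N -> F n x = 0.
Proof.
move=> L oU Ux E; case: n => // n _.
suff H m y : U y -> F m.+1 y = 0 by exact: H.
elim: m y => [|m IH] y Uy.
  apply: cdiff_unique (L 0%N y Logic.I) _; apply: (cdiff_near (f := fun=> k)); last exact: cdiff_cst.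
  by near=> z; rewrite E//; near: z; exact: open_nbhs_nbhs.
apply: cdiff_unique (L m.+1 y Logic.I) _; apply: (cdiff_near (f := fun=> 0)); last exact: cdiff_cst.
by near=> z; rewrite IH//; near: z; exact: open_nbhs_nbhs.
Unshelve. all: by end_near.
Qed.

(** Inside the half-lines the step is locally constant; the end-points 0 and 1 are
    reached by continuity of the derivatives. *)
Lemma step_derive0 m x : x <= 0 \/ 1 <= x -> P m.+1 x = 0.
Proof.
have D0 y : y < 0 \/ 1 < y -> P m.+1 y = 0.
  move=> [y0|y1].
    apply: (@ladder_const0 P y [set z | z < 0] m.+1 1 LP) => // z /= z0.
    by rewrite P1// ltW.
  apply: (@ladder_const0 P y [set z | 1 < z] m.+1 0 LP) => // z /= z0.
  by rewrite P0// ltW.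
suff H z (sgn : R) : (sgn == 1) || (sgn == -1) -> (forall d, 0 < d -> P m.+1 (z + sgn * d) = 0) -> P m.+1 z = 0.
  move=> [x0|x1].
    apply: (H x (-1)) => [|d d0]; first by rewrite eqxx orbT.
    by apply: D0; left; lra.
  apply: (H x 1) => [|d d0]; first by rewrite eqxx.
  by apply: D0; right; lra.
move=> s1 Hd.
have [c1 c2] := @LP m.+1 z Logic.I.
pose w n : R := z + sgn / n.+1%:R.
have wz : w n @[n --> \oo] --> z.
  rewrite -[X in _ --> X]addr0; apply: cvgD; first exact: cvg_cst.
  rewrite -(mulr0 sgn); apply: cvgZr; exact: cvg_harmonic.
have W n : P m.+1 (w n) = 0 by apply: Hd; rewrite invr_gt0.
have e1 := cvg_comp _ _ wz (is_derive_continuous c1).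
have e2 := cvg_comp _ _ wz (is_derive_continuous c2).
apply: cext.
  apply: (cvg_unique _ e1) => //; apply: cvg_near_cst; near=> n; by rewrite /= W.
apply: (cvg_unique _ e2) => //; apply: cvg_near_cst; near=> n; by rewrite /= W.
Unshelve. all: by end_near.
Qed.

Lemma cutl_in e x : 0 < e -> 2 * e <= x -> cutl e 0 x = 1 /\ cutl e 1 x = 0.
Proof.
move=> e0 ex; have : - e^-1 * x + 2 <= 0.
  by rewrite mulNr addrC subr_le0 mulrC ler_pdivlMr// .
move=> h; rewrite /cutl expr0 mul1r P1//; split => //.
by rewrite step_derive0 ?mulr0//; left.
Qed.

Lemma cutl_out e x : 0 < e -> x <= e -> cutl e 0 x = 0 /\ cutl e 1 x = 0.
Proof.
move=> e0 ex; have : 1 <= - e^-1 * x + 2.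
  have : x / e <= 1 by rewrite ler_pdivrMr// mul1r.
  by rewrite mulrC; lra.
move=> h; rewrite /cutl expr0 mul1r P0//; split => //.
by rewrite step_derive0 ?mulr0//; right.
Qed.

Lemma cutr_arg e x : 0 < e -> e^-1 * x + (2 - e^-1) = (x - (1 - 2 * e)) / e.
Proof. by move=> e0; field; rewrite gt_eqF. Qed.

Lemma cutr_in e x : 0 < e -> x <= 1 - 2 * e -> cutr e 0 x = 1 /\ cutr e 1 x = 0.
Proof.
move=> e0 ex; have h : e^-1 * x + (2 - e^-1) <= 0.
  by rewrite cutr_arg// ler_pdivrMr// mul0r subr_le0.
rewrite /cutr expr0 mul1r P1//; split => //.
by rewrite step_derive0 ?mulr0//; left.
Qed.

Lemma cutr_out e x : 0 < e -> 1 - e <= x -> cutr e 0 x = 0 /\ cutr e 1 x = 0.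
Proof.
move=> e0 ex; have h : 1 <= e^-1 * x + (2 - e^-1).
  by rewrite cutr_arg// ler_pdivlMr// mul1r; lra.
rewrite /cutr expr0 mul1r P0//; split => //.
by rewrite step_derive0 ?mulr0//; right.
Qed.

Lemma cutl_bound e x : 0 < e -> normc (cutl e 0 x) <= K /\ normc (cutl e 1 x) <= K / e.
Proof.
move=> e0; have ie : 0 < e^-1 by rewrite invr_gt0.
rewrite /cutl expr0 mul1r expr1 normcM normc_rc normrN gtr0_norm//.
have [h1 h2] := BP (- e^-1 * x + 2); split => //.
by rewrite [X in X <= _]mulrC; apply: ler_wpM2r => //; exact: ltW.
Qed.

Lemma cutr_bound e x : 0 < e -> normc (cutr e 0 x) <= K /\ normc (cutr e 1 x) <= K / e.
Proof.
move=> e0; have ie : 0 < e^-1 by rewrite invr_gt0.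
rewrite /cutr expr0 mul1r expr1 normcM normc_rc gtr0_norm//.
have [h1 h2] := BP (e^-1 * x + (2 - e^-1)); split => //.
by rewrite [X in X <= _]mulrC; apply: ler_wpM2r => //; exact: ltW.
Qed.

Lemma cut0E e x : cut e 0 x = cutl e 0 x + cutr e 0 x - 1. Proof. by []. Qed.
Lemma cut1E e x : cut e 1 x = cutl e 1 x + cutr e 1 x. Proof. by rewrite /cut subr0. Qed.

Lemma cut_out e x : 0 < e -> e <= 1 / 4 -> x <= e \/ 1 - e <= x -> cut e 0 x = 0.
Proof.
move=> e0 e4; rewrite cut0E => -[xe|xe].
  rewrite (cutl_out e0 xe).1 (cutr_in e0 _).1; last lra.
  by rewrite add0r subrr.
rewrite (cutr_out e0 xe).1 (cutl_in e0 _).1; last lra.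
by rewrite addr0 subrr.
Qed.

Lemma cut_in e x : 0 < e -> 2 * e <= x <= 1 - 2 * e -> cut e 0 x = 1 /\ cut e 1 x = 0.
Proof.
move=> e0 /andP[x1 x2]; rewrite cut0E cut1E.
rewrite (cutl_in e0 x1).1 (cutl_in e0 x1).2 (cutr_in e0 x2).1 (cutr_in e0 x2).2.
by rewrite addrK addr0.
Qed.

Lemma cut_bound e x : 0 < e -> normc (cut e 0 x - 1) <= 2 * K + 2.
Proof.
move=> e0; rewrite cut0E; have [l _] := cutl_bound x e0; have [r _] := cutr_bound x e0.
apply: le_trans (normcDB _ _) _; rewrite normc1.
have := normcDB (cutl e 0 x + cutr e 0 x) 1; have := normcD (cutl e 0 x) (cutr e 0 x).
rewrite normc1; lra.
Qed.

Lemma test_function_cut e (H : nat -> R -> C) : 0 < e -> e <= 1 / 4 -> ladder setT H ->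
  test_function (fun x => H 0%N x * cut e 0 x).
Proof.
move=> e0 e4 LH; split.
  exact: (ladder_csmooth openT (@ladder_prodD _ setT H (cut e) 0 0 LH (@ladder_cut e))).
exists `[e, 1 - e]%classic; split.
- exact: segment_compact.
- by move=> x; rewrite /J01/= !in_itv/= => /andP[x0 x1]; apply/andP; split; lra.
- move=> x /= /negP; rewrite in_itv/= negb_and -!ltNge => H'.
  by rewrite cut_out ?mulr0//; case/orP: H' => h; [left|right]; exact: ltW.
Qed.

Lemma cderive_cut e (H : nat -> R -> C) x : ladder setT H ->
  cderive 1 (fun x => H 0%N x * cut e 0 x) x = H 1%N x * cut e 0 x + H 0%N x * cut e 1 x.
Proof. by move=> LH; apply: cderive1E; apply: cdiffM; [exact: LH|exact: ladder_cut]. Qed.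

Lemma cmeas_ladder (H : nat -> R -> C) n (E : set R) : measurable E -> ladder setT H -> cmeas E (H n).
Proof. by move=> mE LH; apply: cmeas_smooth => // x; exists (H n.+1 x); exact: LH. Qed.

(** [b] stands for the derivative of a cut-off: it lives on an interval of length
    [r] and is of size [B / r], so that it acts like a multiple of the Dirac mass. *)
Lemma concentrate (G b : R -> C) (B r v c : R) (g : C) : 0 < r ->
  cintegrable J (fun x => G x * b x) -> (forall x, exists d, cdiff b d x) ->
  0 <= c -> c + r <= 1 -> 0 <= v ->
  (forall x, x < c \/ c + r < x -> b x = 0) -> (forall x, normc (b x) <= B / r) ->
  (forall x, J x -> c <= x <= c + r -> normc (G x - g) <= v) -> 0 <= B ->
  normc (cint J (fun x => G x * b x) - g * cint J b) <= 2 * (v * B).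
Proof.
move=> r0 iG Db c0 cr v0 bout bB Gv B0.
have ib : cintegrable J b.
  have [K' K0 HK] := cdiff_bounded 0 1 Db.
  apply: (@cintegrable_dom _ J b (fun=> K')) => //; first exact: cmeas_smooth.
    by move=> x /J01_sub /=; rewrite in_itv/= => /HK.
  exact: rint_J01_cst.
rewrite -cintZ// -cintB//; last exact: cintegrableZ.
have E : cint J (fun x => G x * b x - g * b x) = cint J (fun x => (G x - g) * b x).
  by apply: eq_cint => x _; rewrite mulrBl.
have iGg : cintegrable J (fun x => (G x - g) * b x).
  have := cintegrableB mJ iG (cintegrableZ g mJ ib).
  by rewrite (_ : (fun x => _) = (fun x => (G x - g) * b x))//; apply/funext => x; rewrite mulrBl.
rewrite E; pose w x := v * (B / r) * (\1_(`[c, c + r]%classic) x : R).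
have rw : rint J (\1_(`[c, c + r]%classic) : R -> R).
  apply: (@rint_dom _ _ _ (fun=> 1)) => //; last exact: rint_J01_cst.
  by move=> x _; rewrite indicE; case: (_ \in _); rewrite ?normr1 ?normr0.
apply: le_trans (@normc_cint_le _ J _ w mJ (cint_meas iGg) _ (rintZ _ mJ rw)) _.
  move=> x Jx; rewrite /w indicE mem_setE in_itv/=; have [xc|] := boolP (c <= x <= c + r).
    rewrite mulr1 normcM; apply: ler_pM => //; [exact: normc_ge0|exact: normc_ge0|exact: Gv].
  rewrite negb_and -!ltNge => /orP xo; rewrite bout ?mulr0 ?normc0//.
rewrite RintZ// ler_pM2l//.
have : \int[mu]_(x in J) (\1_(`[c, c + r]%classic) x : R) <= r.
  have m1 : measurable_fun J (\1_(`[c, c + r]%classic) : R -> R) by exact: measurable_indic.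
  rewrite Rintegral_J01//; apply: le_trans (Rintegral_indic_itv _) _; lra.
move=> H; apply: le_trans (ler_wpM2l _ H) _; first by rewrite mulr_ge0// divr_ge0// ltW.
by rewrite -mulrA divfK// gt_eqF.
Qed.

Lemma cint_cutl e : 0 < e -> e <= 1 / 4 -> cint J (cutl e 1) = 1.
Proof.
move=> e0 e4; have L := @ladder_cutl e.
rewrite cint_J01_cdiff; last by move=> x; eexists; exact: L.
rewrite (cftc ler01 (fun x _ => L 0%N x Logic.I)); last by move=> x _; eexists; exact: L.
rewrite (cutl_in e0 _).1; last lra.
by rewrite (cutl_out e0 _).1 ?subr0// ltW.
Qed.

Lemma cint_cutr e : 0 < e -> e <= 1 / 4 -> cint J (cutr e 1) = -1.
Proof.
move=> e0 e4; have L := @ladder_cutr e.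
rewrite cint_J01_cdiff; last by move=> x; eexists; exact: L.
rewrite (cftc ler01 (fun x _ => L 0%N x Logic.I)); last by move=> x _; eexists; exact: L.
rewrite (cutr_out e0 _).1; last lra.
by rewrite (cutr_in e0 _).1 ?sub0r//; lra.
Qed.

Definition modulus_at p (G : R -> C) := forall d : R, 0 < d ->
  exists2 r : R, 0 < r & forall x, 0 <= x <= 1 -> `|x - p| < r -> normc (G x - G p) <= d.

Lemma modulus_within (G : R -> C) : {within `[0, 1], continuous (fun x => Re (G x))} ->
  {within `[0, 1], continuous (fun x => Im (G x))} -> forall p, 0 <= p <= 1 -> modulus_at p G.
Proof.
move=> c1 c2 p p01 d d0; have d2 : 0 < d / 2 by rewrite divr_gt0.
have Q (q : R -> R) : {within `[0, 1], continuous q} -> exists2 r : R, 0 < r &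
    forall x, 0 <= x <= 1 -> `|x - p| < r -> `|q x - q p| <= d / 2.
  move=> cq; have Ip : I p by rewrite /= in_itv.
  have /cvgrPdist_le /(_ _ d2) := cq p.
  move=> H0; have {H0} : within I (nbhs p) (fun t : R => `|q p - q t| <= d / 2) by rewrite (nbhs_subspace_in Ip).
  rewrite /within/= => /nbhs_ballP[r r0 H].
  exists r => // x x01 xp; rewrite distrC; apply: H; last by rewrite in_itv.
  by rewrite /ball/= distrC.
have [r1 r10 H1] := Q _ c1; have [r2 r20 H2] := Q _ c2.
exists (Num.min r1 r2); first by rewrite lt_min r10.
move=> x x01; rewrite lt_min => /andP[xr1 xr2].
apply: le_trans (normc_le _) _; rewrite ReB ImB.
by have := H1 x x01 xr1; have := H2 x x01 xr2; lra.
Qed.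

Lemma modulusM p (F G : R -> C) B : 0 <= B -> (forall x, 0 <= x <= 1 -> normc (F x) <= B) ->
  modulus_at p F -> modulus_at p G -> modulus_at p (fun x => F x * G x).
Proof.
move=> B0 FB mF mG d d0; pose M := B + normc (G p) + 1.
have M0 : 0 < M by have := normc_ge0 (G p); rewrite /M; lra.
have dM : 0 < d / M by rewrite divr_gt0.
have [r1 r10 H1] := mF _ dM; have [r2 r20 H2] := mG _ dM.
exists (Num.min r1 r2); first by rewrite lt_min r10.
move=> x x01; rewrite lt_min => /andP[xr1 xr2].
have -> : F x * G x - F p * G p = F x * (G x - G p) + (F x - F p) * G p by ring.
apply: le_trans (normcD _ _) _; rewrite !normcM.
have h1 : normc (F x) * normc (G x - G p) <= B * (d / M).
  by apply: ler_pM; [exact: normc_ge0|exact: normc_ge0|exact: FB|exact: H2].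
have h2 : normc (F x - F p) * normc (G p) <= d / M * normc (G p).
  by apply: ler_wpM2r; [exact: normc_ge0|exact: H1].
have : d / M * M = d by rewrite divfK// gt_eqF.
rewrite {2}/M => hd; lra.
Qed.

(** Two integrations by parts. The first one has no boundary term since [psi] and
    [psi1] are limits of test functions and their derivatives. For the second one
    [psi1] is only known to have the weak derivative [psi2], so [H 0] is cut off:
    the derivative of the cut-off produces the boundary terms of [H 0 * psi1], of
    which the one at 0 vanishes. *)
Lemma weak_green (H : nat -> R -> C) psi psi1 psi2 : ladder setT H -> H 0%N 0 = 0 ->
  H2_H10 psi psi1 psi2 ->
  cint J (fun x => H 2 x * psi x) = cint J (fun x => H 0 x * psi2 x) - H 0 1 * psi1 1.
Proof.
move=> LH H00 [[/memL_sqint s0 /memL_sqint s1 /memL_sqint s2] [_ wd2] [cr ci] dense].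
have bdH n : exists2 B, 0 <= B & forall x, J x -> normc (H n x) <= B.
  have [|B B0 HB] := @cdiff_bounded _ (H n) 0 1; first by move=> x; exists (H n.+1 x); exact: LH.
  by exists B => // x /J01_sub /=; rewrite in_itv/= => /HB.
have mH n : cmeas J (H n) by exact: cmeas_ladder.
have iH n g : sqint J g -> cintegrable J (fun x => H n x * g x).
  by move=> /sqint_cintegrableJ ig; have [B _ HB] := bdH n; exact: cintegrable_bddJ HB ig.
have [B1 B10 HB1] := bdH 1%N; have [B2 B20 HB2] := bdH 2%N; have [B0 B00 HB0] := bdH 0%N.
have zero (z : C) M : 0 <= M -> (forall d, 0 < d -> normc z <= M * d) -> z = 0.
  move=> M0 h; apply/eqP; rewrite -normc_eq0 eq_le normc_ge0 andbT.
  rewrite leNgt; apply/negP => z0.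
  have := h (normc z / (2 * (M + 1))) _; rewrite divr_gt0//; last lra.
  move=> /(_ isT); have -> : M * (normc z / (2 * (M + 1))) = normc z * (M / (2 * (M + 1))) by ring.
  rewrite leNgt => /negP; apply; rewrite gtr_pMr// ltr_pdivrMr; lra.
(* the sum is continuous in [psi] for the H^1 norm, and vanishes on test functions *)
have step1 : cint J (fun x => H 2 x * psi x) + cint J (fun x => H 1 x * psi1 x) = 0.
  apply: (zero _ (2 * B2 + 2 * B1)); first lra.
  move=> d d0; have [eta te [n1 n2]] := dense d d0.
  have [D1 D2 e0 e1] := test_functionP te.
  have se : sqint J eta.
    have se' : sqint I eta by apply: sqint_cdiff => x _; eexists; exact: D1.
    exact: sqintS mI mJ (@J01_sub R) se'.
  have sde : sqint J (cderive 1 eta).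
    have se' : sqint I (cderive 1 eta) by apply: sqint_cdiff => x _; eexists; exact: D2.
    exact: sqintS mI mJ (@J01_sub R) se'.
  have P0' : cint J (fun x => H 2 x * eta x) + cint J (fun x => H 1 x * cderive 1 eta x) = 0.
    rewrite !cint_J01_cdiff; first last.
    - by move=> x; eexists; exact: cdiffM (@LH 2 x Logic.I) (D1 x).
    - by move=> x; eexists; exact: cdiffM (@LH 1%N x Logic.I) (D2 x).
    rewrite (cint_parts ler01 (fun x => @LH 1%N x Logic.I) D1).
    - by rewrite e0 e1 !mulr0 subr0 sub0r subrr.
    - by move=> x; eexists; exact: LH.
    - by move=> x; eexists; exact: D2.
  have -> : cint J (fun x => H 2 x * psi x) + cint J (fun x => H 1 x * psi1 x) =
     cint J (fun x => H 2 x * (psi x - eta x)) + cint J (fun x => H 1 x * (psi1 x - cderive 1 eta x)).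
    have E n p q : sqint J p -> sqint J q ->
        cint J (fun x => H n x * (p x - q x)) = cint J (fun x => H n x * p x) - cint J (fun x => H n x * q x).
      by move=> sp sq; rewrite -cintB//; try exact: iH; apply: eq_cint => x _; rewrite mulrBr.
    by rewrite !E// addrACA -opprD P0' subr0.
  apply: le_trans (normcD _ _) _; rewrite mulrDl; apply: lerD.
    by apply: cint_small => //; [exact: sqintB|exact: ltW (nsq_lt n1)].
  by apply: cint_small => //; [exact: sqintB|exact: ltW (nsq_lt n2)].
(* the continuous function whose boundary values appear in the limit *)
pose G x := H 0%N x * psi1 x.
have G0 : G 0 = 0 by rewrite /G H00 mul0r.
have mG p : 0 <= p <= 1 -> modulus_at p G.
  move=> p01; have [|B B0' HB] := @cdiff_bounded _ (H 0%N) 0 1; first by move=> x; eexists; exact: LH.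
  apply: (modulusM B0' HB); apply: modulus_within => //.
    by apply: within_continuous_for => x _; exact: is_derive_continuous (@LH 0%N x Logic.I).1.
  by apply: within_continuous_for => x _; exact: is_derive_continuous (@LH 0%N x Logic.I).2.
suff step2 : cint J (fun x => H 1 x * psi1 x) - G 1 + cint J (fun x => H 0 x * psi2 x) = 0.
  move/eqP: step1; rewrite addr_eq0 => /eqP ->; move/eqP: step2.
  by rewrite -addrA addr_eq0 => /eqP ->; rewrite opprK addrC.
apply: (zero _ (2 + 4 * K)); first by have := K1; lra.
move=> d d0.
have mcut n k : cmeas J (fun x => cut (eps n) k x - 1).
  by apply: cmeasB; [apply: cmeas_ladder => //; exact: ladder_cut|exact: cmeas_cst].
have cut_ev x : J x -> exists N : nat, forall n, (N <= n)%N -> cut (eps n) 0 x - 1 = 0.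
  rewrite /J01/= in_itv/= => /andP[x0 x1].
  have [|N HN] := @eps_small _ (Num.min x (1 - x) / 2).
    by rewrite divr_gt0// lt_min x0/= subr_gt0.
  exists N => n /HN; rewrite ltr_pdivlMr// lt_min => /andP[h1 h2].
  rewrite (cut_in (eps_gt0 n) _).1 ?subrr//; apply/andP; split; lra.
have [N1 HN1] := cint_mult_cvg0 mJ (iH 1%N _ s1) (fun n => mcut n 0%N) (fun n x _ => cut_bound x (eps_gt0 n)) cut_ev d0.
have [N2 HN2] := cint_mult_cvg0 mJ (iH 0%N _ s2) (fun n => mcut n 0%N) (fun n x _ => cut_bound x (eps_gt0 n)) cut_ev d0.
have [|r0 r00 Hr0] := mG 0 _ d d0; first by rewrite lexx ler01.
have [|r1 r10 Hr1] := mG 1 _ d d0; first by rewrite lexx ler01.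
have [|N3 HN3] := @eps_small _ (Num.min r0 r1 / 2); first by rewrite divr_gt0// lt_min r00.
pose n := maxn N1 (maxn N2 N3).
have := HN1 n (leq_maxl _ _); have := HN2 n (leq_trans (leq_maxl _ _) (leq_maxr _ _)).
have := HN3 n (leq_trans (leq_maxr _ _) (leq_maxr _ _)).
move: (@eps R n) (@eps_gt0 R n) (@eps_le4 R n) => e e0 e4 {HN1 HN2 HN3}.
rewrite ltr_pdivlMr// lt_min => /andP[er0 er1] b2 b1.
have := wd2 _ (test_function_cut e0 e4 LH).
have Lc k x := @ladder_cut e k x Logic.I.
have iT (c : nat -> R -> C) k j p : ladder setT c -> sqint J p -> cintegrable J (fun x => c k x * (H j x * p x)).
  move=> Lc' sp; have [|B _ HB] := @cdiff_bounded _ (c k) 0 1; first by move=> x; exists (c k.+1 x); exact: Lc'.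
  apply: (@cintegrable_bddJ _ _ _ B); [exact: cmeas_ladder| |exact: iH].
  by move=> x /J01_sub /=; rewrite in_itv/= => /HB.
have Lcut := @ladder_cut e; have Ll := @ladder_cutl e; have Lr := @ladder_cutr e.
under eq_cint => x _.
  rewrite (cderive_cut _ _ LH) cut1E.
  rewrite (_ : _ * _ = cut e 0 x * (H 1 x * psi1 x) + (cutl e 1 x * G x + cutr e 1 x * G x)); last first.
    by rewrite /G; ring.
  over.
rewrite cintD//; [|exact: iT|by apply: cintegrableD => //; exact: iT].
rewrite cintD//; [|exact: iT|exact: iT].
have -> : cint J (fun x => psi2 x * (H 0%N x * cut e 0 x)) = cint J (fun x => cut e 0 x * (H 0%N x * psi2 x)).
  by apply: eq_cint => x _; ring.
have split1 j p : sqint J p -> cint J (fun x => (cut e 0 x - 1) * (H j x * p x)) =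
    cint J (fun x => cut e 0 x * (H j x * p x)) - cint J (fun x => H j x * p x).
  by move=> sp; rewrite -cintB//; [|exact: iT|exact: iH]; apply: eq_cint => x _; rewrite mulrBl mul1r.
rewrite split1// in b1; rewrite split1// in b2.
have cl : normc (cint J (fun x => G x * cutl e 1 x) - G 0 * cint J (cutl e 1)) <= 2 * (d * K).
  apply: (@concentrate G (cutl e 1) K e d e (G 0)) => //.
  - have := iT (cutl e) 1%N 0%N psi1 Ll s1; congr cintegrable; apply/funext => x; rewrite /G; ring.
  - by move=> x; eexists; exact: Ll.
  - lra.
  - lra.
  - exact: ltW.
  - by move=> x [xe|xe]; [apply: (cutl_out e0 _).2|apply: (cutl_in e0 _).2]; lra.
  - by move=> x; exact: (cutl_bound x e0).2.
  - move=> x /J01_sub /=; rewrite in_itv/= => x01 /andP[x1 x2]; apply: Hr0 => //.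
    by rewrite subr0 ger0_norm; lra.
  - by have := K1; lra.
have cr' : normc (cint J (fun x => G x * cutr e 1 x) - G 1 * cint J (cutr e 1)) <= 2 * (d * K).
  apply: (@concentrate G (cutr e 1) K e d (1 - 2 * e) (G 1)) => //.
  - have := iT (cutr e) 1%N 0%N psi1 Lr s1; congr cintegrable; apply/funext => x; rewrite /G; ring.
  - by move=> x; eexists; exact: Lr.
  - lra.
  - lra.
  - exact: ltW.
  - by move=> x [xe|xe]; [apply: (cutr_in e0 _).2|apply: (cutr_out e0 _).2]; lra.
  - by move=> x; exact: (cutr_bound x e0).2.
  - move=> x /J01_sub /=; rewrite in_itv/= => x01 /andP[x1 x2]; apply: Hr1 => //.
    by rewrite ler0_norm; lra.
  - by have := K1; lra.
rewrite cint_cutl// G0 mul0r subr0 in cl; rewrite cint_cutr// mulrN1 opprK in cr'.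
have -> : cint J (fun x => cutl e 1 x * G x) = cint J (fun x => G x * cutl e 1 x).
  by apply: eq_cint => x _; rewrite mulrC.
have -> : cint J (fun x => cutr e 1 x * G x) = cint J (fun x => G x * cutr e 1 x).
  by apply: eq_cint => x _; rewrite mulrC.
move: (cint J (fun x => G x * cutl e 1 x)) (cint J (fun x => G x * cutr e 1 x)) cl cr' => X1 X2.
move: (cint J (fun x => cut e 0 x * (H 1 x * psi1 x))) (cint J (fun x => cut e 0 x * (H 0 x * psi2 x))) b1 b2 => X3 X4.
move: (cint J (fun x => H 1 x * psi1 x)) (cint J (fun x => H 0 x * psi2 x)) => X5 X6 b1 b2 b3 b4 E.
have -> : X5 - G 1 + X6 = - (X3 - X5) - (X4 - X6) - X1 - (X2 + G 1).
  have -> : X4 = - (X3 + (X1 + X2)) by rewrite E opprK.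
  by ring.
have := normcDB (- (X3 - X5) - (X4 - X6) - X1) (X2 + G 1).
have := normcDB (- (X3 - X5) - (X4 - X6)) X1.
have := normcDB (- (X3 - X5)) (X4 - X6); rewrite normcN.
lra.
Qed.

(** The functions [H 0 * cut e] approximate [H 0] in H^1. Where the derivative of
    the cut-off has size [1 / e], the function [H 0] is [O(e)] since it vanishes at
    the end-points; so the error and its derivative stay bounded, and they live
    on a set of measure [4 e]. *)
Lemma smooth_H2_H10 (H : nat -> R -> C) : ladder setT H -> H 0%N 0 = 0 -> H 0%N 1 = 0 ->
  H2_H10 (H 0%N) (H 1%N) (H 2).
Proof.
move=> LH H00 H01; have K1' : 1 <= K := K1.
have sH n : sqint J (H n).
  apply: (sqintS mI mJ (@J01_sub R)); apply: sqint_cdiff => x _; eexists; exact: LH.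
have bd n : exists2 B, 0 <= B & forall x, 0 <= x <= 1 -> normc (H n x) <= B.
  by apply: cdiff_bounded => x; eexists; exact: LH.
have [B0 B00 HB0] := bd 0%N; have [B1 B10 HB1] := bd 1%N.
have lip x y : 0 <= x <= 1 -> 0 <= y <= 1 -> normc (H 0%N x - H 0%N y) <= 2 * B1 * `|x - y|.
  move=> x01 y01; apply: (@clipschitz _ _ (H 1%N)) => z; first by move=> _; exact: LH.
  move=> /andP[z1 z2]; apply: HB1; apply/andP; split.
    apply: le_trans z1; rewrite le_min; by case/andP: x01 => -> _; case/andP: y01 => ->.
  apply: le_trans z2 _; rewrite ge_max; by case/andP: x01 => _ ->; case/andP: y01 => _ ->.
split.
- by split; apply/memL_sqint.
- by split; apply: smooth_weak_derivative => x; [exact: LH|eexists; exact: LH|exact: LH|eexists; exact: LH].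
- split; apply: within_continuous_for => x _.
    exact: is_derive_continuous (@LH 1%N x Logic.I).1.
  exact: is_derive_continuous (@LH 1%N x Logic.I).2.
move=> d d0; pose M := (2 * K + 2) * (B0 + B1) + 8 * B1 * K + 1.
have M0 : 0 < M.
  have : 0 <= (2 * K + 2) * (B0 + B1) by apply: mulr_ge0; lra.
  have : 0 <= B1 * K by apply: mulr_ge0; lra.
  by rewrite /M; lra.
have [|N HN] := @eps_small _ (d ^+ 2 / (4 * M ^+ 2)).
  by rewrite divr_gt0 ?exprn_gt0// mulr_gt0// exprn_gt0.
have {HN} := HN N (leqnn N).
move: (@eps R N) (@eps_gt0 R N) (@eps_le4 R N) => e e0 e4 He.
have te := test_function_cut e0 e4 LH.
exists (fun x => H 0%N x * cut e 0 x) => //.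
pose i1 x : R := \1_(`[0, 2 * e]%classic) x; pose i2 x : R := \1_(`[1 - 2 * e, 1]%classic) x.
have key (g : R -> C) : sqint J g ->
    (forall x, 0 <= x <= 1 -> normc (g x) <= M) ->
    (forall x, 2 * e <= x <= 1 - 2 * e -> g x = 0) -> L2norm g < d.
  move=> sg gM g0; apply: L2norm_lt => //.
  have ri (b c : R) : rint J (\1_(`[b, c]%classic) : R -> R).
    apply: (@rint_dom _ _ _ (fun=> 1)) => //; last exact: rint_J01_cst.
    by move=> x _; rewrite indicE; case: (_ \in _); rewrite ?normr1 ?normr0.
  have r1 : rint J (fun x => M ^+ 2 * i1 x) by apply: rintZ => //; exact: ri.
  have r2 : rint J (fun x => M ^+ 2 * i2 x) by apply: rintZ => //; exact: ri.
  have M2 : 0 < M ^+ 2 by rewrite exprn_gt0.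
  apply: le_lt_trans (nsq_dom mJ sg _ (rintD mJ r1 r2)) _.
    move=> x /J01_sub/=; rewrite in_itv/= => /andP[x0 x1].
    have g2 : normc (g x) ^+ 2 <= M ^+ 2.
      by rewrite lerXn2r ?nnegrE ?normc_ge0 ?gM ?x0// ltW.
    have [h1|h1] := boolP (x \in `[0, 2 * e]).
      rewrite /i1 indicE mem_setE h1 mulr1.
      have : 0 <= M ^+ 2 * i2 x by rewrite /i2 indicE mulr_ge0// ltW.
      lra.
    have [h2|h2] := boolP (x \in `[1 - 2 * e, 1]).
      rewrite /i2 indicE mem_setE h2 mulr1.
      have : 0 <= M ^+ 2 * i1 x by rewrite /i1 indicE mulr_ge0// ltW.
      lra.
    rewrite g0; first by rewrite normc0 expr0n addr_ge0// mulr_ge0 ?(ltW M2)// /i1 /i2 indicE.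
    move: h1 h2; rewrite !in_itv/= x0 x1 andbT /= -!ltNge => h1 h2.
    by rewrite !ltW.
  have m1 (b c : R) : measurable_fun J (\1_(`[b, c]%classic) : R -> R) by exact: measurable_indic.
  rewrite RintegralD// (RintZ _ mJ (ri _ _)) (RintZ _ mJ (ri _ _)).
  have J1 : \int[mu]_(x in J) i1 x <= 2 * e - 0.
    by rewrite Rintegral_J01; [apply: Rintegral_indic_itv; lra|exact: m1].
  have J2 : \int[mu]_(x in J) i2 x <= 1 - (1 - 2 * e).
    by rewrite Rintegral_J01; [apply: Rintegral_indic_itv; lra|exact: m1].
  apply: (@le_lt_trans _ _ (e * (4 * M ^+ 2))); last by rewrite -ltr_pdivlMr// mulr_gt0.
  have : M ^+ 2 * \int[mu]_(x in J) i1 x <= M ^+ 2 * (2 * e) by apply: ler_wpM2l; [exact: ltW|lra].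
  have : M ^+ 2 * \int[mu]_(x in J) i2 x <= M ^+ 2 * (2 * e) by apply: ler_wpM2l; [exact: ltW|lra].
  lra.
have Lcut := @ladder_cut e.
have sJ (f : R -> C) : (forall x, exists d, cdiff f d x) -> sqint J f.
  by move=> Df; apply: (sqintS mI mJ (@J01_sub R)); apply: sqint_cdiff => x _; exact: Df.
have near_end x : 0 <= x <= 1 -> ~~ (2 * e <= x <= 1 - 2 * e) -> normc (H 0%N x) <= 2 * B1 * (2 * e).
  move=> x01; have /andP[x0 x1] := x01; rewrite negb_and -!ltNge => /orP[h|h].
    have := lip x 0 x01 _; rewrite H00 !subr0 lexx ler01 => /(_ isT) l.
    by apply: le_trans l _; apply: ler_wpM2l; rewrite ?mulr_ge0// ger0_norm// ltW.
  have := lip x 1 x01 _; rewrite H01 !subr0 lexx ler01 => /(_ isT) l.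
  apply: le_trans l _; apply: ler_wpM2l; rewrite ?mulr_ge0// ler0_norm; lra.
split; apply: key.
- apply: sJ => x; eexists; exact: cdiffB (@LH 0%N x Logic.I) (cdiffM (@LH 0%N x Logic.I) (@Lcut 0%N x Logic.I)).
- move=> x x01; have -> : H 0%N x - H 0%N x * cut e 0 x = - (H 0%N x * (cut e 0 x - 1)) by ring.
  rewrite normcN normcM.
  have : normc (H 0%N x) * normc (cut e 0 x - 1) <= B0 * (2 * K + 2).
    by apply: ler_pM; [exact: normc_ge0|exact: normc_ge0|exact: HB0|exact: cut_bound].
  have : 0 <= B1 * K by apply: mulr_ge0; lra.
  rewrite /M; lra.
- by move=> x xin; rewrite (cut_in e0 xin).1 mulr1 subrr.
- apply: sJ => x; exists (H 2 x - prodD H (cut e) 2 0 0 x).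
  apply: cdiffB; first exact: LH.
  have D := @ladder_prodD _ setT H (cut e) 0 0 LH Lcut 1%N x Logic.I.
  by apply: cdiff_ext D => y /=; rewrite (cderive_cut _ _ LH).
- move=> x x01; rewrite (cderive_cut _ _ LH).
  have -> : H 1%N x - (H 1%N x * cut e 0 x + H 0%N x * cut e 1 x) = - (H 1%N x * (cut e 0 x - 1)) - H 0%N x * cut e 1 x by ring.
  apply: le_trans (normcDB _ _) _; rewrite normcN !normcM.
  have b1 : normc (H 1%N x) * normc (cut e 0 x - 1) <= B1 * (2 * K + 2).
    by apply: ler_pM; [exact: normc_ge0|exact: normc_ge0|exact: HB1|exact: cut_bound].
  have b2 : normc (H 0%N x) * normc (cut e 1 x) <= 8 * B1 * K.
    have [xin|xout] := boolP (2 * e <= x <= 1 - 2 * e).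
      rewrite (cut_in e0 xin).2 normc0 mulr0; apply: mulr_ge0; [apply: mulr_ge0|]; lra.
    have c1 : normc (cut e 1 x) <= 2 * K / e.
      rewrite cut1E; apply: le_trans (normcD _ _) _.
      by have := (cutl_bound x e0).2; have := (cutr_bound x e0).2; lra.
    have -> : 8 * B1 * K = 2 * B1 * (2 * e) * (2 * K / e) by field; rewrite gt_eqF.
    by apply: ler_pM => //; [exact: normc_ge0|exact: normc_ge0|exact: near_end].
  have : 0 <= B0 * (2 * K + 2) by apply: mulr_ge0; lra.
  rewrite /M; lra.
- move=> x xin; rewrite (cderive_cut _ _ LH) (cut_in e0 xin).1 (cut_in e0 xin).2.
  by rewrite mulr1 mulr0 addr0 subrr.
Qed.

End WeakForm.

(** * From a smooth solution at positive times to a solution from time 0 *)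
Section TimeEvolution.
Context {R : realType}.
Local Notation C := R[i].
Local Notation Re := (@complex.Re R).
Local Notation Im := (@complex.Im R).
Local Notation normc := (@Normc.normc R).
Local Notation ii := (Complex 0 1 : R[i]).
Local Notation I := (`[0%R, 1%R]%classic : set R).
Local Notation J := (@J01 R).
Implicit Types (f g h : R -> C) (x y t a e d r : R).

Let mJ := @measurable_J01 R.
Let mI : measurable I. Proof. exact: measurable_itv. Qed.

Lemma sqint_IJ f : sqint I f -> sqint J f.
Proof. exact: (sqintS mI mJ (@J01_sub R)). Qed.

Lemma cint_prod_le f g l : sqint J f -> sqint J g -> 0 < l ->
  normc (cint J (fun x => f x * g x)) <= l * nsq J f + l^-1 * nsq J g.
Proof.
move=> [mf if2] [mg ig2] l0.
have i1 : rint J (fun x => l / 2 * normc (f x) ^+ 2) by exact: rintZ.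
have i2 : rint J (fun x => (2 * l)^-1 * normc (g x) ^+ 2) by exact: rintZ.
apply: le_trans (@normc_cint_le _ J _ (fun x => l / 2 * normc (f x) ^+ 2 + (2 * l)^-1 * normc (g x) ^+ 2) mJ _ _ _) _.
- exact: cmeasM.
- by move=> x _; rewrite normcM; exact: amgm.
- exact: rintD.
- rewrite RintegralD// !RintZ// -/(nsq J f) -/(nsq J g) invfM; lra.
Qed.

Lemma cint_pairing_small g d : sqint J g -> 0 < d ->
  exists2 e, 0 < e & forall f, sqint J f -> nsq J f <= e -> normc (cint J (fun x => f x * g x)) <= d.
Proof.
move=> sg d0; pose N := nsq J g; have N0 : 0 <= N by exact: nsq_ge0.
pose l := 2 * (N + 1) / d; have l0 : 0 < l by rewrite divr_gt0// mulr_gt0//; lra.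
exists (d / (2 * l)); first by rewrite divr_gt0// mulr_gt0.
move=> f sf nf; apply: le_trans (cint_prod_le sf sg l0) _.
have h1 : l * nsq J f <= d / 2.
  have -> : d / 2 = l * (d / (2 * l)) by field; rewrite gt_eqF.
  by rewrite ler_pM2l.
have h2 : l^-1 * N <= d / 2.
  have -> : d / 2 = l^-1 * (N + 1) by rewrite /l; field; rewrite !gt_eqF//; lra.
  by rewrite ler_pM2l ?invr_gt0// lerDl.
by rewrite -/N; lra.
Qed.

Lemma cintegrable_prod f g : sqint J f -> sqint J g -> cintegrable J (fun x => f x * g x).
Proof.
move=> [mf if2] [mg ig2].
apply: (@cintegrable_dom _ J _ (fun x => 1 / 2 * normc (f x) ^+ 2 + (2 * 1)^-1 * normc (g x) ^+ 2)) => //.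
- exact: cmeasM.
- by move=> x _; rewrite normcM; exact: amgm.
- by apply: rintD => //; exact: rintZ.
Qed.

Lemma cint_prodB f1 f2 g : sqint J f1 -> sqint J f2 -> sqint J g ->
  cint J (fun x => (f1 x - f2 x) * g x) = cint J (fun x => f1 x * g x) - cint J (fun x => f2 x * g x).
Proof.
move=> s1 s2 sg; rewrite -cintB//; try exact: cintegrable_prod.
by apply: eq_cint => x _; rewrite mulrBl.
Qed.

Lemma continuousL2P T (th : R -> R -> C) :
  (forall t, 0 <= t <= T -> sqint J (th t)) ->
  (forall t0 e, 0 <= t0 <= T -> 0 < e -> exists2 d, 0 < d &
    forall t, 0 <= t <= T -> `|t - t0| < d -> nsq J (fun x => th t x - th t0 x) <= e) ->
  continuousL2 T th.
Proof.
move=> S H; split; first by move=> t tT; apply/memL_sqint; exact: S.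
move=> t0 t0T; apply/cvgrPdist_le => e e0.
have [|d d0 Hd] := H t0 (e ^+ 2) t0T; first by rewrite exprn_gt0.
have N : nbhs t0 (fun t : R => `[0, T]%classic t -> `|0 - L2norm (fun x => th t x - th t0 x)| <= e); last exact: N.
apply/nbhs_ballP; exists d => // t td; rewrite /= in_itv/= => tT.
rewrite sub0r normrN /L2norm ger0_norm ?sqrtr_ge0//.
rewrite -[e]ger0_norm ?(ltW e0)// -sqrtr_sqr ler_sqrt ?sqr_ge0//.
by apply: Hd => //; rewrite distrC.
Qed.

Lemma continuousL2_modulus T (th : R -> R -> C) : continuousL2 T th ->
  (forall t, 0 <= t <= T -> sqint J (th t)) /\
  (forall t0 e, 0 <= t0 <= T -> 0 < e -> exists2 d, 0 < d &
    forall t, 0 <= t <= T -> `|t - t0| < d -> nsq J (fun x => th t x - th t0 x) <= e).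
Proof.
move=> [S H]; split; first by move=> t tT; apply/memL_sqint; exact: S.
move=> t0 e t0T e0; have se : 0 < Num.sqrt e by rewrite sqrtr_gt0.
have /cvgrPdist_lt/(_ _ se) := H t0 t0T.
move=> N; have {N} : nbhs t0 (fun t : R => `[0, T]%classic t -> `|0 - L2norm (fun x => th t x - th t0 x)| < Num.sqrt e) by exact: N.
move=> /nbhs_ballP[d d0 Hd]; exists d => // t tT td.
have := Hd t; rewrite /ball/= in_itv/= distrC => /(_ td) /(_ tT).
rewrite sub0r normrN ger0_norm ?sqrtr_ge0// => /nsq_lt.
by rewrite sqr_sqrtr ?(ltW e0)// => /ltW.
Qed.

Lemma cint_tail (a t : R) (F : R -> C) : 0 < a -> a <= t ->
  cint `]0, t] (fun r => (if r < a then 0 else 1) * F r) = cint `[a, t] F.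
Proof.
move=> a0 at_.
have E : (`[a, t]%classic : set R) = `]0, t]%classic `&` `[a, +oo[%classic.
  apply/seteqP; split => y /=; rewrite !in_itv/= ?andbT; last by move=> [/andP[_ ->] ->].
  by move=> /andP[ay ->]; rewrite (lt_le_trans a0 ay) ay.
rewrite /cint; congr Complex; rewrite E /Rintegral integral_mkcondr; congr fine;
  apply: eq_integral => y _; rewrite patchE mem_setE in_itv/= andbT ltNge;
  by case: (a <= y); rewrite /= ?mul1r ?mul0r.
Qed.

Lemma cint_cc_oc (t : R) (F : R -> C) : cmeas `]0, t] F -> cint `[0, t] F = cint `]0, t] F.
Proof.
move=> [m1 m2]; rewrite /cint /Rintegral; congr Complex; congr fine;
  by rewrite integral_itv_obnd_cbnd//; apply/measurable_EFinP.
Qed.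

(** A smooth solution for positive times with all its derivatives, of order [p] in
    t and [q] in x. The bounds may blow up as t tends to 0; the only information at
    that end is the L^2 convergence [init]. *)
Variable Th : nat -> nat -> R -> R -> C.
Hypothesis Th_dt : forall p q t x, 0 < t -> cdiff (fun y => Th p q y x) (Th p.+1 q t x) t.
Hypothesis Th_dx : forall p q t x, 0 < t -> cdiff (Th p q t) (Th p q.+1 t x) x.
Hypothesis Th_bound : forall p q e, 0 < e -> exists2 K, 0 <= K & forall t x, e < t -> 0 <= x <= 1 ->
  normc (Th p q t x) <= K.
Hypothesis Th_pde : forall p q t x, 0 < t -> Th p q.+2 t x = - ii * Th p.+1 q t x.
Hypothesis Th_x0 : forall p t, Th p 0 t 0 = 0.

Lemma Th_ladder p t : 0 < t -> ladder setT (fun q => Th p q t).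
Proof. by move=> t0 q x _; exact: Th_dx. Qed.

Lemma sqint_Th p q t : 0 < t -> sqint J (Th p q t).
Proof. by move=> t0; apply: sqint_IJ; apply: sqint_cdiff => x _; eexists; exact: Th_dx. Qed.

Lemma cmeas_Th p q t : 0 < t -> cmeas J (Th p q t).
Proof. by move=> t0; have [] := sqint_Th p q t0. Qed.

Lemma cdiff_pairing p q g t : sqint J g -> 0 < t ->
  cdiff (fun t => cint J (fun x => Th p q t x * g x)) (cint J (fun x => Th p.+1 q t x * g x)) t.
Proof.
move=> sg t0; have t2 : 0 < t / 2 by rewrite divr_gt0.
have [K0 K00 H0] := Th_bound p q t2.
have [K1 K10 H1] := Th_bound p.+1 q t2.
have [K2 K20 H2] := Th_bound p.+2 q t2.
have b y : `|y - t| < t / 2 -> t / 2 < y by rewrite ltr_distlC => /andP[]; lra.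
have b0 y : `|y - t| < t / 2 -> 0 < y by move=> /b; lra.
have Kle x : J x -> 0 <= x <= 1 by move/J01_sub; rewrite /= in_itv.
apply: (@cdiff_cint _ J (Th p q) (Th p.+1 q) (Th p.+2 q) g t (t / 2) (K0 + K1 + K2)) => //.
- exact: sqint_cintegrableJ.
- by move=> y /b0; exact: cmeas_Th.
- by move=> y /b0; exact: cmeas_Th.
- by move=> x y _ /b0 y0; exact: Th_dt.
- by move=> x y _ /b0 y0; exact: Th_dt.
- by move=> x y /Kle x01 /b yt; have := H0 y x yt x01; lra.
- by move=> x y /Kle x01 /b yt; have := H1 y x yt x01; lra.
- by move=> x y /Kle x01 /b yt; have := H2 y x yt x01; lra.
Qed.

Variables (T : R) (th0 u : R -> C) (th : R -> R -> C).
Hypothesis sth0 : sqint J th0.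
Hypothesis thE : forall t x, 0 < t <= T -> 0 <= x <= 1 -> th t x = Th 0 0 t x.
Hypothesis uE : forall t, 0 < t <= T -> u t = Th 0 0 t 1.
Hypothesis th00 : forall x, J x -> th 0 x = th0 x.
Hypothesis init : forall e, 0 < e -> exists2 d, 0 < d &
  forall t, 0 < t -> t <= T -> t < d -> nsq J (fun x => Th 0 0 t x - th0 x) <= e.
Hypothesis iu : cintegrable `]0, T] u.

Let Jb x : J x -> 0 <= x <= 1. Proof. by move/J01_sub; rewrite /= in_itv. Qed.

Lemma eq_sqint f g : (forall x, J x -> f x = g x) -> sqint J f -> sqint J g.
Proof.
move=> E [[m1 m2] if2].
have mg : cmeas J g.
  split; [apply: eq_measurable_fun m1|apply: eq_measurable_fun m2];
    by move=> x /set_mem Jx; rewrite E.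
apply: (sqint_dom mJ mg _ if2) => x Jx; by rewrite E.
Qed.

Lemma sqint_th t : 0 <= t <= T -> sqint J (th t).
Proof.
move=> /andP[]; rewrite le_eqVlt => /predU1P[<- _|t0 tT].
  by apply: eq_sqint sth0 => x Jx; rewrite th00.
by apply: eq_sqint (sqint_Th 0 0 t0) => x Jx; rewrite thE ?t0// Jb.
Qed.

Lemma solution_continuousL2 : continuousL2 T th.
Proof.
apply: continuousL2P; first exact: sqint_th.
move=> t0 e /andP[]; rewrite le_eqVlt => /predU1P[<- _|t00 t0T] e0.
  have [d d0 Hd] := init e0; exists d => // t /andP[]; rewrite le_eqVlt => /predU1P[<-|t1 tT].
    move=> _ _; apply: le_trans (ltW e0); rewrite (@eq_nsq _ _ _ (fun=> 0)).
      by rewrite /nsq; under eq_Rintegral do rewrite normc0 expr0n/=; rewrite Rintegral_J01_cst.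
    by move=> x _; rewrite subrr.
  rewrite subr0 gtr0_norm// => td; apply: le_trans (Hd t t1 tT td).
  rewrite le_eqVlt; apply/orP; left; apply/eqP; apply: eq_nsq => x Jx.
  by rewrite thE ?t1 ?Jb// th00.
have t2 : 0 < t0 / 2 by rewrite divr_gt0.
have [K K0 HK] := Th_bound 1%N 0%N t2.
pose M := 2 * K + 1; have M0 : 0 < M by rewrite /M; lra.
exists (Num.min (t0 / 2) (Num.sqrt e / M)).
  by rewrite lt_min t2 divr_gt0// sqrtr_gt0.
move=> t /andP[t_0 tT]; rewrite lt_min => /andP[d1 d2].
have tt : t0 / 2 < t by move: d1; rewrite ltr_distlC => /andP[]; lra.
have t1 : 0 < t by exact: lt_trans tt.
have s1 := sqintB mJ (sqint_th (t := t) _) (sqint_th (t := t0) _).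
apply: le_trans (nsq_dom (u := fun=> e) mJ (s1 _ _) _ (rint_J01_cst _)) _; rewrite ?(ltW t1) ?(ltW t00)//.
  move=> x Jx; rewrite !thE ?t1 ?t00 ?Jb//.
  have l : normc (Th 0 0 t x - Th 0 0 t0 x) <= 2 * K * `|t - t0|.
    apply: (@clipschitz _ (fun y => Th 0 0 y x) (fun y => Th 1 0 y x)) => z /andP[z1 _].
      apply: Th_dt; apply: lt_le_trans z1; by rewrite lt_min t1 t00.
    apply: HK; last exact: Jb.
    by apply: lt_le_trans z1; rewrite lt_min tt andbT; lra.
  have l2 : normc (Th 0 0 t x - Th 0 0 t0 x) <= Num.sqrt e.
    apply: le_trans l _; apply: (@le_trans _ _ (M * `|t - t0|)).
      by apply: ler_wpM2r => //; rewrite /M; lra.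
    by rewrite mulrC -ler_pdivlMr// ltW.
  by rewrite -[leRHS](sqr_sqrtr (ltW e0)) lerXn2r ?nnegrE ?normc_ge0 ?sqrtr_ge0.
by rewrite Rintegral_J01_cst.
Qed.

Lemma nsq_Th_bounded : exists2 B, 0 <= B & forall t, 0 < t <= T -> nsq J (Th 0 0 t) <= B.
Proof.
have [d d0 Hd] := init ltr01.
have d2 : 0 < d / 2 by rewrite divr_gt0.
have [K K0 HK] := Th_bound 0%N 0%N d2.
exists (2 * nsq J th0 + 2 + K ^+ 2).
  by have := nsq_ge0 J th0; have := sqr_ge0 K; lra.
move=> t /andP[t0 tT]; have [td|td] := ltP t d; last first.
  apply: le_trans (nsq_dom (u := fun=> K ^+ 2) mJ (sqint_Th 0 0 t0) _ (rint_J01_cst _)) _.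
    by move=> x Jx; rewrite lerXn2r ?nnegrE ?normc_ge0// HK// ?Jb//; lra.
  by rewrite Rintegral_J01_cst; have := nsq_ge0 J th0; lra.
rewrite (@eq_nsq _ _ _ (fun x => th0 x + (Th 0 0 t x - th0 x))); last first.
  by move=> x _; congr normc; ring.
apply: le_trans (nsqD_le mJ sth0 (sqintB mJ (sqint_Th 0 0 t0) sth0)) _.
by have := Hd t t0 tT td; have := sqr_ge0 K; lra.
Qed.

Section Identity.
Variables psi psi1 psi2 : R -> C.
Hypotheses (spsi : sqint J psi) (spsi2 : sqint J psi2).
Hypothesis green : forall H : nat -> R -> C, ladder setT H -> H 0%N 0 = 0 ->
  cint J (fun x => H 2 x * psi x) = cint J (fun x => H 0 x * psi2 x) - H 0 1 * psi1 1.

Let F t := cint J (fun x => Th 0 0 t x * psi x).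
Let g t := cint J (fun x => Th 0 0 t x * psi2 x) - Th 0 0 t 1 * psi1 1.

Let cdiffF t : 0 < t -> cdiff F (ii * g t) t.
Proof.
move=> t0; have := cdiff_pairing 0 0 spsi t0.
rewrite /g -(green (Th_ladder 0 t0) (Th_x0 0 t)).
rewrite (@eq_cint _ _ (fun x => Th 0 2 t x * psi x) (fun x => (- ii) * (Th 1 0 t x * psi x))); last first.
  by move=> x _; rewrite Th_pde// mulrA.
rewrite cintZ//; last exact: cintegrable_prod (sqint_Th _ _ t0) spsi.
by rewrite mulrA mulrN iiM opprK mul1r.
Qed.

Let cdiffg t : 0 < t -> exists d : C, cdiff g d t.
Proof.
move=> t0; eexists; apply: cdiffB; first exact: cdiff_pairing.
exact: cdiffM (Th_dt 0 0 1 t0) (cdiff_cst (psi1 1) t).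
Qed.

Lemma cintegrable_rate t : 0 <= t <= T -> cintegrable `]0, t] g.
Proof.
move=> /andP[t0 tT]; have [B B0 HB] := nsq_Th_bounded.
have mg : cmeas `]0, t] g.
  have oU : open (`]0, +oo[%classic : set R) by exact: interval_open.
  apply: cmeasS (cmeas_open oU _); first exact: measurable_itv.
    by move=> r /=; rewrite !in_itv/= andbT => /andP[].
  by move=> r; rewrite /= in_itv/= andbT => r0; exact: cdiffg.
have sub : `]0, t]%classic `<=` (`]0, T]%classic : set R).
  by move=> r /=; rewrite !in_itv/= => /andP[-> rt]; exact: le_trans tT.
have iu' : cintegrable `]0, t] u.
  by have [i1 i2] := iu; split; apply: rintS sub _; rewrite ?measurable_itv//; exact: measurable_itv.
have iN := cintegrable_normc (measurable_itv _) iu'.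
have ic : rint `]0, t] (fun=> B + nsq J psi2).
  apply: rintS (rint_cst 0 t _); rewrite ?measurable_itv//; try exact: measurable_itv.
  by move=> r /=; rewrite !in_itv/= => /andP[r0 ->]; rewrite ltW.
apply: (@cintegrable_dom _ _ _ (fun r => B + nsq J psi2 + normc (psi1 1) * normc (u r))) => //.
- move=> r /sub/=; rewrite in_itv/= => r0T; have /andP[r0 rT] := r0T.
  rewrite /g uE// mulrC; apply: le_trans (normcDB _ _) _; rewrite [normc (psi1 1 * _)]normcM.
  rewrite lerD2r; apply: le_trans (cint_prod_le (sqint_Th 0 0 r0) spsi2 ltr01) _.
  by rewrite invr1 !mul1r lerD2r; exact: HB.
- by apply: rintD => //; exact: rintZ.
Qed.

(** On [[a, t]] with [a > 0] this is the fundamental theorem of calculus, the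
    derivative of the pairing with [psi] being computed by Green's formula. As [a]
    tends to 0 the left-hand side converges by [init] and the integral because its
    integrand is integrable up to 0. *)
Lemma weak_identity t : 0 <= t <= T ->
  cint J (fun x => th t x * psi x) = cint J (fun x => th0 x * psi x) +
  ii * cint `[0, t] (fun r => cint J (fun x => th r x * psi2 x) - u r * psi1 1).
Proof.
move=> tT; have /andP[t0 tT'] := tT; have ig := cintegrable_rate tT.
have mD : measurable (`]0, t]%classic : set R) by exact: measurable_itv.
have Eg r : `]0, t]%classic r -> cint J (fun x => th r x * psi2 x) - u r * psi1 1 = g r.
  rewrite /= in_itv/= => /andP[r0 rt]; have rT : r <= T by exact: le_trans tT'.
  rewrite /g uE ?r0//; congr (_ - _); apply: eq_cint => x Jx.
  by rewrite thE ?r0// Jb.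
rewrite cint_cc_oc; last first.
  have [m1 m2] := cint_meas ig; split; [apply: eq_measurable_fun m1|apply: eq_measurable_fun m2];
    by move=> r /set_mem Dr; rewrite Eg.
rewrite (eq_cint Eg); move: t0; rewrite le_eqVlt => /predU1P[t0|t0].
  rewrite -t0 set_itv_ge; last by rewrite bnd_simp ltxx.
  rewrite /cint !Rintegral_set0 -/(0 : C) mulr0 addr0.
  by congr Complex; apply: eq_Rintegral => x /set_mem Jx; rewrite th00.
have -> : cint J (fun x => th t x * psi x) = F t.
  by apply: eq_cint => x Jx; rewrite thE ?t0// Jb.
(* indicators of the initial intervals that are left out *)
pose w n r : C := if r < eps n then 1 else 0.
have mw n : cmeas `]0, t] (w n).
  have m : measurable_fun (`]0, t]%classic : set R) (\1_(`]-oo, eps n[%classic) : R -> R) by exact: measurable_indic.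
  have := cmeas_rc m; congr cmeas; apply/funext => y.
  by rewrite /w indicE mem_setE in_itv/=; case: ifP.
have wb n r : `]0, t]%classic r -> normc (w n r) <= 1.
  by move=> _; rewrite /w; case: ifP; rewrite ?normc1 ?normc0.
have w0 r : `]0, t]%classic r -> exists N : nat, forall n, (N <= n)%N -> w n r = 0.
  rewrite /= in_itv/= => /andP[r0 _]; have [N HN] := eps_small r0.
  by exists N => n Nn; rewrite /w ltNge ltW ?HN.
apply/eqP; rewrite -subr_eq0 -normc_eq0 eq_le normc_ge0 andbT leNgt; apply/negP.
set z := _ - _; move=> z0; pose d := normc z / 4; have d0 : 0 < d by rewrite divr_gt0.
have [N1 H1] := cint_mult_cvg0 mD ig mw wb w0 d0.
have [e e0 He] := cint_pairing_small spsi d0.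
have [d' d'0 Hd'] := init e0.
have [|N2 H2] := @eps_small _ (Num.min t d'); first by rewrite lt_min t0.
pose n := maxn N1 N2; have {H1} := H1 n (leq_maxl _ _).
have := H2 n (leq_maxr _ _); rewrite lt_min => /andP[et ed].
have en := @eps_gt0 R n.
have h2 : normc (F (eps n) - cint J (fun x => th0 x * psi x)) <= d.
  rewrite /F -cint_prodB//; last exact: sqint_Th.
  by apply: He; [apply: sqintB => //; exact: sqint_Th|apply: Hd' => //; rewrite (le_trans _ tT')// ltW].
have E : F t - F (eps n) = ii * (cint `]0, t] g - cint `]0, t] (fun r => w n r * g r)).
  rewrite -(@cftc _ F (fun r => ii * g r) _ _ (ltW et)); first last.
  - move=> r /andP[er _]; have [|d2 D2] := @cdiffg r; first exact: lt_le_trans er.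
    by eexists; exact: cdiffZ D2.
  - by move=> r /andP[er _]; apply: cdiffF; exact: lt_le_trans er.
  have ig' : cintegrable `[eps n, t] g.
    by apply: cintegrable_cdiff => r /andP[er _]; apply: cdiffg; exact: lt_le_trans er.
  rewrite cintZ//; congr (_ * _).
  have iwg : cintegrable `]0, t] (fun r => w n r * g r) by exact: cintegrable_bounded (wb n).
  rewrite -cintB// -(cint_tail g en (ltW et)); apply: eq_cint => r _.
  by rewrite /w; case: ifP => _; rewrite ?mul0r ?mul1r ?subr0 ?subrr.
move=> h1.
have : normc z <= 2 * d.
  have -> : z = (F (eps n) - cint J (fun x => th0 x * psi x)) - ii * cint `]0, t] (fun r => w n r * g r).
    by rewrite /z -[F t](subrK (F (eps n))) E; ring.
  apply: le_trans (normcDB _ _) _; rewrite normcM normc_i mul1r; lra.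
by rewrite /d; lra.
Qed.

End Identity.

End TimeEvolution.

(** * Completeness of the sine functions *)
Section Uniqueness.
Context {R : realType}.
Local Notation C := R[i].
Local Notation Re := (@complex.Re R).
Local Notation Im := (@complex.Im R).
Local Notation normc := (@Normc.normc R).
Local Notation ii := (Complex 0 1 : R[i]).
Local Notation rc := (real_complex R).
Local Notation mu := (@lebesgue_measure R).
Local Notation J := (@J01 R).
Implicit Types (f g h : R -> C) (x y t a b d r : R).

Let mJ := @measurable_J01 R.

(** The primitive [A] of [a] satisfies [A' = - i kap A], so its modulus is constant,
    and it vanishes at 0. The function [a] is extended by constants outside
    [[0, T]] in order to have a primitive differentiable at 0 and [T]. *)
Lemma imaginary_volterra (T kap : R) (a : R -> C) : 0 < T ->
  (forall t0, 0 <= t0 <= T -> forall d, 0 < d -> exists2 r : R, 0 < r &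
    forall t, 0 <= t <= T -> `|t - t0| < r -> normc (a t - a t0) <= d) ->
  (forall t, 0 <= t <= T -> a t = - ii * rc kap * cint `[0, t] a) ->
  forall t, 0 <= t <= T -> a t = 0.
Proof.
move=> T0 ca Ea; have T0' := ltW T0.
pose pr r := Num.max 0 (Num.min T r).
have prI r : 0 <= pr r <= T.
  by rewrite /pr le_max lexx /= ge_max T0' /= ge_min lexx.
have pr_id r : 0 <= r <= T -> pr r = r.
  by move=> /andP[r0 rT]; rewrite /pr min_r// max_r.
have pr_lip r r' : `|pr r - pr r'| <= `|r - r'|.
  have := ler_norm (r - r'); have := ler_norm (- (r - r')); rewrite normrN => h1 h2.
  rewrite /pr; case: (leP T r) => h3; case: (leP T r') => h4;
    (rewrite ?(max_r T0')); try (case: (leP 0 r) => h5); try (case: (leP 0 r') => h6);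
    rewrite ler_norml; apply/andP; split; lra.
pose aa r := a (pr r).
have caa (p : C -> R) : (forall z w, `|p z - p w| <= normc (z - w)) -> continuous (fun r => p (aa r)).
  move=> lp r0; apply/cvgrPdist_le => d d0; have [r r_0 H] := ca _ (prI r0) d d0.
  apply/nbhs_ballP; exists r => // y yr; rewrite distrC; apply: le_trans (lp _ _) _.
  by apply: H => //; apply: le_lt_trans (pr_lip _ _) _; rewrite distrC.
have c1 : continuous (fun r => Re (aa r)).
  by apply: caa => z w; rewrite -ReB normc_Re.
have c2 : continuous (fun r => Im (aa r)).
  by apply: caa => z w; rewrite -ImB normc_Im.
pose A r : C := Complex (prim (fun r => Re (aa r)) (-1) r - prim (fun r => Re (aa r)) (-1) 0)
                        (prim (fun r => Im (aa r)) (-1) r - prim (fun r => Im (aa r)) (-1) 0).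
have DA r : 0 <= r -> cdiff A (aa r) r.
  move=> r0; have r1 : -1 < r by rewrite (lt_le_trans _ r0)// ltrN10.
  split; apply: is_derive_eq (is_deriveB (is_derive_prim _ r1) (is_derive_cst _ r 1)) _ => //;
    by rewrite subr0.
have AE t : 0 <= t <= T -> cint `[0, t] a = A t.
  move=> /andP[t0 tT].
  have Hid x : is_derive x 1 (fun b : R => b) 1 by exact: is_derive_id.
  have P (q : R -> R) : continuous q -> \int[mu]_(r in `[0, t]) q r = prim q (-1) t - prim q (-1) 0.
    move=> cq; transitivity (\int[mu]_(r in `[0, t]) (q r * 1)).
      by apply: eq_Rintegral => x _; rewrite mulr1.
    rewrite (@prim_chain _ q (fun b => b) (fun=> 1) 0 t (-1) t0 cq _
      (fun x _ => Hid x) (fun x _ => is_derive_continuous (is_derive_cst (1 : R) x 1)))//.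
    by move=> x /andP[x0 _]; rewrite (lt_le_trans _ x0)// ltrN10.
  rewrite (@eq_cint _ _ _ aa); last first.
    move=> r; rewrite /= in_itv/= => /andP[r0 rt]; rewrite /aa pr_id// r0/=.
    exact: le_trans tT.
  by rewrite /cint (P _ c1) (P _ c2).
have Eaa t : 0 <= t <= T -> aa t = - ii * rc kap * A t.
  by move=> tT; rewrite /aa pr_id// Ea// AE.
move=> t tT; rewrite Ea// AE//; have /andP[t0 tT'] := tT.
have [z /andP[z0 zt] Ez] := @mean_value_le _ (fun r => normc (A r) ^+ 2)
   (fun r => 2 * (Re (A r) * Re (aa r) + Im (A r) * Im (aa r))) 0 t t0
   (fun r hr => is_derive_normc2 (DA r (andP hr).1)).
have A0 : A 0 = 0 by rewrite /A !subrr.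
have zT : 0 <= z <= T by rewrite z0 (le_trans zt).
have Er : Re (A z) * Re (aa z) + Im (A z) * Im (aa z) = 0.
  rewrite Eaa//; have -> : - ii * rc kap * A z = rc kap * (- (ii * A z)) by ring.
  by rewrite Re_rcM Im_rcM; case: (A z) => p q /=; ring.
have z2 : 0 ^+ 2 = 0 :> R by rewrite expr0n.
move: Ez; rewrite Er mulr0 mul0r A0 normc0 z2 subr0 => /eqP.
by rewrite sqrf_eq0 normc_eq0 => /eqP ->; rewrite mulr0.
Qed.

Let theta x : R := pi * x.

Lemma cmeas_trig (p : R -> R) (dp : R -> R) : (forall x, is_derive x 1 p (dp x)) -> cmeas J (fun x => rc (p x)).
Proof. by move=> Dp; apply: (@cmeas_cdiff _ _ _ (fun x => rc (dp x))) => // x; exact: cdiff_rc. Qed.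

Lemma bernoulli_le (y : R) N : -1 <= y -> 1 + N%:R * y <= (1 + y) ^+ N.
Proof.
move=> y1; elim: N => [|N IH]; first by rewrite mul0r addr0 expr0.
rewrite exprS; apply: le_trans (_ : (1 + y) * (1 + N%:R * y) <= _); last first.
  by apply: ler_wpM2l => //; lra.
rewrite -natr1; have : 0 <= N%:R * (y * y) by rewrite mulr_ge0// -expr2 sqr_ge0.
lra.
Qed.

(** By Bernoulli's inequality the polynomials [(1 - z^n)^(2^n)] tend to 1 for
    [z < 1/2] and to 0 for [z > 1/2], while staying in [[0, 1]]: they approximate a
    step boundedly. *)
Lemma step_power_low (z : R) n : 0 <= z <= 1 -> 0 <= 1 - (1 - z ^+ n) ^+ (2 ^ n) <= (2 * z) ^+ n.
Proof.
move=> /andP[z0 z1]; have zn : 0 <= z ^+ n <= 1 by rewrite exprn_ge0//= exprn_ile1.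
have /andP[zn0 zn1] := zn.
have := @bernoulli_le (- z ^+ n) (2 ^ n); rewrite exprMn natrX mulrN => H.
have {}H := H _; apply/andP; split.
  by rewrite subr_ge0 exprn_ile1//; lra.
by have := H; rewrite lerN2 => /(_ zn1); lra.
Qed.

Lemma step_power_high (z : R) n : 0 < z <= 1 -> 0 <= (1 - z ^+ n) ^+ (2 ^ n) <= (2 * z)^-1 ^+ n.
Proof.
move=> /andP[z0 z1]; have zn : 0 < z ^+ n <= 1 by rewrite exprn_gt0//= exprn_ile1// ltW.
have /andP[zn0 zn1] := zn; set y := z ^+ n in zn zn0 zn1 *.
have v0 : 0 <= (1 - y) ^+ (2 ^ n) by rewrite exprn_ge0//; lra.
rewrite v0/=; have H := @bernoulli_le y (2 ^ n); have {}H : 2 ^+ n * y <= (1 + y) ^+ (2 ^ n).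
  by rewrite -natrX; apply: le_trans (H _); lra.
have p0 : 0 < 2 ^+ n * y by rewrite mulr_gt0// exprn_gt0.
rewrite exprVn exprMn -/y -[_^-1]mul1r ler_pdivlMr//.
apply: le_trans (ler_wpM2l v0 H) _.
rewrite -exprMn exprn_ile1//; nra.
Qed.

Lemma exprn_small (q d : R) : 0 <= q < 1 -> 0 < d -> exists N : nat, forall n, (N <= n)%N -> q ^+ n <= d.
Proof.
move=> /andP[q0 q1] d0; have q1' : `|q| < 1 by rewrite ger0_norm.
have /cvgrPdist_le/(_ _ d0) [N _ HN] := cvg_expr q1'.
by exists N => n Nn; have := HN n Nn; rewrite /= sub0r normrN ger0_norm ?exprn_ge0.
Qed.

Section Completeness.
Variable w : R -> C.
Hypothesis sw : sqint J w.
Hypothesis orth : forall n : nat, cint J (fun x => w x * rc (sin (n%:R * theta x))) = 0.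

Lemma Dtheta (k x : R) : is_derive x 1 (fun x => k * theta x) (k * pi).
Proof. exact: is_derive_eq (is_derive1_comp (is_derive_linear k _) (is_derive_linear pi x)) _. Qed.

Lemma Dsin (k x : R) : is_derive x 1 (fun x => sin (k * theta x)) (cos (k * theta x) * (k * pi)).
Proof. exact: is_derive1_comp (is_derive_sin _) (Dtheta k x). Qed.

Lemma Dcos (x : R) : is_derive x 1 (fun x => cos (theta x)) (- sin (theta x) * pi).
Proof. exact: is_derive1_comp (is_derive_cos _) (is_derive_linear pi x). Qed.

Lemma mcosX k : cmeas J (fun x => rc (cos (theta x) ^+ k)).
Proof.
apply: cmeas_rc; apply: measurable_funX; apply: (@measurable_funS _ _ _ _ setT) => //.
by apply: continuous_measurable_fun => x; exact: is_derive_continuous (Dcos x).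
Qed.

Lemma msin k : cmeas J (fun x => rc (sin (k * theta x))).
Proof. by apply: cmeas_trig => x; exact: Dsin. Qed.

Lemma cos_le x : `|cos x| <= 1 :> R.
Proof. by rewrite ler_norml cos_geN1 cos_le1. Qed.

Lemma sin_le x : `|sin x| <= 1 :> R.
Proof. by rewrite ler_norml sin_geN1 sin_le1. Qed.

Lemma iw : cintegrable J w. Proof. exact: sqint_cintegrableJ. Qed.

Lemma int_trig (n : R) k : cintegrable J (fun x => rc (sin (n * theta x) * cos (theta x) ^+ k) * w x).
Proof.
apply: (@cintegrable_bddJ _ _ _ 1) iw.
  have -> : (fun x => rc (sin (n * theta x) * cos (theta x) ^+ k)) =
      (fun x => rc (sin (n * theta x)) * rc (cos (theta x) ^+ k)) by apply/funext => x; rewrite rcM.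
  exact: cmeasM (msin n) (mcosX k).
move=> x _; rewrite normc_rc normrM -[leRHS]mulr1; apply: ler_pM => //; first exact: sin_le.
by rewrite normrX exprn_ile1// cos_le.
Qed.

(** The product of [sin (n theta)] and [cos theta] is again a combination of sines. *)
Lemma orth_sin_cos k (n : nat) : cint J (fun x => rc (sin (n%:R * theta x) * cos (theta x) ^+ k) * w x) = 0.
Proof.
elim: k n => [|k IH] n.
  rewrite -(orth n); apply: eq_cint => x _; by rewrite expr0 mulr1 mulrC.
case: n => [|n].
  rewrite (@eq_cint _ _ _ (fun=> 0)) ?cint0// => x _.
  by rewrite mul0r sin0 mul0r mul0r.
have E x : sin (n.+1%:R * theta x) * cos (theta x) = 2^-1 * (sin (n.+2%:R * theta x) + sin (n%:R * theta x)).
  have -> : n.+2%:R * theta x = n.+1%:R * theta x + theta x by rewrite -[n.+2%:R]natr1 mulrDl mul1r.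
  have -> : n%:R * theta x = n.+1%:R * theta x - theta x by rewrite -[n.+1%:R]natr1 mulrDl mul1r addrK.
  by rewrite sinD sinB; field.
rewrite (@eq_cint _ _ _ (fun x => rc 2^-1 * (rc (sin (n.+2%:R * theta x) * cos (theta x) ^+ k) * w x +
    rc (sin (n%:R * theta x) * cos (theta x) ^+ k) * w x))); last first.
  by move=> x _; rewrite exprS mulrA E -mulrDl -rcD mulrA -rcM; congr (rc _ * _); ring.
rewrite cintZ//; last by apply: cintegrableD => //; exact: int_trig.
by rewrite cintD// ?IH ?addr0 ?mulr0//; exact: int_trig.
Qed.

Let v x : C := rc (sin (theta x)) * w x.

Lemma iv : cintegrable J v.
Proof.
have := int_trig 1 0; rewrite (_ : (fun x => _) = v)//.
by apply/funext => x; rewrite /v mul1r expr0 mulr1.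
Qed.

Lemma orth_poly (p : {poly R}) : cint J (fun x => rc p.[cos (theta x)] * v x) = 0.
Proof.
rewrite (@eq_cint _ _ _ (fun x => \sum_(i < size p) rc p`_i * (rc (sin (1%:R * theta x) * cos (theta x) ^+ i) * w x))); last first.
  move=> x _; rewrite horner_coef raddf_sum/= mulr_suml; apply: eq_bigr => i _.
  by rewrite /v mul1r !mulrA -!rcM; congr (rc _ * _); ring.
rewrite cint_sum//; last by move=> i; apply: cintegrableZ => //; exact: int_trig.
rewrite big1// => i _; rewrite cintZ//; last exact: int_trig.
by rewrite orth_sin_cos mulr0.
Qed.

(** The affine function [z] of [cos (pi x)] is less than 1/2 exactly for [x < b],
    and the division by 4 keeps it in [[0, 1]]. So the indicator of [[0, b]] is a
    bounded limit of polynomials in [cos (pi x)], to which [v] is orthogonal. *)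
Lemma orth_initial b : 0 < b < 1 -> cint J (fun x => (if x <= b then 1 else 0) * v x) = 0.
Proof.
move=> /andP[b0 b1]; pose c := cos (theta b).
have thI x : J x -> theta x \in `[0, pi].
  rewrite /J01/= !in_itv/= /theta => /andP[x0 x1].
  by rewrite mulr_ge0 ?pi_ge0 ?(ltW x0)//= ler_piMr ?pi_ge0// ltW.
have Jb : J b by rewrite /J01/= in_itv/= b0.
pose z x := 2^-1 - (cos (theta x) - c) / 4.
have zI x : 0 <= z x <= 1.
  have := cos_le (theta x); have := cos_le (theta b); rewrite -/c !ler_norml /z.
  by move=> /andP[h1 h2] /andP[h3 h4]; apply/andP; split; lra.
pose p (n : nat) : {poly R} := (1 - (2^-1%:P - 4^-1 *: ('X - c%:P)) ^+ n) ^+ (2 ^ n).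
have pE n x : (p n).[cos (theta x)] = (1 - z x ^+ n) ^+ (2 ^ n).
  rewrite /p horner_exp hornerD hornerN horner_exp hornerD hornerN hornerZ !hornerE.
  by rewrite /z [4^-1 * _]mulrC.
pose wn n x : C := rc (p n).[cos (theta x)] - (if x <= b then 1 else 0).
have mi : cmeas J (fun x => (if x <= b then 1 else 0) : C).
  have m : measurable_fun J (\1_(`]-oo, b]%classic) : R -> R) by exact: measurable_indic.
  have := cmeas_rc m; congr cmeas; apply/funext => y.
  by rewrite indicE mem_setE in_itv/=; case: ifP.
have mp n : cmeas J (fun x => rc (p n).[cos (theta x)]).
  apply: (@cmeas_trig _ (fun x => (p n)^`().[cos (theta x)] * (- sin (theta x) * pi))) => x.
  exact: is_derive1_comp (is_derive_poly _ _) (Dcos x).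
have mwn n : cmeas J (wn n) by exact: cmeasB.
have p01 n x : 0 <= (p n).[cos (theta x)] <= 1.
  rewrite pE; have /andP[h0 h1] := zI x.
  have h2 : 0 <= z x ^+ n <= 1 by rewrite exprn_ge0//= exprn_ile1.
  have /andP[h3 h4] := h2.
  by rewrite exprn_ge0 ?exprn_ile1//; lra.
have bwn n x : J x -> normc (wn n x) <= 2.
  move=> _; apply: le_trans (normcDB _ _) _; rewrite normc_rc.
  have /andP[h0 h1] := p01 n x; rewrite ger0_norm//.
  by case: ifP => _; rewrite ?normc1 ?normc0; lra.
have conv : {ae mu, forall x, J x -> forall d : R, 0 < d -> exists N : nat, forall n, (N <= n)%N -> normc (wn n x) <= d}.
  exists [set b]; split; first exact: measurable_set1.
    exact: lebesgue_measure_set1.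
  move=> x /=; apply: contra_notP => xb Jx d d0.
  have xnb : x != b by apply/eqP.
  have thlt y y' : J y -> J y' -> (cos (theta y) < cos (theta y')) = (y' < y).
    by move=> Jy Jy'; rewrite ltr_cos ?thI// /theta ltr_pM2l ?pi_gt0.
  have /andP[h0 h1] := zI x.
  have [xb'|xb'] := ltP x b.
    have zx : z x < 2^-1 by have := thlt b x Jb Jx; rewrite xb' /z /c; lra.
    have [|N HN] := @exprn_small (2 * z x) d _ d0.
      by rewrite mulr_ge0//=; lra.
    exists N => n Nn; apply: le_trans (HN n Nn).
    have /andP[s1 s2] := step_power_low n (zI x).
    rewrite /wn (ltW xb') -/(rc 1) -rcN -rcD normc_rc pE distrC ger0_norm//.
  have bx : b < x by rewrite lt_neqAle eq_sym xnb.
  have zx : 2^-1 < z x by have := thlt x b Jx Jb; rewrite bx /z /c; lra.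
  have [|N HN] := @exprn_small (2 * z x)^-1 d _ d0.
    by rewrite invr_ge0 mulr_ge0//= invf_lt1; lra.
  exists N => n Nn; apply: le_trans (HN n Nn).
  have /andP[s1 s2] : 0 <= (1 - z x ^+ n) ^+ (2 ^ n) <= (2 * z x)^-1 ^+ n.
    by apply: step_power_high; rewrite h1 andbT; lra.
  have xb2 : (x <= b) = false by rewrite leNgt bx.
  by rewrite /wn xb2 subr0 normc_rc pE ger0_norm.
have ii1 : cintegrable J (fun x => (if x <= b then 1 else 0) * v x).
  by apply: (@cintegrable_bddJ _ _ _ 1) iv => // x _; case: ifP; rewrite ?normc1 ?normc0.
have ip n : cintegrable J (fun x => rc (p n).[cos (theta x)] * v x).
  apply: (@cintegrable_bddJ _ _ _ 1) iv => // x _; rewrite normc_rc.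
  by have /andP[h0 h1] := p01 n x; rewrite ger0_norm.
apply/eqP; rewrite -normc_eq0 eq_le normc_ge0 andbT leNgt; apply/negP => k0.
set k := normc _ in k0; have k2 : 0 < k / 2 by rewrite divr_gt0.
have [N HN] := cint_mult_cvg0_ae mJ iv mwn bwn conv k2.
have := HN N (leqnn N).
rewrite (@eq_cint _ _ _ (fun x => rc (p N).[cos (theta x)] * v x - (if x <= b then 1 else 0) * v x)); last first.
  by move=> x _; rewrite mulrBl.
by rewrite cintB// orth_poly sub0r normcN -/k; lra.
Qed.

(** Lebesgue's differentiation theorem, for a function with constant primitive. *)
Lemma ae_zero_of_initial (q : R -> R) : rint J q ->
  (forall b, 0 < b < 1 -> \int[mu]_(x in J) ((if x <= b then 1 else 0) * q x) = 0) ->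
  {ae mu, forall x, J x -> q x = 0}.
Proof.
move=> iq H0; pose U : R -> R := q \_ J.
have iU : mu.-integrable setT (EFin \o U).
  by have := (@integrable_mkcond _ _ _ mu J (EFin \o q) mJ).1 iq; rewrite restrict_EFin.
have := @FTC1Ny R U.
have i1 y : mu.-integrable `]-oo, y] (EFin \o U) by exact: integrableS iU.
have i2 : locally_integrable [set: R] U by exact: integrable_locally_restrict.
move=> /(_ i1 i2); apply: filterS; first exact: (ae_filter_ringOfSetsType mu).
move=> x [_ Hd] Jx; have Ux : U x = q x by rewrite /U patchE mem_set.
have F0 y : J y -> \int[mu]_(t in `]-oo, y]) U t = 0.
  move=> Jy; rewrite -(H0 y); last by move: Jy; rewrite /J01/= in_itv.
  rewrite [RHS]Rintegral_mkcond [LHS]Rintegral_mkcond; apply: eq_Rintegral => t _.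
  rewrite /U !patchE mem_setE in_itv/=; case: (t \in J); case: ifP; rewrite ?mul1r ?mul0r//.
rewrite -Ux -Hd derive1E.
have D : is_derive x 1 (fun y => \int[mu]_(t in `]-oo, y]) U t) 0.
  apply: near_eq_is_derive (is_derive_cst 0 x 1); last first.
    near=> y; rewrite F0//; near: y.
    by apply: open_nbhs_nbhs; split => //; exact: interval_open.
exact: (@derive_val _ _ _ _ _ _ _ D).
Unshelve. all: by end_near.
Qed.

(** It suffices that [v], the product of [w] by [sin (pi x)], vanishes, because the
    sine is positive inside the interval. *)
Lemma sine_complete : {ae mu, forall x, J x -> w x = 0}.
Proof.
have H (b : R) : 0 < b < 1 -> \int[mu]_(x in J) ((if x <= b then 1 else 0) * Re (v x)) = 0 /\
   \int[mu]_(x in J) ((if x <= b then 1 else 0) * Im (v x)) = 0.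
  move=> b01; have := orth_initial b01; rewrite /cint => -[h1 h2].
  split; [rewrite -[RHS]h1|rewrite -[RHS]h2]; apply: eq_Rintegral => x _;
    by case: ifP; rewrite ?mul1r ?mul0r.
have [i1 i2] := iv.
have a1 := ae_zero_of_initial i1 (fun b hb => (H b hb).1).
have a2 := ae_zero_of_initial i2 (fun b hb => (H b hb).2).
apply: filterS2 a1 a2; first exact: (ae_filter_ringOfSetsType mu).
move=> x v1 v2 Jx; have v0 : v x = 0 by apply: cext; rewrite ?v1 ?v2.
have s0 : 0 < sin (theta x).
  move: Jx; rewrite /J01/= in_itv/= => /andP[x0 x1].
  by apply: sin_gt0_pi; rewrite /theta mulr_gt0 ?pi_gt0//= gtr_pMr ?pi_gt0.
move/eqP: v0; rewrite /v mulf_eq0 => /orP[|/eqP//].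
by rewrite fmorph_eq0 gt_eqF.
Qed.

End Completeness.

End Uniqueness.

(** * Uniqueness of the solution *)
Section SolutionUniqueness.
Context {R : realType}.
Local Notation C := R[i].
Local Notation Re := (@complex.Re R).
Local Notation Im := (@complex.Im R).
Local Notation normc := (@Normc.normc R).
Local Notation rc := (real_complex R).
Local Notation mu := (@lebesgue_measure R).
Local Notation J := (@J01 R).
Implicit Types (f g h : R -> C) (x y t a b d r : R).

Let mJ := @measurable_J01 R.

(** Each derivative multiplies by [k] and advances the phase by [pi / 2]. *)
Definition sine_ladder (k : R) (m : nat) x : C := rc (k ^+ m * sin (k * x + m%:R * (pi / 2))).

Lemma ladder_sine k : ladder setT (sine_ladder k).
Proof.
move=> m x _; apply: cdiff_rc.
have A : is_derive x 1 (fun x => k * x + m%:R * (pi / 2)) k.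
  by have := is_deriveD (is_derive_linear k x) (is_derive_cst (m%:R * (pi / 2)) x 1); rewrite addr0.
have B := is_derive1_comp (is_derive_linear (k ^+ m) _) (is_derive1_comp (is_derive_sin _) A).
apply: is_derive_eq B _.
have -> : k * x + m.+1%:R * (pi / 2) = (k * x + m%:R * (pi / 2)) + pi / 2 by rewrite -natr1; ring.
by rewrite sinDpihalf exprSr; ring.
Qed.

Lemma sine_ladder0 k x : sine_ladder k 0 x = rc (sin (k * x)).
Proof. by rewrite /sine_ladder expr0 mul1r mul0r addr0. Qed.

Lemma sine_ladder2 k x : sine_ladder k 2 x = - rc (k ^+ 2) * rc (sin (k * x)).
Proof.
rewrite /sine_ladder; have -> : 2%:R * (pi / 2) = pi :> R by field.
by rewrite sinDpi mulrN rcN rcM mulNr.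
Qed.

Lemma sin_natpi (n : nat) : sin (n%:R * pi) = 0 :> R.
Proof.
elim: n => [|n IH]; first by rewrite mul0r sin0.
by rewrite -natr1 mulrDl mul1r sinDpi IH oppr0.
Qed.

Lemma eq_cintegrable (D : set R) f g : measurable D -> (forall x, D x -> f x = g x) ->
  cintegrable D f -> cintegrable D g.
Proof.
move=> mD E [i1 i2]; split; [apply: eq_integrable i1|apply: eq_integrable i2] => // x /set_mem Dx;
  by rewrite /= E.
Qed.

Lemma cintegrable_pairing T (th : R -> R -> C) g t : continuousL2 T th -> sqint J g -> 0 <= t <= T ->
  cintegrable `[0, t] (fun r => cint J (fun x => th r x * g x)).
Proof.
move=> /continuousL2_modulus[sth cth] sg /andP[t0 tT].
pose a r := cint J (fun x => th r x * g x).
have I01 r : `[0, t]%classic r -> 0 <= r <= T.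
  by rewrite /= in_itv/= => /andP[-> rt]; rewrite (le_trans rt).
have ca r0 d : 0 <= r0 <= t -> 0 < d -> exists2 e : R, 0 < e &
    forall r, 0 <= r <= t -> `|r - r0| < e -> normc (a r - a r0) <= d.
  move=> r0t d0; have r0T : 0 <= r0 <= T by apply: I01; rewrite /= in_itv.
  have [e e0 He] := cint_pairing_small sg d0.
  have [e' e'0 He'] := cth r0 e r0T e0.
  exists e' => // r rt rr; have rT : 0 <= r <= T by apply: I01; rewrite /= in_itv.
  rewrite /a -cint_prodB//; try exact: sth.
  by apply: He; [apply: sqintB => //; exact: sth|exact: He'].
have within (p : C -> R) : (forall z w, `|p z - p w| <= normc (z - w)) ->
    {within `[0, t], continuous (fun r => p (a r))}.
  move=> lp; apply/subspace_continuousP => r0 r0t; apply/cvgrPdist_le => d d0.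
  have [|e e0 He] := ca r0 d _ d0; first by move: r0t; rewrite /= in_itv.
  have N : nbhs r0 (fun r : R => `[0, t]%classic r -> `|p (a r0) - p (a r)| <= d); last exact: N.
  apply/nbhs_ballP; exists e => // r rr rt; rewrite distrC; apply: le_trans (lp _ _) _.
  by apply: He; [move: rt; rewrite /= in_itv|rewrite distrC].
split; apply: continuous_compact_integrable; try exact: segment_compact.
  by apply: within => z w; rewrite -ReB normc_Re.
by apply: within => z w; rewrite -ImB normc_Im.
Qed.

(** Tested with [sin (n pi x)], which is admissible, the difference of two solutions
    has its [n]-th sine coefficient equal to [- i (n pi)^2] times its own primitive:
    the control and the initial datum cancel. So all the coefficients vanish. *)
Lemma system_unique T (th0 u : R -> C) (th th' : R -> R -> C) : 0 < T ->
  (forall H : nat -> R -> C, ladder setT H -> H 0%N 0 = 0 -> H 0%N 1 = 0 ->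
     H2_H10 (H 0%N) (H 1%N) (H 2)) ->
  satisfies_system T th0 u th -> satisfies_system T th0 u th' ->
  forall t, 0 <= t <= T -> eqL2 (th' t) (th t).
Proof.
move=> T0 admissible [[um1 um2 u1] cth wth] [_ cth' wth'] t tT.
have [sth cm] := continuousL2_modulus cth; have [sth' cm'] := continuousL2_modulus cth'.
(* the difference of the solutions is tested with [g], the n-th sine *)
pose w t x := th' t x - th t x.
have sw r : 0 <= r <= T -> sqint J (w r) by move=> rT; apply: sqintB => //; [exact: sth'|exact: sth].
have mu01 : measurable (`]0, T[%classic : set R) by exact: measurable_itv.
have mu_ : cmeas `]0, T[ u by [].
have iuT : cintegrable `]0, T[ u.
  apply: (@cintegrable_dom _ _ u (fun r => normc (u r))) => //.
  apply/integrableP; split; first by apply/measurable_EFinP; exact: measurable_normc.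
  rewrite (_ : (fun x => _) = (fun x => (normc (u x) ^+ 1)%:E))//.
  by apply/funext => x /=; rewrite expr1 ger0_norm ?normc_ge0.
have iu r : 0 <= r <= T -> cintegrable `[0, r] u.
  move=> /andP[r0 rT].
  have iuc (q : R -> R) : rint `]0, T[ q -> rint `[0, r] q.
    move=> iq; have : rint `[0, T] q.
      have /integrableP[mq fq] := iq.
      have mq' : measurable_fun `[0, T] (EFin \o q).
        apply/emeasurable_fun_itv_bndo_bndcP/emeasurable_fun_itv_obnd_cbndP; exact: mq.
      apply/integrableP; split => //.
      rewrite (_ : (\int[mu]_(x in `[0%R, T]) _)%E = (\int[mu]_(x in `]0%R, T[) `|(EFin \o q) x|)%E)//.
      by apply: integral_itv_bndoo; apply: measurableT_comp.
    apply: rintS; [exact: measurable_itv|exact: measurable_itv|].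
    by move=> y /=; rewrite !in_itv/= => /andP[-> yr]; exact: le_trans rT.
  by have [i1 i2] := iuT; split; exact: iuc.
have coef (n : nat) : forall t, 0 <= t <= T -> cint J (fun x => w t x * rc (sin (n%:R * (pi * x)))) = 0.
  pose k : R := n%:R * pi; pose g x := rc (sin (n%:R * (pi * x))) : C.
  have gE x : g x = sine_ladder k 0 x by rewrite sine_ladder0 /g /k mulrA.
  have adm : H2_H10 (sine_ladder k 0) (sine_ladder k 1) (sine_ladder k 2).
    apply: admissible; first exact: ladder_sine.
      by rewrite sine_ladder0 mulr0 sin0.
    by rewrite sine_ladder0 mulr1 /k sin_natpi.
  have [[/memL_sqint sg _ /memL_sqint sg2] _ _ _] := adm.
  have sgg : sqint J g by apply: eq_sqint sg => x _; rewrite gE.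
  apply: (@imaginary_volterra _ T (k ^+ 2)) => //.
    move=> t0 t0T d d0; have d2 : 0 < d / 2 by rewrite divr_gt0.
    have [e e0 He] := cint_pairing_small sgg d2.
    have [e1 e10 H1] := cm t0 e t0T e0; have [e2 e20 H2] := cm' t0 e t0T e0.
    exists (Num.min e1 e2); first by rewrite lt_min e10.
    move=> r rT; rewrite lt_min => /andP[r1 r2].
    have s1 := sqintB mJ (sth r rT) (sth t0 t0T); have s2 := sqintB mJ (sth' r rT) (sth' t0 t0T).
    have -> : cint J (fun x => w r x * g x) - cint J (fun x => w t0 x * g x) =
        cint J (fun x => (th' r x - th' t0 x) * g x) - cint J (fun x => (th r x - th t0 x) * g x).
      rewrite -!cint_prodB//; try exact: sw.
      by apply: eq_cint => x _; rewrite /w; ring.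
    apply: le_trans (normcDB _ _) _.
    by have := He _ s1 (H1 r rT r1); have := He _ s2 (H2 r rT r2); lra.
  move=> r rT; have E := wth _ _ _ adm r rT; have E' := wth' _ _ _ adm r rT.
  have -> : cint J (fun x => w r x * g x) =
      cint J (fun x => th' r x * sine_ladder k 0 x) - cint J (fun x => th r x * sine_ladder k 0 x).
    rewrite -cint_prodB//; [|exact: sth'|exact: sth].
    by apply: eq_cint => x _; rewrite gE.
  rewrite E E' opprD addrACA subrr add0r -mulrBr.
  have mr : measurable (`[0, r]%classic : set R) by exact: measurable_itv.
  have iB (p : R -> R -> C) : continuousL2 T p ->
      cintegrable `[0, r] (fun s => cint J (fun x => p s x * sine_ladder k 2 x) - u s * sine_ladder k 1 1).
    move=> cp; apply: (cintegrableB mr (cintegrable_pairing cp sg2 rT)).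
    have := cintegrableZ (sine_ladder k 1 1) mr (iu r rT).
    by rewrite (_ : (fun x => _) = (fun s => u s * sine_ladder k 1 1))//; apply/funext => s; rewrite mulrC.
  rewrite -cintB//; try exact: iB.
  have igw : cintegrable `[0, r] (fun s => cint J (fun x => w s x * g x)).
    have := cintegrableB mr (cintegrable_pairing cth' sgg rT) (cintegrable_pairing cth sgg rT).
    apply: eq_cintegrable => // s; rewrite /= in_itv/= => /andP[s0 sr].
    have sT : 0 <= s <= T by rewrite s0 (le_trans sr)//; case/andP: rT.
    by rewrite -cint_prodB//; [exact: sth'|exact: sth].
  rewrite -[RHS]mulrA mulNr -mulrN; congr (_ * _); rewrite -mulNr -rcN -cintZ//.
  apply: eq_cint => s; rewrite /= in_itv/= => /andP[s0 sr].
  have sT : 0 <= s <= T by rewrite s0 (le_trans sr)//; case/andP: rT.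
  rewrite opprD opprK addrACA [- _ + _]addrC subrr addr0 -cint_prodB//; [|exact: sth'|exact: sth].
  rewrite -cintZ//; last exact: cintegrable_prod (sw s sT) sgg.
  by apply: eq_cint => x _; rewrite sine_ladder2 rcN /w /g /k !mulrA; ring.
have := sine_complete (sw t tT) (fun n => coef n t tT).
apply: filterS; first exact: (ae_filter_ringOfSetsType mu).
by move=> x Hx Jx; apply/eqP; rewrite -subr_eq0; apply/eqP; exact: Hx.
Qed.

End SolutionUniqueness.

(** * The odd extension of the initial datum *)
Section OddExtension.
Context {R : realType}.
Local Notation C := R[i].
Local Notation Re := (@complex.Re R).
Local Notation Im := (@complex.Im R).
Local Notation normc := (@Normc.normc R).
Local Notation mu := (@lebesgue_measure R).
Local Notation D := (`[(-1)%R, 1%R]%classic : set R).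
Local Notation J := (@J01 R).
Implicit Types (f g : R -> C) (x y t : R).

Let mD : measurable D. Proof. exact: measurable_itv. Qed.
Let mJ := @measurable_J01 R.
Let JD : J `<=` D.
Proof. by move=> x; rewrite /J01/= !in_itv/= => /andP[x0 x1]; rewrite (ltW x1) andbT; lra. Qed.

Lemma sqint_oppr f : sqint D f -> sqint D (fun y => f (- y)).
Proof.
move=> [[m1 m2] /integrableP[mq fq]].
have mo (u : R -> R) : measurable_fun D u -> measurable_fun D (fun y => u (- y)).
  move=> mu_; apply: (@measurable_comp _ _ _ _ _ _ D) => //.
  by move=> _ [y /= + <-]; rewrite !in_itv/= => /andP[a b]; apply/andP; split; lra.
have m : cmeas D (fun y => f (- y)) by split; [exact: (mo _ m1)|exact: (mo _ m2)].
split => //; apply/integrableP; split.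
  by apply/measurable_EFinP; exact: measurable_normc2.
rewrite (@integral_oppr_D _ (fun y => `|(normc (f y) ^+ 2)%:E|%E))//.
exact: measurableT_comp.
Qed.

Lemma sqint_zero_ext f : sqint J f -> sqint D (fun y => if 0 < y < 1 then f y else 0).
Proof.
move=> [[m1 m2] i2]; set g := fun y => _.
have mg : cmeas D g.
  have H (p : C -> R) : p 0 = 0 -> measurable_fun J (fun y => p (f y)) -> measurable_fun D (fun y => p (g y)).
    move=> p0 /(measurable_restrictT _ mJ) mp; apply: (@measurable_funS _ _ _ _ setT) => //.
    apply: eq_measurable_fun mp => y _.
    by rewrite patchE mem_setE in_itv/= /g; case: ifP.
  by split; exact: H.
split => //; have := i2; rewrite /rint (_ : J = D `&` J); last by apply/esym/setIidr; exact: JD.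
move=> /(proj1 (integrable_restrict mu mJ mD _)).
apply: eq_integrable => // y _.
rewrite patchE mem_setE in_itv [in RHS]/= /g.
by case: ifP => _; rewrite ?normc0 ?expr0n.
Qed.

Variable th0 : R -> C.

(** Written as [g y - g (- y)], with [g] the extension by zero, the odd extension
    inherits measurability and integrability from [g]. *)
Lemma odd_ext_split y : odd_ext th0 y =
  (if 0 < y < 1 then th0 y else 0) - (if 0 < - y < 1 then th0 (- y) else 0).
Proof.
rewrite /odd_ext; case: ifP => [/andP[y0 y1]|_].
  by rewrite oppr_gt0 ltNge (ltW y0) subr0.
by rewrite oppr_gt0 ltrNl andbC; case: ifP => _; rewrite sub0r ?oppr0.
Qed.

Lemma odd_ext_odd y : odd_ext th0 (- y) = - odd_ext th0 y.
Proof. by rewrite !odd_ext_split opprK opprB. Qed.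

Lemma sqint_odd_ext : sqint J th0 -> sqint D (odd_ext th0).
Proof.
move=> /sqint_zero_ext sg; have := sqintB mD sg (sqint_oppr sg).
by congr sqint; apply/funext => y; rewrite odd_ext_split.
Qed.

Lemma theta_minusE t x : 0 < t -> theta_minus th0 t x = evol (odd_ext th0) 0 t x.
Proof.
move=> t0; rewrite /theta_minus gt_eqF//; apply: eq_cint => y _.
by rewrite EkernelE.
Qed.

Hypothesis sth0 : sqint J th0.

Lemma flux_flat t : 0 < t -> cdiff (theta_minus th0 t) (flat (odd_ext th0) 0 t) 0.
Proof.
move=> t0; have := cdiff_evol_x (sqint_cintegrable (sqint_odd_ext sth0)) 0 0 t0.
rewrite /flat mul1r muln0; by apply: cdiff_ext => x; rewrite theta_minusE.
Qed.

End OddExtension.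

(** * The control and its trajectory *)
Section SteeringControl.
Context {R : realType}.
Local Notation C := R[i].
Local Notation Re := (@complex.Re R).
Local Notation Im := (@complex.Im R).
Local Notation normc := (@Normc.normc R).
Local Notation ii := (Complex 0 1 : R[i]).
Local Notation rc := (real_complex R).
Local Notation D := (`[(-1)%R, 1%R]%classic : set R).
Local Notation J := (@J01 R).

Lemma prodD_left0 (F G : nat -> R -> C) t n i j : (forall k, (i <= k)%N -> F k t = 0) ->
  prodD F G n i j t = 0.
Proof.
elim: n i j => [|n IH] i j H /=; first by rewrite H// mul0r.
by rewrite !IH ?addr0// => k ik; rewrite H// ltnW.
Qed.

Lemma prodD_left1 (F G : nat -> R -> C) t n j : F 0 t = 1 -> (forall k, F k.+1 t = 0) ->
  prodD F G n 0 j t = G (j + n)%N t.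
Proof.
move=> F1 F0; elim: n j => [|n IH] j /=; first by rewrite F1 mul1r addn0.
by rewrite prodD_left0 ?add0r ?IH ?addSnnS// => -[].
Qed.

(** A smaller radius weakens a Gevrey bound; this brings the two factors of the
    flat output to a common radius. *)
Lemma gevrey_weaken (s A r r' : R) n : 0 <= A -> 0 < r' -> r' <= r ->
  A * (n`!%:R `^ s / r ^+ n) <= A * (n`!%:R `^ s / r' ^+ n).
Proof.
move=> A0 r0 rr; apply: ler_wpM2l => //; apply: ler_wpM2l; first exact: powR_ge0.
have r1 : 0 < r by exact: lt_le_trans rr.
rewrite lef_pV2 ?posrE ?exprn_gt0//; apply: lerXn2r => //; rewrite nnegrE; exact: ltW.
Qed.

Variables (th0 : R -> C) (T tau s : R) (phi : R -> R).
Hypotheses (sth0 : sqint J th0) (tau0 : 0 < tau) (tauT : tau < T) (s12 : 1 < s < 2).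
Hypothesis hphi : gevrey_step s phi.

Let f := odd_ext th0.
Let sf : sqint D f. Proof. exact: sqint_odd_ext. Qed.
Let jf : cintegrable D f. Proof. exact: sqint_cintegrable sf. Qed.

Definition step (n : nat) (x : R) : C := cderive n (fun y => rc (phi y)) x.

Lemma step_facts : [/\ ladder setT step, forall x, x <= 0 -> step 0 x = 1,
  forall x, 1 <= x -> step 0 x = 0 & exists M r : R, [/\ 0 < M, 0 < r &
    forall n x, normc (step n x) <= M * (n`!%:R `^ s / r ^+ n)]].
Proof.
have [[U [g [_ TU sg gE [M [r [M0 r0 B]]]]]] p1 p0] := hphi.
have UT : U = setT by apply/seteqP.
have E : g = fun y => rc (phi y) by apply/funext => y; exact: gE.
split.
- by rewrite E UT in sg; exact: csmooth_ladder.
- by move=> x x0; rewrite /step /cderive /= p1.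
- by move=> x x0; rewrite /step /cderive /= p0.
exists M, r; split => // n x; rewrite mulrA; have := B n x Logic.I; by rewrite E.
Qed.

Let a : R := (T - tau)^-1.
Let a0 : 0 < a. Proof. by rewrite invr_gt0 subr_gt0. Qed.
Let b : R := - (tau * a).

Definition cutoff (n : nat) (t : R) : C := rc a ^+ n * step n (a * t + b).

(** The closed form of all the derivatives of [Y] on the positive half-line. *)
Definition output (n : nat) (t : R) : C := prodD cutoff (flat f) n 0 0 t.

Lemma ladder_output : ladder [set t | 0 < t] output.
Proof.
apply: ladder_prodD; last exact: ladder_flat.
by have [L _ _ _] := step_facts; move=> n t _; exact: (ladder_affine a b L).
Qed.

Lemma output_bound (e : R) : 0 < e -> exists M rho : R, [/\ 0 < M, 0 < rho &
  forall n t, e < t -> normc (output n t) <= M * (n`!%:R `^ s / rho ^+ n)].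
Proof.
move=> e0; have [_ _ _ [M [r [M0 r0 B]]]] := step_facts.
have s1 : 1 <= s by case/andP: s12 => /ltW.
have [M' [r' [M'0 r'0 B']]] := flat_bound jf e0 s1.
have q0 : 0 < Num.min (r / a) r' by rewrite lt_min divr_gt0.
exists (M * M'), (Num.min (r / a) r' / 2); split; [exact: mulr_gt0|exact: divr_gt0|].
apply: (@prodD_bound _ [set t | e < t]) => //; rewrite ?(ltW M0) ?(ltW M'0)//.
  move=> n t _; rewrite /cutoff normcM normcX normc_rc gtr0_norm//.
  apply: le_trans (ler_wpM2l (exprn_ge0 _ (ltW a0)) (B _ _)) _.
  have -> : a ^+ n * (M * (n`!%:R `^ s / r ^+ n)) = M * (n`!%:R `^ s / (r / a) ^+ n).
    by rewrite expr_div_n invf_div mulrCA; congr (_ * _); rewrite mulrCA.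
  by apply: (gevrey_weaken _ _ (ltW M0) q0); rewrite ge_min lexx.
move=> n t et; apply: le_trans (B' n t et) _.
by apply: (gevrey_weaken _ _ (ltW M'0) q0); rewrite ge_min lexx orbT.
Qed.

(** Where the cut-off is 1 up to the boundary, with all its derivatives vanishing,
    the output has the derivatives of the flux. *)
Lemma output_before n t : t <= tau -> output n t = flat f n t.
Proof.
have [L p1 p0 _] := step_facts; move=> tt.
have A : a * t + b <= 0.
  by rewrite /b mulrC subr_le0; apply: ler_wpM2r => //; exact: ltW.
rewrite /output prodD_left1//; first by rewrite /cutoff mul1r p1.
by move=> k; rewrite /cutoff (step_derive0 L p1 p0) ?mulr0//; left.
Qed.

(** At [T] the cut-off vanishes with all its derivatives: this is the reason why the
    final state is zero. *)
Lemma output_end n : output n T = 0.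
Proof.
have [L p1 p0 _] := step_facts.
have A : a * T + b = 1.
  by rewrite /b mulrC -mulrBl mulfV// gt_eqF// subr_gt0.
apply: prodD_left0 => -[_|k _]; rewrite /cutoff A; first by rewrite p0 ?mulr0.
by rewrite (step_derive0 L p1 p0) ?mulr0//; right.
Qed.

Let Y := Yflat T tau phi th0.

Lemma YflatE t : 0 < t -> Y t = output 0 t.
Proof.
move=> t0; rewrite /Y /Yflat (cderive1E (flux_flat sth0 t0)) /output /= /cutoff mul1r.
congr (_ * _); rewrite /step /cderive /= /b.
have -> : a * t - tau * a = (t - tau) / (T - tau) by rewrite mulrC -mulrBl.
by [].
Qed.

Lemma cderive_Yflat n t : 0 < t -> cderive n Y t = output n t.
Proof.
by move=> t0; apply: (@ladder_cderive _ _ _ Y (@open_gt _ 0) ladder_output) => // x; exact: YflatE.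
Qed.

Lemma cderivable_Yflat n t : 0 < t -> cderivable (cderive n Y) t.
Proof.
by move=> t0; apply: (@ladder_csmooth _ _ _ Y (@open_gt _ 0) ladder_output) => // x; exact: YflatE.
Qed.

Lemma theta_termE t x : 0 < t -> theta_term Y t x = sterm output 0 0 t x.
Proof.
move=> t0; apply/funext => j; rewrite /theta_term /sterm cderive_Yflat// addn0; congr (_ * _).
by rewrite -mulrA; congr (_ * _); rewrite /dmon /= subn0 /mon rcM rcV natcE.
Qed.

Lemma u_termE t : 0 < t -> u_term Y t = sterm output 0 0 t 1.
Proof.
move=> t0; rewrite -theta_termE//; apply/funext => j.
by rewrite /theta_term /u_term expr1n mulr1.
Qed.

(** One formula for all positive times: up to [tau] it is the Taylor expansion of
    the free evolution, after [tau] the definition of the trajectory. *)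
Lemma trajectoryE t x : 0 < t -> 0 <= x <= 1 -> trajectory tau th0 Y t x = ser output 0 0 t x.
Proof.
move=> t0 x01; rewrite /trajectory /ser; case: ifP => tt; last by rewrite theta_termE.
rewrite theta_minusE// (evol_series jf (@odd_ext_odd _ th0) t0 x01).
by apply: eq_csum => j; rewrite /sterm output_before.
Qed.

Lemma controlE t : 0 < t -> control tau th0 Y t = ser output 0 0 t 1.
Proof.
move=> t0; have i01 : 0 <= (1 : R) <= 1 by rewrite ler01 lexx.
rewrite -trajectoryE// /trajectory /control; case: ifP => // _.
by rewrite theta_termE// u_termE.
Qed.

(** The hypotheses of the theory of the flat series, on each half-line [t > e]; the
    constants depend on [e] since the flux is singular at time 0. *)
Lemma output_series (e : R) : 0 < e -> exists M rho : R, [/\ 0 < rho, 0 < M,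
  ladder [set t | e < t] output &
  forall n t, e < t -> normc (output n t) <= M * (n`!%:R `^ s / rho ^+ n)].
Proof.
move=> e0; have [M [rho [M0 r0 B]]] := output_bound e0; exists M, rho; split => //.
by move=> n t et; apply: ladder_output; exact: lt_trans et.
Qed.

Local Notation Th := (ser output).

Lemma output_dt p q t x : 0 < t -> cdiff (fun y => Th p q y x) (Th p.+1 q t x) t.
Proof.
move=> t0; have t2 : 0 < t / 2 by rewrite divr_gt0.
have [M [rho [r0 M0 L B]]] := output_series t2.
by apply: (ser_dt s12 r0 M0 L B); lra.
Qed.

Lemma output_dx p q t x : 0 < t -> cdiff (Th p q t) (Th p q.+1 t x) x.
Proof.
move=> t0; have t2 : 0 < t / 2 by rewrite divr_gt0.
have [M [rho [r0 M0 L B]]] := output_series t2.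
by apply: (ser_dx s12 r0 M0 B); lra.
Qed.

Lemma output_summable p q t x : 0 < t -> csummable (sterm output p q t x).
Proof.
move=> t0; have t2 : 0 < t / 2 by rewrite divr_gt0.
have [M [rho [r0 M0 L B]]] := output_series t2.
by apply: (ser_summable s12 r0 M0 B); lra.
Qed.

Lemma output_pde p q t x : 0 < t -> Th p q.+2 t x = - ii * Th p.+1 q t x.
Proof.
move=> t0; have t2 : 0 < t / 2 by rewrite divr_gt0.
have [M [rho [r0 M0 L B]]] := output_series t2.
by apply: (ser_pde s12 r0 M0 B); lra.
Qed.

Lemma output_ser_bound p q (e : R) : 0 < e -> exists2 K : R, 0 <= K & forall t x, e < t -> 0 <= x <= 1 ->
  normc (Th p q t x) <= K.
Proof.
move=> e0; have [M [rho [r0 M0 L B]]] := output_series e0.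
have [K [r1 [r2 [K0 r10 r20 H]]]] := ser_bound s12 r0 M0 B ler01.
eexists; last first.
  by move=> t x et /andP[x0 x1]; apply: (H p q t x et); rewrite ger0_norm.
by rewrite divr_ge0 ?mulr_ge0 ?powR_ge0 ?exprn_ge0 ?ltW.
Qed.

Lemma trajectory_initial (e : R) : 0 < e -> exists2 d : R, 0 < d & forall t, 0 < t -> t <= T -> t < d ->
  nsq J (fun x => Th 0 0 t x - th0 x) <= e.
Proof.
move=> e0; have [d d0 H] := initial_cvg_sqint sf e0.
exists (Num.min d tau); first by rewrite lt_min d0.
move=> t t0 _; rewrite lt_min => /andP[td tt].
have := H t; rewrite t0 td => /(_ isT); rewrite -nsq_J01; last first.
  apply: sqintB; [exact: measurable_itv|exact: sqint_evol|].
  apply: sqintS sf; [exact: measurable_itv|exact: measurable_itv|].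
  by move=> x /=; rewrite !in_itv/= => /andP[x0 ->]; rewrite andbT (le_trans _ x0)// lerN10.
apply: le_trans; rewrite le_eqVlt; apply/orP; left; apply/eqP; apply: eq_nsq => x Jx.
have /= := J01_sub Jx; rewrite in_itv/= => x01.
rewrite -trajectoryE// /trajectory ltW// theta_minusE//; congr (normc (_ - _)).
by rewrite /f /odd_ext; move: Jx; rewrite /J01/= in_itv/= => ->.
Qed.

Local Notation u := (control tau th0 Y).

Lemma cmeas_control : cmeas `]0, T] u.
Proof.
have m : cmeas `]0, T] (fun t => Th 0 0 t 1).
  have oU : open (`]0, +oo[%classic : set R) by exact: interval_open.
  apply: cmeasS (cmeas_open oU _); first exact: measurable_itv.
    by move=> r /=; rewrite !in_itv/= andbT => /andP[].
  by move=> r; rewrite /= in_itv/= andbT => r0; eexists; exact: output_dt.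
have [m1 m2] := m; split; [apply: eq_measurable_fun m1|apply: eq_measurable_fun m2];
  by move=> t /set_mem; rewrite /= in_itv/= => /andP[t0 _]; rewrite controlE.
Qed.

(** Up to [tau] the control is the trace of the free evolution, afterwards it is
    bounded; the sum of the two bounds holds on the whole interval. *)
Lemma control_L4 : rint `]0, T] (fun t => normc (u t) ^+ 4).
Proof.
have T0 : 0 < T by exact: lt_trans tauT.
have mI : measurable (`]0, T]%classic : set R) by exact: measurable_itv.
have t2 : 0 < tau / 2 by rewrite divr_gt0.
have [K K0 HK] := output_ser_bound 0 0 t2.
have me : cmeas `]0, T] (fun t => evol f 0 t 1).
  have oU : open (`]0, +oo[%classic : set R) by exact: interval_open.
  apply: cmeasS (cmeas_open oU _); first exact: measurable_itv.
    by move=> r /=; rewrite !in_itv/= andbT => /andP[].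
  by move=> r; rewrite /= in_itv/= andbT => r0; eexists; exact: (cdiff_evol_t jf 0 1 r0).
have m4 (g : R -> C) : cmeas `]0, T] g -> measurable_fun `]0, T] (fun t => normc (g t) ^+ 4).
  by move=> mg; apply: measurable_funX; exact: measurable_normc.
have ie : rint `]0, T] (fun t => normc (evol f 0 t 1) ^+ 4).
  apply/integrableP; split; first by apply/measurable_EFinP; exact: m4.
  have [mf if2] := sf; have := trace_L4 mf if2 T0.
  apply: le_lt_trans; rewrite le_eqVlt; apply/orP; left; apply/eqP.
  by apply: eq_integral => t _ /=; rewrite ger0_norm ?exprn_ge0 ?normc_ge0.
apply: (rint_dom (v := fun t => normc (evol f 0 t 1) ^+ 4 + K ^+ 4)) => //.
- exact: (m4 _ cmeas_control).
- move=> t; rewrite /= in_itv/= => /andP[t0 tT]; rewrite ger0_norm ?exprn_ge0 ?normc_ge0//.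
  have [tt|tt] := leP t tau.
    by rewrite /control tt theta_minusE// lerDl exprn_ge0.
  rewrite ler_wpDl ?exprn_ge0 ?normc_ge0// controlE//.
  apply: lerXn2r; rewrite ?nnegrE ?normc_ge0//; apply: HK; first by lra.
  by rewrite ler01 lexx.
- apply: rintD => //; apply: (rintS _ mI _ (rint_cst 0 T _)); first exact: measurable_itv.
  by move=> t /=; rewrite !in_itv/= => /andP[/ltW -> ->].
Qed.

Lemma cintegrable_control : cintegrable `]0, T] u.
Proof.
have mI : measurable (`]0, T]%classic : set R) by exact: measurable_itv.
apply: (@cintegrable_dom _ _ _ (fun t => 1 + normc (u t) ^+ 4)) => //; first exact: cmeas_control.
  move=> t _; have := normc_ge0 (u t); set z := normc _ => z0.
  have [z1|z1] := leP z 1; first by rewrite ler_wpDr ?exprn_ge0.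
  by rewrite ler_wpDl// -{1}[z]expr1 ler_weXn2l// ltW.
apply: rintD => //; last exact: control_L4.
apply: (rintS _ mI _ (rint_cst 0 T _)); first exact: measurable_itv.
by move=> t /=; rewrite !in_itv/= => /andP[/ltW -> ->].
Qed.

Lemma memL_control p : rint `]0, T] (fun t => normc (u t) ^+ p) -> memL p `]0, T[ u.
Proof.
move=> ip; have sub : `]0, T[%classic `<=` (`]0, T]%classic : set R).
  by move=> t /=; rewrite !in_itv/= => /andP[-> /ltW].
have [m1 m2] := cmeasS (measurable_itv _) sub cmeas_control.
split => //.
have /integrableP[_] := rintS (measurable_itv _) (measurable_itv _) sub ip.
rewrite (_ : (fun x => _) = (fun t => (normc (u t) ^+ p)%:E))//.
by apply/funext => t /=; rewrite ger0_norm ?exprn_ge0 ?normc_ge0.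
Qed.

Lemma memL4_control : memL 4 `]0, T[ u.
Proof. apply: memL_control; exact: control_L4. Qed.

Lemma memL1_control : memL 1 `]0, T[ u.
Proof.
apply: memL_control; have := cintegrable_normc (measurable_itv _) cintegrable_control.
by congr rint; apply/funext => t; rewrite expr1.
Qed.

Lemma gevrey_control (e : R) : 0 < e -> gevrey s `[e, T] u.
Proof.
move=> e0; have e2 : 0 < e / 2 by rewrite divr_gt0.
have [M [rho [r0 M0 L B]]] := output_series e2.
apply: (ser_gevrey s12 r0 M0 L B); first by lra.
by move=> t /andP[et _]; apply: controlE; exact: lt_le_trans et.
Qed.

Local Notation theta := (trajectory tau th0 Y).

Lemma gevrey2_trajectory (e : R) : 0 < e ->
  gevrey2 s (s / 2) (`[e, T] `*` `[0, 1]) (fun z => theta z.1 z.2).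
Proof.
move=> e0; have e2 : 0 < e / 2 by rewrite divr_gt0.
have [M [rho [r0 M0 L B]]] := output_series e2.
apply: (ser_gevrey2 s12 r0 M0 L B); first by lra.
by move=> t x /andP[et _] x01; apply: trajectoryE => //; exact: lt_le_trans et.
Qed.

Lemma trajectory_solution : is_solution T th0 u theta.
Proof.
have T0 : 0 < T by exact: lt_trans tauT.
have [L p1 p0 [M [r [M0 r0 B]]]] := step_facts.
pose K := 1 + M * (0`!%:R `^ s / r ^+ 0) + M * (1`!%:R `^ s / r ^+ 1).
have B0 n : 0 <= M * (n`!%:R `^ s / r ^+ n).
  by apply: le_trans (B n 0); exact: normc_ge0.
have K1 : 1 <= K by rewrite /K; have := B0 0; have := B0 1; lra.
have BP x : normc (step 0 x) <= K /\ normc (step 1 x) <= K.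
  by have := B 0 x; have := B 1 x; have := B0 0; have := B0 1; rewrite /K; split; lra.
have thE t x : 0 < t <= T -> 0 <= x <= 1 -> theta t x = Th 0 0 t x.
  by move=> /andP[t0 _] x01; exact: trajectoryE.
have uE t : 0 < t <= T -> u t = Th 0 0 t 1 by move=> /andP[t0 _]; exact: controlE.
have th00 x : J x -> theta 0 x = th0 x.
  rewrite /J01/= in_itv/= /trajectory (ltW tau0) /theta_minus eqxx /odd_ext => ->.
  by [].
have sys : satisfies_system T th0 u theta.
  split; first exact: memL1_control.
    exact: (solution_continuousL2 output_dt output_dx output_ser_bound sth0 thE th00 trajectory_initial).
  move=> psi psi1 psi2 Hpsi t tT.
  have [[/memL_sqint spsi _ /memL_sqint spsi2] _ _ _] := Hpsi.
  apply: (weak_identity output_dt output_dx output_ser_bound output_pde (ser_x0 output)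
    sth0 thE uE th00 trajectory_initial cintegrable_control spsi spsi2) => // H LH H0.
  exact: (weak_green L p1 p0 K1 BP LH H0 Hpsi).
split=> // th' sys' t tT; apply: (system_unique T0 _ sys sys' tT) => H LH H0 H1.
exact: (smooth_H2_H10 L p1 p0 K1 BP LH H0 H1).
Qed.

Lemma trajectory_final x : 0 <= x <= 1 -> theta T x = 0.
Proof.
move=> x01; rewrite trajectoryE//; last exact: lt_trans tauT.
rewrite /ser (_ : sterm output 0 0 T x = fun=> 0); first exact: csum0.
by apply/funext => j; rewrite /sterm output_end mulr0.
Qed.

End SteeringControl.

Theorem theorem3 (R : realType) (theta0 : R -> R[i]) (T tau s : R)
    (phi : R -> R)
    (htheta0 : memL 2 J01 theta0) (hT : 0 < T)
    (htau : 0 < tau < T) (hs : 1 < s < 2) (hphi : gevrey_step s phi) :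
  let Y := Yflat T tau phi theta0 in
  let u := control tau theta0 Y in
  let theta := trajectory tau theta0 Y in
  (* the objects in the formulas for Y, u and theta are well defined *)
  [/\ forall t, 0 < t <= T -> cderivable (theta_minus theta0 t) 0,
      forall (j : nat) t, 0 < t <= T -> cderivable (cderive j Y) t,
      forall t, tau < t <= T -> csummable (u_term Y t) &
      forall t x, tau < t <= T -> 0 <= x <= 1 -> csummable (theta_term Y t x)]
  /\
  [/\ steers T theta0 u (fun=> 0),
      memL 4 `]0, T[ u &
      forall e, 0 < e < T -> gevrey s `[e, T] u]
  /\
  [/\ is_solution T theta0 u theta,
      continuousL2 T theta &
      forall e, 0 < e < T ->
        gevrey2 s (s / 2) (`[e, T] `*` `[0, 1]) (fun z => theta z.1 z.2)].
Proof.
move=> Y u theta; have /memL_sqint sth0 := htheta0; have /andP[tau0 tauT] := htau.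
have sol := trajectory_solution sth0 tau0 tauT hs hphi.
split; [split|split; split].
- by move=> t /andP[t0 _]; exact: cdiff_cderivable (flux_flat sth0 t0).
- by move=> j t /andP[t0 _]; exact: (cderivable_Yflat T tau sth0 hphi).
- move=> t /andP[tt _]; have t0 : 0 < t by exact: lt_trans tt.
  rewrite (u_termE T tau sth0 hphi t0); exact: (output_summable sth0 tauT hs hphi).
- move=> t x /andP[tt _] _; have t0 : 0 < t by exact: lt_trans tt.
  rewrite (theta_termE T tau sth0 hphi x t0); exact: (output_summable sth0 tauT hs hphi).
- exists theta => //; apply: aeW => x Jx.
  apply: (trajectory_final sth0 tau0 tauT hphi).
  by have := J01_sub Jx; rewrite /= in_itv.
- exact: (memL4_control sth0 tau0 tauT hs hphi).
- by move=> e /andP[e0 _]; exact: (gevrey_control sth0 tauT hs hphi).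
- exact: sol.
- by have [[]] := sol.
- by move=> e /andP[e0 _]; exact: (gevrey2_trajectory sth0 tauT hs hphi).
Qed.
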